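(* Let $\mathcal H=\{h_1,\dots,h_k\}$ be an admissible set, and let $0\le\ell_1,\ell_2\le k$ be integers. Suppose that Hypotheses $BV(\theta)$ and $BV_2(\theta)$ are both satisfied and $R\le N^{(\theta-\epsilon)/2}$. If $h_0\in\mathcal H$, then \begin{align*} \sum_{N<n\le 2N}\varpi*\varpi(n+h_0)\,\Lambda_R(n;\mathcal H,\ell_1)\Lambda_R(n;\mathcal H,\ell_2) =\Big\{&\binom{\ell_1+\ell_2+2}{\ell_1+1}(N\log N)\mathfrak S(\mathcal H)\frac{(\log R)^{k+\ell_1+\ell_2+1}}{(k+\ell_1+\ell_2+1)!}\\ &+2T(k,\ell_1,\ell_2)N\mathfrak S(\mathcal H)\frac{(\log R)^{k+\ell_1+\ell_2+2}}{(k+\ell_1+\ell_2+2)!}\Big\}\Big\{1+O\Big(\frac{\beta(\mathcal H)\mathfrak S(\mathcal H)}{\log R}\Big)\Big\}, \end{align*} where \[ T(k,\ell_1,\ell_2)=-\binom{\ell_1+\ell_2+3}{\ell_2+1}-\binom{\ell_1+\ell_2+3}{\ell_1+1}+\binom{\ell_1+\ell_2+2}{\ell_1+1}, \] and the implied constant depends at most on $k$.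
   Context: $\varpi(n)=\log n$ if $n$ is prime and $0$ otherwise; $\varpi*\varpi(n)=\sum_{d\mid n}\varpi(d)\varpi(n/d)$. $\mathcal H$ is a set of $k\ge2$ distinct integers, and $P(n;\mathcal H)=\prod_{h\in\mathcal H}(n+h)$. For squarefree $d$, $\nu_d$ is the number of residue classes $a$ mod $d$ with $P(a;\mathcal H)\equiv 0\pmod d$. The set $\mathcal H$ is admissible if $\nu_p<p$ for all primes $p$. Define \[ \mathfrak S(\mathcal H)=\prod_p(1-\nu_p/p)(1-1/p)^{-k},\qquad \beta(\mathcal H)=\sum_p (k-\nu_p)\log p/p. \] For squarefree $d$, let $f(d)=d/\nu_d$ and $f_1(d)=\prod_{p\mid d}(p-\nu_p)/\nu_p$. For $0\le\ell\le k$, \[ \lambda_{d,\ell}=\mu(d)\frac{f(d)}{f_1(d)}\frac{\mathfrak S(\mathcal H)}{\ell!}\sum_{r<R/d,\ (r,d)=1}\frac{\mu^2(r)}{f_1(r)}(\log\tfrac{R}{rd})^\ell\quad\text{for } d<R, \] and $\lambda_{d,\ell}=0$ for $d\ge R$. Let $\Lambda_R(n;\mathcal H,\ell)=\sum_{d\mid P(n;\mathcal H)}\lambda_{d,\ell}$. Error terms: - For $(a,q)=1$, $E(x;q,a)$ is defined by $\sum_{x<n\le2x,\ n\equiv a\,(q)}\varpi(n)=x/\phi(q)+E(x;q,a)$, with $E(x,q)=\max_{(a,q)=1}|E(x;q,a)|$ and $E^*(N,q)=\max_{x\le N}E(x,q)$. - Let $C_0=2\log2-2\gamma-1-2\sum_p\frac{\log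 p}{p(p-1)}$. For $(a,r)=1$, $E_2(x;r,a)$ is defined by $\sum_{x<n\le 2x,\ n\equiv a\,(r)}\varpi*\varpi(n)=\frac{x}{\phi(r)}(\log x+C_0-2\sum_{p\mid r}\frac{\log p}{p})+E_2(x;r,a)$, with $E_2(x,r)=\max_{(a,r)=1}|E_2(x;r,a)|$ and $E_2^*(N,r)=\max_{x\le N}E_2(x,r)$. For $1/2<\theta\le1$: - $BV(\theta)$ means: for all $A,\epsilon>0$, $\sum_{q\le N^{\theta-\epsilon}}E^*(N,q)\ll_{A,\epsilon}N(\log N)^{-A}$. - $BV_2(\theta)$ means the same with $E_2^*$ in place of $E^*$. Here $N,R\to\infty$. *)

(* Defs.v *)
From HB Require Import structures.
From mathcomp Require Import all_boot all_order all_algebra.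
From mathcomp Require Import all_classical all_reals all_analysis.
Set Implicit Arguments. Unset Strict Implicit. Unset Printing Implicit Defensive.
Import Order.TTheory GRing.Theory Num.Theory numFieldNormedType.Exports.
Local Open Scope ring_scope.
Local Open Scope classical_set_scope.

Section Defs.
Variable R : realType.

Definition vpi (n : nat) : R := if prime n then ln (n%:R) else 0.

Definition vpi2 (n : nat) : R := \sum_(d <- divisors n) vpi d * vpi (n %/ d).

Definition vpi2z (m : int) : R := if m is Posz n then vpi2 n else 0.

Definition sqfree (n : nat) : bool := (0 < n)%N && all (fun p => ~~ (p ^ 2 %| n)%N) (primes n).
Definition moebius (n : nat) : R := if sqfree n then (-1) ^+ size (primes n) else 0.

Definition Ppoly (H : seq int) (n : int) : int := \prod_(h <- H) (n + h).

Definition nu (H : seq int) (d : nat) : nat :=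
  count (fun a : nat => (d%:Z %| Ppoly H a%:Z)%Z) (iota 0 d).

Definition admissible (H : seq int) : Prop := forall p, prime p -> (nu H p < p)%N.

Definition sing (H : seq int) : R :=
  limn (fun x : nat => \prod_(0 <= p < x | prime p)
          ((1 - (nu H p)%:R / p%:R) * (1 - 1 / p%:R) ^- size H : R)).

Definition betaH (H : seq int) : R :=
  limn (fun x : nat => \sum_(0 <= p < x | prime p)
          ((size H)%:R - (nu H p)%:R) * ln (p%:R) / p%:R : R).

Definition fF (H : seq int) (d : nat) : R := d%:R / (nu H d)%:R.
Definition f1 (H : seq int) (d : nat) : R :=
  \prod_(p <- primes d) ((p%:R - (nu H p)%:R) / (nu H p)%:R).

Definition lambda (RR : R) (H : seq int) (l d : nat) : R :=
  if d%:R < RR then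
    moebius d * (fF H d / f1 H d) * (sing H / (l`!)%:R) *
    \sum_(1 <= r < (Num.truncn RR).+1 | (r%:R < RR / d%:R) && coprime r d)
       (moebius r ^+ 2 / f1 H r * ln (RR / (r * d)%:R) ^+ l)
  else 0.

Definition Lam (RR : R) (H : seq int) (l : nat) (n : int) : R :=
  \sum_(d <- divisors `|Ppoly H n|%N) lambda RR H l d.

Definition euler_gamma : R :=
  limn (fun n : nat => \sum_(1 <= i < n.+1) 1 / i%:R - ln (n%:R) : R).

Definition C0 : R :=
  2 * ln 2 - 2 * euler_gamma - 1
  - 2 * limn (fun x : nat => \sum_(0 <= p < x | prime p) ln (p%:R) / (p%:R * (p%:R - 1)) : R).

Definition Eqa (x : R) (q a : nat) : R :=
  \sum_(0 <= n < (Num.truncn (2 * x)).+1 | (x < n%:R) && (n%:R <= 2 * x) && (n %% q == a %% q)%N)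
     vpi n - x / (totient q)%:R.
Definition Eq (x : R) (q : nat) : R := \big[Num.max/0]_(a < q | coprime a q) `|Eqa x q a|.
Definition Estar (N : R) (q : nat) : R := sup [set y | exists2 x, 0 < x <= N & y = Eq x q].

Definition E2ra (x : R) (r a : nat) : R :=
  \sum_(0 <= n < (Num.truncn (2 * x)).+1 | (x < n%:R) && (n%:R <= 2 * x) && (n %% r == a %% r)%N)
     vpi2 n
  - x / (totient r)%:R * (ln x + C0 - 2 * \sum_(p <- primes r) ln (p%:R) / p%:R).
Definition E2r (x : R) (r : nat) : R := \big[Num.max/0]_(a < r | coprime a r) `|E2ra x r a|.
Definition E2star (N : R) (r : nat) : R := sup [set y | exists2 x, 0 < x <= N & y = E2r x r].

Definition BV (theta : R) : Prop :=
  forall A eps : R, 0 < A -> 0 < eps -> exists C : R, forall N : R, 2 <= N ->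
    \sum_(1 <= q < (Num.truncn (N `^ (theta - eps))).+1) Estar N q <= C * (N * ln N `^ (- A)).
Definition BV2 (theta : R) : Prop :=
  forall A eps : R, 0 < A -> 0 < eps -> exists C : R, forall N : R, 2 <= N ->
    \sum_(1 <= q < (Num.truncn (N `^ (theta - eps))).+1) E2star N q <= C * (N * ln N `^ (- A)).

Definition Tcoef (l1 l2 : nat) : R :=
  - ('C(l1 + l2 + 3, l2 + 1))%:R - ('C(l1 + l2 + 3, l1 + 1))%:R + ('C(l1 + l2 + 2, l1 + 1))%:R.

Definition LHS7 (N RR : R) (H : seq int) (h0 : int) (l1 l2 : nat) : R :=
  \sum_(0 <= n < (Num.truncn (2 * N)).+1 | (N < n%:R) && (n%:R <= 2 * N))
     vpi2z (n%:Z + h0) * Lam RR H l1 n%:Z * Lam RR H l2 n%:Z.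

Definition Main7 (N RR : R) (H : seq int) (l1 l2 : nat) : R :=
  let k := size H in
  ('C(l1 + l2 + 2, l1 + 1))%:R * (N * ln N) * sing H
     * ln RR ^+ (k + l1 + l2 + 1) / ((k + l1 + l2 + 1)`!)%:R
  + 2 * Tcoef l1 l2 * N * sing H * ln RR ^+ (k + l1 + l2 + 2) / ((k + l1 + l2 + 2)`!)%:R.

End Defs.

(* Main.v *)
(** Expand both factors [Lam] and interchange the sums.  For squarefree [d] and [e] one must then sum
    [vpi * vpi] over the integers [m = n + h0] for which the lcm of [d] and [e] divides [P(m - h0)].
    The [m] coprime to the lcm are covered by BV_2; any other contributing [m] is a product of two
    primes, one of which, [p], divides the lcm, and BV applies to the other one.  The factors [c ^ omega]
    in the error terms are absorbed by AM-GM against the trivial bound for the error.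

    What is left is a Selberg quadratic form and, for each [p], a similar form restricted to pairs whose
    lcm is divisible by [p].  The identity that diagonalises Selberg's form writes the first as a sum over
    squarefree [a] of a multiplicative weight times a product of two sums of [1/phi] over integers coprime
    to [a]; the form restricted to multiples of [p] is a difference of two such forms whose weight
    vanishes at [p].

    The sums of multiplicative functions are evaluated by real-variable means.  A sum over squarefree
    integers with smooth weight [F(log(R/a))] is the product over primes of the operators
    [1 + g(p) * (shift by log p)] applied to [F].  Comparing with the operator
    [F(X) |-> sum_m F(X - log m)/m] for [zeta], each local factor becomes a polynomial in the shift close
    to 1.  Its value at 1 contributes to the singular series and its logarithmic derivative there to the
    secondary term, which is at most a multiple of [betaH].  Finally the sum over [p] is done by Mertens'
    theorem. *)

(* The obstacle is uniformity: the implied constant may depend on k alone, while each comparison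
   with the zeta operator costs a constant depending on [H] through the finitely many primes with
   fewer than k roots. Hence the outer sums are expanded to two terms: the first coefficient is a
   singular series, the second is controlled by [betaH], and whatever depends badly on [H] lies one
   power of the logarithm lower, where a threshold depending on [H] swallows it. Errors without
   [betaH] or the singular series are absorbed by [betaH_ge] and [sing_gt], which are uniform for
   given k. For the inner sums one term suffices, but with an error multiplicative in the excluded
   integer, because it is summed against the outer weight. This gives the modified weight [GamP],
   whose Euler product exceeds that of [Gs] by at most a factor depending on k. A relative error
   also needs a main term that does not cancel. [Tcoef] can be negative; k at least 2 and R at most
   the square root of N preserve half of the first term. Since theta - eps is below 1, the boundary
   terms created by shifting the sum by [h0] are negligible. *)
Require Import Defs.
From HB Require Import structures.
From mathcomp Require Import all_boot all_order all_algebra.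
From mathcomp Require Import all_classical all_reals all_analysis.
From mathcomp Require Import fintype finset.
From mathcomp Require Import ring lra zify.
Import Order.TTheory GRing.Theory Num.Theory.
Import numFieldNormedType.Exports.
Local Open Scope ring_scope.
Set Implicit Arguments. Unset Strict Implicit. Unset Printing Implicit Defensive.

(* [lra] reads every hypothesis, which is slow in the long proofs below; most calls only need the inequalities. *)
Ltac slra := first
  [ repeat match goal with x := _ |- _ => clearbody x end;
    repeat match goal with H : ?T |- _ =>
      lazymatch T with
      | is_true (_ <= _) => fail
      | is_true (_ < _) => fail
      | is_true (_ <= _ <= _) => fail
      | _ => clear H
      end end; lra
  | lra ].

(** * Selberg's diagonalisation *)

Section SetSums.
Variable I : finType.
Implicit Types (A B D E S T : {set I}).

Lemma set_ind (P : {set I} -> Prop) : P set0 ->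
  (forall x S, x \notin S -> P S -> P (x |: S)) -> forall S, P S.
Proof.
move=> P0 PU S; have [n] := ubnP #|S|; elim: n S => // n IH S leS.
have [->//|[x xS]] := set_0Vmem S.
rewrite -(setD1K xS); apply: PU; first by rewrite !inE eqxx.
by apply: IH; move: leS; rewrite (cardsD1 x S) xS.
Qed.

Lemma sum_subsetU1 (V : nmodType) S x (f : {set I} -> V) : x \notin S ->
  \sum_(A : {set I} | A \subset x |: S) f A = \sum_(A : {set I} | A \subset S) (f A + f (x |: A)).
Proof.
move=> xS; rewrite big_split /= (bigID (fun A : {set I} => x \in A)) /= addrC; congr (_ + _).
  apply: eq_bigl => A; apply/andP/idP => [[AS xA]|AS].
    by apply/subsetP => y yA; move: (subsetP AS _ yA); rewrite !inE => /orP[/eqP yx|//]; rewrite -yx yA in xA.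
  split; first exact: subset_trans AS (subsetUr _ _).
  by apply: contra xS => /(subsetP AS).
rewrite (reindex_onto (fun A => x |: A) (fun A => A :\ x)) /=; last first.
  by move=> A /andP[_ xA]; rewrite setD1K.
apply: eq_bigl => A; rewrite setU11 andbT; apply/andP/idP => [[AS /eqP <-]|AS].
  apply/subsetP => y; rewrite !inE => /andP[yx /orP[/eqP e|yA]]; first by rewrite e eqxx in yx.
  by move: (subsetP AS y); rewrite !inE yA orbT (negbTE yx) /=; apply.
split; first exact: setUS.
apply/eqP/setP => y; rewrite !inE; case: eqP => //= ->.
by apply/esym/negbTE; apply: contra xS => /(subsetP AS).
Qed.

Lemma sum_setD1 (V : nmodType) x (f : {set I} -> V) :
  \sum_(A : {set I}) f A = \sum_(A : {set I} | x \notin A) (f A + f (x |: A)).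
Proof.
transitivity (\sum_(A : {set I} | A \subset x |: (setT :\ x)) f A).
  by apply: eq_bigl => A; rewrite setD1K ?inE // subsetT.
rewrite sum_subsetU1; last by rewrite !inE eqxx.
by apply: eq_bigl => A; rewrite subsetD1 subsetT.
Qed.

Lemma sum_superset (V : nmodType) A (f : {set I} -> V) :
  \sum_(T : {set I} | A \subset T) f T = \sum_(B : {set I} | [disjoint A & B]) f (A :|: B).
Proof.
rewrite (reindex_onto (fun B => A :|: B) (fun T => T :\: A)) /=; last first.
  by move=> T AT; rewrite -[RHS](setID T A) (setIidPr AT).
apply: eq_bigl => B; rewrite subsetUl /=; apply/eqP/idP => [<-|].
  by rewrite -setI_eq0 setIDA setIC setDIl setDv setI0.
rewrite -setI_eq0 => /eqP AB; rewrite setDUl setDv set0U.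
by apply/setDidPl; rewrite -setI_eq0 setIC AB.
Qed.

Section Diag.
Variable R : comNzRingType.
Implicit Types f g F : I -> R.

Lemma prodE f A : \prod_(i in A) f i = \prod_i (if i \in A then f i else 1).
Proof. exact: big_mkcond. Qed.

Lemma sum_prod_if f g :
  \sum_(A : {set I}) \prod_i (if i \in A then f i else g i) = \prod_i (f i + g i).
Proof. by rewrite bigA_distr. Qed.

(** Sets of primes stand for squarefree integers. The sum over r coprime to d in the sieve weight is
    written over the supersets T, which stand for d r; [g] will be 1/[f1] at primes and [w] the
    smooth cut-off. *)
Definition lamset f g (w : {set I} -> R) D : R :=
  (\prod_(i in D) - f i) * \sum_(T : {set I} | D \subset T) (\prod_(i in T) g i) * w T.

Definition ysum (u : I -> R) (w : {set I} -> R) A : R :=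
  \sum_(B : {set I} | [disjoint A & B]) (\prod_(i in B) u i) * w (A :|: B).

Lemma lamsetE f g w D : lamset f g w D = (\prod_(i in D) - (f i * g i)) * ysum g w D.
Proof.
rewrite /lamset sum_superset /ysum !mulr_sumr; apply: eq_bigr => B /disjoint_setI0 AB.
have -> : \prod_(i in D :|: B) g i = (\prod_(i in D) g i) * \prod_(i in B) g i.
  rewrite !prodE -big_split /=; apply: eq_bigr => i _; rewrite inE.
  have [iD|iD] := boolP (i \in D); rewrite ?mul1r //=.
  by case: ifP => [iB|]; rewrite ?mulr1 //; move/setP/(_ i): AB; rewrite !inE iD iB.
have -> : \prod_(i in D) - (f i * g i) = (\prod_(i in D) - f i) * \prod_(i in D) g i.
  by rewrite -big_split /=; apply: eq_bigr => i _; rewrite mulNr.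
by ring.
Qed.

(** After exchanging D and T the inner sum over D is an Euler product. An index of A is forced into
    D, an index of T outside A contributes [(1 - f i * F i) * g i], and an index outside both
    contributes 1; hence only the T containing A survive. *)
Lemma sum_lamset f g F w A :
  \sum_(D : {set I}) lamset f g w D *
     \prod_i (if i \in A then (i \in D)%:R else if i \in D then F i else 1) =
  (\prod_(i in A) - (f i * g i)) * ysum (fun i => (1 - f i * F i) * g i) w A.
Proof.
transitivity (\sum_(T : {set I}) w T * \prod_i (if i \in A then (if i \in T then - (f i * g i) else 0)
   else if i \in T then (1 - f i * F i) * g i else 1)).
  transitivity (\sum_(D : {set I}) \sum_(T : {set I}) w T * (\prod_i (if i \in T then g i else 1)) *
     \prod_i (if i \in D then - f i * (i \in T)%:R * (if i \in A then 1 else F i)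
              else if i \in A then 0 else 1)).
    apply: eq_bigr => D _; rewrite /lamset (big_mkcond (fun T : {set I} => D \subset T)) /= mulr_sumr mulr_suml.
    apply: eq_bigr => T _; rewrite !prodE; case: ifP => DT.
      transitivity (w T * (\prod_i (if i \in T then g i else 1)) *
        ((\prod_i (if i \in D then - f i else 1)) *
         \prod_i (if i \in A then (i \in D)%:R else if i \in D then F i else 1))); first by ring.
      congr (_ * _); rewrite -big_split /=; apply: eq_bigr => i _.
      case: ifP => iD; last by case: ifP; rewrite mul1r.
      by rewrite (subsetP DT _ iD) mulr1; case: ifP.
    have [x xD xT] := subsetPn (negbT DT).
    by rewrite [X in _ = _ * X](bigD1 x) //= xD (negbTE xT) !(mulr0, mul0r).
  rewrite exchange_big /=; apply: eq_bigr => T _.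
  rewrite -mulr_sumr sum_prod_if -mulrA -big_split /=; congr (_ * _).
  apply: eq_bigr => i _; case: ifP => _; case: ifP => _; rewrite ?mulr0 ?mul0r ?addr0 ?add0r ?mulr1 ?mul1r //.
    by rewrite mulrN mulrC.
  by rewrite mulrDl mulrDr mul1r mulr1 mulNr addrC mulNr mulrN; congr (_ - _); rewrite mulrC.
rewrite (bigID (fun T : {set I} => A \subset T)) /= [X in _ + X]big1 ?addr0; last first.
  move=> T /subsetPn[x xA xT]; rewrite (bigD1 x) //= xA (negbTE xT) mul0r mulr0 //.
rewrite sum_superset /ysum mulr_sumr; apply: eq_bigr => B /disjoint_setI0 AB.
have dAB : forall i, i \in A -> i \in B = false.
  by move=> i iA; apply: contraTF iA => iB; apply/negP => iA; move/setP/(_ i): AB; rewrite !inE iA iB.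
rewrite mulrA mulrC !prodE; congr (_ * _); rewrite -big_split /=; apply: eq_bigr => i _.
rewrite inE; have [iA|iA] := boolP (i \in A); first by rewrite dAB // mulr1.
by rewrite mul1r.
Qed.

(** At each index the factor for the union equals [F i * (1 - F i)] times the indicator of lying in
    both D and E, plus the product of the separate factors for D and for E. Expanding over the set A
    where the first summand is chosen decouples D from E, and [sum_lamset] evaluates each side. *)
Theorem diagonalization f g F w1 w2 :
  \sum_(D : {set I}) \sum_(E : {set I}) lamset f g w1 D * lamset f g w2 E * \prod_(i in D :|: E) F i =
  \sum_(A : {set I}) (\prod_(i in A) (F i * (1 - F i) * (f i * g i) ^+ 2)) *
     (ysum (fun i => (1 - f i * F i) * g i) w1 A *
      ysum (fun i => (1 - f i * F i) * g i) w2 A).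
Proof.
pose h A D := \prod_i (if i \in A then (i \in D)%:R else if i \in D then F i else 1) : R.
have FE D E : \prod_(i in D :|: E) F i = \sum_(A : {set I}) (\prod_(i in A) (F i * (1 - F i))) * (h A D * h A E).
  transitivity (\prod_i (((i \in D) && (i \in E))%:R * (F i * (1 - F i)) +
      (if i \in D then F i else 1) * (if i \in E then F i else 1))).
    rewrite prodE; apply: eq_bigr => i _; rewrite inE.
    case: (i \in D); case: (i \in E) => /=; rewrite ?mul0r ?mul1r ?mulr1 ?add0r //.
    by rewrite -mulrDr subrK mulr1.
  rewrite -sum_prod_if; apply: eq_bigr => A _.
  rewrite prodE -!big_split /=; apply: eq_bigr => i _.
  case: ifP => _; rewrite ?mul1r //.
  by case: (i \in D); case: (i \in E); rewrite /= ?mul1r ?mulr1 ?mul0r ?mulr0.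
transitivity (\sum_(A : {set I}) (\prod_(i in A) (F i * (1 - F i))) *
   ((\sum_(D : {set I}) lamset f g w1 D * h A D) * (\sum_(E : {set I}) lamset f g w2 E * h A E))).
  under eq_bigr => D _ do under eq_bigr => E _ do rewrite FE mulr_sumr.
  under eq_bigr => D _ do rewrite exchange_big /=.
  rewrite exchange_big /=; apply: eq_bigr => A _.
  rewrite big_distrlr /= mulr_sumr; apply: eq_bigr => D _; rewrite mulr_sumr.
  by apply: eq_bigr => E _; ring.
apply: eq_bigr => A _; rewrite !sum_lamset.
have -> : \prod_(i in A) (F i * (1 - F i) * (f i * g i) ^+ 2) =
    (\prod_(i in A) (F i * (1 - F i))) * ((\prod_(i in A) - (f i * g i)) * \prod_(i in A) - (f i * g i)).
  by rewrite -!big_split /=; apply: eq_bigr => i _; ring.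
by ring.
Qed.

(* Restricting the index set to the complement of [p] amounts to setting the weight [g] to zero there. *)
Definition mask p g : I -> R := fun i => if i == p then 0 else g i.

Lemma prod_mask p g A : \prod_(i in A) mask p g i = if p \in A then 0 else \prod_(i in A) g i.
Proof.
case: ifP => pA; first by rewrite (bigD1 p) //= /mask eqxx mul0r.
by apply: eq_bigr => i iA; rewrite /mask; case: eqP => // e; rewrite -e iA in pA.
Qed.

Lemma lamset_mask_in p f g w D : p \in D -> lamset f (mask p g) w D = 0.
Proof.
move=> pD; rewrite /lamset [X in _ * X]big1 ?mulr0 // => T /subsetP /(_ p pD) pT.
by rewrite prod_mask pT mul0r.
Qed.

(** If p is not in D, it is free in T; summing over its two states moves the weight at p from [g]
    into [w]. *)
Lemma lamset_mask p f g w D : p \notin D ->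
  lamset f g w D = lamset f (mask p g) (fun T => w T + g p * w (p |: T)) D.
Proof.
move=> pD; rewrite /lamset; congr (_ * _).
rewrite (big_mkcond (fun T : {set I} => D \subset T)) /= (sum_setD1 p) /= [RHS]big_mkcond [RHS](bigID (fun T : {set I} => p \in T)) /=.
rewrite [X in _ = X + _]big1 ?add0r => [|T pT]; last by rewrite prod_mask pT mul0r if_same.
apply: eq_bigr => T pT; rewrite prod_mask (negbTE pT).
have -> : (D \subset p |: T) = (D \subset T).
  apply/idP/idP => [|s]; last exact: subset_trans s (subsetUr _ _).
  move=> /subsetP s; apply/subsetP => i iD; move: (s i iD); rewrite !inE => /orP[/eqP e|//].
  by rewrite -e iD in pD.
case: ifP => _; last by rewrite addr0.
by rewrite big_setU1 //=; ring.
Qed.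

(** Putting p into D forces it into T and brings the factor [- f p]. The total coefficient of
    [w (p |: T)] is therefore [g p - f p * g p], which is -1 for the sieve weights. *)
Lemma lamset_maskD p f g w D : p \notin D -> g p - f p * g p = -1 ->
  lamset f g w D + lamset f g w (p |: D) = lamset f (mask p g) (fun T => w T - w (p |: T)) D.
Proof.
move=> pD fg; rewrite (lamset_mask f g w pD).
have -> : lamset f g w (p |: D) = lamset f (mask p g) (fun T => - (f p * g p) * w (p |: T)) D.
  rewrite /lamset big_setU1 //= -mulrA mulrCA; congr (_ * _).
  rewrite mulr_sumr (big_mkcond (fun T : {set I} => p |: D \subset T)) /= (sum_setD1 p) /= [RHS]big_mkcond [RHS](bigID (fun T : {set I} => p \in T)) /=.
  rewrite [X in _ = X + _]big1 ?add0r => [|T pT]; last by rewrite prod_mask pT mul0r if_same.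
  apply: eq_bigr => T pT; rewrite prod_mask (negbTE pT).
  rewrite subUset sub1set (negbTE pT) /= add0r.
  have -> : (p |: D \subset p |: T) = (D \subset T).
    apply/idP/idP => [|s]; last exact: setUS.
    move=> /subsetP s; apply/subsetP => i iD; move: (s i); rewrite !inE iD orbT => /(_ isT) /orP[/eqP e|//].
    by rewrite -e iD in pD.
  by case: ifP => _ //; rewrite big_setU1 //=; ring.
rewrite /lamset -mulrDr -big_split /=; congr (_ * _); apply: eq_bigr => T _.
rewrite -mulrDr; congr (_ * _).
by rewrite -addrA -mulrDl fg mulN1r.
Qed.

(** Fix D and E without p. Of the four ways to add p, three put it in the union, so their sum is (x
    + x')(y + y') - x y, where primes mark the weights with p added. [lamset_maskD] and
    [lamset_mask] rewrite both products with the weight masked at p. *)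
Lemma sum_lamset_mem p f g F w1 w2 : g p - f p * g p = -1 ->
  \sum_(D : {set I}) \sum_(E : {set I} | p \in D :|: E) lamset f g w1 D * lamset f g w2 E *
      \prod_(i in (D :|: E) :\ p) F i =
  (\sum_(D : {set I}) \sum_(E : {set I}) lamset f (mask p g) (fun T => w1 T - w1 (p |: T)) D *
       lamset f (mask p g) (fun T => w2 T - w2 (p |: T)) E * \prod_(i in D :|: E) F i) -
  (\sum_(D : {set I}) \sum_(E : {set I}) lamset f (mask p g) (fun T => w1 T + g p * w1 (p |: T)) D *
       lamset f (mask p g) (fun T => w2 T + g p * w2 (p |: T)) E * \prod_(i in D :|: E) F i).
Proof.
move=> fg.
have red w1' w2' : \sum_(D : {set I}) \sum_(E : {set I}) lamset f (mask p g) w1' D *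
       lamset f (mask p g) w2' E * \prod_(i in D :|: E) F i =
    \sum_(D : {set I} | p \notin D) \sum_(E : {set I} | p \notin E) lamset f (mask p g) w1' D *
       lamset f (mask p g) w2' E * \prod_(i in D :|: E) F i.
  rewrite (bigID (fun D : {set I} => p \in D)) /= big1 ?add0r => [|D pD]; last first.
    by rewrite big1 // => E _; rewrite lamset_mask_in // !mul0r.
  apply: eq_bigr => D _; rewrite (bigID (fun E : {set I} => p \in E)) /= big1 ?add0r // => E pE.
  by rewrite (lamset_mask_in _ _ _ pE) mulr0 mul0r.
rewrite !red -sumrB (sum_setD1 p); apply: eq_bigr => D pD.
rewrite -sumrB !(big_mkcond (fun E => p \in _)) /= -big_split /= (sum_setD1 p).
apply: eq_bigr => E pE.
have DE : p \notin D :|: E by rewrite inE negb_or pD.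
have e1 : (D :|: (p |: E)) :\ p = D :|: E.
  apply/setP => i; rewrite !inE; have [->|//] := eqVneq i p.
  by rewrite /= (negbTE pD) (negbTE pE).
have e2 : ((p |: D) :|: E) :\ p = D :|: E by rewrite -setUA setUCA e1.
have e3 : ((p |: D) :|: (p |: E)) :\ p = D :|: E.
  by apply/setP => i; rewrite !inE; have [->|//] := eqVneq i p; rewrite /= (negbTE pD) (negbTE pE).
rewrite e1 e2 e3 !inE !eqxx !orbT (negbTE pD) (negbTE pE) /= add0r.
rewrite -!lamset_maskD // -!lamset_mask //.
by ring.
Qed.

End Diag.
End SetSums.

(** * Elementary inequalities and the convergent majorant m^(-3/2) *)

Section Elementary.
Variable R : realType.
Implicit Types (a b x y X : R) (m n j : nat).

Lemma powB_le a b n : 0 <= b <= a -> a ^+ n.+1 - b ^+ n.+1 <= n.+1%:R * a ^+ n * (a - b).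
Proof.
move=> /andP[b0 ba]; elim: n => [|n IH]; first by rewrite expr0 !expr1; lra.
have an : b ^+ n.+1 <= a ^+ n.+1 by rewrite lerXn2r // nnegrE; lra.
have := ler_wpM2l (le_trans b0 ba) IH.
have := ler_wpM2r (_ : 0 <= a - b) an; rewrite subr_ge0 => /(_ ba).
rewrite (exprS a n.+1) (exprS b n.+1) -(natr1 n.+1) (exprS a n).
nra.
Qed.

Lemma powB_ge a b n : 0 <= b <= a -> n.+1%:R * b ^+ n * (a - b) <= a ^+ n.+1 - b ^+ n.+1.
Proof.
move=> /andP[b0 ba]; elim: n => [|n IH]; first by rewrite expr0 !expr1; lra.
have an : b ^+ n.+1 <= a ^+ n.+1 by rewrite lerXn2r // nnegrE; lra.
have := ler_wpM2l b0 IH.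
have := ler_wpM2r (_ : 0 <= a - b) an; rewrite subr_ge0 => /(_ ba).
rewrite (exprS a n.+1) (exprS b n.+1) -(natr1 n.+1) (exprS b n).
nra.
Qed.

Lemma powB_taylor a b n : 0 <= b <= a ->
  `|a ^+ n.+2 - b ^+ n.+2 - n.+2%:R * a ^+ n.+1 * (a - b)| <=
  n.+2%:R * n.+1%:R * a ^+ n * (a - b) ^+ 2.
Proof.
move=> ab; have h1 := powB_le n.+1 ab; have h2 := powB_ge n.+1 ab.
have h3 := powB_le n ab; case/andP: ab => b0 ba.
have : n.+2%:R * (a - b) * (a ^+ n.+1 - b ^+ n.+1) <= n.+2%:R * (a - b) * (n.+1%:R * a ^+ n * (a - b)).
  by rewrite ler_wpM2l // mulr_ge0 // subr_ge0.
by rewrite ler_norml => h4; apply/andP; split; nra.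
Qed.

(** This is m^(-3/2), the common majorant of all convergent sums below: any power of log m over m^2
    is at most a multiple of it, and its partial sums never exceed 4. *)
Definition q32 m : R := (m%:R * Num.sqrt m%:R)^-1.

Lemma q32_ge0 m : 0 <= q32 m.
Proof. by rewrite invr_ge0 mulr_ge0 // sqrtr_ge0. Qed.

Lemma q32_gt0 m : (0 < m)%N -> 0 < q32 m.
Proof. by move=> m0; rewrite invr_gt0 mulr_gt0 // ?sqrtr_gt0 ltr0n. Qed.

(** With s and t the square roots of m and m + 1, the difference of the reciprocals is 1/(s t (s +
    t)), and t at most 3 s/2 bounds the denominator by 4 s^3. *)
Lemma q32_tele m : (0 < m)%N ->
  q32 m <= 4 * ((Num.sqrt m%:R)^-1 - (Num.sqrt m.+1%:R)^-1).
Proof.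
move=> m0; set s := Num.sqrt m%:R; set t := Num.sqrt m.+1%:R.
have s0 : 0 < s by rewrite sqrtr_gt0 ltr0n.
have t0 : 0 < t by rewrite sqrtr_gt0 ltr0n.
have s2 : s ^+ 2 = m%:R by rewrite sqr_sqrtr.
have t2 : t ^+ 2 = s ^+ 2 + 1 by rewrite sqr_sqrtr // s2 natr1.
have s1 : 1 <= s ^+ 2 by rewrite s2 ler1n.
have st : s <= t by rewrite ler_psqrt // ?nnegrE // ler_nat.
have ts : t <= 3 / 2 * s.
  by rewrite -(@ler_pXn2r _ 2) // ?nnegrE; [rewrite exprMn t2; nra|lra|lra].
have -> : q32 m = (s ^+ 3)^-1 by rewrite /q32 -/s -s2 -exprSr.
have -> : s^-1 - t^-1 = (s * t * (s + t))^-1.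
  have e : (t - s) * (t + s) = 1 by rewrite -subr_sqr t2; ring.
  have n1 : s != 0 by lra.
  have n2 : t != 0 by lra.
  have n3 : s + t != 0 by lra.
  apply: (@mulfI _ (s * t * (s + t))); first by rewrite !mulf_neq0.
  rewrite mulfV ?mulf_neq0 // -[RHS]e; field.
  by rewrite n1 n2.
have h : s * t * (s + t) <= 4 * s ^+ 3.
  have h2 : t * (s + t) <= 4 * s ^+ 2 by nra.
  by have := ler_wpM2l (ltW s0) h2; rewrite exprS; lra.
have d0 : 0 < s * t * (s + t) by rewrite !mulr_gt0 // addr_gt0.
by rewrite ler_pdivlMr // ler_pdivrMl ?exprn_gt0 //; lra.
Qed.

Lemma sum_q32 n : \sum_(1 <= m < n) q32 m <= 4.
Proof.
case: n => [|n]; first by rewrite big_geq.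
apply: (@le_trans _ _ (\sum_(1 <= m < n.+1) 4 * ((Num.sqrt m%:R)^-1 - (Num.sqrt m.+1%:R)^-1 : R))).
  by apply: ler_sum_nat => m /andP[m0 _]; apply: q32_tele.
rewrite -mulr_sumr -{2}(mulr1 4) ler_wpM2l //.
rewrite (telescope_sumr_eq (fun m => - (Num.sqrt m%:R)^-1)) //; last by move=> m _; ring.
by rewrite sqrtr1 invr1 opprK addrC lerBlDl lerDr invr_ge0 sqrtr_ge0.
Qed.

Lemma expR_ge_pow (c : nat) y : 0 <= y -> (y / c.+1%:R) ^+ c.+1 <= expR y.
Proof.
move=> y0; have {2}-> : y = c.+1%:R * (y / c.+1%:R) by rewrite mulrC divfK // pnatr_eq0.
rewrite expRM_natl lerXn2r ?nnegrE ?expR_ge0 ?divr_ge0 //.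
by apply: le_trans (expR_ge1Dx _); rewrite lerDr.
Qed.

Lemma sqrt_expR y : Num.sqrt (expR y) = expR (y / 2).
Proof.
have -> : expR y = expR (y / 2) ^+ 2.
  by rewrite -expRM_natl mulrC divfK // pnatr_eq0.
by rewrite sqrtr_sqr ger0_norm ?expR_ge0.
Qed.

Lemma polyln_le_sqrt (c : nat) : {C : R | 0 < C & forall x, 1 <= x -> (1 + ln x) ^+ c <= C * Num.sqrt x}.
Proof.
exists ((2 * c.+1%:R) ^+ c.+1) => [|x x1]; first by rewrite exprn_gt0 // mulr_gt0 // ltr0n.
have x0 : 0 < x by lra.
have l0 : 0 <= ln x by exact: ln_ge0.
rewrite -{2}(lnK (x := x)) ?posrE // sqrt_expR.
have -> : ln x / 2 = c.+1%:R * (ln x / (2 * c.+1%:R)).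
  by field; rewrite addrC natr1 pnatr_eq0.
rewrite expRM_natl -exprMn; apply: (@le_trans _ _ ((1 + ln x) ^+ c.+1)).
  by rewrite exprS ler_peMl ?exprn_ge0 //; lra.
have c1 : 1 <= c.+1%:R :> R by rewrite ler1n.
apply: lerXn2r; rewrite ?nnegrE; [lra|by rewrite mulr_ge0 ?expR_ge0; lra|].
apply: (@le_trans _ _ (2 * c.+1%:R * (1 + ln x / (2 * c.+1%:R)))).
  rewrite mulrDr mulr1 [X in _ <= _ + X]mulrC divfK ?mulf_neq0 ?pnatr_eq0 //.
  by lra.
by rewrite ler_wpM2l ?expR_ge1Dx //; lra.
Qed.

(** The finitely many exceptional values are paid for by enlarging the constant. Through this step
    constants come to depend on [H]. *)
Lemma eventually_all (f h : nat -> R) (P : pred nat) n0 D :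
  (forall n, P n -> 0 < h n) -> (forall n, P n -> (n0 <= n)%N -> f n <= D * h n) ->
  exists2 D', 0 <= D' & forall n, P n -> f n <= D' * h n.
Proof.
move=> h0 fD.
exists (`|D| + \sum_(i < n0) `|f i / h i|); first by rewrite addr_ge0 ?sumr_ge0.
move=> n Pn; have hn := h0 n Pn; rewrite -ler_pdivrMr //.
case: (leqP n0 n) => [le|lt].
  apply: (@le_trans _ _ D); first by rewrite ler_pdivrMr // fD.
  by apply: le_trans (ler_norm D) _; rewrite lerDl sumr_ge0.
rewrite (bigD1 (Ordinal lt)) //=.
have : 0 <= \sum_(i < n0 | i != Ordinal lt) `|f i / h i| by rewrite sumr_ge0.
have := ler_norm (f n / h n); have := normr_ge0 D; lra.
Qed.

End Elementary.

(** * The summation operator of zeta *)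

Section TOperator.
Variable R : realType.
Implicit Types (X : R) (F G : R -> R) (m n : nat).

Definition supp0 F := forall X, X <= 0 -> F X = 0.

Definition rough n m := all (fun p => (n <= p)%N) (primes m).

(** The zeta operator restricted to integers without prime factor below n. The index m = 0 passes
    the test [rough], but its term is 0 because the inverse of 0 is 0. *)
Definition Tn n F X : R :=
  \sum_(0 <= m < (Num.truncn (expR X)).+1 | rough n m) F (X - ln m%:R) / m%:R.

Lemma truncn_expR_lt X m : (Num.truncn (expR X) < m)%N -> X < ln (m%:R : R).
Proof.
move=> h; have m0 : (0 < m)%N by apply: leq_ltn_trans h.
have : expR X < m%:R.
  by apply: lt_le_trans (truncnS_gt _) _; rewrite ler_nat.
by rewrite -{1}(@lnK _ m%:R) ?posrE ?ltr0n // ltr_expR.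
Qed.

Lemma le_truncn_expR X m : (0 < m)%N -> (m <= Num.truncn (expR X))%N -> ln (m%:R : R) <= X.
Proof.
move=> m0 h; rewrite -ler_expR lnK ?posrE ?ltr0n //.
by rewrite -truncn_ge_nat // expR_ge0.
Qed.

Lemma TnE n F X M : supp0 F -> (Num.truncn (expR X) < M)%N ->
  Tn n F X = \sum_(0 <= m < M | rough n m) F (X - ln m%:R) / m%:R.
Proof.
move=> F0 h; rewrite /Tn [RHS](@big_cat_nat _ _ _ (Num.truncn (expR X)).+1) //=.
rewrite [X in _ = _ + X]big_nat_cond [X in _ = _ + X]big1 ?addr0 // => m /andP[/andP[hm _] _].
by rewrite F0 ?mul0r // subr_le0 ltW // truncn_expR_lt.
Qed.

Lemma sum_dvdn (V : nmodType) (h : nat -> V) n K : (0 < n)%N ->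
  \sum_(0 <= m < n * K | (n %| m)%N) h m = \sum_(0 <= m < K) h (n * m)%N.
Proof.
move=> n0; elim: K => [|K IH]; first by rewrite muln0 !big_geq.
rewrite mulnS addnC (@big_cat_nat _ _ _ (n * K)) ?leq_addr //= IH big_nat_recr //=; congr (_ + _).
rewrite big_mkcond (@big_ltn _ _ _ (n * K)); last by rewrite -[X in (X < _)%N]addn0 ltn_add2l.
rewrite dvdn_mulr // -[RHS]addr0; congr (_ + _).
rewrite big_nat_cond big1 // => m /andP[/andP[h1 h2] _].
case: ifP => // /dvdnP[q E]; move: h1 h2; rewrite E (mulnC q) addnC -mulnS !ltn_pmul2l // => h1 h2.
by move: (leq_trans h2 h1); rewrite ltnn.
Qed.

Lemma roughS n m : prime n -> rough n.+1 m = rough n m && (~~ (n %| m)%N || (m == 0)%N).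
Proof.
move=> pn; have [->|m0] := posnP m; first by rewrite orbT andbT.
rewrite orbF; apply/allP/andP => [h|[/allP h nm] p pm].
  split; first by apply/allP => p /h /ltnW.
  by apply/negP => nm; have := h n; rewrite mem_primes pn m0 nm ltnn => /(_ isT).
rewrite ltn_neqAle h // andbT; apply: contra nm => /eqP ->.
by move: pm; rewrite mem_primes => /and3P[].
Qed.

Lemma roughS_nprime n m : ~~ prime n -> rough n.+1 m = rough n m.
Proof.
move=> pn; apply: eq_in_all => p; rewrite mem_primes => /and3P[pp _ _].
by rewrite [RHS]leq_eqVlt; case: eqP => //= e; rewrite e pp in pn.
Qed.

Lemma rough_mul n m : prime n -> (0 < m)%N -> rough n (n * m) = rough n m.
Proof.
move=> pn m0; have n0 := prime_gt0 pn; apply/allP/allP => h p pm.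
  by apply: h; rewrite primesM // pm orbT.
by move: pm; rewrite primesM // primes_prime // inE => /orP[/eqP ->//|]; exact: h.
Qed.

(** One step of the sieve of Eratosthenes, read as an identity of operators: the multiples of n that
    are rough are n m with m rough, so deleting them subtracts the shift by log n divided by n. *)
Lemma Tn_prime n F X : supp0 F -> prime n ->
  Tn n.+1 F X = Tn n F X - Tn n F (X - ln n%:R) / n%:R.
Proof.
move=> F0 pn; have n0 := prime_gt0 pn; set K := (Num.truncn (expR X)).+1.
have nK : (Num.truncn (expR X) < n * K)%N by apply: leq_trans (leq_pmull _ n0).
have XK : (Num.truncn (expR (X - ln (n%:R : R))) < K)%N.
  rewrite ltnS; apply: le_truncn; rewrite ler_expR gerBl ln_ge0 // ler1n //.
rewrite (TnE _ F0 nK) (TnE _ F0 nK) (TnE _ F0 XK).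
rewrite [X in _ = X - _](bigID (fun m => (n %| m)%N)) /=.
have -> : \sum_(0 <= m < n * K | rough n m && (n %| m)%N) F (X - ln m%:R) / m%:R =
          (\sum_(0 <= m < K | rough n m) F (X - ln n%:R - ln m%:R) / m%:R) / n%:R.
  transitivity (\sum_(0 <= m < n * K | (n %| m)%N) if rough n m then F (X - ln (m%:R : R)) / m%:R else 0).
    by rewrite -big_mkcondr; apply: eq_bigl => m; rewrite andbC.
  rewrite sum_dvdn // mulr_suml [RHS]big_mkcond; apply: eq_bigr => m _.
  have [->|m0] := posnP m; first by rewrite muln0 !(invr0, mulr0, mul0r, if_same).
  rewrite rough_mul //; case: ifP => // _.
  by rewrite natrM lnM ?posrE ?ltr0n // opprD addrA invfM [n%:R^-1 * _]mulrC mulrA.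
rewrite addrAC subrr add0r big_mkcond [RHS]big_mkcond; apply: eq_bigr => m _.
rewrite roughS //; have [->|m0] := posnP m; first by rewrite !(invr0, mulr0, if_same).
by rewrite orbF.
Qed.

Lemma Tn_nprime n F X : ~~ prime n -> Tn n.+1 F X = Tn n F X.
Proof. by move=> pn; apply: eq_bigl => m; rewrite roughS_nprime. Qed.

(** Every m with 1 < m < n has a prime factor below n, and m at least n is cut off by the support of
    F; only m = 1 remains. *)
Lemma Tn_large n F X : supp0 F -> (0 < n)%N -> X <= ln n%:R -> Tn n F X = F X.
Proof.
move=> F0 n0 Xn.
rewrite (@TnE _ _ _ (Num.truncn (expR X)).+2) // big_mkcond big_ltn // big_ltn //=.
rewrite invr0 mulr0 add0r ln1 subr0 divr1 big_nat_cond big1 ?addr0 // => m /andP[/andP[m2 _] _].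
case: ifP => // rm.
have [nm|mn] := leqP n m.
  by rewrite F0 ?mul0r // subr_le0; apply: le_trans Xn _; rewrite ler_ln ?posrE ?ltr0n ?ler_nat //; lia.
have := allP rm (pdiv m); rewrite mem_primes pdiv_prime // pdiv_dvd (ltnW m2) => /(_ isT) h.
by have := leq_trans h (pdiv_leq (ltnW m2)); rewrite leqNgt mn.
Qed.

Definition T F := Tn 0 F.

Lemma rough0 m : rough 0 m. Proof. exact/allP. Qed.

Lemma TE F X : T F X = \sum_(1 <= m < (Num.truncn (expR X)).+1) F (X - ln m%:R) / m%:R.
Proof.
rewrite /T /Tn (eq_bigl predT) => [|m]; last by rewrite rough0.
by rewrite big_ltn // invr0 mulr0 add0r.
Qed.

Lemma supp0_T F : supp0 F -> supp0 (T F).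
Proof.
move=> F0 X X0; rewrite TE big_nat_cond big1 // => m /andP[/andP[m1 _] _].
by rewrite F0 ?mul0r // subr_le0 (le_trans X0) // ln_ge0 // ler1n.
Qed.

End TOperator.

(** * Harmonic sums and Euler's constant *)

Section Harmonic.
Variable R : realType.
Implicit Types (X : R) (m n N j : nat).

Lemma lnS_bounds m : (0 < m)%N ->
  ((m.+1%:R)^-1 : R) <= (ln m.+1%:R - ln m%:R : R) <= (m%:R)^-1.
Proof.
move=> m0; have mp : 0 < m%:R :> R by rewrite ltr0n.
have m1 : m.+1%:R = m%:R + 1 :> R by rewrite natr1.
rewrite -ln_div ?posrE ?ltr0n //; apply/andP; split; last first.
  have -> : m.+1%:R / m%:R = 1 + m%:R^-1 :> R by rewrite m1; field; rewrite lt0r_neq0.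
  by apply: le_ln1Dx; rewrite (lt_le_trans (ltrN10 R)) // invr_ge0.
rewrite -[X in X <= _]opprK lerNl -lnV ?posrE ?divr_gt0 ?ltr0n // invf_div.
have -> : m%:R / m.+1%:R = 1 + - m.+1%:R^-1 :> R by rewrite m1; field; rewrite natr1 pnatr_eq0.
apply: le_ln1Dx; rewrite ltrN2 invf_lt1 ?ltr0n // ltr1n //.
Qed.

(** The excess of 1/m over the integral of 1/x from m to m + 1; the sum of all these excesses is
    Euler's constant. *)
Definition del m : R := m%:R^-1 - (ln m.+1%:R - ln m%:R).

Lemma del_bounds m : (0 < m)%N -> 0 <= del m <= m%:R^-1 - m.+1%:R^-1.
Proof. by move=> m0; have /andP[h1 h2] := lnS_bounds m0; rewrite /del subr_ge0 h2 lerB. Qed.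

Lemma del_sq m : (0 < m)%N -> del m <= (m%:R^-1) ^+ 2.
Proof.
move=> m0; have /andP[_ h] := del_bounds m0; apply: le_trans h _.
have mp : 0 < m%:R :> R by rewrite ltr0n.
rewrite -natr1; have -> : m%:R^-1 - (m%:R + 1)^-1 = m%:R^-1 * (m%:R + 1)^-1 :> R by field; lra.
by rewrite expr2 ler_wpM2l ?invr_ge0 ?ler0n // lef_pV2 ?posrE; lra.
Qed.

Lemma sum_del N M : (0 < N)%N -> (N <= M)%N -> 0 <= \sum_(N <= m < M) del m <= N%:R^-1.
Proof.
move=> N0 NM; apply/andP; split.
  rewrite big_nat_cond; apply: sumr_ge0 => m /andP[/andP[h _] _].
  by have /andP[] := del_bounds (leq_trans N0 h).
apply: (@le_trans _ _ (\sum_(N <= m < M) (m%:R^-1 - m.+1%:R^-1 : R))).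
  by apply: ler_sum_nat => m /andP[h _]; have /andP[] := del_bounds (leq_trans N0 h).
rewrite (telescope_sumr_eq (fun m => - (m%:R)^-1)) //; last by move=> m _; ring.
by rewrite opprK addrC lerBlDl lerDr invr_ge0.
Qed.

Lemma gam_ex : {g : R | forall N, (0 < N)%N -> `|\sum_(1 <= m < N) del m - g| <= N%:R^-1}.
Proof.
pose D N := \sum_(1 <= m < N.+1) del m.
have nd : nondecreasing_seq D.
  apply/nondecreasing_seqP => n; rewrite /D [leRHS]big_nat_recr //= lerDl.
  by have /andP[] := @del_bounds n.+1 isT.
have cv : cvgn D.
  apply: nondecreasing_is_cvgn => //; exists 1 => _ [n _ <-].
  by have /andP[_] := @sum_del 1 n.+1 isT isT; rewrite invr1.
exists (limn D) => N N0; rewrite distrC ger0_norm; last first.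
  rewrite subr_ge0; case: N N0 => // N _.
  exact: (nondecreasing_cvgn_le nd cv N).
rewrite lerBlDl; apply: limr_le => //; near=> M.
have NM : (N <= M.+1)%N by near: M; exists N => // M /= h; apply: leqW.
rewrite /D (@big_cat_nat _ _ _ N) //= lerD2l.
by have /andP[] := sum_del N0 NM.
Unshelve. all: by end_near.
Qed.

Lemma sum_inv_le X : 0 < X -> \sum_(1 <= m < (Num.truncn (expR X)).+1) (m%:R^-1 : R) <= 1 + X.
Proof.
move=> X0; set N := Num.truncn _.
have N1 : (0 < N)%N by rewrite truncn_gt0 ltW // expR_gt1.
rewrite big_ltn // invr1 lerD2l big_add1 /=.
apply: (@le_trans _ _ (\sum_(1 <= m < N) (ln m.+1%:R - ln m%:R : R))).
  by apply: ler_sum_nat => m /andP[h _]; have /andP[] := lnS_bounds h.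
rewrite telescope_sumr // ln1 subr0; exact: le_truncn_expR.
Qed.

End Harmonic.

(** * The zeta operator on powers *)

Section ESums.
Variable R : realType.
Implicit Types (X a b C : R) (F G : R -> R) (m n j J : nat).

Lemma ltN_ln X : 0 < X -> [/\ (0 < Num.truncn (expR X))%N,
  0 <= X - ln (Num.truncn (expR X))%:R <= 1 & X <= (Num.truncn (expR X))%:R].
Proof.
move=> X0; set N := Num.truncn _.
have N1 : (0 < N)%N by rewrite truncn_gt0 ltW // expR_gt1.
have h1 : ln (N%:R : R) <= X by exact: le_truncn_expR.
have h2 : X < ln (N.+1%:R : R) by exact: truncn_expR_lt.
have /andP[_ h3] := @lnS_bounds R N N1.
have h4 : (N%:R : R)^-1 <= 1 by rewrite invf_le1 ?ltr0n // ler1n.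
split => //; first by apply/andP; split; slra.
by apply: le_trans (ltW h2) _; rewrite -natr1 addrC le_ln1Dx // (lt_le_trans (ltrN10 R)) // ler0n.
Qed.

Lemma step_range X m : 0 < X -> (1 <= m < Num.truncn (expR X))%N ->
  [/\ 0 <= X - ln (m.+1%:R : R) <= X - ln (m%:R : R), X - ln (m%:R : R) <= X
    & 0 <= ln (m.+1%:R : R) - ln m%:R <= 1].
Proof.
move=> X0 /andP[m1 mN]; have /andP[h1 h2] := @lnS_bounds R m m1.
have h4 : (m%:R : R)^-1 <= 1 by rewrite invf_le1 ?ltr0n // ler1n.
have h5 : ln (m.+1%:R : R) <= X by exact: le_truncn_expR.
have h6 : 0 <= ln (m%:R : R) by rewrite ln_ge0 // ler1n.
have h7 : 0 <= (m.+1%:R : R)^-1 by rewrite invr_ge0.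
have h8 := le_trans h7 h1.
by split; try apply/andP; try split; slra.
Qed.

Lemma tele_pow X J N : (0 < N)%N ->
  \sum_(1 <= m < N) ((X - ln (m%:R : R)) ^+ J - (X - ln (m.+1%:R : R)) ^+ J) =
  X ^+ J - (X - ln (N%:R : R)) ^+ J.
Proof.
move=> N0; rewrite (telescope_sumr_eq (fun m => - (X - ln (m%:R : R)) ^+ J)) //; last by move=> m _; ring.
by rewrite ln1 subr0; ring.
Qed.

(** 1/m is the sum of [del] and log(m + 1) - log m. The second part compares with the telescoping
    differences of (X - log m)^(J + 1)/(J + 1); the first is nonnegative with total at most 1. *)
Lemma esum1 J X : 0 < X ->
  `|\sum_(1 <= m < (Num.truncn (expR X)).+1) (X - ln m%:R) ^+ J / m%:R - X ^+ J.+1 / J.+1%:R|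
  <= 4 * (1 + X) ^+ J.
Proof.
move=> X0; have [N1 /andP[aN0 aN1] _] := ltN_ln X0.
have sr := @step_range X ^~ X0; set N := Num.truncn _ in N1 aN0 aN1 sr *.
rewrite big_nat_recr //=; set S := \sum_(_ <= _ < _) _; set aN := X - ln (N%:R : R) in aN0 aN1 *.
have JN : 0 < J.+1%:R :> R by rewrite ltr0n.
have T1 := @tele_pow X J.+1 N N1; have T0 := @tele_pow X J N N1.
rewrite -/aN in T1 T0.
have lo : (X ^+ J.+1 - aN ^+ J.+1) / J.+1%:R <= S.
  rewrite -T1 mulr_suml; apply: ler_sum_nat => m mN.
  have [ab aX eps] := sr m mN; have h := powB_le J ab.
  have m1 : (0 < m)%N by case/andP: mN.
  have /andP[_ h2] := @lnS_bounds R m m1.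
  rewrite ler_pdivrMr //; apply: le_trans h _.
  rewrite -mulrA mulrC ler_wpM2r ?ler0n // ler_wpM2l ?exprn_ge0 //; first by case/andP: ab => h0 h1; exact: le_trans h1.
  slra.
have up : S <= (X ^+ J.+1 - aN ^+ J.+1) / J.+1%:R + X ^+ J * 1 + (X ^+ J - aN ^+ J).
  apply: (@le_trans _ _ ((X ^+ J.+1 - aN ^+ J.+1) / J.+1%:R + X ^+ J * (\sum_(1 <= m < N) del R m) + (X ^+ J - aN ^+ J))).
    rewrite -T1 -T0 mulr_suml mulr_sumr -!big_split /=; apply: ler_sum_nat => m mN.
    have [ab aX /andP[eps0 eps1]] := sr m mN; have h := powB_ge J ab.
    have m1 : (0 < m)%N by case/andP: mN.
    have /andP[d0 _] := @del_bounds R m m1.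
    set a := X - ln m%:R in ab aX h *; set b := X - ln m.+1%:R in ab h *.
    have e : (m%:R : R)^-1 = del R m + (a - b) by rewrite /del /a /b; ring.
    have /andP[b0 ba] := ab.
    have abJ : b ^+ J <= a ^+ J by rewrite lerXn2r // ?nnegrE //; exact: le_trans ba.
    have aXJ : a ^+ J <= X ^+ J by rewrite lerXn2r // ?nnegrE ?(ltW X0) //; exact: le_trans ba.
    have h' : b ^+ J * (a - b) <= (a ^+ J.+1 - b ^+ J.+1) / J.+1%:R.
      by rewrite ler_pdivlMr //; move: h; rewrite -mulrA mulrC.
    have h2 : a ^+ J * del R m <= X ^+ J * del R m by rewrite ler_wpM2r.
    have h3 : (a ^+ J - b ^+ J) * (a - b) <= a ^+ J - b ^+ J.
      by rewrite ler_piMr ?subr_ge0 // /a /b; slra.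
    rewrite e; move: h'; set c := (J.+1%:R)^-1 => h'; slra.
  rewrite lerD2r lerD2l ler_wpM2l ?exprn_ge0 ?(ltW X0) //.
  by have /andP[_] := @sum_del R 1 N isT N1; rewrite invr1.
have aNJ : 0 <= aN ^+ J <= 1 by rewrite exprn_ge0 //= exprn_ile1.
have aNJ1 : 0 <= aN ^+ J.+1 <= 1 by rewrite exprn_ge0 //= exprn_ile1.
have q0 : 0 <= aN ^+ J.+1 / J.+1%:R <= 1.
  have /andP[u1 u2] := aNJ1; apply/andP; split; first exact: divr_ge0 u1 (ltW JN).
  by rewrite ler_pdivrMr // mul1r (le_trans u2) // ler1n.
have q1 : 0 <= aN ^+ J / N%:R <= aN ^+ J.
  have /andP[u1 u2] := aNJ; rewrite divr_ge0 //=.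
  by rewrite ler_piMr // invf_le1 ?ler1n ?ltr0n.
have XJ : X ^+ J <= (1 + X) ^+ J by rewrite lerXn2r ?nnegrE //; slra.
have oJ : 1 <= (1 + X) ^+ J by rewrite exprn_ege1 //; slra.
have X0J : 0 <= X ^+ J by rewrite exprn_ge0 // ltW.
rewrite mulrBl in lo up.
move: lo up q0; set c := (J.+1%:R)^-1 => lo up.
case/andP => *; case/andP: q1 => *.
by rewrite ler_norml; apply/andP; split; slra.
Qed.

Lemma q32E m : (0 < m)%N -> q32 R m = Num.sqrt m%:R * (m%:R^-1) ^+ 2.
Proof.
move=> m0; have s0 : 0 < Num.sqrt (m%:R : R) by rewrite sqrtr_gt0 ltr0n.
have s2 : Num.sqrt (m%:R : R) ^+ 2 = m%:R by rewrite sqr_sqrtr.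
rewrite /q32; set s := Num.sqrt _ in s0 s2 *; rewrite -s2; field.
by rewrite lt0r_neq0.
Qed.

(** The splitting of [esum1] with a second-order Taylor bound on the telescoping part. Against
    [del], the power of X - log m may be replaced by that of X because the sum of log m/m^2
    converges; so C.2 is the sum of all [del]. *)
Lemma esum2 j : {C : R * R | 0 <= C.1 & forall X, 0 < X ->
  `|\sum_(1 <= m < (Num.truncn (expR X)).+1) (X - ln m%:R) ^+ j.+1 / m%:R
     - X ^+ j.+2 / j.+2%:R - C.2 * X ^+ j.+1| <= C.1 * (1 + X) ^+ j}.
Proof.
have [g gP] := gam_ex R.
have [C1 C10 C1P] := polyln_le_sqrt R 1.
exists (4 * C1 * j.+1%:R + 3, g) => /= [|X X0].
  by rewrite addr_ge0 // !mulr_ge0 // ltW.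
have [N1 /andP[aN0 aN1] XN] := ltN_ln X0.
have sr := @step_range X ^~ X0; set N := Num.truncn _ in N1 aN0 aN1 sr XN *.
rewrite big_nat_recr //=; set S := \sum_(_ <= _ < _) _; set aN := X - ln (N%:R : R) in aN0 aN1 *.
have JN : 0 < j.+2%:R :> R by rewrite ltr0n.
have T1 := @tele_pow X j.+2 N N1; rewrite -/aN in T1.
have Xj : X ^+ j <= (1 + X) ^+ j by rewrite lerXn2r ?nnegrE //; slra.
have X0j : 0 <= X ^+ j by rewrite exprn_ge0 // ltW.
have main : `|S - (X ^+ j.+2 - aN ^+ j.+2) / j.+2%:R - X ^+ j.+1 * \sum_(1 <= m < N) del R m|
   <= 4 * C1 * j.+1%:R * (1 + X) ^+ j.
  rewrite -T1 mulr_suml mulr_sumr -!sumrB.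
  apply: le_trans (ler_norm_sum _ _ _) _.
  apply: (@le_trans _ _ (\sum_(1 <= m < N) C1 * j.+1%:R * (1 + X) ^+ j * q32 R m)); last first.
    rewrite -mulr_sumr mulrC; have -> : 4 * C1 * j.+1%:R * (1 + X) ^+ j = 4 * (C1 * j.+1%:R * (1 + X) ^+ j) by ring.
    rewrite ler_wpM2r ?sum_q32 // !mulr_ge0 ?ltW ?exprn_gt0 //; slra.
  apply: ler_sum_nat => m mN.
  have [ab aX /andP[eps0 eps1]] := sr m mN; have h := powB_taylor j ab.
  have m1 : (0 < m)%N by case/andP: mN.
  have /andP[d0 _] := @del_bounds R m m1; have dsq := @del_sq R m m1.
  have /andP[_ epsm] := @lnS_bounds R m m1.
  set a := X - ln m%:R in ab aX h *; set b := X - ln m.+1%:R in ab h *.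
  have e : (m%:R : R)^-1 = del R m + (a - b) by rewrite /del /a /b; ring.
  have /andP[b0 ba] := ab; have a0 := le_trans b0 ba.
  have aXj : a ^+ j <= X ^+ j by rewrite lerXn2r // ?nnegrE ?(ltW X0).
  have lm0 : 0 <= ln (m%:R : R) by rewrite ln_ge0 // ler1n.
  have Xa : 0 <= a <= X by rewrite a0.
  have h2 := powB_le j Xa.
  have h3 : a ^+ j.+1 <= X ^+ j.+1 by rewrite lerXn2r // ?nnegrE ?(ltW X0).
  have -> : a ^+ j.+1 / m%:R - (a ^+ j.+2 - b ^+ j.+2) / j.+2%:R - X ^+ j.+1 * del R m =
    - ((a ^+ j.+2 - b ^+ j.+2 - j.+2%:R * a ^+ j.+1 * (a - b)) / j.+2%:R) -
    (X ^+ j.+1 - a ^+ j.+1) * del R m.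
    rewrite e; field; slra.
  apply: le_trans (ler_normB _ _) _; rewrite normrN.
  have p1 : `|(a ^+ j.+2 - b ^+ j.+2 - j.+2%:R * a ^+ j.+1 * (a - b)) / j.+2%:R| <=
            j.+1%:R * X ^+ j * m%:R^-1 ^+ 2.
    rewrite normrM [X in _ * X]ger0_norm ?invr_ge0 // ler_pdivrMr //.
    apply: le_trans h _.
    have -> : j.+2%:R * j.+1%:R * a ^+ j * (a - b) ^+ 2 = j.+1%:R * (a ^+ j * (a - b) ^+ 2) * j.+2%:R by ring.
    rewrite -(mulrA j.+1%:R (X ^+ j)) ler_wpM2r // ler_wpM2l //.
    apply: ler_pM; rewrite ?exprn_ge0 // ?subr_ge0 //.
    rewrite lerXn2r ?nnegrE ?subr_ge0 ?invr_ge0 //.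
    by rewrite /a /b; slra.
  have p2 : `|(X ^+ j.+1 - a ^+ j.+1) * del R m| <= j.+1%:R * X ^+ j * ln m%:R * m%:R^-1 ^+ 2.
    rewrite ger0_norm ?mulr_ge0 ?subr_ge0 //.
    apply: ler_pM; rewrite ?subr_ge0 //.
    by apply: le_trans h2 _; rewrite /a opprB addrC subrK.
  apply: le_trans (lerD p1 p2) _.
  rewrite q32E //; set s := Num.sqrt _; set q := _ ^+ 2.
  have q0 : 0 <= q by rewrite exprn_ge0.
  have h5 : 1 + ln m%:R <= C1 * s by have := C1P m%:R; rewrite expr1 ler1n => ->.
  have -> : j.+1%:R * X ^+ j * q + j.+1%:R * X ^+ j * ln m%:R * q = (j.+1%:R * q) * (X ^+ j * (1 + ln m%:R)) by ring.
  have -> : C1 * j.+1%:R * (1 + X) ^+ j * (s * q) = (j.+1%:R * q) * ((1 + X) ^+ j * (C1 * s)) by ring.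
  by rewrite ler_wpM2l ?mulr_ge0 // ler_pM //; slra.
have aNJ : 0 <= aN ^+ j.+1 <= 1 by rewrite exprn_ge0 //= exprn_ile1.
have aNJ1 : 0 <= aN ^+ j.+2 <= 1 by rewrite exprn_ge0 //= exprn_ile1.
have q0 : 0 <= aN ^+ j.+2 / j.+2%:R <= 1.
  have /andP[u1 u2] := aNJ1; apply/andP; split; first exact: divr_ge0 u1 (ltW JN).
  by rewrite ler_pdivrMr // mul1r (le_trans u2) // ler1n.
have q1 : 0 <= aN ^+ j.+1 / N%:R <= 1.
  have /andP[u1 u2] := aNJ; rewrite divr_ge0 //=.
  by rewrite ler_pdivrMr ?ltr0n // mul1r (le_trans u2) // ler1n.
(* The missing tail of the constant is at most 1/N, and X is at most N, so one power of X is
   gained. *)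
have gN : `|X ^+ j.+1 * \sum_(1 <= m < N) del R m - g * X ^+ j.+1| <= (1 + X) ^+ j.
  rewrite -mulrC -mulrBl normrM (ger0_norm (_ : 0 <= X ^+ j.+1)) ?exprn_ge0 ?(ltW X0) //.
  apply: (@le_trans _ _ (N%:R^-1 * X ^+ j.+1)).
    by rewrite ler_wpM2r ?gP // exprn_ge0 // ltW.
  rewrite exprS mulrA; apply: le_trans Xj; rewrite ler_piMl // mulrC ler_pdivrMr ?ltr0n // mul1r //.
have oJ : 1 <= (1 + X) ^+ j by rewrite exprn_ege1 //; slra.
rewrite mulrBl in main.
move: main q0; set c := (j.+2%:R)^-1 => main.
case/andP => *; case/andP: q1 => *.
move: main gN; rewrite !ler_norml => /andP[m1 m2] /andP[g1 g2].
by apply/andP; split; slra.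
Qed.

End ESums.

(** * One-term and two-term expansions under the zeta operator *)

Section Asymptotics.
Variable R : realType.
Implicit Types (X Y a b c s C : R) (F G : R -> R) (m n i j l : nat) (P Q : {poly R}) (g : nat -> R).

Definition asy1 j a C F := supp0 F /\ forall X, 0 < X -> `|F X - a * X ^+ j.+1| <= C * (1 + X) ^+ j.
Definition asy2 j a b C F := supp0 F /\ forall X, 0 < X ->
  `|F X - a * X ^+ j.+2 - b * X ^+ j.+1| <= C * (1 + X) ^+ j.

(** Truncated power. For j = 0 it is the indicator of X > 0, strict so as to match the condition r <
    R/d in the sieve weight. *)
Definition pw j X : R := if 0 < X then X ^+ j else 0.

Lemma supp0_pw j : supp0 (pw j). Proof. by move=> X X0; rewrite /pw ltNge X0. Qed.

Lemma pw_ge0 j X : 0 <= pw j X.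
Proof. by rewrite /pw; case: ifP => // X0; rewrite exprn_ge0 // ltW. Qed.

Lemma pwS_E j X : 0 <= X -> pw j.+1 X = X ^+ j.+1.
Proof. by move=> X0; rewrite /pw lt_neqAle X0 andbT eq_sym; case: eqP => //= ->; rewrite expr0n. Qed.

Lemma TE_range F X m : 0 < X -> (1 <= m < (Num.truncn (expR X)).+1)%N ->
  0 <= X - ln (m%:R : R) <= X.
Proof.
move=> X0 /andP[m1 mN]; rewrite subr_ge0 le_truncn_expR //= gerBl ln_ge0 // ler1n //.
Qed.

Lemma T_pw_asy1 l : asy1 l (l.+1%:R^-1) 5 (T (pw l)).
Proof.
split; first exact/supp0_T/supp0_pw.
move=> X X0; have E := esum1 l X0; rewrite TE; have [N1 aN XN] := ltN_ln X0.
set N := Num.truncn _ in E N1 aN XN *.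
have D : `|\sum_(1 <= m < N.+1) pw l (X - ln m%:R) / m%:R - \sum_(1 <= m < N.+1) (X - ln m%:R) ^+ l / m%:R| <= (1 + X) ^+ l.
  case: l {E} => [|l].
    rewrite !big_nat_recr //= opprD addrACA -sumrB big_nat_cond big1 ?add0r; last first.
      move=> m /andP[mN _]; have [/andP[h0 h1] h2 _] := step_range X0 mN.
      have {h0 h1} : X - ln (m%:R : R) > 0.
        have /andP[m1 m2] := mN; apply: lt_le_trans (_ : ln m.+1%:R - ln m%:R <= _).
          by apply: lt_le_trans (proj1 (andP (@lnS_bounds R m m1))); rewrite invr_gt0.
        slra.
      by rewrite /pw expr0 => ->; rewrite subrr.
    rewrite !expr0 -mulrBl normrM [X in _ * X]ger0_norm ?invr_ge0 // ler_pdivrMr ?ltr0n //.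
    apply: (@le_trans _ _ 1); last by rewrite mul1r ler1n.
    by rewrite /pw expr0; case: ifP => _; rewrite ?subrr ?normr0 // sub0r normrN normr1.
  rewrite (_ : \sum_(1 <= m < N.+1) pw l.+1 _ / _ = \sum_(1 <= m < N.+1) (X - ln m%:R) ^+ l.+1 / m%:R).
    by rewrite subrr normr0 exprn_ge0 // addr_ge0 ?ltW.
  apply: eq_big_nat => m mN; rewrite pwS_E //.
  by have /andP[] := @TE_range (pw 0) X m X0 mN.
move: E D; set c := (l.+1%:R)^-1; rewrite !ler_norml => /andP[E1 E2] /andP[D1 D2].
apply/andP; split; slra.
Qed.

(** The operator integrates both leading powers, and the secondary constant of [esum2] feeds a into
    the new b. The two constants depend on j only, which permits iteration. *)
Lemma T_asy2 j : {K : R * R | 0 <= K.1 & forall a b C F, 0 <= C -> asy2 j a b C F ->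
  asy2 j.+1 (a / j.+3%:R) (b / j.+2%:R + K.2 * a) (C + K.1 * (`|a| + `|b|)) (T F)}.
Proof.
have [[K g] /= K0 Kg] := esum2 R j.+1.
exists (K + 4, g) => /= [|a b C F C0 [F0 FE]]; first by rewrite addr_ge0.
split; first exact: supp0_T.
move=> X X0; have := Kg X X0; have := esum1 j.+1 X0; have SI := sum_inv_le X0; rewrite TE.
have TR := @TE_range F X ^~ X0.
set N := (Num.truncn _).+1 in TR SI *; set S1 := \sum_(_ <= _ < _) _; set S2 := \sum_(_ <= _ < _) _ => E1 E2.
have main : `|\sum_(1 <= m < N) F (X - ln m%:R) / m%:R - a * S2 - b * S1| <= C * (1 + X) ^+ j.+1.
  rewrite /S1 /S2 !mulr_sumr -!sumrB; apply: le_trans (ler_norm_sum _ _ _) _.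
  apply: (@le_trans _ _ (\sum_(1 <= m < N) C * (1 + X) ^+ j * m%:R^-1)); last first.
    by rewrite -mulr_sumr exprSr mulrA ler_wpM2l // mulr_ge0 // exprn_ge0 // addr_ge0 ?ltW.
  apply: ler_sum_nat => m mN; have /andP[x0 xX] := TR m mN.
  set x := X - ln m%:R in x0 xX *.
  have -> : F x / m%:R - a * (x ^+ j.+2 / m%:R) - b * (x ^+ j.+1 / m%:R) =
    (F x - a * x ^+ j.+2 - b * x ^+ j.+1) / m%:R by ring.
  rewrite normrM [X in _ * X]ger0_norm ?invr_ge0 // ler_wpM2r ?invr_ge0 //.
  have [xp|] := ltP 0 x; last first.
    move=> xn; have -> : x = 0 by apply/le_anti/andP.
    rewrite F0 // !expr0n /= !mulr0 !subr0 normr0 mulr_ge0 // exprn_ge0 //.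
    by rewrite addr_ge0 // ltW.
  apply: le_trans (FE x xp) _; rewrite ler_wpM2l // lerXn2r ?nnegrE //; slra.
have XJ : 0 <= (1 + X) ^+ j.+1 by rewrite exprn_ge0 // addr_ge0 // ltW.
have -> : \sum_(1 <= m < N) F (X - ln m%:R) / m%:R - a / j.+3%:R * X ^+ j.+3 - (b / j.+2%:R + g * a) * X ^+ j.+2 =
  (\sum_(1 <= m < N) F (X - ln m%:R) / m%:R - a * S2 - b * S1) +
  (a * (S2 - X ^+ j.+3 / j.+3%:R - g * X ^+ j.+2) + b * (S1 - X ^+ j.+2 / j.+2%:R)) by ring.
apply: le_trans (ler_normD _ _) _; rewrite mulrDl lerD //.
apply: le_trans (ler_normD _ _) _; rewrite !normrM.
have h1 := ler_wpM2l (normr_ge0 a) E2; have h2 := ler_wpM2l (normr_ge0 b) E1.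
have p1 : 0 <= `|a| * (1 + X) ^+ j.+1 by rewrite mulr_ge0.
have p2 : 0 <= `|b| * (1 + X) ^+ j.+1 by rewrite mulr_ge0.
have p3 : 0 <= K * (`|b| * (1 + X) ^+ j.+1) by rewrite mulr_ge0.
slra.
Qed.

(** Starting from the power i + 2 leaves room for two exact terms at every stage, with an error two
    degrees below the leading one. *)
Lemma Titer_asy2 (kap i : nat) : exists b C, 0 <= C /\
  asy2 (kap + i) (i.+2`!%:R / (kap + i).+2`!%:R) b C (iter kap (@T R) (pw i.+2)).
Proof.
elim: kap => [|kap [b [C [C0 IH]]]].
  exists 0, 0; split=> //; split; first exact: supp0_pw.
  move=> X X0 /=; rewrite /pw X0 add0n divff ?pnatr_eq0 -?lt0n ?fact_gt0 //=.
  by rewrite mul1r mul0r subrr subr0 normr0 mul0r.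
have [K K0 KP] := T_asy2 (kap + i).
have := KP _ _ _ _ C0 IH; set a := _ / _ => H.
exists (b / (kap + i).+2%:R + K.2 * a), (C + K.1 * (`|a| + `|b|)); split.
  by rewrite addr_ge0 // mulr_ge0 // addr_ge0.
rewrite iterS addSn; have -> // : i.+2`!%:R / (kap + i).+3`!%:R = a / (kap + i).+3%:R.
by rewrite /a (factS (kap + i).+2) natrM invfM mulrA mulrAC.
Qed.

(** * Polynomials in a shift, and products of them over primes *)

Definition act P s F X : R := \sum_(i < size P) P`_i * F (X - s * i%:R).

Lemma actE P s F X n : (size P <= n)%N -> act P s F X = \sum_(i < n) P`_i * F (X - s * i%:R).
Proof.
move=> sn; rewrite /act (big_ord_widen n (fun i => P`_i * F (X - s * i%:R))) // big_mkcond.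
by apply: eq_bigr => i _; case: ltnP => // h; rewrite nth_default // mul0r.
Qed.

Lemma act_mul1X P c s F X :
  act (P * (1 + c *: 'X)) s F X = act P s F X + c * act P s F (X - s).
Proof.
have E : P * (1 + c *: 'X) = P + c *: (P * 'X) by rewrite mulrDr mulr1 scalerAr.
rewrite (@actE _ s F X (size P).+2); last first.
  rewrite E (leq_trans (size_polyD _ _)) // geq_max leqW //=.
  by rewrite (leq_trans (size_scale_leq _ _)) // (leq_trans (size_polyMleq _ _)) // size_polyX addn2.
rewrite (@actE P s F X (size P).+2); last by rewrite leqW.
rewrite (@actE P s F (X - s) (size P).+1) //.
under eq_bigr => i _ do rewrite E coefD coefZ mulrDl.
rewrite big_split /=; congr (_ + _).
rewrite big_ord_recl coefMX eqxx mulr0 mul0r add0r mulr_sumr; apply: eq_bigr => i _.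
rewrite coefMX /= -mulrA; congr (_ * (_ * F _)).
by rewrite -[bump 0 i]/(i.+1) -natr1; ring.
Qed.

Lemma act_1X c s F X : act (1 + c *: 'X) s F X = F X + c * F (X - s).
Proof.
rewrite -[1 + _]mul1r act_mul1X /act size_poly1 !big_ord1 coef1 !mul1r mulr0 !subr0 //.
Qed.

Lemma act_lin P s F G c X : act P s (fun Y => F Y + c * G Y) X = act P s F X + c * act P s G X.
Proof.
rewrite /act mulr_sumr -big_split /=; apply: eq_bigr => i _; ring.
Qed.

Lemma act_shift P s F c X : act P s (fun Y => F (Y - c)) X = act P s F (X - c).
Proof. by apply: eq_bigr => i _; congr (_ * F _); ring. Qed.

Fixpoint Lop (P : nat -> {poly R}) n F {struct n} : R -> R :=
  if n is m.+1 then (if prime m then act (P m) (ln m%:R) (Lop P m F) else Lop P m F) else F.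

Lemma ln_prime_ge0 p : prime p -> 0 <= ln (p%:R : R).
Proof. by move=> pp; rewrite ln_ge0 // ler1n prime_gt0. Qed.

Lemma Lop_local (P : nat -> {poly R}) n F G X : (forall Y, Y <= X -> F Y = G Y) -> Lop P n F X = Lop P n G X.
Proof.
elim: n X => [|n IH] X FG /=; first exact: FG.
case: ifP => pn; last exact: IH.
apply: eq_bigr => i _; congr (_ * _); apply: IH => Y YX; apply: FG.
apply: le_trans YX _; rewrite gerBl mulr_ge0 // ln_prime_ge0 //.
Qed.

Lemma Lop_shift (P : nat -> {poly R}) n F s X : Lop P n (fun Y => F (Y - s)) X = Lop P n F (X - s).
Proof.
elim: n X => [|n IH] X //=; case: ifP => pn //.
by apply: eq_bigr => i _; rewrite IH; congr (_ * Lop _ _ _ _); ring.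
Qed.

Lemma Lop_lin (P : nat -> {poly R}) n F G c X :
  Lop P n (fun Y => F Y + c * G Y) X = Lop P n F X + c * Lop P n G X.
Proof.
elim: n X => [|n IH] X //=; case: ifP => pn //.
by rewrite -act_lin; apply: eq_bigr => i _; rewrite IH.
Qed.

(** All operators involved are combinations of translations and therefore commute, so the linear
    factors can be gathered into an inner product over primes. *)
Lemma Lop_mul1X (P : nat -> {poly R}) (c : nat -> R) n F X :
  Lop (fun p => P p * (1 + c p *: 'X)) n F X = Lop P n (Lop (fun p => 1 + c p *: 'X) n F) X.
Proof.
elim: n X => [|n IH] X //=; case: ifP => pn; last exact: IH.
rewrite act_mul1X -act_shift -act_lin; apply: eq_bigr => i _; congr (_ * _).
rewrite !IH -(Lop_shift _ _ _ (ln n%:R)) -Lop_lin; congr (Lop _ _ _ _).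
by apply: funext => Y; rewrite act_1X.
Qed.

Lemma Lop_ext (P Q : nat -> {poly R}) n F X : (forall p, prime p -> P p = Q p) -> Lop P n F X = Lop Q n F X.
Proof.
move=> PQ; elim: n X => [|n IH] X //=; case: ifP => pn //.
by rewrite /act PQ //; apply: eq_bigr => i _; rewrite IH.
Qed.

(** Iterating [Tn_prime]: the truncated Euler product of the inverse of zeta sieves the primes below
    n out of the zeta operator. *)
Lemma Lop_T n F X : supp0 F -> Lop (fun p => 1 + (- p%:R^-1) *: 'X) n (T F) X = Tn n F X.
Proof.
move=> F0; elim: n X => [|n IH] X //=; case: ifP => pn; last by rewrite Tn_nprime ?pn.
by rewrite act_1X !IH Tn_prime // mulNr mulrC.
Qed.

(** The local factor of the sum weighted by g, multiplied by kap local factors of the inverse of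
    zeta. When g is close to kap/p the linear terms nearly cancel. *)
Definition locpoly (kap : nat) g p : {poly R} := (1 + g p *: 'X) * (1 + (- p%:R^-1) *: 'X) ^+ kap.

Lemma supp0_Titer (kap : nat) F : supp0 F -> supp0 (iter kap (@T R) F).
Proof. by move=> F0; elim: kap => //= kap; exact: supp0_T. Qed.

(** Up to log n the truncated inverse of zeta inverts the zeta operator exactly, so each of the kap
    copies of [T] is traded for one linear factor at every prime. *)
Lemma Lop_locpoly (kap : nat) g n F X : supp0 F -> (0 < n)%N -> X <= ln n%:R ->
  Lop (locpoly kap g) n (iter kap (@T R) F) X = Lop (fun p => 1 + g p *: 'X) n F X.
Proof.
move=> F0 n0 Xn; elim: kap => [|kap IH].
  by apply: Lop_ext => p pp; rewrite /locpoly expr0 mulr1.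
rewrite -IH (@Lop_ext _ (fun p => locpoly kap g p * (1 + (- p%:R^-1) *: 'X))); last first.
  by move=> p _; rewrite /locpoly exprSr mulrA.
rewrite Lop_mul1X; apply: Lop_local => Y YX.
by have F0i := supp0_Titer kap F0; rewrite Lop_T // Tn_large // (le_trans YX).
Qed.

Lemma supp0_act P s F : 0 <= s -> supp0 F -> supp0 (act P s F).
Proof.
move=> s0 F0 X X0; rewrite /act big1 // => i _; rewrite F0 ?mulr0 // (le_trans _ X0) //.
by rewrite gerBl mulr_ge0.
Qed.

Lemma supp0_Lop (P : nat -> {poly R}) n F : supp0 F -> supp0 (Lop P n F).
Proof.
by move=> F0; elim: n => //= n IH; case: ifP => // pn; apply: supp0_act => //; exact: ln_prime_ge0.
Qed.

Lemma Lop1X_stable g n n' F X : supp0 F -> (0 < n)%N -> (n <= n')%N -> X <= ln n%:R ->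
  Lop (fun p => 1 + g p *: 'X) n' F X = Lop (fun p => 1 + g p *: 'X) n F X.
Proof.
move=> F0 n0 nn' Xn; rewrite -(subnKC nn'); elim: (n' - n)%N => [|d IH]; first by rewrite addn0.
rewrite addnS /=; case: ifP => // pn; rewrite act_1X [X in _ + _ * X]supp0_Lop ?mulr0 ?addr0 //.
rewrite subr_le0; apply: le_trans Xn _.
by rewrite ler_ln ?posrE ?ltr0n ?ler_nat ?leq_addr // addn_gt0 n0.
Qed.

(** * Sums over sets of primes *)

Definition onprimes g p : R := if prime p then g p else 0.
Definition Lg n (A : {set 'I_n}) : R := \sum_(i in A) ln (i%:R).
Definition gprod n g (A : {set 'I_n}) : R := \prod_(i in A) onprimes g i.
Definition setsum n g F X : R := \sum_(A : {set 'I_n}) gprod g A * F (X - Lg A).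

Lemma setsumE n g F X : setsum n g F X = Lop (fun p => 1 + g p *: 'X) n F X.
Proof.
suff h m Y : (m <= n)%N ->
    \sum_(A : {set 'I_n} | A \subset [set i : 'I_n | (i < m)%N]) gprod g A * F (Y - Lg A) =
    Lop (fun p => 1 + g p *: 'X) m F Y.
  rewrite -h //; apply: eq_bigl => A.
  by apply/esym/idP; apply/fintype.subsetP => i _; rewrite inE.
elim: m Y => [|m IH] Y mn /=.
  rewrite (big_pred1 finset.set0) => [|A]; first by rewrite /gprod /Lg !big_set0 mul1r subr0.
  rewrite /= -finset.subset0; congr (_ \subset _); apply/setP => i; by rewrite !inE.
have -> : [set i : 'I_n | (i < m.+1)%N] = Ordinal mn |: [set i : 'I_n | (i < m)%N].
  by apply/setP => i; rewrite !inE ltnS leq_eqVlt.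
rewrite sum_subsetU1; last by rewrite inE ltnn.
rewrite big_split /= IH ?(ltnW mn) //.
have -> : \sum_(A : {set 'I_n} | A \subset [set i : 'I_n | (i < m)%N])
    gprod g (Ordinal mn |: A) * F (Y - Lg (Ordinal mn |: A)) =
    onprimes g m * Lop (fun p => 1 + g p *: 'X) m F (Y - ln m%:R).
  rewrite -IH ?(ltnW mn) // mulr_sumr; apply: eq_bigr => A /fintype.subsetP Am.
  have mA : Ordinal mn \notin A by apply/negP => /Am; rewrite inE ltnn.
  by rewrite /gprod /Lg !big_setU1 //= mulrA opprD addrA.
rewrite /onprimes; case: ifP => pm; last by rewrite mul0r addr0.
by rewrite act_1X.
Qed.

End Asymptotics.

(** * Effect of one local factor on an expansion *)

Section Tracking.
Variable R : realType.
Implicit Types (X Y a b c s t C D : R) (F G : R -> R) (m n i j l p kap : nat) (P Q : {poly R}) (g : nat -> R).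

(** A second moment of the shifts: it ignores the constant coefficient, and the square of i is the
    loss of a two-term expansion under a shift by i times s. *)
Definition n2 P : R := \sum_(i < size P) `|P`_i| * i%:R ^+ 2.

Lemma n2E P n : (size P <= n)%N -> n2 P = \sum_(i < n) `|P`_i| * i%:R ^+ 2.
Proof.
move=> sn; rewrite /n2 (big_ord_widen n (fun i => `|P`_i| * i%:R ^+ 2)) // big_mkcond.
by apply: eq_bigr => i _; case: ltnP => // h; rewrite nth_default // normr0 mul0r.
Qed.

Lemma n2_ge0 P : 0 <= n2 P.
Proof. by apply: sumr_ge0 => i _; rewrite mulr_ge0 // exprn_ge0. Qed.

Lemma n2D P Q : n2 (P + Q) <= n2 P + n2 Q.
Proof.
have h : (size (P + Q)%R <= maxn (size P) (size Q))%N by exact: size_polyD.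
rewrite (n2E h) (n2E (leq_maxl _ (size Q) : (size P <= _)%N)) (n2E (leq_maxr (size P) _ : (size Q <= _)%N)).
rewrite -big_split /=; apply: ler_sum => i _.
by rewrite coefD -mulrDl ler_wpM2r ?exprn_ge0 // ler_normD.
Qed.

Lemma n2Z c P : n2 (c *: P) = `|c| * n2 P.
Proof.
rewrite (n2E (size_scale_leq c P)) /n2 mulr_sumr.
by apply: eq_bigr => i _; rewrite coefZ normrM mulrA.
Qed.

Lemma n2_1 : n2 1 = 0.
Proof. by rewrite /n2 size_poly1 big_ord1 expr0n mulr0. Qed.

Lemma n2_X : n2 'X = 1.
Proof. by rewrite /n2 size_polyX big_ord_recl big_ord1 !coefX /= normr0 mul0r add0r normr1 mul1r expr1n. Qed.

Lemma n2_MX P : P`_0 = 0 -> n2 (P * 'X) <= 4 * n2 P.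
Proof.
move=> P0; have h : (size (P * 'X)%R <= (size P).+1)%N.
  by rewrite (leq_trans (size_polyMleq _ _)) // size_polyX addn2.
rewrite (n2E h) big_ord_recl coefMX eqxx normr0 mul0r add0r /n2 mulr_sumr.
apply: ler_sum => i _; rewrite coefMX /=.
have [->|i0] := posnP i; first by rewrite P0 normr0 !mul0r mulr0.
rewrite [leRHS]mulrCA ler_wpM2l // -[bump 0 i]/(i.+1) -natr1.
have : 1 <= i%:R :> R by rewrite ler1n.
by move=> i1; nra.
Qed.

Lemma n2_X2 : n2 ('X * 'X) <= 4.
Proof. by apply: le_trans (n2_MX _) _; rewrite ?coefX // n2_X mulr1. Qed.

Lemma locfactor (kap : nat) : {K : R | 0 <= K & forall q, 0 <= q -> q <= 1 ->
  exists2 E : {poly R}, E`_0 = 0 & n2 E <= K * q ^+ 2 /\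
    (1 + (- q) *: 'X) ^+ kap = 1 + (- (kap%:R * q)) *: 'X + E}.
Proof.
elim: kap => [|kap [K K0 KP]].
  by exists 0 => // q _ _; exists 0; rewrite ?coef0 //; split; [rewrite mul0r /n2 size_poly0 big_ord0|rewrite expr0 mul0r oppr0 scale0r !addr0].
exists (5 * K + 4 * kap%:R) => [|q q0 q1]; first by rewrite addr_ge0 // mulr_ge0.
have [E E0 [nE EE]] := KP q q0 q1.
exists (E + (- q) *: (E * 'X) + (kap%:R * q ^+ 2) *: ('X * 'X)).
  by rewrite !coefD !coefZ !coefMX E0 /= !mulr0 !addr0.
split.
  apply: le_trans (n2D _ _) _; apply: le_trans (lerD (n2D _ _) (lexx _)) _.
  rewrite !n2Z normrN (ger0_norm q0) ger0_norm ?mulr_ge0 ?exprn_ge0 //.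
  have h1 : q * n2 (E * 'X) <= 4 * n2 E.
    apply: (@le_trans _ _ (n2 (E * 'X))); last exact: n2_MX.
    by rewrite ler_piMl // n2_ge0.
  have h2 : kap%:R * q ^+ 2 * n2 ('X * 'X) <= kap%:R * q ^+ 2 * 4.
    by rewrite ler_wpM2l ?n2_X2 // mulr_ge0 // exprn_ge0.
  slra.
by rewrite exprSr EE -!mul_polyC -natr1 expr2 !(polyCN, polyCD, polyCM, polyCMn, polyC1); ring.
Qed.

(** The linear coefficient is g - kap/p. The others are O(p^-2) or a product of g with at least one
    factor 1/p; writing g at most |g - kap/p| + kap/p brings the latter into the stated form, for
    large g as well. *)
Lemma n2_locpoly (kap : nat) : {K : R | 1 <= K & forall g p, prime p -> 0 <= g p ->
  (locpoly kap g p)`_0 = 1 /\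
  n2 (locpoly kap g p) <= K * (`|g p - kap%:R / p%:R| + (p%:R^-1) ^+ 2)}.
Proof.
have [K K0 KP] := locfactor kap.
exists (1 + 9 * K + 4 * kap%:R + 4 * kap%:R ^+ 2 + 4 * kap%:R * K).
  have : 0 <= kap%:R * K by rewrite mulr_ge0.
  have : 0 <= kap%:R ^+ 2 :> R by rewrite exprn_ge0.
  have : 0 <= kap%:R :> R by [].
  slra.
move=> g p pp g0; have p0 : 0 < p%:R :> R by rewrite ltr0n prime_gt0.
have q1 : (p%:R^-1 : R) <= 1 by rewrite invf_le1 // ler1n prime_gt0.
have [E E0 [nE EE]] := KP p%:R^-1 (ltac:(by rewrite invr_ge0)) q1.
rewrite /locpoly EE; set q := _^-1 in q1 nE EE *.
have q0 : 0 <= q by rewrite invr_ge0.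
have -> : (1 + g p *: 'X) * (1 + - (kap%:R * q) *: 'X + E) =
   1 + (g p - kap%:R * q) *: 'X + (E + ((- (g p * kap%:R * q)) *: ('X * 'X) + g p *: (E * 'X))).
  by rewrite -!mul_polyC !(polyCN, polyCD, polyCM, polyCMn, polyC1, polyCB); ring.
split; first by rewrite !coefD !coefZ !coefMX coef1 coefX E0 /= !mulr0 !addr0.
set d := `|_|.
have gd : g p <= d + kap%:R * q.
  by rewrite /d; have := ler_norm (g p - kap%:R / p%:R); rewrite -/q; slra.
have d0 : 0 <= d by exact: normr_ge0.
have X1 : n2 (1 + (g p - kap%:R * q) *: 'X) <= d.
  by apply: le_trans (n2D _ _) _; rewrite n2_1 n2Z n2_X mulr1 add0r.
have X2 : n2 (- (g p * kap%:R * q) *: ('X * 'X)) <= 4 * (g p * kap%:R * q).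
  rewrite n2Z normrN ger0_norm ?mulr_ge0 // mulrC ler_wpM2r ?n2_X2 // !mulr_ge0 //.
have X3 : n2 (g p *: (E * 'X)) <= 4 * (g p * n2 E).
  by rewrite n2Z ger0_norm // mulrCA ler_wpM2l // n2_MX.
apply: le_trans (n2D _ _) _.
have h := n2D E (- (g p * kap%:R * q) *: ('X * 'X) + g p *: (E * 'X)).
have h' := n2D (- (g p * kap%:R * q) *: ('X * 'X)) (g p *: (E * 'X)).
have k0 : 0 <= kap%:R :> R by [].
have e1 : g p * kap%:R * q <= d * kap%:R + kap%:R ^+ 2 * q ^+ 2.
  have : g p * (kap%:R * q) <= (d + kap%:R * q) * (kap%:R * q) by rewrite ler_wpM2r // mulr_ge0.
  have : d * (kap%:R * q) <= d * kap%:R by rewrite ler_wpM2l // ler_piMr.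
  slra.
have e2 : g p * n2 E <= K * d + kap%:R * K * q ^+ 2.
  have n0 := n2_ge0 E.
  have : g p * n2 E <= (d + kap%:R * q) * (K * q ^+ 2) by rewrite ler_pM.
  have q2 : q ^+ 2 <= 1 by rewrite exprn_ile1.
  have : d * K * q ^+ 2 <= d * K by rewrite ler_piMr // mulr_ge0.
  have : kap%:R * K * q ^+ 2 * q <= kap%:R * K * q ^+ 2 by rewrite ler_piMr // !mulr_ge0 // exprn_ge0.
  slra.
have q20 : 0 <= q ^+ 2 by rewrite exprn_ge0.
have k20 : 0 <= kap%:R ^+ 2 :> R by rewrite exprn_ge0.
have f1 : 0 <= K * d by rewrite mulr_ge0.
have f2 : 0 <= kap%:R * d by rewrite mulr_ge0.
have f3 : 0 <= kap%:R ^+ 2 * d by rewrite mulr_ge0.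
have f4 : 0 <= kap%:R * K * d by rewrite !mulr_ge0.
have f5 : 0 <= K * q ^+ 2 by rewrite mulr_ge0.
have f6 : 0 <= kap%:R * q ^+ 2 by rewrite mulr_ge0.
have f7 : 0 <= kap%:R ^+ 2 * q ^+ 2 by rewrite mulr_ge0.
have f8 : 0 <= kap%:R * K * q ^+ 2 by rewrite !mulr_ge0.
slra.
Qed.

Lemma horner1E P n : (size P <= n)%N -> P.[1] = \sum_(i < n) P`_i.
Proof.
move=> sn; rewrite horner_coef (big_ord_widen n (fun i => P`_i * 1 ^+ i)) // big_mkcond.
by apply: eq_bigr => i _; case: ltnP => h; rewrite ?expr1n ?mulr1 // nth_default.
Qed.

Lemma deriv1E P n : (size P <= n)%N -> P^`().[1] = \sum_(i < n) P`_i * i%:R.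
Proof.
move=> sn; rewrite (@horner1E _ n); last first.
  have [->|P0] := eqVneq P 0; first by rewrite deriv0 size_poly0.
  exact: leq_trans (ltnW (lt_size_deriv P0)) sn.
case: n sn => [|n] sn; first by rewrite !big_ord0.
rewrite big_ord_recr big_ord_recl /= mulr0 add0r coef_deriv nth_default // mul0rn addr0.
by apply: eq_bigr => i _; rewrite coef_deriv mulr_natr.
Qed.

Lemma sum_coef_le P (c : nat -> R) C D : P`_0 = 1 -> 0 <= C -> 0 <= D -> c 0%N <= C ->
  (forall i, (0 < i)%N -> c i <= C + D * i%:R ^+ 2) ->
  \sum_(i < (size P).+1) `|P`_i| * c i <= C + (C + D) * n2 P.
Proof.
move=> P0 C0 D0 c0 cC; rewrite (@n2E P (size P).+1) // !big_ord_recl /= P0 normr1 mul1r expr0n mulr0 add0r.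
rewrite mulr_sumr lerD //; apply: ler_sum => i _.
rewrite [leRHS]mulrCA ler_wpM2l // -[bump 0 i]/(i.+1); apply: le_trans (cC i.+1 isT) _.
have : 1 <= i.+1%:R ^+ 2 :> R by rewrite exprn_ege1 // ler1n.
move=> h; rewrite mulrDl lerD2r ler_peMr //.
Qed.

(** The loss is linear in t for every t: below X by the mean value bound, from X on because F(X - t)
    vanishes while X^(j + 1) is at most t X^j. *)
Lemma shift1 j a C F X t : 0 <= C -> asy1 j a C F -> 0 < X -> 0 <= t ->
  `|F (X - t) - a * X ^+ j.+1| <= (C + j.+1%:R * `|a| * t) * (1 + X) ^+ j.
Proof.
move=> C0 [F0 FE] X0 t0.
have Xj0 : 0 <= X ^+ j by rewrite exprn_ge0 // ltW.
have Xj : X ^+ j <= (1 + X) ^+ j by rewrite lerXn2r ?nnegrE //; slra.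
have at0 : 0 <= `|a| * t by rewrite mulr_ge0.
have [tX|Xt] := ltP t X.
  have Xt0 : 0 < X - t by slra.
  have h1 := FE _ Xt0.
  have xx : 0 <= X - t <= X by apply/andP; split; slra.
  have h2 := powB_le j xx.
  have h3 : (X - t) ^+ j.+1 <= X ^+ j.+1 by rewrite lerXn2r // ?nnegrE; slra.
  have -> : F (X - t) - a * X ^+ j.+1 = (F (X - t) - a * (X - t) ^+ j.+1) - a * (X ^+ j.+1 - (X - t) ^+ j.+1) by ring.
  apply: le_trans (ler_normB _ _) _; rewrite [leRHS]mulrDl lerD //.
    apply: le_trans h1 _; rewrite ler_wpM2l // lerXn2r ?nnegrE //; slra.
  rewrite normrM (ger0_norm (_ : 0 <= X ^+ j.+1 - _)) ?subr_ge0 //.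
  apply: (@le_trans _ _ (`|a| * (j.+1%:R * X ^+ j * t))).
    by rewrite ler_wpM2l //; apply: le_trans h2 _; rewrite opprB addrC subrK.
  have := ler_wpM2l (mulr_ge0 (ler0n R j.+1) at0) Xj; slra.
rewrite F0 ?subr_le0 // sub0r normrN normrM (ger0_norm (_ : 0 <= X ^+ j.+1)) ?exprn_ge0 ?(ltW X0) //.
rewrite exprS; have h1 : X * X ^+ j <= t * (1 + X) ^+ j by rewrite ler_pM // ltW.
have h2 := ler_wpM2l (normr_ge0 a) h1.
have j0 : 0 <= j%:R * (`|a| * t * (1 + X) ^+ j) by rewrite !mulr_ge0 // exprn_ge0 // addr_ge0 // ltW.
have c0 : 0 <= C * (1 + X) ^+ j by rewrite mulr_ge0 // exprn_ge0 // addr_ge0 // ltW.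
rewrite -natr1; slra.
Qed.

Lemma act_asy1 j a C F P s : 0 <= C -> 0 <= s -> P`_0 = 1 -> asy1 j a C F ->
  asy1 j (a * P.[1]) (C + (C + j.+1%:R * `|a| * s) * n2 P) (act P s F).
Proof.
move=> C0 s0 P0 FA; split; first by apply: supp0_act => //; case: FA.
move=> X X0; rewrite (@actE _ P s F X (size P).+1) // (@horner1E P (size P).+1) //.
rewrite mulr_sumr mulr_suml -sumrB; apply: le_trans (ler_norm_sum _ _ _) _.
apply: (@le_trans _ _ ((\sum_(i < (size P).+1) `|P`_i| * (C + j.+1%:R * `|a| * (s * i%:R))) * (1 + X) ^+ j)).
  rewrite mulr_suml; apply: ler_sum => i _.
  have -> : P`_i * F (X - s * i%:R) - a * P`_i * X ^+ j.+1 = P`_i * (F (X - s * i%:R) - a * X ^+ j.+1) by ring.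
  by rewrite normrM -mulrA ler_wpM2l // shift1 // mulr_ge0.
rewrite ler_wpM2r ?exprn_ge0 ?addr_ge0 ?(ltW X0) //.
apply: (@sum_coef_le P (fun i => C + j.+1%:R * `|a| * (s * i%:R))) => //.
- by rewrite !mulr_ge0.
- by rewrite !mulr0 addr0.
move=> i i0; rewrite lerD2l [leLHS]mulrA ler_wpM2l ?mulr_ge0 //.
by rewrite expr2 ler_peMr // ler1n.
Qed.

Lemma shift2 j a b C F X t : 0 <= C -> asy2 j a b C F -> 0 < X -> 0 <= t ->
  `|F (X - t) - a * X ^+ j.+2 + j.+2%:R * a * t * X ^+ j.+1 - b * X ^+ j.+1| <=
   (C + j.+2%:R * j.+2%:R * (`|a| * t ^+ 2 + `|b| * t)) * (1 + X) ^+ j.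
Proof.
move=> C0 [F0 FE] X0 t0.
have Xj0 : 0 <= X ^+ j by rewrite exprn_ge0 // ltW.
have Xj : X ^+ j <= (1 + X) ^+ j by rewrite lerXn2r ?nnegrE //; slra.
have OX : 0 <= (1 + X) ^+ j by rewrite exprn_ge0 // addr_ge0 // ltW.
have at0 : 0 <= `|a| * t ^+ 2 by rewrite mulr_ge0 // exprn_ge0.
have bt0 : 0 <= `|b| * t by rewrite mulr_ge0.
have J1 : 1 <= j.+2%:R :> R by rewrite ler1n.
have J2 : j.+1%:R <= j.+2%:R :> R by rewrite ler_nat.
have J0 : 0 <= j.+1%:R :> R by [].
have [tX|Xt] := ltP t X.
  have Xt0 : 0 < X - t by slra.
  have h1 := FE _ Xt0.
  have xx : 0 <= X - t <= X by apply/andP; split; slra.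
  have h2 := powB_le j xx; have h3 := powB_taylor j xx.
  have h4 : (X - t) ^+ j.+1 <= X ^+ j.+1 by rewrite lerXn2r // ?nnegrE; slra.
  have et : X - (X - t) = t by ring.
  rewrite et in h2 h3.
  have -> : F (X - t) - a * X ^+ j.+2 + j.+2%:R * a * t * X ^+ j.+1 - b * X ^+ j.+1 =
   (F (X - t) - a * (X - t) ^+ j.+2 - b * (X - t) ^+ j.+1)
   - (a * (X ^+ j.+2 - (X - t) ^+ j.+2 - j.+2%:R * X ^+ j.+1 * t) + b * (X ^+ j.+1 - (X - t) ^+ j.+1)) by ring.
  apply: le_trans (ler_normB _ _) _; rewrite [leRHS]mulrDl lerD //.
    apply: le_trans h1 _; rewrite ler_wpM2l // lerXn2r ?nnegrE //; slra.
  apply: le_trans (ler_normD _ _) _; rewrite !normrM (ger0_norm (_ : 0 <= X ^+ j.+1 - _)) ?subr_ge0 //.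
  apply: (@le_trans _ _ (`|a| * (j.+2%:R * j.+1%:R * X ^+ j * t ^+ 2) + `|b| * (j.+1%:R * X ^+ j * t))).
    by rewrite lerD // ler_wpM2l.
  have k1 : j.+2%:R * j.+1%:R * (`|a| * t ^+ 2 * X ^+ j) <= j.+2%:R * j.+2%:R * (`|a| * t ^+ 2 * (1 + X) ^+ j).
    by rewrite ler_pM ?mulr_ge0 // ?exprn_ge0 // ler_wpM2l // mulr_ge0 // exprn_ge0.
  have k2 : j.+1%:R * (`|b| * t * X ^+ j) <= j.+2%:R * j.+2%:R * (`|b| * t * (1 + X) ^+ j).
    rewrite ler_pM ?mulr_ge0 //; first by apply: le_trans J2 _; rewrite ler_peMr.
    by rewrite ler_wpM2l // mulr_ge0.
  slra.
rewrite F0 ?subr_le0 //.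
have -> : 0 - a * X ^+ j.+2 + j.+2%:R * a * t * X ^+ j.+1 - b * X ^+ j.+1 =
   a * ((j.+2%:R * t - X) * X * X ^+ j) - b * (X * X ^+ j) by rewrite !exprS; ring.
apply: le_trans (ler_normB _ _) _; rewrite !normrM.
have Xn : `|X| = X by rewrite ger0_norm // ltW.
have Xjn : `|X ^+ j| = X ^+ j by rewrite ger0_norm.
have jt : t <= j.+2%:R * t by rewrite ler_peMl.
have jn : `|j.+2%:R * t - X| = j.+2%:R * t - X by rewrite ger0_norm // subr_ge0; slra.
rewrite Xn Xjn jn.
have k1 : (j.+2%:R * t - X) * X <= j.+2%:R * t ^+ 2.
  apply: (@le_trans _ _ (j.+2%:R * t * t)); last by rewrite expr2 mulrA.
  by apply: ler_pM => //; slra.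
have k2 : `|a| * ((j.+2%:R * t - X) * X * X ^+ j) <= `|a| * (j.+2%:R * j.+2%:R * t ^+ 2 * (1 + X) ^+ j).
  rewrite ler_wpM2l // ler_pM //; first by rewrite mulr_ge0 //; slra.
  apply: le_trans k1 _; rewrite -mulrA ler_peMl // mulr_ge0 // exprn_ge0 //.
have k3 : `|b| * (X * X ^+ j) <= `|b| * (j.+2%:R * j.+2%:R * t * (1 + X) ^+ j).
  rewrite ler_wpM2l // ler_pM // ?(ltW X0) //; apply: le_trans Xt _.
  by rewrite -mulrA; apply: le_trans jt _; rewrite ler_peMl // mulr_ge0.
have k4 : 0 <= C * (1 + X) ^+ j by rewrite mulr_ge0.
slra.
Qed.

(** [shift2] is summed against the coefficients of P: their sum P(1) multiplies both terms, and the
    first-order loss (j + 2) a s i, weighted by the i-th coefficient, adds up to the derivative at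
    1. *)
Lemma act_asy2 j a b C F P s : 0 <= C -> 0 <= s -> P`_0 = 1 -> asy2 j a b C F ->
  asy2 j (a * P.[1]) (b * P.[1] - j.+2%:R * a * s * P^`().[1])
    (C + (C + j.+2%:R * j.+2%:R * (`|a| + `|b|) * (s + s ^+ 2)) * n2 P) (act P s F).
Proof.
move=> C0 s0 P0 FA; split; first by apply: supp0_act => //; case: FA.
move=> X X0; rewrite (@actE _ P s F X (size P).+1) // (@horner1E P (size P).+1) // (@deriv1E P (size P).+1) //.
rewrite 3!mulr_sumr -sumrB !mulr_suml -!sumrB; apply: le_trans (ler_norm_sum _ _ _) _.
apply: (@le_trans _ _ ((\sum_(i < (size P).+1) `|P`_i| *
    (C + j.+2%:R * j.+2%:R * (`|a| * (s * i%:R) ^+ 2 + `|b| * (s * i%:R)))) * (1 + X) ^+ j)).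
  rewrite mulr_suml; apply: ler_sum => i _.
  have -> : P`_i * F (X - s * i%:R) - a * P`_i * X ^+ j.+2 - (b * P`_i - j.+2%:R * a * s * (P`_i * i%:R)) * X ^+ j.+1
     = P`_i * (F (X - s * i%:R) - a * X ^+ j.+2 + j.+2%:R * a * (s * i%:R) * X ^+ j.+1 - b * X ^+ j.+1) by ring.
  by rewrite normrM -[leRHS]mulrA ler_wpM2l // shift2 // mulr_ge0.
rewrite ler_wpM2r ?exprn_ge0 ?addr_ge0 ?(ltW X0) //.
apply: (@sum_coef_le P (fun i => C + j.+2%:R * j.+2%:R * (`|a| * (s * i%:R) ^+ 2 + `|b| * (s * i%:R))) C
  (j.+2%:R * j.+2%:R * (`|a| + `|b|) * (s + s ^+ 2))) => //.
- by rewrite !mulr_ge0 // addr_ge0 // exprn_ge0.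
- by rewrite !mulr0 expr0n !mulr0 addr0 mulr0 addr0.
move=> i i0; rewrite lerD2l -!mulrA ler_wpM2l // ler_wpM2l //.
have i1 : 1 <= i%:R :> R by rewrite ler1n.
set x : R := i%:R in i1 *.
have x2 : x <= x ^+ 2 by rewrite expr2 ler_peMr //; slra.
have h1 : 0 <= `|b| * s ^+ 2 * x ^+ 2 by rewrite !mulr_ge0 // exprn_ge0; slra.
have h2 : 0 <= `|a| * s * x ^+ 2 by rewrite !mulr_ge0 // exprn_ge0; slra.
have h3 : `|b| * s * x <= `|b| * s * x ^+ 2 by rewrite ler_wpM2l // mulr_ge0.
rewrite exprMn; slra.
Qed.

End Tracking.

(** * Expansions of sums over squarefree integers *)

Section PrimeSums.
Variable R : realType.
Implicit Types (X a b c C D : R) (F : R -> R) (m n i j l p kap : nat) (g e : nat -> R).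

Lemma ln_q32 (c : nat) : {C : R | 0 < C & forall m, (0 < m)%N ->
  (1 + ln (m%:R : R)) ^+ c * (m%:R^-1) ^+ 2 <= C * q32 R m}.
Proof.
have [C C0 CP] := polyln_le_sqrt R c; exists C => // m m0.
by rewrite q32E // [leRHS]mulrA ler_wpM2r ?exprn_ge0 ?invr_ge0 // CP // ler1n.
Qed.

Lemma sum_primes_q32 n D e : (forall p, prime p -> e p <= D * q32 R p) -> 0 <= D ->
  \sum_(0 <= p < n | prime p) e p <= 4 * D.
Proof.
move=> eD D0; apply: (@le_trans _ _ (\sum_(1 <= p < n) D * q32 R p)); last first.
  by rewrite -mulr_sumr mulrC ler_wpM2r // sum_q32.
case: n => [|n]; first by rewrite !big_geq.
rewrite big_mkcond big_ltn //= add0r; apply: ler_sum => p _.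
by case: ifP => pp; [exact: eD|rewrite mulr_ge0 // q32_ge0].
Qed.

Lemma prod_primes_q32 n D e : (forall p, prime p -> 0 <= e p <= D * q32 R p) -> 0 <= D ->
  \prod_(0 <= p < n | prime p) (1 + e p) <= expR (4 * D).
Proof.
move=> eD D0; apply: (@le_trans _ _ (expR (\sum_(0 <= p < n | prime p) e p))).
  rewrite expR_sum; apply: ler_prod => p pp; have /andP[e0 _] := eD p pp.
  by rewrite expR_ge1Dx andbT addr_ge0.
by rewrite ler_expR; apply: sum_primes_q32 => // p /eD /andP[].
Qed.

Lemma prod_nat_recr (P : pred nat) e n :
  \prod_(0 <= p < n.+1 | P p) e p = (\prod_(0 <= p < n | P p) e p) * (if P n then e n else 1).
Proof. by rewrite big_mkcond big_nat_recr //= -big_mkcond. Qed.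

Lemma sum_nat_recr (P : pred nat) e n :
  \sum_(0 <= p < n.+1 | P p) e p = (\sum_(0 <= p < n | P p) e p) + (if P n then e n else 0).
Proof. by rewrite big_mkcond big_nat_recr //= -big_mkcond. Qed.

Lemma asy1_le j a C D F : C <= D -> asy1 j a C F -> asy1 j a D F.
Proof.
move=> CD [F0 FE]; split=> // X X0; apply: le_trans (FE X X0) _.
by rewrite ler_wpM2r // exprn_ge0 // addr_ge0 // ltW.
Qed.

Lemma asy2_le j a b C D F : C <= D -> asy2 j a b C F -> asy2 j a b D F.
Proof.
move=> CD [F0 FE]; split=> // X X0; apply: le_trans (FE X X0) _.
by rewrite ler_wpM2r // exprn_ge0 // addr_ge0 // ltW.
Qed.

Lemma prime_inv p : prime p -> 0 < (p%:R^-1 : R) <= 1 / 2.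
Proof.
move=> pp; rewrite invr_gt0 ltr0n prime_gt0 //=.
by rewrite div1r lef_pV2 ?posrE ?ltr0n ?prime_gt0 // ler_nat prime_gt1.
Qed.

Lemma locpoly1 kap g p : (locpoly kap g p).[1] = (1 + g p) * (1 - p%:R^-1) ^+ kap.
Proof. by rewrite /locpoly !hornerE. Qed.

Lemma size_n2 (P : {poly R}) : P`_0 = 1 -> `|P.[1]| <= 1 + n2 P.
Proof.
move=> P0; rewrite (@horner1E _ P (size P).+1) //.
apply: le_trans (ler_norm_sum _ _ _) _.
rewrite (eq_bigr (fun i : 'I_(size P).+1 => `|P`_i| * 1)) => [|i _]; last by rewrite mulr1.
apply: le_trans (@sum_coef_le _ P (fun=> 1) 1 0 _ _ _ _ _) _ => //; last by rewrite addr0 mul1r.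
by move=> i _; rewrite mul0r addr0.
Qed.

Lemma deriv_n2 (P : {poly R}) : `|P^`().[1]| <= n2 P.
Proof.
rewrite (@deriv1E _ P (size P)) // /n2; apply: le_trans (ler_norm_sum _ _ _) _.
apply: ler_sum => i _; rewrite normrM ler_wpM2l // normr_nat -natrX ler_nat.
by case: (i : nat) => // m; rewrite leq_pmulr.
Qed.

Lemma deriv_locpoly kap g p : prime p -> 0 <= g p ->
  (locpoly kap g p)^`().[1] = (locpoly kap g p).[1] * (g p / (1 + g p) - kap%:R / (p%:R - 1)).
Proof.
move=> pp g0; have /andP[q0 q1] := prime_inv pp; rewrite locpoly1.
have p1 : 1 < p%:R :> R by rewrite ltr1n prime_gt1.
rewrite /locpoly derivM derivD derivC derivZ derivX deriv_exp derivD derivC derivZ derivX !hornerE.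
case: kap => [|k] /=; rewrite hornerMn ?mulr0n !hornerE; first by rewrite ?expr0; field; rewrite !lt0r_neq0 //; slra.
rewrite exprS; set z := _ ^+ k; rewrite -mulr_natr.
set q : R := p%:R^-1 in q0 q1 *.
have pE : p%:R = q^-1 :> R by rewrite invrK.
rewrite pE; field; rewrite !lt0r_neq0 //=; slra.
Qed.

Definition invm1 p : R := (p%:R - 1)^-1.
Definition gmask (A : pred nat) p : R := if A p then 0 else invm1 p.

Lemma invm1_ge0 p : prime p -> 0 <= invm1 p.
Proof. by move=> pp; rewrite invr_ge0 subr_ge0 ler1n prime_gt0. Qed.

(* First order expansion for the totient-weighted sums; the dependence on the excluded primes is multiplicative. *)
Lemma setsum_coprime : {Cc : R * R | 0 < Cc.1 /\ 0 < Cc.2 & forall l n (A : pred nat) X,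
  (0 < n)%N -> X <= ln n%:R -> 0 < X ->
  `|setsum n (gmask A) (pw l) X - (\prod_(0 <= p < n | prime p && A p) (1 - p%:R^-1)) * X ^+ l.+1 / l.+1%:R|
   <= Cc.1 * (\prod_(0 <= p < n | prime p && A p) (1 + Cc.2 * ((1 + ln p%:R) / p%:R))) * (1 + X) ^+ l}.
Proof.
have [K K1 KP] := @n2_locpoly R 1.
have [C1 C10 C1P] := ln_q32 1.
have K0 : 0 < K by slra.
exists (5 * expR (4 * (3 * K * C1)), 2 * K) => /= [|l n A X n0 Xn X0].
  by split; rewrite !mulr_gt0 // expR_gt0.
pose P := locpoly 1 (gmask A); pose e p := n2 (P p) * (1 + ln (p%:R : R)).
have g0 p : prime p -> 0 <= gmask A p.
  by move=> pp; rewrite /gmask; case: ifP => // _; exact: invm1_ge0.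
have e0 p : prime p -> 0 <= e p.
  by move=> pp; rewrite mulr_ge0 ?n2_ge0 // addr_ge0 // ln_prime_ge0.
pose am m : R := \prod_(0 <= p < m | prime p && A p) (1 - p%:R^-1).
pose E m : R := \prod_(0 <= p < m | prime p) (1 + e p).
have am01 m : 0 <= am m <= 1.
  rewrite prodr_ge0 => [|p /andP[/prime_inv /andP[h1 h2] _]]; last by slra.
  by rewrite prodr_ile1 // => p /andP[/prime_inv /andP[h1 h2] _]; apply/andP; split; slra.
have E1 m : 1 <= E m.
  rewrite /E; elim: m => [|m IH]; first by rewrite big_geq.
  rewrite prod_nat_recr; case: ifP => pm; last by rewrite mulr1.
  by apply: (le_trans IH); rewrite ler_peMr ?lerDl ?e0 // (le_trans ler01 IH).
(* 5 is the constant of [T_pw_asy1]. A prime multiplies the error by at most 1 + e(p), since the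
   leading coefficient [am m] stays below 1 and hence below [5 * E m]. *)
have main m : asy1 l (am m * l.+1%:R^-1) (5 * E m) (Lop P m (T (pw l))).
  elim: m => [|m IH].
    by rewrite /am /E !big_geq // mul1r mulr1; exact: T_pw_asy1.
  rewrite /am /E !prod_nat_recr -/(am m) -/(E m) /=; have [pm|pm] /= := boolP (prime m); last by rewrite !mulr1.
  have [P0 nP] := KP _ m pm (g0 m pm); have s0 := @ln_prime_ge0 R m pm.
  have pc : 0 <= 5 * E m by have := E1 m; slra.
  have := act_asy1 pc s0 P0 IH.
  have -> : am m * l.+1%:R^-1 * (locpoly 1 (gmask A) m).[1] = am m * (if A m then 1 - m%:R^-1 else 1) * l.+1%:R^-1.
    rewrite locpoly1 /gmask expr1; case: ifP => Am /=; first by rewrite addr0 mul1r; ring.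
    have /andP[q0 q1] := prime_inv pm; rewrite mulr1 /invm1.
    rewrite -[RHS]mulr1; congr (_ * _).
    have pE : m%:R = (m%:R^-1)^-1 :> R by rewrite invrK.
    rewrite {1}pE; set q := _^-1 in q0 q1 *; field; rewrite !lt0r_neq0 //=; slra.
  apply: asy1_le; rewrite -/(P m).
  have -> : 5 * (E m * (1 + e m)) = 5 * E m + 5 * E m * (1 + ln m%:R) * n2 (P m) by rewrite /e; ring.
  rewrite lerD2l ler_wpM2r ?n2_ge0 //.
  have -> : l.+1%:R * `|am m / l.+1%:R| * ln m%:R = am m * ln m%:R.
    have /andP[a0 _] := am01 m.
    by rewrite ger0_norm ?divr_ge0 // [_ * (am m / _)]mulrCA divff ?pnatr_eq0 // mulr1.
  rewrite mulrDr mulr1 lerD2l ler_wpM2r //.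
  by have /andP[_ h] := am01 m; have := E1 m; slra.
rewrite setsumE -(@Lop_locpoly _ 1 _ _ _ _ (supp0_pw l) n0 Xn).
have [_ /(_ X X0)] := main n.
rewrite -/(am n) /= -/P mulrAC => h; apply: le_trans h _.
rewrite ler_wpM2r ?exprn_ge0 ?addr_ge0 ?(ltW X0) // -mulrA ler_wpM2l //.
pose e1 p := 3 * K * ((1 + ln (p%:R : R)) * p%:R^-1 ^+ 2).
(* A prime outside A has g = 1/(p - 1), within O(p^-2) of 1/p, and contributes to a convergent
   product. A prime in A has linear coefficient -1/p, which leaves a factor 1 + O((1 + log p)/p). *)
apply: (@le_trans _ _ ((\prod_(0 <= p < n | prime p) (1 + e1 p)) *
   \prod_(0 <= p < n | prime p && A p) (1 + 2 * K * ((1 + ln p%:R) / p%:R)))); last first.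
  rewrite ler_wpM2r //.
    apply: prodr_ge0 => p /andP[pp _]; have := @ln_prime_ge0 R p pp => h.
    by rewrite addr_ge0 // !mulr_ge0 ?invr_ge0 ?addr_ge0 // ltW.
  apply: prod_primes_q32; last by rewrite !mulr_ge0 ?ltW.
  move=> p pp; have h := @ln_prime_ge0 R p pp; apply/andP; split.
    by rewrite !mulr_ge0 ?exprn_ge0 ?invr_ge0 ?addr_ge0 // ltW.
  rewrite /e1 -[leRHS]mulrA ler_wpM2l ?mulr_ge0 ?(ltW K0) //.
  by have := C1P p (prime_gt0 pp); rewrite expr1.
rewrite /E [X in _ * X]big_mkcondr -big_split /=; apply: ler_prod => p pp.
rewrite addr_ge0 ?e0 //=; have [_ nP] := KP _ p pp (g0 p pp).
have h := @ln_prime_ge0 R p pp; have /andP[q0 q1] := prime_inv pp.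
rewrite /e /e1 -/(P p) in nP *; set L := 1 + ln _; set q := _^-1 in q0 q1 nP *.
have L0 : 0 <= L by rewrite /L addr_ge0.
move: nP; rewrite /gmask; case: ifP => Ap.
  rewrite mul1r sub0r normrN ger0_norm ?(ltW q0) // => nP.
  have h1 : n2 (P p) * L <= K * (q + q ^+ 2) * L by rewrite ler_wpM2r.
  have h2 : 0 <= K * L * q ^+ 2 by rewrite !mulr_ge0 ?exprn_ge0 // ltW.
  have h3 : 0 <= K * L * q by rewrite !mulr_ge0 // ltW.
  have h4 : 0 <= (3 * K * (L * q ^+ 2)) * (2 * K * (L * q)) by rewrite !mulr_ge0 ?exprn_ge0 // ltW.
  have h5 : 0 <= K * L * (q - q ^+ 2).
    by rewrite !mulr_ge0 ?(ltW K0) // subr_ge0 expr2 ler_piMr ?ltW //; slra.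
  slra.
move=> nP; rewrite mulr1 lerD2l.
have d : `|invm1 p - 1 * q| <= 2 * q ^+ 2.
  have -> : invm1 p - 1 * q = q ^+ 2 / (1 - q).
    rewrite /invm1 -[X in (X - 1)^-1]invrK -/q; field.
    by rewrite !lt0r_neq0 //=; slra.
  rewrite ger0_norm; last by rewrite divr_ge0 ?exprn_ge0 ?ltW //; slra.
  rewrite ler_pdivrMr; last slra.
  have : 0 <= q ^+ 2 by rewrite exprn_ge0 // ltW.
  nra.
have h1 : n2 (P p) <= 3 * K * q ^+ 2.
  apply: le_trans nP _; have := ler_wpM2l (ltW K0) d; slra.
by have := ler_wpM2r L0 h1; slra.
Qed.

Definition eulerprod kap g n : R := \prod_(0 <= p < n | prime p) ((1 + g p) * (1 - p%:R^-1) ^+ kap).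
Definition logderiv kap g n : R :=
  \sum_(0 <= p < n | prime p) (g p / (1 + g p) - kap%:R / (p%:R - 1)) * ln p%:R.

Lemma eulerprod_bound kap g D : 0 <= D -> (forall p, prime p -> 0 <= g p) ->
  (forall p, prime p -> `|g p - kap%:R / p%:R| * (1 + ln p%:R) ^+ 2 <= D * q32 R p) ->
  exists2 D1, 0 <= D1 & [/\ forall p, prime p ->
     n2 (locpoly kap g p) * (1 + ln p%:R) ^+ 2 <= D1 * q32 R p,
     forall n, 0 < eulerprod kap g n <= expR (4 * D1)
     & forall n, `|logderiv kap g n| <= 4 * (2 ^+ kap * D1)].
Proof.
move=> D0 g0 gD; have [K K1 KP] := @n2_locpoly R kap.
have [C2 C20 C2P] := ln_q32 2; have K0 : 0 < K by slra.
have nD p : prime p -> n2 (locpoly kap g p) * (1 + ln p%:R) ^+ 2 <= K * (D + C2) * q32 R p.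
  move=> pp; have [_ nP] := KP _ p pp (g0 p pp); have h := @ln_prime_ge0 R p pp.
  apply: le_trans (ler_wpM2r _ nP) _; first by rewrite exprn_ge0 // addr_ge0.
  rewrite -!mulrA ler_wpM2l ?(ltW K0) // [leRHS]mulrDl mulrDl lerD ?gD //.
  by rewrite mulrC; exact: C2P (prime_gt0 pp).
have KD0 : 0 <= K * (D + C2) by exact: mulr_ge0 (ltW K0) (addr_ge0 D0 (ltW C20)).
exists (K * (D + C2)) => //.
have n2D1 p : prime p -> n2 (locpoly kap g p) <= K * (D + C2) * q32 R p.
  move=> pp; apply: le_trans (nD p pp); have h := @ln_prime_ge0 R p pp.
  by rewrite ler_peMr ?n2_ge0 // exprn_ege1 // lerDl.
(* The lower bound is what allows passing from the derivative at 1, controlled by [n2], to the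
   logarithmic derivative. *)
have P1 p : prime p -> (2^-1) ^+ kap <= (locpoly kap g p).[1].
  move=> pp; rewrite locpoly1; have /andP[q0 q1] := prime_inv pp; have := g0 p pp => gp.
  have q2 : (2^-1 : R) ^+ kap <= (1 - p%:R^-1) ^+ kap by apply: lerXn2r; rewrite ?nnegrE; slra.
  by rewrite -[leLHS]mul1r ler_pM // ?exprn_ge0 //; slra.
have P10 p : prime p -> 0 < (locpoly kap g p).[1].
  by move=> pp; apply: lt_le_trans (P1 p pp); rewrite exprn_gt0.
split=> // n.
  rewrite /eulerprod; under eq_bigr => p _ do rewrite -locpoly1.
  rewrite prodr_gt0 //=; apply: (@le_trans _ _ (\prod_(0 <= p < n | prime p) (1 + n2 (locpoly kap g p)))).
    apply: ler_prod => p pp; rewrite (ltW (P10 p pp)) /=.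
    have [P0 _] := KP _ p pp (g0 p pp).
    exact: le_trans (ler_norm _) (size_n2 P0).
  apply: prod_primes_q32 => //.
  by move=> p pp; rewrite n2_ge0 /= n2D1.
rewrite /logderiv; apply: le_trans (ler_norm_sum _ _ _) _.
apply: sum_primes_q32; last by rewrite mulr_ge0 ?exprn_ge0.
move=> p pp; have h := @ln_prime_ge0 R p pp; have d := deriv_locpoly kap pp (g0 p pp).
set x := (_ - _) in d *.
have dx : `|x| <= 2 ^+ kap * n2 (locpoly kap g p).
  have := deriv_n2 (locpoly kap g p); rewrite d normrM (ger0_norm (ltW (P10 p pp))).
  have := ler_wpM2r (normr_ge0 x) (P1 p pp) => h1 h2.
  have := ler_wpM2l (_ : 0 <= (2 : R) ^+ kap) (le_trans h1 h2).
  by rewrite mulrA -exprMn divff // expr1n mul1r; apply; rewrite exprn_ge0.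
rewrite normrM (ger0_norm h); apply: le_trans (ler_wpM2r h dx) _.
have h1 : n2 (locpoly kap g p) * ln p%:R <= K * (D + C2) * q32 R p.
  by apply: le_trans (nD p pp); rewrite ler_wpM2l ?n2_ge0 // expr2; nra.
have := ler_wpM2l (_ : 0 <= (2 : R) ^+ kap) h1; rewrite exprn_ge0 // => /(_ isT).
by rewrite !mulrA.
Qed.

(** The order of quantifiers carries the uniformity: b is chosen before g, whereas D' may depend on
    g but only multiplies the lowest power. The Euler product runs up to a free n', so that at fixed
    X it can be brought as close to its limit as desired. *)
Lemma setsum_asy2 kap i : exists b : R, forall g D, 0 <= D -> (forall p, prime p -> 0 <= g p) ->
  (forall p, prime p -> `|g p - kap%:R / p%:R| * (1 + ln p%:R) ^+ 2 <= D * q32 R p) ->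
  exists2 D', 0 <= D' & forall n n' X, (0 < n)%N -> (n <= n')%N -> X <= ln n%:R -> 0 < X ->
   `|setsum n g (pw i.+2) X - i.+2`!%:R / (kap + i).+2`!%:R * eulerprod kap g n' * X ^+ (kap + i).+2
     - eulerprod kap g n' * (b - (kap + i).+2%:R * (i.+2`!%:R / (kap + i).+2`!%:R) * logderiv kap g n') * X ^+ (kap + i).+1|
   <= D' * (1 + X) ^+ (kap + i).
Proof.
have [b [C0 [C00 FA]]] := Titer_asy2 R kap i.
set a := _ / _ in FA *; clearbody a; exists b => g D D0 g0 gD.
have [D1 D10 [nD PP LL]] := eulerprod_bound D0 g0 gD.
have [K K1 KP] := @n2_locpoly R kap.
set j := (kap + i)%N in FA *.
pose B := expR (4 * D1) * (`|a| + (`|b| + j.+2%:R * `|a| * (4 * (2 ^+ kap * D1)))).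
pose M := j.+2%:R * j.+2%:R * B.
have B0 : 0 <= B.
  by rewrite mulr_ge0 ?expR_ge0 // addr_ge0 // addr_ge0 // !mulr_ge0 // exprn_ge0.
have M0 : 0 <= M by apply: mulr_ge0 => //; exact: mulr_ge0.
pose P := locpoly kap g; pose e p := n2 (P p) * (1 + ln (p%:R : R)) ^+ 2.
pose E m : R := \prod_(0 <= p < m | prime p) (1 + e p).
have e0 p : prime p -> 0 <= e p.
  by move=> pp; rewrite mulr_ge0 ?n2_ge0 // exprn_ge0 // addr_ge0 // ln_prime_ge0.
have E1 m : 1 <= E m.
  rewrite /E; elim: m => [|m IH]; first by rewrite big_geq.
  rewrite prod_nat_recr; case: ifP => pm; last by rewrite mulr1.
  by apply: (le_trans IH); rewrite ler_peMr ?lerDl ?e0 // (le_trans ler01 IH).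
pose Pn := eulerprod kap g; pose Ln := logderiv kap g.
(* The error constant solves the recursion in which C + M is multiplied by 1 + e(p) at each prime; M
   bounds the contribution of the two coefficients in [act_asy2]. *)
have main m : asy2 j (a * Pn m) (Pn m * (b - j.+2%:R * a * Ln m)) ((C0 + M) * E m - M)
    (Lop P m (iter kap (@T R) (pw i.+2))).
  elim: m => [|m IH].
    by rewrite /Pn /Ln /eulerprod /logderiv /E !big_geq // !mulr0 mulr1 mul1r subr0 mulr1 addrK.
  rewrite /Pn /Ln /eulerprod /logderiv /E !prod_nat_recr sum_nat_recr -/(eulerprod kap g m) -/(logderiv kap g m).
  rewrite -/(Pn m) -/(Ln m) -/(E m) /=; case: ifP => pm; last by rewrite !mulr1 addr0.
  have [P0 _] := KP _ m pm (g0 m pm); have s0 := @ln_prime_ge0 R m pm.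
  have pc : 0 <= (C0 + M) * E m - M.
    have h : (C0 + M) * 1 <= (C0 + M) * E m by rewrite ler_wpM2l // addr_ge0.
    slra.
  have := act_asy2 pc s0 P0 IH.
  rewrite (deriv_locpoly _ pm (g0 m pm)) -locpoly1 -/(P m).
  have -> : a * (Pn m * (P m).[1]) = a * Pn m * (P m).[1] by ring.
  set x := (_ - _ / (_ - 1)).
  have -> : Pn m * (b - j.+2%:R * a * Ln m) * (P m).[1] - j.+2%:R * (a * Pn m) * ln m%:R * ((P m).[1] * x)
     = Pn m * (P m).[1] * (b - j.+2%:R * a * (Ln m + x * ln m%:R)) by ring.
  apply: asy2_le.
  have nB : `|a * Pn m| + `|Pn m * (b - j.+2%:R * a * Ln m)| <= B.
    have /andP[p0 p1] := PP m; rewrite !normrM (ger0_norm (ltW p0)) mulrC -mulrDr ler_pM ?addr_ge0 ?(ltW p0) //.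
    by rewrite lerD2l; apply: le_trans (ler_normB _ _) _; rewrite lerD2l !normrM normr_nat ler_wpM2l ?mulr_ge0.
  have ME : (`|a * Pn m| + `|Pn m * (b - j.+2%:R * a * Ln m)|) * (j.+2%:R * j.+2%:R) <= M.
    by rewrite mulrC ler_wpM2l // mulr_ge0.
  set C := _ - M in pc *; set Z := `|_| + `|_| in nB ME *; set s := ln _ in s0 *.
  have -> : (C0 + M) * (E m * (1 + e m)) - M = C + (C + M) * (1 + s) ^+ 2 * n2 (P m).
    rewrite /C /e -/s; ring.
  rewrite lerD2l ler_wpM2r ?n2_ge0 //.
  have s1 : 1 <= (1 + s) ^+ 2 by rewrite exprn_ege1 // lerDl.
  have s2 : s + s ^+ 2 <= (1 + s) ^+ 2 by nra.
  rewrite [leRHS]mulrDl lerD //; first by rewrite ler_peMr.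
  have -> : j.+2%:R * j.+2%:R * Z * (s + s ^+ 2) = (Z * (j.+2%:R * j.+2%:R)) * (s + s ^+ 2) by ring.
  by rewrite ler_pM // ?addr_ge0 // ?exprn_ge0 // !mulr_ge0 // addr_ge0.
exists ((C0 + M) * expR (4 * D1)); first by rewrite mulr_ge0 ?expR_ge0 // addr_ge0.
move=> n n' X n0 nn' Xn X0.
have F0 := @supp0_pw R i.+2; have n0' : (0 < n')%N by exact: leq_trans nn'.
have Xn' : X <= ln (n'%:R : R).
  by apply: le_trans Xn _; rewrite ler_ln ?posrE ?ltr0n // ler_nat.
rewrite setsumE -(Lop1X_stable _ F0 n0 nn' Xn) -(@Lop_locpoly _ kap _ _ _ _ F0 n0' Xn').
have [_ /(_ X X0) h] := main n'; apply: le_trans h _.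
rewrite ler_wpM2r ?exprn_ge0 ?addr_ge0 ?(ltW X0) //.
have h : (C0 + M) * E n' <= (C0 + M) * expR (4 * D1).
  rewrite ler_wpM2l ?addr_ge0 //; apply: prod_primes_q32 => // p pp.
  by rewrite e0 //= nD.
by slra.
Qed.

End PrimeSums.

(** * Estimates of Chebyshev and Mertens *)

Section Mertens.
Variable R : realType.
Implicit Types (X C : R) (m n p j N B : nat).

Lemma ln_decomp N B : (0 < N)%N -> (forall p, p \in primes N -> (p < B)%N) ->
  ln (N%:R : R) = \sum_(0 <= p < B | prime p) (logn p N)%:R * ln p%:R.
Proof.
move=> N0 NB.
have -> : ln (N%:R : R) = \sum_(p <- primes N) (logn p N)%:R * ln p%:R.
  rewrite {1}(prod_prime_decomp N0) prime_decompE big_map /=.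
  have : forall p, p \in primes N -> (0 < p)%N by move=> p; rewrite mem_primes => /and3P[/prime_gt0].
  elim: (primes N) => [|p s IH] h; first by rewrite !big_nil ln1.
  have sp : forall q, q \in s -> (0 < q)%N by move=> q qs; apply: h; rewrite inE qs orbT.
  have p0 : (0 < p)%N by apply: h; rewrite inE eqxx.
  rewrite !big_cons natrM lnM ?posrE ?ltr0n ?expn_gt0 ?p0 //; last first.
    rewrite big_seq; apply: (big_ind (fun x => 0 < x)%N) => [//|a b a0 b0|q qs].
      by rewrite muln_gt0 a0.
    by rewrite expn_gt0 sp.
  by rewrite IH // natrX lnXn ?ltr0n // mulr_natl.
rewrite [RHS](bigID (fun p => p \in primes N)) /= [X in _ = _ + X]big1 ?addr0; last first.
  move=> p /andP[pp pN]; suff -> : logn p N = 0%N by rewrite mul0r.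
  by apply/eqP; rewrite -leqn0 leqNgt logn_gt0.
rewrite -[RHS]big_filter; apply: perm_big; apply: uniq_perm.
- exact: primes_uniq.
- by rewrite filter_uniq // iota_uniq.
move=> p; rewrite mem_filter mem_index_iota /=.
apply/idP/idP => [h|/andP[/andP[_ ->]]//]; rewrite h NB // andbT andbT.
by move: h; rewrite mem_primes => /and3P[].
Qed.

Lemma sum_ln_primes_le N B : (0 < N)%N ->
  \sum_(0 <= p < B | prime p && (p %| N)%N) ln (p%:R : R) <= ln N%:R.
Proof.
move=> N0; rewrite (@ln_decomp N (maxn B N.+1)) //; last first.
  move=> p; rewrite mem_primes => /and3P[_ _ pN].
  by apply: leq_trans (leq_maxr _ _); rewrite ltnS dvdn_leq.
have h : (B <= maxn B N.+1)%N by rewrite leq_maxl.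
rewrite [leRHS](@big_cat_nat _ _ _ B) //= -[leLHS]addr0 lerD //; last first.
  by apply: sumr_ge0 => p pp; rewrite mulr_ge0 // ln_prime_ge0.
rewrite big_mkcondr; apply: ler_sum => p pp; have h0 := @ln_prime_ge0 R p pp.
case: ifP => pN; last by rewrite mulr_ge0.
by rewrite ler_peMl // ler1n logn_gt0 mem_primes pp N0 pN.
Qed.

Lemma bin_central_le m : ('C(m.*2.+1, m) <= 4 ^ m)%N.
Proof.
have h : (2 ^ m.*2.+1 = \sum_(i < m.*2.+2) 'C(m.*2.+1, i))%N.
  by rewrite -[2%N]/(1 + 1)%N expnDn; apply: eq_bigr => i _; rewrite !exp1n !muln1.
have m1 : (m < m.*2.+2)%N by lia.
have m2 : (m.+1 < m.*2.+2)%N by lia.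
have : ('C(m.*2.+1, m) + 'C(m.*2.+1, m.+1) <= 2 ^ m.*2.+1)%N.
  rewrite h (bigD1 (Ordinal m1)) //= (bigD1 (Ordinal m2)) /=; last by rewrite -val_eqE /=; lia.
  by rewrite addnA leq_addr.
have -> : 'C(m.*2.+1, m.+1) = 'C(m.*2.+1, m).
  by rewrite -bin_sub; [congr binomial; lia|lia].
rewrite expnS -[4%N]/(2 ^ 2)%N -expnM mul2n; lia.
Qed.

(** Induction in the style of Erdős: for n = 2m + 1 the primes from m + 2 to n all divide the
    binomial coefficient of n over m, which is at most 4^m; an even n above 2 adds no prime. *)
Lemma theta_le n : \sum_(0 <= p < n.+1 | prime p) ln (p%:R : R) <= n%:R * ln 4.
Proof.
have l4 : 0 <= ln (4 : R) by rewrite ln_ge0 // ler1n.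
have [k] := ubnP n; elim: k n => // k IH n nk.
have [n2|n2] := leqP n 2.
  have h : ln (2 : R) <= ln 4 by rewrite ler_ln ?posrE ?ltr0n // ler_nat.
  have h2 : 0 <= ln (2 : R) by rewrite ln_ge0 // ler1n.
  case: n n2 nk => [|[|[|n]]] // _ _; rewrite /index_iota /= !big_cons big_nil /= ?mul0r ?mul1r ?addr0 //; slra.
case/boolP: (odd n) => on; last first.
  rewrite sum_nat_recr ifF ?addr0; last by apply/negP => /even_prime[e|e]; [rewrite e in n2|rewrite e in on].
  case: n n2 on nk => // n n2 on nk; apply: le_trans (IH n _) _; first by lia.
  by rewrite ler_wpM2r // ler_nat.
have [m e] : exists m, n = m.*2.+1 by exists n./2; rewrite -{1}(odd_double_half n) on.
have m0 : (0 < m)%N by lia.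
rewrite e (@big_cat_nat _ _ _ m.+2) //=; last by lia.
have -> : m.*2.+1%:R * ln (4 : R) = m.+1%:R * ln 4 + ln (4 ^ m)%:R.
  by rewrite natrX lnXn // -[ln _ *+ m]mulr_natl -mulrDl -natrD; congr (_%:R * _); lia.
rewrite lerD ?IH //; first by lia.
have C0 : (0 < 'C(m.*2.+1, m))%N by rewrite bin_gt0; lia.
apply: (@le_trans _ _ (ln ('C(m.*2.+1, m))%:R)); last first.
  by rewrite ler_ln ?posrE ?ltr0n ?expn_gt0 // ler_nat bin_central_le.
apply: le_trans (sum_ln_primes_le m.*2.+2 C0).
rewrite [leRHS](@big_cat_nat _ _ _ m.+2) //=; last by lia.
rewrite -[leLHS]add0r lerD //.
  by apply: sumr_ge0 => p /andP[pp _]; exact: ln_prime_ge0.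
rewrite big_nat_cond [leRHS]big_nat_cond.
rewrite le_eqVlt; apply/orP; left; apply/eqP; apply: eq_bigl => p.
case: (boolP (prime p)) => pp; rewrite ?andbF ?andbT //=.
have [/andP[h1 h2]|//] := boolP (m.+2 <= p < m.*2.+2)%N; rewrite /=; apply/esym.
have f : (p %| (m.*2.+1)`!)%N by rewrite dvdn_fact // prime_gt0 //=; lia.
have nf q : (q < p)%N -> ~~ (p %| q`!)%N.
  elim: q => [|q IHq] qp; first by rewrite fact0 dvdn1; case: (p) pp => [|[]].
  rewrite factS Euclid_dvdM // negb_or IHq ?(ltnW qp) // andbT.
  by apply/negP => /dvdn_leq h; have := h isT; lia.
have := @bin_fact m.*2.+1 m; rewrite -{2}[m]addn0 => /(_ ltac:(lia)) bf.
move: f; rewrite -bf !Euclid_dvdM // => /orP[->//|/orP[h|h]].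
  by move: h; rewrite (negbTE (nf _ _)) //; lia.
by move: h; rewrite (negbTE (nf _ _)) //; lia.
Qed.

Lemma ln_fact_bounds n : n%:R * ln n%:R - n%:R <= ln (n`!%:R : R) <= n%:R * ln n%:R.
Proof.
case: n => [|n]; first by rewrite !mul0r fact0 ln1; apply/andP; split; slra.
have n0 : 0 < n.+1%:R :> R by [].
have f0 : 0 < n.+1`!%:R :> R by rewrite ltr0n fact_gt0.
apply/andP; split.
  have h : n.+1%:R ^+ n.+1 <= expR (n.+1%:R : R) * n.+1`!%:R.
    rewrite -ler_pdivrMr //; apply: le_trans (expR_ge1Dxn n _) => //; rewrite lerDr //.
  move: h; rewrite -ler_ln ?posrE ?exprn_gt0 ?mulr_gt0 ?expR_gt0 //.
  by rewrite lnXn // lnM ?posrE ?expR_gt0 // expRK -[ln _ *+ _]mulr_natl lerBlDl.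
rewrite mulr_natl -lnXn // ler_ln ?posrE ?exprn_gt0 // -natrX ler_nat.
elim: n {n0 f0} => // n IH; rewrite factS expnS leq_mul2l /= (leq_trans IH) // leq_exp2r //.
Qed.

Lemma geom_le (q : R) n : 0 <= q < 1 -> \sum_(1 <= k < n.+1) q ^+ k <= q / (1 - q).
Proof.
move=> /andP[q0 q1]; suff -> : \sum_(1 <= k < n.+1) q ^+ k = (q - q ^+ n.+1) / (1 - q).
  by rewrite ler_pM2r ?invr_gt0 ?subr_gt0 // gerBl exprn_ge0.
elim: n => [|n IH]; first by rewrite big_geq // expr1 subrr mul0r.
by rewrite big_nat_recr //= IH (exprS q n.+1); field; slra.
Qed.

Definition plog n : R := \sum_(0 <= p < n.+1 | prime p) ln p%:R / p%:R.

Lemma logn_fact_bounds p n : prime p ->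
  (n%:R / p%:R - 1 : R) <= (logn p n`!)%:R <= (n%:R / (p%:R - 1) : R).
Proof.
move=> pp; rewrite logn_fact //; have p0 : 0 < p%:R :> R by rewrite ltr0n prime_gt0.
have [q0 q1] := andP (@prime_inv R p pp).
apply/andP; split.
  have [->|n0] := posnP n; first by rewrite mul0r sub0r (@le_trans _ _ 0) // lerN10.
  apply: (@le_trans _ _ (n %/ p)%:R).
    rewrite lerBlDr ler_pdivrMr // natr1 -natrM ler_nat.
    by rewrite ltnW // ltn_ceil // prime_gt0.
  by rewrite ler_nat big_ltn ?ltnS // expn1 leq_addr.
rewrite natr_sum; apply: (@le_trans _ _ (n%:R * \sum_(1 <= k < n.+1) p%:R^-1 ^+ k)).
  rewrite mulr_sumr; apply: ler_sum => k _.
  rewrite exprVn -natrX ler_pdivlMr ?ltr0n ?expn_gt0 ?prime_gt0 // -natrM ler_nat leq_divM //.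
have -> : n%:R / (p%:R - 1) = n%:R * (p%:R^-1 / (1 - p%:R^-1)) :> R.
  have pE : p%:R = (p%:R^-1)^-1 :> R by rewrite invrK.
  rewrite {1}pE; set q := _^-1 in q0 q1 *; field; rewrite !lt0r_neq0 //=; slra.
by rewrite ler_wpM2l // geom_le //; apply/andP; split; slra.
Qed.

(** Compare log n! with its prime factorisation. The exponent of p lies between n/p - 1 and n/(p -
    1); the loss on the left is paid by [theta_le], the one on the right by the convergent sum of
    log p/p^2. *)
Lemma mertens : {C : R | 0 < C & forall n, (0 < n)%N -> `|plog n - ln n%:R| <= C}.
Proof.
have [C1 C10 C1P] := ln_q32 R 1.
have l4 : 0 <= ln (4 : R) by rewrite ln_ge0 // ler1n.
exists (ln 4 + 1 + 4 * (2 * C1)) => [|n n0].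
  by have := mulr_gt0 (ltr0n R 2) C10; slra.
have /andP[f1 f2] := ln_fact_bounds n; have th := theta_le n.
have np : 0 < n%:R :> R by rewrite ltr0n.
have E : ln (n`!%:R : R) = \sum_(0 <= p < n.+1 | prime p) (logn p n`!)%:R * ln p%:R.
  apply: ln_decomp; first by rewrite fact_gt0.
  move=> p; rewrite mem_primes => /and3P[pp _]; rewrite ltnS leqNgt.
  apply: contraL => np'; elim: n np' {n0 f1 f2 th np} => [|n IHn] np'.
    by rewrite fact0 dvdn1; case: (p) pp => [|[]].
  rewrite factS Euclid_dvdM // negb_or IHn ?(ltnW np') // andbT.
  by apply/negP => /dvdn_leq h; have := h isT; lia.
have lo : n%:R * plog n - n%:R * ln 4 <= ln (n`!%:R : R).
  apply: le_trans (_ : n%:R * plog n - \sum_(0 <= p < n.+1 | prime p) ln p%:R <= _); first by slra.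
  rewrite E /plog mulr_sumr -sumrB; apply: ler_sum => p pp.
  have /andP[h _] := logn_fact_bounds n pp; have := ler_wpM2r (@ln_prime_ge0 R p pp) h; slra.
have up : ln (n`!%:R : R) <= n%:R * plog n + n%:R * (4 * (2 * C1)).
  rewrite E /plog mulr_sumr.
  have h : \sum_(0 <= p < n.+1 | prime p) 2 * (ln p%:R * (p%:R^-1) ^+ 2) <= 4 * (2 * C1).
    apply: sum_primes_q32 => [p pp|]; last by rewrite mulr_ge0 // ltW.
    rewrite -[leRHS]mulrA ler_wpM2l //; apply: le_trans (C1P p (prime_gt0 pp)).
    by rewrite expr1 ler_wpM2r ?exprn_ge0 ?invr_ge0 // lerDr.
  apply: le_trans (lerD (lexx _) (ler_wpM2l (ltW np) h)).
  rewrite mulr_sumr -big_split /=; apply: ler_sum => p pp.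
  have /andP[_ h1] := logn_fact_bounds n pp; have l0 := @ln_prime_ge0 R p pp.
  apply: le_trans (ler_wpM2r l0 h1) _.
  have [q0 q1] := andP (@prime_inv R p pp).
  have pE : p%:R = (p%:R^-1)^-1 :> R by rewrite invrK.
  have -> : n%:R / (p%:R - 1) * ln p%:R = n%:R * ln p%:R * (p%:R - 1)^-1 :> R by ring.
  have -> : n%:R * (ln p%:R / p%:R) + n%:R * (2 * (ln p%:R * p%:R^-1 ^+ 2)) =
    n%:R * ln p%:R * (p%:R^-1 + 2 * p%:R^-1 ^+ 2) :> R by ring.
  rewrite ler_wpM2l ?mulr_ge0 //.
  rewrite {1}pE; set q := _^-1 in q0 q1 *.
  have -> : (q^-1 - 1)^-1 = q / (1 - q) by field; rewrite !lt0r_neq0 //; slra.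
  rewrite ler_pdivrMr; last by slra.
  nra.
have k1 : 0 <= n%:R * ln (4 : R) by rewrite mulr_ge0.
have k2 : 0 <= n%:R * C1 by rewrite mulr_ge0 // ltW.
rewrite ler_norml; apply/andP; split.
  rewrite -(ler_pM2l np); slra.
rewrite -(ler_pM2l np); slra.
Qed.

Lemma harmonic_bounds n : (0 < n)%N -> 0 <= \sum_(1 <= m < n.+1) (m%:R^-1 : R) - ln n%:R <= 2.
Proof.
move=> n0; rewrite big_nat_recr //=.
have -> : \sum_(1 <= m < n) (m%:R^-1 : R) = ln n%:R + \sum_(1 <= m < n) del R m.
  have te := @telescope_sumr R 1 n (fun m => ln (m%:R : R)) n0; rewrite ln1 subr0 in te.
  rewrite -te -big_split /=.
  by apply: eq_bigr => m _; rewrite /del addrC subrK.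
have /andP[h1 h2] := @sum_del R 1 n isT n0; rewrite invr1 in h2.
have h3 : 0 <= (n%:R^-1 : R) <= 1 by rewrite invr_ge0 ler0n /= invf_le1 ?ltr0n // ler1n.
case/andP: h3 => h3 h4; apply/andP; split; slra.
Qed.

Lemma abel_bound (d psi : nat -> R) C n :
  (forall m, (1 <= m)%N -> `|\sum_(1 <= i < m.+1) d i| <= C) ->
  (forall m, (1 <= m)%N -> 0 <= psi m.+1 <= psi m) -> 0 <= psi 1%N ->
  `|\sum_(1 <= m < n) d m * psi m| <= C * psi 1%N.
Proof.
move=> dC psiD psi1.
pose D m := \sum_(1 <= i < m.+1) d i.
have C0 : 0 <= C by apply: le_trans (dC 1%N isT).
have E m : \sum_(1 <= i < m.+1) d i * psi i = D m * psi m.+1 + \sum_(1 <= i < m.+1) D i * (psi i - psi i.+1).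
  elim: m => [|m IH]; first by rewrite /D !big_geq // mul0r addr0.
  have DS : D m.+1 = D m + d m.+1 by rewrite /D big_nat_recr.
  by rewrite big_nat_recr //= IH [X in _ = _ + X]big_nat_recr //= DS; ring.
case: n => [|n]; first by rewrite big_geq // normr0 mulr_ge0.
rewrite E; apply: le_trans (ler_normD _ _) _.
case: n => [|n]; first by rewrite /D !big_geq // mul0r normr0 addr0 mulr_ge0.
have h1 : `|D n.+1 * psi n.+2| <= C * psi n.+2.
  have /andP[p0 _] := psiD n.+1 isT.
  by rewrite normrM (ger0_norm p0) ler_wpM2r // dC.
have h2 : `|\sum_(1 <= i < n.+2) D i * (psi i - psi i.+1)| <= C * (psi 1%N - psi n.+2).
  apply: le_trans (ler_norm_sum _ _ _) _.
  rewrite -[psi 1%N - _]opprB -(@telescope_sumr R 1 n.+2 psi) // -sumrN mulr_sumr.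
  apply: ler_sum_nat => i /andP[i1 _]; have /andP[_ p1] := psiD i i1.
  by rewrite normrM opprB (ger0_norm (_ : 0 <= psi i - _)) ?subr_ge0 // ler_wpM2r ?subr_ge0 // dC.
slra.
Qed.

(** By Mertens the partial sums of log p/p (at primes) minus 1/m are bounded, and summation by parts
    against the decreasing weight preserves this. The prime sum is thereby replaced by the zeta
    operator on [pw j.+1]. *)
Lemma sum_prime_log : {C : R | 0 < C & forall j n X, 0 < X -> X <= ln n%:R -> (0 < n)%N ->
  `|\sum_(0 <= p < n | prime p) ln p%:R / p%:R * pw j.+1 (X - ln p%:R) - X ^+ j.+2 / j.+2%:R|
   <= C * (1 + X) ^+ j.+1}.
Proof.
have [C C0 CP] := mertens; exists (C + 7) => [|j n X X0 Xn n0]; first by slra.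
pose psi m := pw j.+1 (X - ln (m%:R : R)).
pose d m : R := (if prime m then ln m%:R / m%:R else 0) - m%:R^-1.
have psi1 : psi 1%N = X ^+ j.+1 by rewrite /psi ln1 subr0 pwS_E // ltW.
have XJ : X ^+ j.+1 <= (1 + X) ^+ j.+1 by rewrite lerXn2r ?nnegrE //; slra.
have A : `|\sum_(1 <= m < n) d m * psi m| <= (C + 2) * psi 1%N.
  apply: abel_bound => [m m1|m m1|]; last exact: pw_ge0.
    have -> : \sum_(1 <= i < m.+1) d i = plog m - \sum_(1 <= i < m.+1) (i%:R^-1 : R).
      by rewrite sumrB /plog [in RHS]big_mkcond [in RHS]big_ltn //= add0r.
    have := CP m m1; have /andP[h1 h2] := harmonic_bounds m1.
    rewrite !ler_norml => /andP[h3 h4]; apply/andP; split; slra.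
  rewrite /psi pw_ge0 /=.
  have lm : ln (m%:R : R) <= ln m.+1%:R by rewrite ler_ln ?posrE ?ltr0n // ler_nat.
  rewrite /pw; case: ifP => h1; last by case: ifP => // h2; rewrite exprn_ge0 // ltW.
  rewrite ifT; last by slra.
  by rewrite lerXn2r ?nnegrE; slra.
have TT := T_pw_asy1 R j.+1; case: TT => _ /(_ X X0).
have -> : T (pw j.+1) X = \sum_(1 <= m < n) m%:R^-1 * psi m.
  rewrite /T (@TnE _ 0 _ _ n.+1) //; last 2 first.
  - exact: supp0_pw.
  - rewrite ltnS leqNgt; apply/negP => h.
    have := le_truncn_expR (ltn0Sn n) h; apply/negP; rewrite -ltNge; apply: le_lt_trans Xn _.
    by rewrite ltr_ln ?posrE ?ltr0n // ltr_nat.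
  rewrite (eq_bigl predT) => [|m]; last by rewrite rough0.
  rewrite big_ltn // invr0 mulr0 add0r big_nat_recr //=.
  rewrite [X in _ + X](_ : _ = 0) ?addr0; last first.
    by rewrite supp0_pw ?mul0r // subr_le0.
  by apply: eq_bigr => m _; rewrite mulrC.
have -> : \sum_(0 <= p < n | prime p) ln p%:R / p%:R * pw j.+1 (X - ln p%:R) =
  \sum_(1 <= m < n) d m * psi m + \sum_(1 <= m < n) m%:R^-1 * psi m.
  rewrite -big_split /= big_mkcond big_ltn //= add0r; apply: eq_bigr => m _.
  by rewrite -mulrDl subrK; case: ifP => // _; rewrite mul0r.
rewrite psi1 in A; have A' := ler_wpM2l (_ : 0 <= C + 2) XJ.
have {A'}A' := A' (ltac:(slra)).
have := le_trans A A'; set c := (j.+2%:R)^-1; rewrite !ler_norml => /andP[h1 h2] /andP[h3 h4].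
apply/andP; split; slra.
Qed.

End Mertens.

(** * The singular series *)

Section RootCounts.
Implicit Types (H : seq int) (p a d : nat) (h n : int).

Lemma dvd_Ppoly p H n : prime p ->
  (p%:Z %| Ppoly H n)%Z = has (fun h => (p%:Z %| n + h)%Z) H.
Proof.
move=> pp; rewrite /Ppoly; elim: H => [|h H IH] /=.
  by rewrite big_nil dvdzE /= dvdn1; case: (p) pp => [|[]].
by rewrite big_cons -IH !dvdzE abszM Euclid_dvdM.
Qed.

Definition res p h : nat := `|((- h) %% p%:Z)%Z|%N.

Lemma resE p h a : (0 < p)%N -> (a < p)%N -> (p%:Z %| a%:Z + h)%Z = (a == res p h).
Proof.
move=> p0 ap; have pz : p%:Z != 0 by rewrite lt0r_neq0 // ltz_nat.
have -> : (p%:Z %| a%:Z + h)%Z = (a%:Z == - h %[mod p%:Z])%Z by rewrite eqz_mod_dvd opprK.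
rewrite modz_small; last by rewrite /= ltz_nat.
rewrite /res -eqz_nat gez0_abs // modz_ge0 //.
Qed.

Lemma res_lt p h : (0 < p)%N -> (res p h < p)%N.
Proof.
move=> p0; have pz : p%:Z != 0 by rewrite lt0r_neq0 // ltz_nat.
by rewrite /res -ltz_nat gez0_abs ?modz_ge0 // ltz_pmod // ltz_nat.
Qed.

Lemma nu_res p H : prime p -> nu H p = size (undup [seq res p h | h <- H]).
Proof.
move=> pp; have p0 := prime_gt0 pp; rewrite /nu -size_filter.
apply/perm_size/uniq_perm; rewrite ?undup_uniq ?filter_uniq ?iota_uniq // => a.
rewrite mem_filter mem_iota add0n /= mem_undup dvd_Ppoly //.
apply/andP/mapP => [[/hasP[h hH hd] ap]|[h hH ->]].
  by exists h => //; apply/eqP; rewrite -resE.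
rewrite res_lt //; split=> //; apply/hasP; exists h => //.
by rewrite resE ?res_lt.
Qed.

Lemma nu_ge1 p H : prime p -> (0 < size H)%N -> (1 <= nu H p)%N.
Proof.
move=> pp; case: H => // h H _; rewrite nu_res //.
case e : (undup _) => [|//]; have : res p h \in undup [seq res p h | h <- h :: H].
  by rewrite mem_undup map_f // inE eqxx.
by rewrite e.
Qed.

Lemma nu_le p H : prime p -> (nu H p <= size H)%N.
Proof. by move=> pp; rewrite nu_res // (leq_trans (size_undup _)) // size_map. Qed.

(** Two elements of [H] with the same root mod p differ by a multiple of p, which is impossible for
    p above the sum of all differences. *)
Lemma nu_large H : uniq H -> exists P0, forall p, prime p -> (P0 <= p)%N -> nu H p = size H.
Proof.
move=> uH; pose D := (\sum_(h <- H) \sum_(g <- H) `|(h - g)%R|%N)%N.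
exists D.+1 => p pp Dp; have p0 := prime_gt0 pp.
rewrite nu_res // undup_id ?size_map //; rewrite map_inj_in_uniq // => h g hH gH e.
apply/eqP; rewrite -subr_eq0 -absz_eq0; apply/negPn; rewrite -lt0n; apply/negP => hg.
have dv : (p%:Z %| (res p h)%:Z + h)%Z by rewrite resE ?res_lt.
have dv' : (p%:Z %| (res p h)%:Z + g)%Z by rewrite resE ?e ?res_lt.
have : (p%:Z %| h - g)%Z.
  have -> : h - g = ((res p h)%:Z + h) - ((res p h)%:Z + g) by rewrite opprD addrACA subrr add0r.
  exact: rpredB.
rewrite dvdzE /= => /dvdn_leq => /(_ hg); apply/negP; rewrite -ltnNge.
apply: leq_trans Dp; rewrite ltnS /D (big_rem h hH) /= (big_rem g gH) /= -addnA leq_addr //.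
Qed.

End RootCounts.

Section Singular.
Variable R : realType.
Implicit Types (X C : R) (n p k : nat) (H : seq int).

(** The local weight of the diagonalised form after the factor (1 - 1/p)^2 coming from the two inner
    sums has been included (see [one_sub_fF]). It behaves like (k - 1)/p. *)
Definition Gs H p : R := ((nu H p)%:R - 1) / (p%:R - (nu H p)%:R).
Definition singn H n : R :=
  \prod_(0 <= p < n | prime p) ((1 - (nu H p)%:R / p%:R) * (1 - 1 / p%:R) ^- size H).
Definition betan H n : R :=
  \sum_(0 <= p < n | prime p) ((size H)%:R - (nu H p)%:R) * ln (p%:R) / p%:R.

Lemma nu_real H p : admissible H -> (0 < size H)%N -> prime p ->
  [/\ 1 <= (nu H p)%:R :> R, (nu H p)%:R + 1 <= p%:R :> R & (nu H p)%:R <= (size H)%:R :> R].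
Proof.
move=> ad s0 pp; rewrite ler1n nu_ge1 // natr1 !ler_nat nu_le //; split=> //.
exact: ad.
Qed.

Lemma Gs_ge0 H p : admissible H -> (0 < size H)%N -> prime p -> 0 <= Gs H p.
Proof.
by move=> ad s0 pp; have [h1 h2 h3] := nu_real ad s0 pp; apply: divr_ge0; slra.
Qed.

Lemma Gs_le H p : admissible H -> (0 < size H)%N -> prime p ->
  Gs H p <= (size H)%:R * ((size H)%:R + 1) / p%:R.
Proof.
move=> ad s0 pp; have [h1 h2 h3] := nu_real ad s0 pp.
have p0 : 0 < p%:R :> R by rewrite ltr0n prime_gt0.
rewrite /Gs; set v : R := (nu H p)%:R in h1 h2 h3 *; set k : R := (size H)%:R in h3 *.
rewrite ler_pdivrMr; last by slra.
rewrite mulrAC ler_pdivlMr //.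
have : p%:R <= (v + 1) * (p%:R - v) by nra.
have : 0 <= p%:R - v by slra.
set P : R := p%:R in p0 h2 *; move=> x1 x2.
have y1 : (v - 1) * P <= v * ((v + 1) * (P - v)) by apply: ler_pM; slra.
have y2 : v * ((v + 1) * (P - v)) <= k * ((k + 1) * (P - v)).
  by apply: ler_pM; rewrite ?mulr_ge0 ?ler_wpM2r //; slra.
slra.
Qed.

(** 1 + [Gs] equals (p - 1)/(p - nu); hence the sum weighted by [Gs], of dimension k - 1, produces
    the reciprocal of the singular series. *)
Lemma eulerfactor H p : admissible H -> (0 < size H)%N -> prime p ->
  (1 + Gs H p) * (1 - p%:R^-1) ^+ (size H).-1 =
  ((1 - (nu H p)%:R / p%:R) * (1 - 1 / p%:R) ^- size H)^-1.
Proof.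
move=> ad s0 pp; have [h1 h2 h3] := nu_real ad s0 pp.
have p0 : 0 < p%:R :> R by rewrite ltr0n prime_gt0.
have p1 : 1 < p%:R :> R by rewrite ltr1n prime_gt1.
rewrite invfM invrK -{2}(prednK s0) exprS div1r mulrA; congr (_ * _).
rewrite /Gs; set v : R := (nu H p)%:R in h1 h2 h3 *; set P : R := p%:R in p0 p1 h2 *.
by field; rewrite !lt0r_neq0 //; slra.
Qed.

Lemma eulerprod_singn H n : admissible H -> (0 < size H)%N ->
  eulerprod (size H).-1 (Gs H) n = (singn H n)^-1.
Proof.
move=> ad s0; rewrite /eulerprod /singn -prodfV; apply: eq_bigr => p pp.
exact: eulerfactor.
Qed.

(** The local logarithmic derivative is exactly -(k - nu)/(p - 1), and p - 1 is at least p/2. *)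
Lemma logderiv_Gs H n : admissible H -> (0 < size H)%N ->
  `|logderiv (size H).-1 (Gs H) n| <= 2 * betan H n.
Proof.
move=> ad s0; rewrite /logderiv /betan mulr_sumr; apply: le_trans (ler_norm_sum _ _ _) _.
apply: ler_sum => p pp; have [h1 h2 h3] := nu_real ad s0 pp.
have l0 := @ln_prime_ge0 R p pp.
have p1 : 2 <= p%:R :> R by rewrite ler_nat prime_gt1.
have kE : ((size H).-1)%:R = (size H)%:R - 1 :> R by rewrite -{2}(prednK s0) -natr1 addrK.
rewrite /Gs kE; set v : R := (nu H p)%:R in h1 h2 h3 *; set P : R := p%:R in p1 h2 l0 *.
set k : R := (size H)%:R in h3 *.
have -> : (v - 1) / (P - v) / (1 + (v - 1) / (P - v)) - (k - 1) / (P - 1) = - ((k - v) / (P - 1)).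
  by field; rewrite !lt0r_neq0 //; slra.
rewrite normrM normrN (ger0_norm l0) ger0_norm; last by apply: divr_ge0; slra.
have -> : 2 * ((k - v) * ln P / P) = (k - v) * (2 / P) * ln P by ring.
rewrite ler_wpM2r // ler_wpM2l //; first by slra.
rewrite ler_pdivlMr; last by slra.
by rewrite ler_pdivrMl; slra.
Qed.

(* Unlike most constants below, this bound depends only on the size of [H]. *)
Lemma Gs_eulerprod_le k : {C : R | 0 < C & forall H, size H = k -> admissible H -> (0 < k)%N ->
  forall n, eulerprod k.-1 (Gs H) n <= C}.
Proof.
pose D : R := 8 * k%:R ^+ 3 + 2 * k%:R ^+ 2.
have D0 : 0 <= D by rewrite addr_ge0 // mulr_ge0 // exprn_ge0.
exists (expR (4 * D)) => [|H sH ad k0 n]; first exact: expR_gt0.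
(* For p at most 2k the factor is bounded crudely through p - nu at least 1. Beyond 2k, replacing nu
   by k only increases it, and the linear terms in 1/p cancel. *)
pose e p : R := if (p <= 2 * k)%N then 2 * k%:R else 2 * k%:R ^+ 2 * p%:R^-1 ^+ 2.
have k1 : 1 <= k%:R :> R by rewrite ler1n.
apply: (@le_trans _ _ (\prod_(0 <= p < n | prime p) (1 + e p))); last first.
  apply: prod_primes_q32 => // p pp; have p0 := prime_gt0 pp.
  have sq : p%:R^-1 ^+ 2 <= q32 R p.
    rewrite q32E // ler_peMl ?exprn_ge0 ?invr_ge0 //.
    by rewrite -[leLHS]sqrtr1 ler_psqrt ?nnegrE // ler1n.
  have q0 := q32_ge0 R p; rewrite /e; case: ifP => pk; apply/andP; split.
  - by rewrite mulr_ge0.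
  - have P0 : 0 < p%:R :> R by rewrite ltr0n.
    have i0 : 0 <= p%:R^-1 :> R by rewrite invr_ge0.
    have : 1 <= 2 * k%:R * p%:R^-1 :> R by rewrite ler_pdivlMr // mul1r -natrM ler_nat.
    move=> h; have h2 : 1 <= (2 * k%:R * p%:R^-1) ^+ 2 :> R by rewrite exprn_ege1.
    have h3 : 8 * k%:R ^+ 3 * p%:R^-1 ^+ 2 <= 8 * k%:R ^+ 3 * q32 R p.
      by rewrite ler_wpM2l // mulr_ge0 // exprn_ge0.
    have h4 : 0 <= 2 * k%:R ^+ 2 * q32 R p by rewrite !mulr_ge0 ?exprn_ge0.
    have h5 : 2 * k%:R <= 2 * k%:R * (2 * k%:R * p%:R^-1) ^+ 2 :> R by rewrite ler_peMr // mulr_ge0.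
    rewrite /D; slra.
  - by rewrite mulr_ge0 ?exprn_ge0 ?invr_ge0 // mulr_ge0 // exprn_ge0.
  - have h3 : 2 * k%:R ^+ 2 * p%:R^-1 ^+ 2 <= 2 * k%:R ^+ 2 * q32 R p.
      by rewrite ler_wpM2l // mulr_ge0 // exprn_ge0.
    have h4 : 0 <= 8 * k%:R ^+ 3 * q32 R p by rewrite !mulr_ge0 ?exprn_ge0.
    rewrite /D; slra.
apply: ler_prod => p pp; have s0 : (0 < size H)%N by rewrite sH.
have [h1 h2 h3] := nu_real ad s0 pp; rewrite sH in h3.
have /andP[q0 q1] := @prime_inv R p pp; have g0 := Gs_ge0 ad s0 pp.
apply/andP; split.
  by rewrite mulr_ge0 ?exprn_ge0 //; slra.
have P2 : 2 <= p%:R :> R by rewrite ler_nat prime_gt1.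
have oG : 1 + Gs H p = (p%:R - 1) / (p%:R - (nu H p)%:R).
  by rewrite /Gs; field; rewrite !lt0r_neq0 //; slra.
have b1 : (1 - p%:R^-1 : R) ^+ k.-1 <= 1 by rewrite exprn_ile1 //; slra.
rewrite /e; case: ifP => pk.
  apply: (@le_trans _ _ (1 + Gs H p)).
    by rewrite ler_piMr // addr_ge0.
  rewrite oG ler_pdivrMr; last by slra.
  have : p%:R <= 2 * k%:R :> R by rewrite -natrM ler_nat.
  set P : R := p%:R in h2 P2 *; set v : R := (nu H p)%:R in h1 h2 h3 *; move=> hP.
  have : (1 + 2 * k%:R) * 1 <= (1 + 2 * k%:R) * (P - v) by rewrite ler_wpM2l //; slra.
  slra.
move/negbT: pk; rewrite -ltnNge => pk.
have Pk : 2 * k%:R <= p%:R :> R by rewrite -natrM ler_nat ltnW.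
have bern : (1 - p%:R^-1 : R) ^+ k.-1 <= 1 - (k%:R - 1) * p%:R^-1 + (k%:R - 1) ^+ 2 * p%:R^-1 ^+ 2.
  have -> : k%:R - 1 = (k.-1)%:R :> R by rewrite -{1}(prednK k0) -natr1 addrK.
  elim: (k.-1) => [|m IH]; first by rewrite expr0 mul0r expr0n mul0r; slra.
  rewrite exprS -natr1; set q := p%:R^-1 in q0 q1 IH *; set M : R := m%:R in IH *.
  have := ler_wpM2l (_ : 0 <= 1 - q) IH => h.
  have {}h := h (ltac:(slra)); apply: le_trans h _.
  have M0 : 0 <= M by rewrite /M.
  have m1 : 0 <= M * q ^+ 2 by rewrite mulr_ge0 ?exprn_ge0 // ltW.
  have m2 : 0 <= M ^+ 2 * q ^+ 3 by rewrite mulr_ge0 ?exprn_ge0 // ltW.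
  have m3 : 0 <= q ^+ 2 by rewrite exprn_ge0 // ltW.
  slra.
have oGk : 1 + Gs H p <= (1 - p%:R^-1) / (1 - k%:R * p%:R^-1).
  rewrite oG; set P : R := p%:R in h2 P2 Pk q0 q1 *.
  have -> : (1 - P^-1) / (1 - k%:R * P^-1) = (P - 1) / (P - k%:R).
    by field; rewrite !lt0r_neq0 //; slra.
  by rewrite ler_wpM2l ?lef_pV2 ?posrE //; slra.
set q := p%:R^-1 in q0 q1 b1 bern oGk *.
have kq : k%:R * q <= 1 / 2.
  by rewrite /q ler_pdivrMr ?(lt_le_trans _ P2) //; slra.
have B0 : 0 <= (1 - q) ^+ k.-1 by rewrite exprn_ge0 //; slra.
apply: (@le_trans _ _ ((1 - q) / (1 - k%:R * q) * (1 - (k%:R - 1) * q + (k%:R - 1) ^+ 2 * q ^+ 2))).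
  by apply: ler_pM; rewrite ?addr_ge0.
rewrite mulrAC ler_pdivrMr; last by slra.
set K : R := k%:R in k1 kq *.
have m3 : 0 <= q ^+ 2 by rewrite exprn_ge0 // ltW.
have m4 : 0 <= (K - 1) * q ^+ 2 by rewrite mulr_ge0 //; slra.
have m5 : 0 <= (K - 1) ^+ 2 * q ^+ 3 by rewrite mulr_ge0 ?exprn_ge0 //; slra.
have m6 : 0 <= K ^+ 2 * q ^+ 2 * (1 / 2 - K * q) by rewrite !mulr_ge0 ?exprn_ge0 //; slra.
slra.
Qed.

End Singular.

Section SingularLimits.
Variable R : realType.
Implicit Types (X C : R) (n p k : nat) (H : seq int).

Lemma bernoulli (q : R) n : 0 <= q <= 1 -> 1 - n%:R * q <= (1 - q) ^+ n.
Proof.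
move=> /andP[q0 q1]; elim: n => [|n IH]; first by rewrite expr0 mul0r subr0.
rewrite exprS -natr1; have := ler_wpM2l (_ : 0 <= 1 - q) IH => /(_ ltac:(slra)).
have : 0 <= n%:R * q ^+ 2 by rewrite mulr_ge0 ?exprn_ge0.
slra.
Qed.

Lemma singn_gt0 H n : admissible H -> (0 < size H)%N -> 0 < singn R H n.
Proof.
move=> ad s0; rewrite prodr_gt0 // => p pp; have [h1 h2 h3] := @nu_real R _ _ ad s0 pp.
have /andP[q0 q1] := @prime_inv R p pp.
rewrite divr_gt0 ?exprn_gt0 //; last by rewrite div1r; slra.
by rewrite subr_gt0 ltr_pdivrMr ?ltr0n ?prime_gt0 // mul1r; slra.
Qed.

(** Once nu = k, Bernoulli's inequality makes every factor at most 1, so a shifted sequence of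
    partial products decreases; [Gs_eulerprod_le] bounds it away from 0. *)
Lemma sing_cvg H : uniq H -> admissible H -> (0 < size H)%N ->
  (singn R H @ \oo --> sing R H)%classic.
Proof.
move=> uH ad s0; have [P0 hP] := nu_large uH.
have [C C0 CP] := @Gs_eulerprod_le R (size H).
suff : cvgn (singn R H) by [].
suff : cvgn (fun n => singn R H (n + P0)%N).
  by case/cvg_ex => /= l; rewrite cvg_shiftn => ul; apply/cvg_ex; exists l.
apply: nonincreasing_is_cvgn.
  apply/nonincreasing_seqP => n /=; rewrite addSn /singn prod_nat_recr -/(singn R H _).
  case: ifP => pp; last by rewrite mulr1.
  rewrite ler_piMr ?(ltW (singn_gt0 _ ad s0)) // hP ?leq_addl //.
  have /andP[q0 q1] := @prime_inv R _ pp; rewrite div1r.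
  rewrite ler_pdivrMr ?mul1r; first by apply: bernoulli; apply/andP; split; slra.
  by rewrite exprn_gt0 //; slra.
exists C^-1 => _ [n _ <-] /=.
have := CP H erefl ad s0 (n + P0)%N; rewrite eulerprod_singn // => h.
by rewrite -[leRHS]invrK lef_pV2 ?posrE ?invr_gt0 // singn_gt0.
Qed.

Lemma sing_gt k : {c : R | 0 < c & forall H, size H = k -> uniq H -> admissible H -> (0 < k)%N ->
  c <= sing R H}.
Proof.
have [C C0 CP] := @Gs_eulerprod_le R k.
exists C^-1 => [|H sH uH ad k0]; first by rewrite invr_gt0.
have s0 : (0 < size H)%N by rewrite sH.
have cv := sing_cvg uH ad s0; rewrite -(cvg_lim (@Rhausdorff R) cv).
apply: limr_ge; first by apply/cvg_ex; exists (sing R H).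
near=> n; have := CP H sH ad k0 n; rewrite -sH eulerprod_singn // => h.
by rewrite -[leRHS]invrK lef_pV2 ?posrE ?invr_gt0 // singn_gt0.
Unshelve. all: by end_near. Qed.

Lemma betan_nd H : admissible H -> (0 < size H)%N -> nondecreasing_seq (betan R H).
Proof.
move=> ad s0; apply/nondecreasing_seqP => n; rewrite /betan sum_nat_recr lerDl.
case: ifP => pp //; have [h1 h2 h3] := @nu_real R _ _ ad s0 pp.
by rewrite divr_ge0 // mulr_ge0 ?ln_prime_ge0 // subr_ge0.
Qed.

Lemma betan_le H n : uniq H -> admissible H -> (0 < size H)%N -> betan R H n <= betaH R H.
Proof.
move=> uH ad s0; have nd := betan_nd ad s0; have [P0 hP] := nu_large uH.
have st m : betan R H (m + P0) = betan R H P0.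
  elim: m => // m IH; rewrite addSn /betan sum_nat_recr -/(betan R H (m + P0)) -/(betan R H P0) IH.
  by case: ifP => pp; rewrite ?addr0 // hP ?leq_addl // subrr mul0r mul0r addr0.
apply: (nondecreasing_cvgn_le nd); apply: nondecreasing_is_cvgn => //.
by exists (betan R H P0) => _ [m _ <-]; rewrite -(st m); apply: nd; exact: leq_addr.
Qed.

(** Admissibility forces nu = 1 at the prime 2, which alone contributes (k - 1) log 2/2. This bound
    lets errors without the factor [betaH] be absorbed. *)
Lemma betaH_ge H : uniq H -> admissible H -> (2 <= size H)%N -> ln 2 / 2 <= betaH R H.
Proof.
move=> uH ad s2; have s0 : (0 < size H)%N by exact: leq_trans s2.
apply: le_trans (betan_le 3 uH ad s0).
rewrite /betan /index_iota /= !big_cons big_nil /= addr0.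
have := ad 2%N isT; rewrite ltnS => n2; have n1 := nu_ge1 (isT : prime 2) s0.
have -> : nu H 2 = 1%N by apply/eqP; rewrite eqn_leq n2 n1.
have : 2 <= (size H)%:R :> R by rewrite ler_nat.
have l2 : 0 <= ln (2 : R) by rewrite ln_ge0 // ler1n.
move=> h; have : 0 <= ((size H)%:R - 2) * ln (2 : R) by rewrite mulr_ge0 // subr_ge0.
slra.
Qed.

Lemma Gs_dev H : uniq H -> admissible H -> (0 < size H)%N ->
  exists2 D, 0 <= D & forall p, prime p ->
   `|Gs R H p - ((size H).-1)%:R / p%:R| * (1 + ln p%:R) ^+ 2 <= D * q32 R p.
Proof.
move=> uH ad s0; have [P0 hP] := nu_large uH; have [C C0 CP] := @ln_q32 R 2.
apply: (@eventually_all R (fun p => `|Gs R H p - ((size H).-1)%:R / p%:R| * (1 + ln p%:R) ^+ 2)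
  (q32 R) prime (maxn P0 (2 * size H)) (2 * (size H)%:R ^+ 2 * C)).
  by move=> p pp; apply: q32_gt0; exact: prime_gt0.
move=> p pp; rewrite geq_max => /andP[pP pk].
rewrite /Gs hP //; set k : R := (size H)%:R.
have kE : ((size H).-1)%:R = k - 1 by rewrite /k -{2}(prednK s0) -natr1 addrK.
rewrite kE; have Pk : 2 * k <= p%:R by rewrite -natrM ler_nat.
have k1 : 1 <= k by rewrite ler1n.
set P : R := p%:R in Pk *.
have -> : (k - 1) / (P - k) - (k - 1) / P = (k - 1) * k * (P^-1 * (P - k)^-1).
  by field; rewrite !lt0r_neq0 //; slra.
have i1 : (P - k)^-1 <= 2 * P^-1.
  rewrite -[leRHS]invrK lef_pV2 ?posrE ?invr_gt0 ?mulr_gt0 ?invr_gt0 //; [|slra|slra].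
  by rewrite invfM invrK; slra.
have P0' : 0 < P^-1 by rewrite invr_gt0; slra.
have kk : 0 <= (k - 1) * k by rewrite mulr_ge0; slra.
have i0 : 0 <= (P - k)^-1 by rewrite invr_ge0; slra.
rewrite ger0_norm; last exact: mulr_ge0 kk (mulr_ge0 (ltW P0') i0).
have L0 : 0 <= (1 + ln P) ^+ 2 by rewrite exprn_ge0 // addr_ge0 // ln_prime_ge0.
apply: (@le_trans _ _ (2 * k ^+ 2 * ((1 + ln P) ^+ 2 * P^-1 ^+ 2))); last first.
  rewrite -[leRHS]mulrA ler_wpM2l ?CP ?prime_gt0 // mulr_ge0 // exprn_ge0; slra.
have -> : 2 * k ^+ 2 * ((1 + ln P) ^+ 2 * P^-1 ^+ 2) = k ^+ 2 * (P^-1 * (2 * P^-1)) * (1 + ln P) ^+ 2 by ring.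
rewrite ler_wpM2r //; apply: ler_pM => //; first by rewrite mulr_ge0 // ltW.
  by rewrite expr2; nra.
by rewrite ler_wpM2l // ltW.
Qed.

(** The outer weight multiplied by the square of the error factor of the inner sums (see
    [Gam_GamP]); dividing by (1 - 1/p)^2 recovers the outer weight from [Gs]. *)
Definition GamP (c : R) H p : R := Gs R H p * ((1 + c * ((1 + ln p%:R) / p%:R)) / (1 - p%:R^-1)) ^+ 2.

Lemma GamP_bounds c H p : 0 <= c -> admissible H -> (0 < size H)%N -> prime p ->
  Gs R H p <= GamP c H p <=
  Gs R H p + Gs R H p * ((4 * (c + 1) + 4 * (c + 1) ^+ 2) * (1 + ln p%:R) ^+ 2 * p%:R^-1).
Proof.
move=> c0 ad s0 pp; have /andP[q0 q1] := @prime_inv R p pp.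
have g0 := @Gs_ge0 R H p ad s0 pp; have l0 := @ln_prime_ge0 R p pp.
rewrite /GamP; set q := p%:R^-1 in q0 q1 *; set L := 1 + ln _.
have L1 : 1 <= L by rewrite /L lerDl.
have cL : 0 <= c * L by rewrite mulr_ge0 //; slra.
have y0 : 0 <= 2 * (c + 1) * L * q by rewrite !mulr_ge0 //; slra.
have r1 : 1 <= (1 + c * (L * q)) / (1 - q).
  rewrite ler_pdivlMr; last by slra.
  have : 0 <= c * (L * q) by rewrite !mulr_ge0 //; slra.
  slra.
have r2 : (1 + c * (L * q)) / (1 - q) <= 1 + 2 * (c + 1) * L * q.
  rewrite ler_pdivrMr; last by slra.
  have a1 : 0 <= c * L * q * (1 - 2 * q) by rewrite !mulr_ge0 //; slra.
  have a2 : 0 <= (L - 1) * q by rewrite mulr_ge0; slra.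
  have a3 : 0 <= L * q * (1 - 2 * q) by rewrite !mulr_ge0 //; slra.
  slra.
apply/andP; split; first by rewrite ler_peMr // exprn_ege1.
have mE (G Z : R) : G + G * Z = G * (1 + Z) by ring.
rewrite mE ler_wpM2l //.
apply: (@le_trans _ _ ((1 + 2 * (c + 1) * L * q) ^+ 2)).
  by apply: lerXn2r => //; rewrite ?nnegrE; slra.
have e1 : L * q <= L ^+ 2 * q by rewrite ler_wpM2r ?(ltW q0) // expr2 ler_peMr //; slra.
have e2 : L ^+ 2 * q ^+ 2 <= L ^+ 2 * q.
  by rewrite ler_wpM2l ?exprn_ge0 //; [slra|rewrite expr2 ler_piMr //; slra].
have c1 : 0 <= c + 1 by slra.
have f1 := ler_wpM2l (mulr_ge0 (ler0n R 4) c1) e1.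
have f2 := ler_wpM2l (mulr_ge0 (ler0n R 4) (exprn_ge0 2 c1)) e2.
have -> : (1 + 2 * (c + 1) * L * q) ^+ 2 = 1 + (4 * (c + 1) * (L * q) + 4 * (c + 1) ^+ 2 * (L ^+ 2 * q ^+ 2)) by ring.
have -> : 1 + (4 * (c + 1) + 4 * (c + 1) ^+ 2) * L ^+ 2 * q =
  1 + (4 * (c + 1) * (L ^+ 2 * q) + 4 * (c + 1) ^+ 2 * (L ^+ 2 * q)) by ring.
by rewrite lerD2l lerD.
Qed.

Lemma GamP_dev c H : 0 <= c -> uniq H -> admissible H -> (0 < size H)%N ->
  exists2 D, 0 <= D & forall p, prime p ->
   `|GamP c H p - ((size H).-1)%:R / p%:R| * (1 + ln p%:R) ^+ 2 <= D * q32 R p.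
Proof.
move=> c0 uH ad s0; have [D D0 hD] := Gs_dev uH ad s0.
have [C C0 CP] := @ln_q32 R 4.
pose M := 4 * (c + 1) + 4 * (c + 1) ^+ 2; pose k : R := (size H)%:R.
have c1 : 0 <= c + 1 by slra.
have M0 : 0 <= M by rewrite addr_ge0 // mulr_ge0 // exprn_ge0.
have k0 : 0 <= k * (k + 1) by rewrite mulr_ge0 // addr_ge0.
exists (D + k * (k + 1) * M * C) => [|p pp]; first by rewrite addr_ge0 // mulr_ge0 ?(ltW C0) // mulr_ge0.
have /andP[b1 b2] := GamP_bounds c0 ad s0 pp.
have l0 := @ln_prime_ge0 R p pp; have /andP[q0 q1] := @prime_inv R p pp.
have gl := @Gs_le R H p ad s0 pp; have g0 := @Gs_ge0 R H p ad s0 pp.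
have L0 : 0 <= 1 + ln (p%:R : R) by rewrite addr_ge0.
have -> : GamP c H p - ((size H).-1)%:R / p%:R = (Gs R H p - ((size H).-1)%:R / p%:R) + (GamP c H p - Gs R H p) by ring.
apply: (@le_trans _ _ ((`|Gs R H p - ((size H).-1)%:R / p%:R| + `|GamP c H p - Gs R H p|) * (1 + ln p%:R) ^+ 2)).
  by rewrite ler_wpM2r ?exprn_ge0 // ler_normD.
rewrite mulrDl [leRHS]mulrDl lerD ?hD //.
rewrite ger0_norm ?subr_ge0 //; set L := 1 + ln _ in L0 *; set q := p%:R^-1 in q0 q1 b2 gl *.
have e : GamP c H p - Gs R H p <= k * (k + 1) * q * (M * L ^+ 2 * q).
  rewrite lerBlDl; apply: le_trans b2 _; rewrite lerD2l ler_wpM2r //.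
  by rewrite !mulr_ge0 ?exprn_ge0 // ltW.
apply: le_trans (ler_wpM2r (exprn_ge0 2 L0) e) _.
have := CP p (prime_gt0 pp); rewrite -/L -/q => h.
have := ler_wpM2l (mulr_ge0 k0 M0) h; slra.
Qed.

(** By [GamP_bounds] and [Gs_le] the two weights differ by O((1 + log p)^2/p^2) with a constant
    depending on c and k only, so the quotient of the products is bounded uniformly in [H]. *)
Lemma GamP_eulerprod c k : 0 <= c -> {C : R | 0 < C & forall H, size H = k -> admissible H -> (0 < k)%N ->
  forall n, eulerprod k.-1 (GamP c H) n <= C * eulerprod k.-1 (Gs R H) n}.
Proof.
move=> c0; have [C1 C10 C1P] := @ln_q32 R 2.
pose M := 4 * (c + 1) + 4 * (c + 1) ^+ 2; pose K : R := k%:R.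
have c1 : 0 <= c + 1 by slra.
have M0 : 0 <= M by rewrite addr_ge0 // mulr_ge0 // exprn_ge0.
have k0 : 0 <= K * (K + 1) by rewrite mulr_ge0 // addr_ge0.
pose D := K * (K + 1) * M * C1.
have D0 : 0 <= D by rewrite /D mulr_ge0 ?(ltW C10) // mulr_ge0.
exists (expR (4 * D)) => [|H sH ad kk n]; first exact: expR_gt0.
have s0 : (0 < size H)%N by rewrite sH.
pose e p := K * (K + 1) * M * ((1 + ln p%:R) ^+ 2 * p%:R^-1 ^+ 2).
have ep0 p : prime p -> 0 <= e p.
  move=> pp; apply: mulr_ge0 (mulr_ge0 k0 M0) _.
  by rewrite mulr_ge0 // exprn_ge0 ?invr_ge0 // addr_ge0 // ln_prime_ge0.
apply: (@le_trans _ _ ((\prod_(0 <= p < n | prime p) (1 + e p)) * eulerprod k.-1 (Gs R H) n)); last first.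
  rewrite ler_wpM2r //.
    rewrite prodr_ge0 // => p pp; have /andP[q0 q1] := @prime_inv R p pp.
    have g0 := @Gs_ge0 R H p ad s0 pp.
    by rewrite mulr_ge0 ?exprn_ge0 //; slra.
  apply: prod_primes_q32 => // p pp; rewrite ep0 //= /e /D.
  by rewrite -[leRHS]mulrA ler_wpM2l ?C1P ?prime_gt0 // mulr_ge0.
rewrite /eulerprod -big_split /=; apply: ler_prod => p pp.
have /andP[q0 q1] := @prime_inv R p pp; have g0 := @Gs_ge0 R H p ad s0 pp.
have /andP[b1 b2] := GamP_bounds c0 ad s0 pp; have l0 := @ln_prime_ge0 R p pp.
have gl := @Gs_le R H p ad s0 pp; rewrite sH -/K in gl.
have B0 : 0 <= (1 - p%:R^-1 : R) ^+ k.-1 by rewrite exprn_ge0 //; slra.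
apply/andP; split; first by rewrite mulr_ge0 //; slra.
rewrite mulrA ler_wpM2r //.
have e0 := ep0 p pp.
have : Gs R H p * (M * (1 + ln p%:R) ^+ 2 * p%:R^-1) <= e p.
  apply: le_trans (ler_wpM2r _ gl) _.
    by rewrite mulr_ge0 ?(ltW q0) // mulr_ge0 // exprn_ge0 // addr_ge0.
  rewrite /e le_eqVlt; apply/orP; left; apply/eqP; ring.
have : 0 <= e p * Gs R H p by rewrite mulr_ge0.
rewrite -/M in b2; slra.
Qed.

End SingularLimits.

(** * Outer sums with constants uniform in [H] *)

Section WeightedSums.
Variable R : realType.
Implicit Types (X C D : R) (n p k i : nat) (H : seq int) (g : nat -> R).

Lemma gprod_ge0 n g (A : {set 'I_n}) : (forall p, prime p -> 0 <= g p) -> 0 <= gprod g A.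
Proof. by move=> g0; apply: prodr_ge0 => j _; rewrite /onprimes; case: ifP => // /g0. Qed.

Lemma eulerprod_near H (eta : R) n : uniq H -> admissible H -> (0 < size H)%N -> 0 < eta ->
  exists2 n', (n <= n')%N & `|eulerprod (size H).-1 (Gs R H) n' - (sing R H)^-1| <= eta.
Proof.
move=> uH ad s0 e0; have [c c0 cP] := @sing_gt R (size H).
have sp : 0 < sing R H by apply: lt_le_trans (cP H erefl uH ad s0).
pose proof (@cvgV R nat _ _ (singn R H) _ (lt0r_neq0 sp) (@sing_cvg R H uH ad s0)) as cv.
move/cvgrPdist_le: cv => /(_ _ e0) [N _ hN].
exists (maxn n N); rewrite ?leq_maxl // eulerprod_singn // distrC.
exact: hN (maxn n N) (leq_maxr _ _).
Qed.

Lemma large_n X n : exists n', [/\ (n <= n')%N, (0 < n')%N & X <= ln (n'%:R : R)].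
Proof.
exists (maxn n (Num.truncn (expR X)).+1); split; rewrite ?leq_maxl //.
  by rewrite (leq_trans _ (leq_maxr _ _)).
apply/ltW/truncn_expR_lt; exact: leq_trans (leq_maxr _ _).
Qed.

(** The leading constants a and b depend on k and i only, and the logarithmic derivative is at most
    2 [betaH]. The remaining constant D' depends on [H] and is defeated by the threshold X0. *)
Lemma Gs_sum k i : (2 <= k)%N -> {C : R | 0 < C & forall H, size H = k -> uniq H -> admissible H ->
  exists X0, forall n X, X0 <= X -> (0 < n)%N -> X <= ln n%:R ->
   `|setsum n (Gs R H) (pw i.+2) X - i.+2`!%:R / (k.-1 + i).+2`!%:R / sing R H * X ^+ (k.-1 + i).+2|
    <= C * (betaH R H / sing R H * X ^+ (k.-1 + i).+1)}.
Proof.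
move=> k2; have k0 : (0 < k)%N by exact: leq_trans k2.
have [b bP] := cid (setsum_asy2 R k.-1 i).
set a : R := _ / _ in bP *; set J := (k.-1 + i)%N in bP *.
have a0 : 0 < a by rewrite divr_gt0 // ltr0n fact_gt0.
clearbody a.
have l2 : 0 < ln (2 : R) by rewrite ln_gt0 // ltr1n.
exists ((a + 2 * `|b|) * (2 / ln 2) + 4 * J.+2%:R * a + 1) => [|H sH uH ad].
  have h1 : 0 <= (a + 2 * `|b|) * (2 / ln 2).
    by rewrite mulr_ge0 ?divr_ge0 ?(ltW l2) // addr_ge0 ?(ltW a0) // mulr_ge0.
  have h2 : 0 <= 4 * J.+2%:R * a by rewrite mulr_ge0 ?(ltW a0).
  slra.
have s0 : (0 < size H)%N by rewrite sH.
have [D D0 DP] := Gs_dev R uH ad s0; rewrite sH in DP.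
have g0 p : prime p -> 0 <= Gs R H p by move=> pp; exact: Gs_ge0.
have [D' D'0 D'P] := bP _ _ D0 g0 DP.
have [c c0 cP] := @sing_gt R k.
have sp : 0 < sing R H by apply: lt_le_trans (cP H sH uH ad k0).
have bt := @betaH_ge R H uH ad (ltac:(by rewrite sH)).
set S := sing R H in sp *; set B := betaH R H in bt *.
have B0 : 0 < B by apply: lt_le_trans bt; rewrite divr_gt0.
exists (Num.max 1 (D' * 2 ^+ J * S / B)) => n X; rewrite ge_max => /andP[X1 X2] n0 Xn.
have X0 : 0 < X by slra.
have S0 : 0 < S^-1 by rewrite invr_gt0.
(* The tolerance carries a factor 1/X so that replacing the Euler product by its limit in the
   leading term costs one power of X. *)
have [n' nn'] := @eulerprod_near H (S^-1 / X) n uH ad s0 (divr_gt0 S0 X0).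
rewrite sH -/S => hE.
have := D'P n n' X n0 nn' Xn X0.
set E := eulerprod _ _ _ in hE *; set L := logderiv _ _ _; set W := setsum _ _ _ _ => hW.
have hL : `|L| <= 2 * B.
  have := @logderiv_Gs R H n' ad s0; rewrite sH => h; apply: le_trans h _.
  by rewrite ler_wpM2l //; exact: betan_le.
have SX : S^-1 / X <= S^-1 by rewrite ler_pdivrMr // ler_peMr // ltW.
have E2 : `|E| <= 2 * S^-1.
  have -> : E = S^-1 + (E - S^-1) by ring.
  apply: le_trans (ler_normD _ _) _; rewrite (gtr0_norm S0); have := le_trans hE SX; slra.
have XJ1 : 0 < X ^+ J.+1 by rewrite exprn_gt0.
have XJ : 0 < X ^+ J by rewrite exprn_gt0.
have -> : W - a / S * X ^+ J.+2 = (W - a * E * X ^+ J.+2 - E * (b - J.+2%:R * a * L) * X ^+ J.+1)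
   + (a * ((E - S^-1) * X) * X ^+ J.+1 + E * (b - J.+2%:R * a * L) * X ^+ J.+1) by rewrite !exprS; ring.
apply: le_trans (ler_normD _ _) _.
have t1 : D' * (1 + X) ^+ J <= B / S * X ^+ J.+1.
  apply: (@le_trans _ _ (D' * (2 * X) ^+ J)).
    by rewrite ler_wpM2l // lerXn2r ?nnegrE //; slra.
  rewrite exprMn mulrA exprS mulrA ler_wpM2r ?(ltW XJ) //.
  move: X2; rewrite ler_pdivrMr // => X2; rewrite [leRHS]mulrAC ler_pdivlMr //; slra.
have t2 : `|a * ((E - S^-1) * X) * X ^+ J.+1| <= a * S^-1 * X ^+ J.+1.
  rewrite normrM (gtr0_norm XJ1) ler_wpM2r ?(ltW XJ1) // normrM (gtr0_norm a0) ler_wpM2l ?(ltW a0) //.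
  by rewrite normrM (gtr0_norm X0) -ler_pdivlMr.
have t3 : `|E * (b - J.+2%:R * a * L) * X ^+ J.+1| <= 2 * S^-1 * (`|b| + J.+2%:R * a * (2 * B)) * X ^+ J.+1.
  rewrite normrM (gtr0_norm XJ1) ler_wpM2r ?(ltW XJ1) // normrM ler_pM //.
  apply: le_trans (ler_normB _ _) _; rewrite lerD2l !normrM normr_nat (gtr0_norm a0) ler_wpM2l //.
  by rewrite mulr_ge0 // ltW.
have t4 : `|a * ((E - S^-1) * X) * X ^+ J.+1 + E * (b - J.+2%:R * a * L) * X ^+ J.+1| <=
   a * S^-1 * X ^+ J.+1 + 2 * S^-1 * (`|b| + J.+2%:R * a * (2 * B)) * X ^+ J.+1.
  by apply: le_trans (ler_normD _ _) _; exact: lerD.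
apply: le_trans (lerD (le_trans hW t1) t4) _.
have q : (a + 2 * `|b|) * 1 <= (a + 2 * `|b|) * (2 / ln 2 * B).
  rewrite ler_wpM2l //; first by rewrite addr_ge0 ?mulr_ge0 // ltW.
  by move: bt; rewrite ler_pdivrMr // mulrAC ler_pdivlMr // mul1r mulrC.
have := ler_wpM2r (ltW (mulr_gt0 S0 XJ1)) q; slra.
Qed.

(** [setsum_asy2] only handles powers of exponent at least 2, so the sharp cut-off is dominated by a
    smooth one: if X - log a is positive, then 2X - log a exceeds X. Thus X^2 times the sum is at
    most the sum with [pw 2] at 2X. *)
Lemma GamP_sum k c : 0 <= c -> (2 <= k)%N -> {C : R | 0 < C & forall H, size H = k -> uniq H -> admissible H ->
  exists X0, forall n X, X0 <= X -> (0 < n)%N -> X <= ln n%:R ->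
   setsum n (GamP c H) (pw 0) X <= C / sing R H * X ^+ k.-1}.
Proof.
move=> c0 k2; have k0 : (0 < k)%N by exact: leq_trans k2.
have [b bP] := cid (setsum_asy2 R k.-1 0).
rewrite addn0 in bP; set a : R := _ / _ in bP *; set J := k.-1 in bP *.
have a0 : 0 < a by rewrite divr_gt0 // ltr0n fact_gt0.
clearbody a.
have [C1 C10 C1P] := @GamP_eulerprod R c k c0; rewrite -/J in C1P.
pose C2 : R := 2 * C1 * (a + 1) * 2 ^+ J.+2 + 1.
have C20 : 0 < C2 by rewrite /C2 addr_gt0 // mulr_gt0 ?exprn_gt0 // mulr_gt0 ?addr_gt0 // mulr_gt0.
exists C2 => // H sH uH ad.
have s0 : (0 < size H)%N by rewrite sH.
have [D D0 DP] := GamP_dev c0 uH ad s0; rewrite sH -/J in DP.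
have g0 p : prime p -> 0 <= GamP c H p.
  move=> pp; have /andP[h _] := GamP_bounds c0 ad s0 pp; apply: le_trans h; exact: Gs_ge0.
have [D' D'0 D'P] := bP _ _ D0 g0 DP.
have [D1 D10 [_ _ LL]] := eulerprod_bound D0 g0 DP.
have [cs cs0 csP] := @sing_gt R k.
have sp : 0 < sing R H by apply: lt_le_trans (csP H sH uH ad k0).
set S := sing R H in sp *.
pose B := `|b| + J.+2%:R * a * (4 * (2 ^+ J * D1)).
have S0 : 0 < S^-1 by rewrite invr_gt0.
exists (Num.max 1 (Num.max B (D' * 4 ^+ J * S))) => n X; rewrite !ge_max => /andP[X1 /andP[X2 X3]] n0 Xn.
have X0 : 0 < X by slra.
have [m [nm m0 Xm]] := large_n (2 * X) n.
have X20 : 0 < 2 * X by slra.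
have [n' nn'] := @eulerprod_near H S^-1 m uH ad s0 S0.
rewrite sH -/S -/J => hE.
have := D'P m n' (2 * X) m0 nn' Xm X20.
have EC := C1P H sH ad k0 n'.
set E := eulerprod _ _ _ in EC *; set L := logderiv _ _ _; set W := setsum _ _ _ _ => hW.
have E0 : 0 <= E.
  rewrite prodr_ge0 // => p pp; have /andP[q0 q1] := @prime_inv R p pp; have := g0 p pp => h.
  by rewrite mulr_ge0 ?exprn_ge0 //; slra.
have E2 : E <= 2 * C1 * S^-1.
  apply: le_trans EC _; move: hE; rewrite ler_norml => /andP[_ h].
  have hh : eulerprod J (Gs R H) n' <= 2 * S^-1 by slra.
  have := ler_wpM2l (ltW C10) hh; slra.
have low : setsum n (GamP c H) (pw 0) X * X ^+ 2 <= W.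
  rewrite setsumE -(Lop1X_stable _ (@supp0_pw R 0) n0 nm Xn) -setsumE /W /setsum mulr_suml.
  apply: ler_sum => A _; rewrite -mulrA ler_wpM2l ?gprod_ge0 //.
  rewrite /pw expr0; case: ltP => h; last by rewrite mul0r; case: ifP => // _; rewrite sqr_ge0.
  rewrite mul1r ifT; last by slra.
  by rewrite lerXn2r ?nnegrE; slra.
rewrite -(ler_pM2r (exprn_gt0 2 X0)); apply: le_trans low _.
have hL : `|b - J.+2%:R * a * L| <= B.
  apply: le_trans (ler_normB _ _) _; rewrite lerD2l !normrM normr_nat (gtr0_norm a0) ler_wpM2l ?LL //.
  by rewrite mulr_ge0 // ltW.
have t1 : D' * (1 + 2 * X) ^+ J <= S^-1 * X ^+ J.+2.
  apply: (@le_trans _ _ (D' * (4 * X) ^+ J)).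
    by rewrite ler_wpM2l // lerXn2r ?nnegrE //; slra.
  have -> : X ^+ J.+2 = X ^+ 2 * X ^+ J by rewrite -exprD.
  have hh : D' * 4 ^+ J <= S^-1 * X ^+ 2.
    rewrite ler_pdivlMl // mulrC; apply: le_trans X3 _.
    by rewrite expr2 ler_peMl // ltW.
  rewrite exprMn; have := ler_wpM2r (exprn_ge0 J (ltW X0)) hh; slra.
have XJ2 : 0 <= (2 * X) ^+ J.+1 by rewrite exprn_ge0 // ltW.
have t2 : E * (b - J.+2%:R * a * L) * (2 * X) ^+ J.+1 <= E * (2 * X) ^+ J.+2.
  rewrite (exprS (2 * X) J.+1) mulrA ler_wpM2r // ler_wpM2l //.
  apply: le_trans (ler_norm _) _; apply: le_trans hL _; slra.
have t3 : E * ((a + 1) * (2 * X) ^+ J.+2) <= 2 * C1 * S^-1 * ((a + 1) * (2 * X) ^+ J.+2).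
  rewrite ler_wpM2r // mulr_ge0 ?exprn_ge0 ?(ltW X20) //; slra.
have -> : C2 / S * X ^+ J * X ^+ 2 = 2 * C1 * S^-1 * ((a + 1) * (2 * X) ^+ J.+2) + S^-1 * X ^+ J.+2.
  by rewrite /C2 exprMn !exprS expr0; ring.
move: hW; rewrite ler_norml => /andP[_ h]; slra.
Qed.

Lemma setsum_upper kap g D : 0 <= D -> (forall p, prime p -> 0 <= g p) ->
  (forall p, prime p -> `|g p - kap%:R / p%:R| * (1 + ln p%:R) ^+ 2 <= D * q32 R p) ->
  exists2 C, 0 < C & forall n X, (0 < n)%N -> X <= ln n%:R -> 0 < X ->
   setsum n g (pw 0) X <= C * (1 + X) ^+ kap.+2.
Proof.
move=> D0 g0 DP; have [b bP] := setsum_asy2 R kap 0.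
rewrite addn0 in bP; set a : R := _ / _ in bP *.
have a0 : 0 < a by rewrite divr_gt0 // ltr0n fact_gt0.
clearbody a.
have [D' D'0 D'P] := bP _ _ D0 g0 DP.
have [D1 D10 [_ PP LL]] := eulerprod_bound D0 g0 DP.
pose B := `|b| + kap.+2%:R * a * (4 * (2 ^+ kap * D1)).
have B0 : 0 <= B by rewrite addr_ge0 // mulr_ge0 ?mulr_ge0 ?exprn_ge0 // ltW.
pose E0 := expR (4 * D1).
have E00 : 0 < E0 by rewrite expR_gt0.
exists ((a * E0 + E0 * B + D') * 2 ^+ kap.+2).
  by rewrite mulr_gt0 ?exprn_gt0 // ltr_pwDl // ltr_pwDl ?mulr_gt0 // mulr_ge0 // ltW.
move=> n X n0 Xn X0; have X10 : 0 < X + 1 by slra.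
have [m [nm m0 Xm]] := large_n (X + 1) n.
have := D'P m m (X + 1) m0 (leqnn m) Xm X10.
have /andP[Ep El] := PP m; rewrite -/E0 in El.
set E := eulerprod _ _ _ in Ep El *; set L := logderiv _ _ _; set W := setsum _ _ _ _ => hW.
have low : setsum n g (pw 0) X <= W.
  rewrite setsumE -(Lop1X_stable _ (@supp0_pw R 0) n0 nm Xn) -setsumE /W /setsum.
  apply: ler_sum => A _; rewrite ler_wpM2l ?gprod_ge0 //.
  rewrite {1}/pw expr0; case: ltP => h; last exact: pw_ge0.
  rewrite /pw ifT; last by slra.
  by rewrite exprn_ege1 //; slra.
apply: le_trans low _.
have hL : `|b - kap.+2%:R * a * L| <= B.
  apply: le_trans (ler_normB _ _) _; rewrite lerD2l !normrM normr_nat (gtr0_norm a0) ler_wpM2l ?LL //.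
  by rewrite mulr_ge0 // ltW.
pose Y := (2 + X) ^+ kap.+2.
have Y0 : 0 <= Y by rewrite exprn_ge0; slra.
have y1 : (X + 1) ^+ kap.+2 <= Y by rewrite lerXn2r ?nnegrE; slra.
have y2 : (X + 1) ^+ kap.+1 <= Y.
  apply: le_trans y1; rewrite [leRHS]exprS ler_peMl ?exprn_ge0; slra.
have y3 : (1 + (X + 1)) ^+ kap <= Y.
  have -> : 1 + (X + 1) = 2 + X by ring.
  rewrite /Y !exprS mulrA ler_peMl ?exprn_ge0 //; nra.
have y4 : Y <= 2 ^+ kap.+2 * (1 + X) ^+ kap.+2.
  by rewrite -exprMn lerXn2r ?nnegrE; slra.
have Z1 : a * E * (X + 1) ^+ kap.+2 <= a * E0 * Y.
  by apply: ler_pM; rewrite ?exprn_ge0 ?mulr_ge0 ?(ltW a0) ?(ltW Ep) ?(ltW X10) // ler_wpM2l // ltW.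
have Z2 : E * (b - kap.+2%:R * a * L) * (X + 1) ^+ kap.+1 <= E0 * B * Y.
  apply: le_trans (ler_norm _) _; rewrite normrM [X in _ * X]ger0_norm ?exprn_ge0 ?(ltW X10) //.
  by apply: ler_pM => //; rewrite ?exprn_ge0 ?(ltW X10) // normrM (gtr0_norm Ep) ler_pM // ltW.
have Z3 := ler_wpM2l D'0 y3.
have Z4 : (a * E0 + E0 * B + D') * Y <= (a * E0 + E0 * B + D') * (2 ^+ kap.+2 * (1 + X) ^+ kap.+2).
  by rewrite ler_wpM2l // !addr_ge0 ?mulr_ge0 // ltW.
move: hW; rewrite ler_norml => /andP[_ h]; slra.
Qed.

End WeightedSums.

Lemma sum_count (P : pred nat) m : count P (iota 0 m) = (\sum_(i < m) P i)%N.
Proof.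
rewrite -sum1_count big_mkcond (_ : iota 0 m = index_iota 0 m) ?big_mkord; last by rewrite /index_iota subn0.
by apply: eq_bigr => i _; case: (P i).
Qed.

Lemma count_crt2 (P Q : pred nat) m n : coprime m n -> (0 < m)%N -> (0 < n)%N ->
  count (fun a => P (a %% m)%N && Q (a %% n)%N) (iota 0 (m * n)) =
  (count P (iota 0 m) * count Q (iota 0 n))%N.
Proof.
move=> co m0 n0; rewrite !sum_count big_distrlr /= pair_big /=.
pose h (a : 'I_(m * n)) : 'I_m * 'I_n := (Ordinal (ltn_pmod a m0), Ordinal (ltn_pmod a n0)).
have hi : injective h.
  move=> a b [e1 e2]; apply/val_inj => /=.
  have : (a == b %[mod m * n])%N by rewrite chinese_remainder // e1 e2 !eqxx.
  by rewrite !modn_small // => /eqP.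
have hb : bijective h by apply: inj_card_bij => //; rewrite card_prod !card_ord.
rewrite (reindex h) /=; last by apply: onW_bij.
by apply: eq_bigr => a _; case: (P _); case: (Q _).
Qed.

(** * Squarefree integers as sets of primes *)

Section PrimeSets.
Variable N : nat.
Implicit Types (A B D T : {set 'I_N}).

Definition prm D : nat := (\prod_(i in D) (i : nat))%N.
Definition allp D := [forall i in D, prime (i : 'I_N)].

Lemma allpP D : reflect (forall i, i \in D -> prime i) (allp D).
Proof. exact: 'forall_implyP. Qed.

Lemma allp0 : allp finset.set0.
Proof. by apply/allpP => i; rewrite inE. Qed.

Lemma allpU A B : allp (A :|: B) = allp A && allp B.
Proof.
apply/allpP/andP => [h|[/allpP hA /allpP hB] i].
  by split; apply/allpP => i iA; apply: h; rewrite inE iA ?orbT.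
by rewrite inE => /orP[/hA|/hB].
Qed.

Lemma allpU1 x D : allp (x |: D) = prime x && allp D.
Proof.
rewrite allpU; congr (_ && _); apply/allpP/idP => [h|px i]; first by apply: h; rewrite inE.
by rewrite inE => /eqP ->.
Qed.

Lemma allpD A B : allp A -> allp (A :\: B).
Proof. by move=> /allpP h; apply/allpP => i; rewrite inE => /andP[_ /h]. Qed.

Lemma prm0 : prm finset.set0 = 1%N.
Proof. by rewrite /prm big_set0. Qed.

Lemma prmU1 x D : x \notin D -> prm (x |: D) = (x * prm D)%N.
Proof. by move=> xD; rewrite /prm big_setU1. Qed.

Lemma prm_gt0 D : allp D -> (0 < prm D)%N.
Proof.
by move=> /allpP h; rewrite /prm; apply: (big_ind (fun x => 0 < x)%N) => [//|a b|i /h /prime_gt0 //];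
  rewrite muln_gt0 => -> ->.
Qed.

Lemma dvd_prm q D : prime q -> allp D -> (q %| prm D)%N = [exists i in D, val i == q].
Proof.
move=> pq /allpP h; apply/idP/exists_inP => [|[i iD /eqP <-]]; last first.
  by rewrite /prm (bigD1 i) //= dvdn_mulr.
rewrite /prm; elim/big_rec: _ => [|i x iD IH]; first by rewrite dvdn1; case: (q) pq => [|[]].
rewrite Euclid_dvdM // dvdn_prime2 // ?h // => /orP[/eqP e|/IH //].
by exists i => //; rewrite e.
Qed.

Lemma primes_prm D : allp D -> perm_eq (primes (prm D)) [seq val i | i <- enum D].
Proof.
move=> aD; apply: uniq_perm; first exact: primes_uniq.
  by rewrite map_inj_uniq ?enum_uniq //; exact: val_inj.
move=> q; rewrite mem_primes prm_gt0 //=; apply/andP/mapP => [[pq]|[i]].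
  by rewrite dvd_prm // => /exists_inP[i iD /eqP <-]; exists i; rewrite ?mem_enum.
rewrite mem_enum => iD ->; have pi := allpP D aD i iD; split=> //.
by rewrite dvd_prm //; apply/exists_inP; exists i.
Qed.

Lemma big_primes_prm (V : Type) (idx : V) (op : Monoid.com_law idx) (f : nat -> V) D : allp D ->
  \big[op/idx]_(p <- primes (prm D)) f p = \big[op/idx]_(i in D) f i.
Proof. by move=> aD; rewrite (perm_big _ (primes_prm aD)) big_map big_enum. Qed.

Lemma coprime_prm A B : allp A -> allp B -> coprime (prm A) (prm B) = [disjoint A & B].
Proof.
move=> aA aB; rewrite coprime_has_primes ?prm_gt0 //.
apply/hasPn/idP => [h|dAB p].
  rewrite -setI_eq0; apply/eqP/setP => i; rewrite !inE; apply/negbTE/negP => /andP[iA iB].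
  have := h i; rewrite (perm_mem (primes_prm aA)) (perm_mem (primes_prm aB)).
  by rewrite !map_f ?mem_enum // => /(_ isT).
rewrite (perm_mem (primes_prm aA)) (perm_mem (primes_prm aB)) => /mapP[i]; rewrite mem_enum => iB ->.
apply/negP => /mapP[j]; rewrite mem_enum => jA /val_inj ij; subst j.
by move/disjoint_setI0/setP/(_ i): dAB; rewrite !inE jA iB.
Qed.

Lemma coprime_prmU1 x D : x \notin D -> prime x -> allp D -> coprime x (prm D).
Proof.
move=> xD px aD; rewrite prime_coprime // dvd_prm //; apply/exists_inP => -[i iD /eqP /val_inj e].
by rewrite -e iD in xD.
Qed.

Lemma sqfree_prm D : allp D -> sqfree (prm D).
Proof.
move=> aD; rewrite /sqfree prm_gt0 //=; apply/allP => q.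
rewrite (perm_mem (primes_prm aD)) => /mapP[i]; rewrite mem_enum => iD ->.
have pi := allpP D aD i iD; apply/negP; rewrite -(setD1K iD) prmU1 ?inE ?eqxx //.
rewrite expnS expn1 dvdn_pmul2l ?prime_gt0 // dvd_prm ?allpD // => /exists_inP[j].
by rewrite !inE => /andP[ji _] /eqP /val_inj e; rewrite e eqxx in ji.
Qed.

Lemma totient_prm D : allp D -> totient (prm D) = (\prod_(i in D) (i : nat).-1)%N.
Proof.
elim/set_ind: D => [|x D xD IH]; first by rewrite prm0 big_set0.
rewrite allpU1 => /andP[px aD]; rewrite prmU1 // totient_coprime ?coprime_prmU1 //.
by rewrite IH // big_setU1 //= totient_prime.
Qed.

Lemma count_crt (Q : nat -> pred nat) D : allp D ->
  count (fun a => [forall i in D, Q i (a %% i)%N]) (iota 0 (prm D)) =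
  (\prod_(i in D) count (Q i) (iota 0 i))%N.
Proof.
elim/set_ind: D => [|x D xD IH].
  rewrite prm0 big_set0 /= => _; case: forall_inP => // h; exfalso; apply: h => i.
  by rewrite inE.
rewrite allpU1 => /andP[px aD]; have co := coprime_prmU1 xD px aD.
rewrite prmU1 // big_setU1 //= -(IH aD).
rewrite -(count_crt2 (Q x) (fun a => [forall i in D, Q i (a %% i)%N]) co (prime_gt0 px) (prm_gt0 aD)).
apply: eq_count => a.
apply/forall_inP/andP => [h|[h /forall_inP h'] i].
  split; first by apply: h; rewrite setU11.
  apply/forall_inP => i iD; rewrite modn_dvdm; last by rewrite /prm (bigD1 i) //= dvdn_mulr.
  by apply: h; rewrite inE iD orbT.
rewrite !inE => /orP[/eqP -> //|iD].
by have := h' i iD; rewrite modn_dvdm // /prm (bigD1 i) //= dvdn_mulr.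
Qed.

Lemma dvd_prm_all D m : allp D -> (prm D %| m)%N = [forall i in D, (i : nat) %| m]%N.
Proof.
elim/set_ind: D => [|x D xD IH].
  by rewrite prm0 dvd1n => _; apply/esym/forall_inP => i; rewrite inE.
rewrite allpU1 => /andP[px aD]; rewrite prmU1 // Gauss_dvd ?coprime_prmU1 // IH //.
apply/andP/forall_inP => [[h /forall_inP h'] i|h].
  by rewrite !inE => /orP[/eqP -> //|/h'].
by split; [apply: h; rewrite setU11|apply/forall_inP => i iD; apply: h; rewrite inE iD orbT].
Qed.

Definition pset (d : nat) : {set 'I_N} := [set i : 'I_N | prime i && (i %| d)%N].

Lemma allp_pset d : allp (pset d).
Proof. by apply/allpP => i; rewrite inE => /andP[]. Qed.

Lemma psetK D : allp D -> pset (prm D) = D.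
Proof.
move=> aD; apply/setP => i; rewrite inE; apply/andP/idP => [[pi]|iD].
  by rewrite dvd_prm // => /exists_inP[j jD /eqP /val_inj <-].
have pi := allpP D aD i iD; split=> //.
by rewrite dvd_prm //; apply/exists_inP; exists i.
Qed.

Lemma prod_primes_sqfree d : sqfree d -> (\prod_(p <- primes d) p)%N = d.
Proof.
move=> /andP[d0 /allP sq]; rewrite [RHS](prod_prime_decomp d0) prime_decompE big_map /=.
apply: eq_big_seq => p pd; suff -> : logn p d = 1%N by rewrite expn1.
have pp : prime p by move: pd; rewrite mem_primes => /andP[].
apply/eqP; rewrite eqn_leq logn_gt0 pd andbT leqNgt; apply: contra (sq p pd).
by rewrite pfactor_dvdn.
Qed.

Lemma prm_pset d : (d < N)%N -> sqfree d -> prm (pset d) = d.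
Proof.
move=> dN sd; have d0 : (0 < d)%N by case/andP: sd.
rewrite -[RHS](prod_primes_sqfree sd).
transitivity (\prod_(p <- primes (prm (pset d))) p)%N.
  by rewrite (big_primes_prm _ (fun p => p) (allp_pset d)).
apply: perm_big; apply: uniq_perm; rewrite ?primes_uniq // => q.
rewrite !mem_primes d0 prm_gt0 ?allp_pset //=; case: (boolP (prime q)) => //= pq.
rewrite dvd_prm ?allp_pset //; apply/exists_inP/idP => [[i]|qd].
  by rewrite inE => /andP[_ h] /eqP <-.
have qN : (q < N)%N by apply: leq_ltn_trans dN; exact: dvdn_leq.
by exists (Ordinal qN); rewrite ?inE /= ?pq.
Qed.

(** [prm] and [pset] are mutually inverse here. The bound on [prm D] has to be kept, since a set of
    primes below N may have a product beyond N. *)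
Lemma sum_sqfree (V : nmodType) (f : nat -> V) :
  \sum_(0 <= d < N | sqfree d) f d = \sum_(D : {set 'I_N} | allp D && (prm D < N)%N) f (prm D).
Proof.
have [N0|N0] := posnP N.
  rewrite big_geq ?N0 // big1 // => D /andP[_]; by rewrite [X in (_ < X)%N]N0 ltn0.
rewrite big_mkord.
pose o (D : {set 'I_N}) : 'I_N := if insub (prm D) is Some i then i else Ordinal N0.
have oE D : (prm D < N)%N -> o D = prm D :> nat by move=> h; rewrite /o insubT.
rewrite (reindex_onto o (fun d : 'I_N => pset d)) /=; last first.
  by move=> d sd; apply: val_inj; rewrite /= oE prm_pset.
apply: eq_big => [D|D /andP[h /eqP e]]; last first.
  by rewrite -[in RHS]e prm_pset // oE // -e prm_pset.
apply/andP/andP => [[sd /eqP e]|[aD DN]].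
  by rewrite -e prm_pset // allp_pset.
by rewrite oE // sqfree_prm // psetK.
Qed.

End PrimeSets.

(** * The sieve weights as sums over supersets *)

Section Lambda.
Variable R : realType.
Implicit Types (X C RR : R) (d n p k l : nat) (H : seq int).

Definition gw H p : R := (nu H p)%:R / (p%:R - (nu H p)%:R).
Definition fw H p : R := p%:R / (nu H p)%:R.

Lemma ln_prm n (D : {set 'I_n}) : allp D -> ln ((prm D)%:R : R) = Lg R D.
Proof.
elim/set_ind: D => [|x D xD IH]; first by rewrite prm0 ln1 /Lg big_set0.
rewrite allpU1 => /andP[px aD]; rewrite prmU1 // /Lg big_setU1 //= -/(Lg R D) -IH //.
by rewrite natrM lnM // posrE ltr0n ?prm_gt0 // prime_gt0.
Qed.

Lemma nu_prm H n (D : {set 'I_n}) : allp D -> nu H (prm D) = (\prod_(i in D) nu H i)%N.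
Proof.
move=> aD; have hD := allpP D aD.
transitivity (\prod_(i in D) count (fun a => (i%:Z %| Ppoly H a%:Z)%Z) (iota 0 i))%N; last by [].
rewrite -(count_crt (fun i a => (i%:Z %| Ppoly H a%:Z)%Z)) // /nu; apply: eq_count => a.
rewrite dvdzE /= dvd_prm_all //; apply: eq_forallb_in => i iD.
have pi := hD i iD.
rewrite -[LHS]/(i%:Z %| Ppoly H a%:Z)%Z !dvd_Ppoly //.
apply: eq_has => h; rewrite {1}(divn_eq a i) PoszD PoszM -addrA.
by rewrite rpredDl // dvdz_mull.
Qed.

Lemma moebius_prm n (D : {set 'I_n}) : allp D -> moebius R (prm D) = (-1) ^+ #|D|.
Proof.
move=> aD; rewrite /moebius sqfree_prm //; congr (_ ^+ _).
by rewrite (perm_size (primes_prm aD)) size_map -cardE.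
Qed.

Lemma f1_prm H n (D : {set 'I_n}) : allp D -> (f1 R H (prm D))^-1 = gprod (gw H) D.
Proof.
move=> aD; rewrite /f1 (big_primes_prm _ (fun p => (p%:R - (nu H p)%:R) / (nu H p)%:R)) //.
rewrite -prodfV; apply: eq_bigr => i iD.
by rewrite invf_div /onprimes (allpP D aD i iD).
Qed.

Lemma fF_prm H n (D : {set 'I_n}) : allp D -> fF R H (prm D) = \prod_(i in D) fw H i.
Proof.
move=> aD; rewrite /fF nu_prm // /prm !natr_prod -prodf_div.
by apply: eq_bigr.
Qed.

Lemma gprod_nallp g n (D : {set 'I_n}) : ~~ allp D -> gprod g D = 0 :> R.
Proof.
move=> nD; have /existsP[i] := nD; rewrite negb_imply => /andP[iD pi].
by rewrite /gprod (bigD1 i) //= /onprimes (negbTE pi) mul0r.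
Qed.

Lemma Lg_ge0 n (D : {set 'I_n}) : allp D -> 0 <= Lg R D.
Proof. by move=> /allpP h; apply: sumr_ge0 => i /h; exact: ln_prime_ge0. Qed.

Lemma LgU n (A B : {set 'I_n}) : [disjoint A & B] -> Lg R (A :|: B) = Lg R A + Lg R B.
Proof.
move=> dAB; rewrite /Lg -bigU //=; apply: eq_bigl => i; by rewrite !inE.
Qed.

Definition wfun RR H l n (T : {set 'I_n}) : R := sing R H / l`!%:R * pw l (ln RR - Lg R T).
Definition lam RR H l n (D : {set 'I_n}) : R :=
  lamset (fun i : 'I_n => fw H i) (fun i : 'I_n => onprimes (gw H) i) (@wfun RR H l n) D.

Lemma lam_nallp RR H l n (D : {set 'I_n}) : ~~ allp D -> lam RR H l D = 0.
Proof.
move=> nD; rewrite /lam /lamset [X in _ * X]big1 ?mulr0 // => T DT.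
rewrite -/(gprod (gw H) T) gprod_nallp ?mul0r //.
by apply: contra nD => /allpP h; apply/allpP => i /(subsetP DT)/h.
Qed.

Lemma lam_large RR H l n (D : {set 'I_n}) : allp D -> ln RR <= Lg R D -> lam RR H l D = 0.
Proof.
move=> aD hD; rewrite /lam lamsetE /ysum [X in _ * X]big1 ?mulr0 // => B dDB.
have [aB|nB] := boolP (allp B); last by rewrite -/(gprod (gw H) B) gprod_nallp ?mul0r.
rewrite /wfun LgU // (supp0_pw l) ?mulr0 //.
by have := Lg_ge0 aB; slra.
Qed.

(** [lamsetE] turns supersets of D into sets B disjoint from D, which are the r coprime to d. Sets B
    that represent no r in the range of summation get weight 0 from the truncated power or from a
    non-prime element. *)
Lemma lambdaE RR H l (D : {set 'I_(Num.truncn RR).+1}) : 0 < RR -> allp D ->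
  lambda RR H l (prm D) = lam RR H l D.
Proof.
move=> R0 aD; have d0 := prm_gt0 aD; have dp : 0 < (prm D)%:R :> R by rewrite ltr0n.
rewrite /lambda; case: ltP => dR; last first.
  rewrite lam_large // -ln_prm // ler_ln ?posrE //.
rewrite /lam lamsetE moebius_prm // f1_prm // fF_prm //.
have -> : \prod_(i in D) - (fw H i * onprimes (gw H) i) =
   (-1) ^+ #|D| * ((\prod_(i in D) fw H i) * gprod (gw H) D).
  by rewrite prodrN /gprod -big_split.
rewrite -!mulrA; congr (_ * _); congr (_ * _); congr (_ * _).
rewrite mulrA mulr_sumr /ysum.
set n := (Num.truncn RR).+1 in D aD d0 dp dR *.
transitivity (\sum_(0 <= r < n | sqfree r) if (r%:R < RR / (prm D)%:R) && coprime r (prm D)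
   then sing R H / l`!%:R * ((f1 R H r)^-1 * ln (RR / (r * prm D)%:R) ^+ l) else 0).
  rewrite [RHS]big_mkcond [RHS]big_ltn // (_ : sqfree 0 = false) // [RHS]/= add0r [LHS]big_mkcond; apply: eq_bigr => r _.
  rewrite /moebius; case: (sqfree r); case: ifP => // _; first by rewrite sqrr_sign mul1r.
  by rewrite expr0n !mul0r mulr0.
rewrite sum_sqfree [RHS](bigID (fun B : {set 'I_n} => allp B && (prm B < n)%N)) /=.
rewrite [X in _ = _ + X]big1 ?addr0 => [|B /andP[dDB]]; last first.
  rewrite negb_and => /orP[nB|nB]; first by rewrite -/(gprod (gw H) B) gprod_nallp ?mul0r.
  have [aB|nB'] := boolP (allp B); last by rewrite -/(gprod (gw H) B) gprod_nallp ?mul0r.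
  rewrite /wfun LgU // (supp0_pw l) ?mulr0 //; rewrite -leqNgt in nB.
  have : ln RR <= Lg R B.
    rewrite -ln_prm // ler_ln ?posrE ?ltr0n ?prm_gt0 //.
    by apply: le_trans (ltW (truncnS_gt RR)) _; rewrite ler_nat.
  by have := Lg_ge0 aD; slra.
rewrite big_mkcond [RHS]big_mkcond; apply: eq_bigr => B _.
case: (boolP (allp B && (prm B < n)%N)) => [/andP[aB _]|]; last by rewrite andbF.
rewrite andbT coprime_sym coprime_prm //; have [dDB|] := boolP [disjoint D & B]; last by rewrite andbF.
rewrite andbT f1_prm // /wfun LgU // /pw -!ln_prm //.
have b0 := prm_gt0 aB; have bp : 0 < (prm B)%:R :> R by rewrite ltr0n.
have e : ln (RR / (prm B * prm D)%:R) = ln RR - (ln (prm D)%:R + ln (prm B)%:R).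
  by rewrite natrM ln_div ?posrE ?mulr_gt0 // lnM ?posrE //; ring.
have -> : ((prm B)%:R < RR / (prm D)%:R) = (0 < ln RR - (ln (prm D)%:R + ln (prm B)%:R)).
  rewrite ltr_pdivlMr // -lnM ?posrE // subr_gt0 ltr_ln ?posrE ?mulr_gt0 //.
  by rewrite [(prm D)%:R * _]mulrC.
case: ifP => _; last by rewrite !mulr0.
by rewrite e /gprod mulrCA.
Qed.

(** The nonvanishing matters because [divisors 0] is the singleton of 1, whereas every integer
    divides 0. *)
Lemma Lam_sum RR H l (m : int) : 0 < RR -> Ppoly H m != 0 ->
  Lam RR H l m = \sum_(D : {set 'I_(Num.truncn RR).+1})
     (if allp D && (prm D %| `|Ppoly H m|)%N then lam RR H l D else 0).
Proof.
move=> R0 Pm; set n := (Num.truncn RR).+1; set P := `|Ppoly H m|%N.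
have P0 : (0 < P)%N by rewrite absz_gt0.
transitivity (\sum_(0 <= d < n | sqfree d) if (d %| P)%N then lambda RR H l d else 0).
  rewrite /Lam (bigID (fun d => d < n)%N) /= [X in _ + X]big1 ?addr0; last first.
    move=> d; rewrite -leqNgt => nd; rewrite /lambda ifF //; apply/negbTE; rewrite -leNgt.
    by apply: le_trans (ltW (truncnS_gt RR)) _; rewrite ler_nat.
  transitivity (\sum_(0 <= d < n | (d %| P)%N) lambda RR H l d).
    rewrite -big_filter -[RHS]big_filter; apply: perm_big; apply: uniq_perm.
    - by rewrite filter_uniq // divisors_uniq.
    - by rewrite filter_uniq // iota_uniq.
    by move=> d; rewrite !mem_filter mem_index_iota -dvdn_divisors //= andbC.
  rewrite big_mkcond [RHS]big_mkcond; apply: eq_bigr => d _.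
  case: (boolP (sqfree d)) => // nd; rewrite /lambda /moebius (negbTE nd).
  by case: ifP => // _; case: ifP => // _; rewrite !mul0r.
rewrite sum_sqfree big_mkcond; apply: eq_bigr => D _.
have [aD|//] := boolP (allp D); rewrite /= lambdaE //.
case: ifP => // /negbT; rewrite -leqNgt => nD; rewrite lam_large ?if_same //.
rewrite -ln_prm // ler_ln ?posrE ?ltr0n ?prm_gt0 //.
by apply: le_trans (ltW (truncnS_gt RR)) _; rewrite ler_nat.
Qed.

Lemma Lam_le RR H l (m : int) : 0 < RR ->
  `|Lam RR H l m| <= \sum_(D : {set 'I_(Num.truncn RR).+1}) `|lam RR H l D|.
Proof.
move=> R0; have [P0|P0] := eqVneq (Ppoly H m) 0.
  rewrite /Lam P0 absz0 (_ : divisors 0 = [:: 1%N]) // big_seq1 -(prm0 (Num.truncn RR).+1).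
  by rewrite lambdaE ?allp0 // (bigD1 set0) //= lerDl sumr_ge0.
rewrite Lam_sum //; apply: le_trans (ler_norm_sum _ _ _) _.
by apply: ler_sum => D _; case: ifP => // _; rewrite normr0.
Qed.

End Lambda.

(** * Products of two primes in residue classes *)

Section PrimePairs.
Variable R : realType.
Implicit Types (x N : R) (d n m p q k l a : nat) (H : seq int).

Lemma vpi_ge0 n : 0 <= vpi R n.
Proof. by rewrite /vpi; case: ifP => // pn; exact: ln_prime_ge0. Qed.

Lemma vpi_le n m : (0 < m)%N -> (n <= m)%N -> vpi R n <= ln m%:R.
Proof.
move=> m0 nm; rewrite /vpi; case: ifP => pn; last by rewrite ln_ge0 // ler1n.
by rewrite ler_ln ?posrE ?ltr0n // ?ler_nat // prime_gt0.
Qed.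

Lemma vpi2E n : (0 < n)%N -> vpi2 R n = \sum_(p <- primes n) ln p%:R * vpi R (n %/ p)%N.
Proof.
move=> n0; rewrite /vpi2 (bigID prime) /= [X in _ + X]big1 ?addr0; last first.
  by move=> d pd; rewrite /vpi (negbTE pd) mul0r.
transitivity (\sum_(d <- divisors n | prime d) ln d%:R * vpi R (n %/ d)%N).
  by apply: eq_bigr => d pd; rewrite {1}/vpi pd.
rewrite -[LHS]big_filter ; apply: perm_big; apply: uniq_perm.
- by rewrite filter_uniq // divisors_uniq.
- exact: primes_uniq.
by move=> d; rewrite mem_filter -dvdn_divisors // mem_primes n0.
Qed.

Lemma vpi2_ge0 n : 0 <= vpi2 R n.
Proof. by apply: sumr_ge0 => d _; rewrite mulr_ge0 // vpi_ge0. Qed.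

Lemma vpi2_le n m : (0 < m)%N -> (n <= m)%N -> vpi2 R n <= ln m%:R ^+ 2.
Proof.
move=> m0 nm; have lm : 0 <= ln (m%:R : R) by rewrite ln_ge0 // ler1n.
have [->|n0] := posnP n.
  by rewrite /vpi2 (_ : divisors 0 = [:: 1%N]) // big_seq1 /vpi mul0r exprn_ge0.
rewrite vpi2E //; apply: (@le_trans _ _ (\sum_(p <- primes n) ln p%:R * ln m%:R)).
  rewrite big_seq [leRHS]big_seq; apply: ler_sum => p; rewrite mem_primes => /andP[pp _].
  rewrite ler_wpM2l ?ln_prime_ge0 // vpi_le //.
  exact: leq_trans (leq_div _ _) nm.
rewrite -mulr_suml expr2 ler_wpM2r //.
apply: (@le_trans _ _ (ln n%:R)); last by rewrite ler_ln ?posrE ?ltr0n // ler_nat.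
rewrite (_ : \sum_(p <- primes n) ln p%:R = \sum_(0 <= p < n.+1 | prime p && (p %| n)%N) ln p%:R).
  exact: sum_ln_primes_le.
rewrite -[RHS]big_filter; apply: perm_big; apply: uniq_perm; rewrite ?primes_uniq ?filter_uniq ?iota_uniq //.
move=> p; rewrite mem_filter mem_primes n0 mem_index_iota /=.
by case: (boolP (prime p)) => //= pp; case: (boolP (p %| n)%N) => //= pn; rewrite ltnS dvdn_leq.
Qed.

(* For [p] dividing [m], only the factorisation [m = p * (m / p)] into primes can contribute to the convolution. *)
Lemma vpi2_dvd p m : (0 < m)%N -> prime p -> (p %| m)%N -> (p * p)%N != m ->
  vpi2 R m = 2 * (ln p%:R * vpi R (m %/ p)%N).
Proof.
move=> m0 pp pm ppm; have p0 := prime_gt0 pp; rewrite vpi2E //.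
have mE : (m = p * (m %/ p))%N by rewrite mulnC divnK.
have [pm'|npm'] := boolP (prime (m %/ p)%N); last first.
  rewrite {2}/vpi (negbTE npm') !mulr0 big_seq big1 // => q; rewrite mem_primes => /and3P[pq _ qm].
  rewrite /vpi; case: ifP => pe; last by rewrite mulr0.
  have qE : (m = q * (m %/ q))%N by rewrite mulnC divnK.
  move: pm; rewrite qE Euclid_dvdM // !dvdn_prime2 // => /orP[/eqP e|/eqP e].
    by rewrite e pe in npm'.
  move: npm'; rewrite e {1}qE mulnK ?pq //; exact: prime_gt0.
have ne : p != (m %/ p)%N by apply: contra ppm => /eqP e; rewrite mE -e.
have pr : perm_eq (primes m) [:: p; (m %/ p)%N].
  apply: uniq_perm; rewrite ?primes_uniq //=; first by rewrite inE ne.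
  move=> q; rewrite mem_primes !inE m0 /=; apply/andP/orP => [[pq]|[/eqP ->|/eqP ->]].
  - by rewrite {1}mE Euclid_dvdM // !dvdn_prime2 // => /orP.
  - by [].
  - by rewrite pm' {2}mE dvdn_mull.
rewrite (perm_big _ pr) big_cons big_seq1.
have -> : (m %/ (m %/ p) = p)%N by rewrite {1}mE mulnK // prime_gt0.
rewrite /vpi pp pm' /=; ring.
Qed.

Lemma range_truncn N n : 0 <= N ->
  (N < n%:R) && (n%:R <= 2 * N) = ((Num.truncn N).+1 <= n < (Num.truncn (2 * N)).+1)%N.
Proof. by move=> N0; rewrite ltnS truncn_ge_nat ?mulr_ge0 // truncn_lt_nat. Qed.

Lemma sum_class (w : nat -> R) (I c : pred nat) K M : (0 < M)%N -> (forall m, c (m %% M)%N = c m) ->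
  \sum_(0 <= m < K | I m && c m) w m =
  \sum_(a < M | c a) \sum_(0 <= m < K | I m && (m %% M == a %% M)%N) w m.
Proof.
move=> M0 cM; rewrite (partition_big (fun m => Ordinal (ltn_pmod m M0)) (fun a : 'I_M => c a)) /=; last first.
  by move=> m /andP[_ cm]; rewrite cM.
apply: eq_bigr => a ca; apply: eq_bigl => m.
rewrite -val_eqE /= [(a %% M)%N]modn_small // -andbA; congr (_ && _).
by apply/andP/idP => [[]//|/eqP e]; split; [rewrite -cM e|apply/eqP].
Qed.

Lemma count_class a q K : (a < q)%N -> (\sum_(0 <= n < q * K | (n %% q == a)%N) 1 = K)%N.
Proof.
move=> aq; have q0 : (0 < q)%N by apply: leq_ltn_trans aq.
elim: K => [|K IH]; first by rewrite muln0 big_geq.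
rewrite mulnS addnC (@big_cat_nat _ _ _ (q * K)) ?leq_addr //= IH -[RHS]addn1; congr (_ + _)%N.
rewrite -{1}[(q * K)%N]add0n big_addn addnC addnK big_mkord.
rewrite (big_pred1 (Ordinal aq)) // => i.
by rewrite /= addnC [(q * K)%N]mulnC modnMDl -val_eqE /= modn_small.
Qed.

Lemma count_class_le a q B : (0 < q)%N -> (\sum_(0 <= n < B | (n %% q == a %% q)%N) 1 <= B %/ q + 1)%N.
Proof.
move=> q0; rewrite -[leqRHS](count_class (B %/ q + 1) (ltn_pmod a q0)).
have h : (B <= q * (B %/ q + 1))%N by rewrite addn1 mulnC ltnW // ltn_ceil.
by rewrite [leqRHS](@big_cat_nat _ _ _ B) //= leq_addr.
Qed.

Lemma sum_class_le (w : nat -> R) x W q a : 0 < (q%:R : R) <= x -> (forall n, n%:R <= 2 * x -> 0 <= w n <= W) ->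
  0 <= W ->
  forall y, 0 < y <= x -> 0 <= \sum_(0 <= n < (Num.truncn (2 * y)).+1 | (y < n%:R) && (n%:R <= 2 * y) && (n %% q == a %% q)%N) w n
    <= 4 * x / q%:R * W.
Proof.
move=> /andP[q0 qx] wW W0 y /andP[y0 yx]; have q0' : (0 < q)%N by rewrite -(ltr0n R).
have x1 : 1 <= q%:R :> R by rewrite ler1n.
have wn n : n%:R <= 2 * y -> 0 <= w n <= W by move=> h; apply: wW; slra.
apply/andP; split; first by apply: sumr_ge0 => n /andP[/andP[_ /wn /andP[]]].
apply: (@le_trans _ _ (\sum_(0 <= n < (Num.truncn (2 * y)).+1 | (n %% q == a %% q)%N) W)).
  rewrite big_mkcond [leRHS]big_mkcond; apply: ler_sum => n _.
  case: ifP => [/andP[/andP[_ /wn /andP[_ h]] ->]//|_]; by case: ifP.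
have -> : \sum_(0 <= n < (Num.truncn (2 * y)).+1 | (n %% q == a %% q)%N) W =
    (\sum_(0 <= n < (Num.truncn (2 * y)).+1 | (n %% q == a %% q)%N) 1)%N%:R * W.
  by rewrite natr_sum mulr_suml; apply: eq_bigr => n _; rewrite mul1r.
rewrite ler_wpM2r //; apply: (@le_trans _ _ ((Num.truncn (2 * y)).+1 %/ q + 1)%:R).
  by rewrite ler_nat count_class_le.
rewrite natrD; apply: (@le_trans _ _ ((2 * y + 1) / q%:R + 1)).
  rewrite lerD2r ler_pdivlMr // -natrM; apply: (@le_trans _ _ (Num.truncn (2 * y)).+1%:R).
    by rewrite ler_nat leq_divM.
  by rewrite -natr1 lerD2r truncn_le mulr_ge0 // ltW.
rewrite -[X in _ + X](@divff _ (q%:R : R)) ?lt0r_neq0 // -mulrDl ler_wpM2r ?invr_ge0 //; slra.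
Qed.

End PrimePairs.

(** * Trivial bounds for the error terms *)

Section TrivialBounds.
Variable R : realType.
Implicit Types (x y N : R) (d n m p q k l a : nat) (H : seq int).

Lemma ln2_ge : (1 / 2 : R) <= ln 2.
Proof.
have /andP[h _] := @lnS_bounds R 1 isT; rewrite ln1 subr0 in h.
by rewrite div1r.
Qed.

Lemma totient_prm_ge n (V : {set 'I_n}) : allp V ->
  0 < ((totient (prm V))%:R^-1 : R) <= 2 ^+ #|V| / (prm V)%:R.
Proof.
move=> aV; have v0 : 0 < (prm V)%:R :> R by rewrite ltr0n prm_gt0.
have t0 : 0 < (totient (prm V))%:R :> R by rewrite ltr0n totient_gt0 prm_gt0.
rewrite invr_gt0 t0 /= -[leLHS]mul1r ler_pdivrMr // mulrAC ler_pdivlMr // mul1r.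
rewrite totient_prm // -natrX -natrM ler_nat -prod_nat_const -big_split /=.
apply: leq_prod => i iV; have := prime_gt1 (allpP V aV i iV); lia.
Qed.

(** [sup] of an unbounded set is a default value, so a starred error majorises its members only once
    a trivial bound is available. *)
Lemma Estar_sup (e : R -> nat -> R) N q (Bd : R) : 0 < N -> (forall x, 0 < x <= N -> e x q <= Bd) ->
  (forall x, 0 < x <= N -> e x q <= sup [set y | exists2 x, 0 < x <= N & y = e x q]%classic) /\
  sup [set y | exists2 x, 0 < x <= N & y = e x q]%classic <= Bd.
Proof.
move=> N0 eB; split.
  move=> x xN; apply: ub_le_sup; first by exists Bd => _ [z zN ->]; exact: eB.
  by exists x.
apply: ge_sup; first by exists (e N q); exists N => //; rewrite N0 lexx.
by move=> _ [z zN ->]; exact: eB.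
Qed.

Lemma sup_star_ge0 (e : R -> nat -> R) N q : (forall x, 0 <= e x q) ->
  0 <= sup [set y | exists2 x, 0 < x <= N & y = e x q]%classic.
Proof.
move=> e0; have [h|h] := pselect (has_sup [set y | exists2 x, 0 < x <= N & y = e x q]%classic); last by rewrite sup_out.
have [[y [x xN _]] hb] := h.
by apply: le_trans (e0 x) _; apply: ub_le_sup => //; exists x.
Qed.

Lemma Eq_ge0 x q : 0 <= Eq x q.
Proof. exact: bigmax_ge_id. Qed.

Lemma E2r_ge0 x q : 0 <= E2r x q.
Proof. exact: bigmax_ge_id. Qed.

Lemma Estar_ge0 N q : 0 <= Estar N q.
Proof. apply: sup_star_ge0 => x; exact: Eq_ge0. Qed.

Lemma E2star_ge0 N q : 0 <= E2star N q.
Proof. apply: sup_star_ge0 => x; exact: E2r_ge0. Qed.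

Lemma ln2N N : 2 <= N -> 1 / 2 <= ln N /\ ln (2 * N) <= 2 * ln N.
Proof.
move=> N2; have l2 : ln 2 <= ln N by rewrite ler_ln ?posrE; slra.
have := ln2_ge; rewrite lnM ?posrE; slra.
Qed.

(** A class to a modulus q at most N has at most 4N/q members in the range, each of weight at most
    log(2N). The factor 2^omega comes from bounding q/phi(q) prime by prime. *)
Lemma Eq_bound n (V : {set 'I_n}) N x : allp V -> 2 <= N -> (prm V)%:R <= N -> 0 < x <= N ->
  Eq x (prm V) <= 10 * (N * ln N * (2 ^+ #|V| / (prm V)%:R)).
Proof.
move=> aV N2 VN xN; have [l1 l2] := ln2N N2; have /andP[x0 xN'] := xN.
have q0 : 0 < (prm V)%:R :> R by rewrite ltr0n prm_gt0.
have /andP[t0 t1] := totient_prm_ge aV.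
have o1 : 1 <= 2 ^+ #|V| :> R by rewrite exprn_ege1 // ler1n.
have i0 : 0 < (prm V)%:R^-1 :> R by rewrite invr_gt0.
have NN : 0 < N by slra.
have Z1 : (prm V)%:R^-1 <= 2 ^+ #|V| / (prm V)%:R :> R by rewrite ler_peMl // ltW.
set Z : R := 2 ^+ #|V| / _ in t1 Z1 *.
have Z0 : 0 < Z by apply: lt_le_trans Z1.
have Nl0 : 0 <= N * Z * (2 * ln N - 1) by rewrite !mulr_ge0 //; slra.
apply: bigmax_le => [|a _]; first by rewrite mulr_ge0 // mulr_ge0 ?mulr_ge0; slra.
have W w : w%:R <= 2 * N -> 0 <= vpi R w <= 2 * ln N.
  move=> wN; rewrite vpi_ge0 /=; rewrite /vpi; case: ifP => pw; last by slra.
  by apply: le_trans l2; rewrite ler_ln ?posrE ?ltr0n ?prime_gt0 //; slra.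
have := @sum_class_le R _ N _ (prm V) a _ W _ x xN; rewrite q0 VN => /(_ isT ltac:(slra)).
rewrite /Eqa; set S := \sum_(_ <= _ < _ | _) _ => /andP[S0 S1].
have T1 : x / (totient (prm V))%:R <= N * Z by rewrite ler_pM // ltW.
have T0 : 0 <= x / (totient (prm V))%:R by rewrite mulr_ge0 // ltW.
have S2 : S <= 8 * (N * ln N * Z).
  apply: le_trans S1 _.
  have -> : 4 * N / (prm V)%:R * (2 * ln N) = 8 * (N * ln N * (prm V)%:R^-1) by ring.
  by rewrite ler_wpM2l // ler_wpM2l // mulr_ge0; slra.
rewrite ler_norml; apply/andP; split; slra.
Qed.

Lemma E2r_bound n (V : {set 'I_n}) N x : allp V -> 2 <= N -> (prm V)%:R <= N -> 0 < x <= N ->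
  E2r x (prm V) <= (26 + 4 * `|C0 R|) * (N * ln N ^+ 2 * (2 ^+ #|V| / (prm V)%:R)).
Proof.
move=> aV N2 VN xN; have [l1 l2] := ln2N N2; have /andP[x0 xN'] := xN.
have q0 : 0 < (prm V)%:R :> R by rewrite ltr0n prm_gt0.
have /andP[t0 t1] := totient_prm_ge aV.
have o1 : 1 <= 2 ^+ #|V| :> R by rewrite exprn_ege1 // ler1n.
have i0 : 0 < (prm V)%:R^-1 :> R by rewrite invr_gt0.
have NN : 0 < N by slra.
have Z1 : (prm V)%:R^-1 <= 2 ^+ #|V| / (prm V)%:R :> R by rewrite ler_peMl // ltW.
set Z : R := 2 ^+ #|V| / _ in t1 Z1 *.
have Z0 : 0 < Z by apply: lt_le_trans Z1.
have lN : ln N <= 2 * ln N ^+ 2 by rewrite expr2; nra.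
have lN1 : 1 <= 4 * ln N ^+ 2 by rewrite expr2; nra.
have c0 := normr_ge0 (C0 R).
apply: bigmax_le => [|a _].
  by apply: mulr_ge0 (mulr_ge0 (mulr_ge0 (ltW NN) (sqr_ge0 _)) (ltW Z0)); slra.
have W w : w%:R <= 2 * N -> 0 <= vpi2 R w <= 4 * ln N ^+ 2.
  move=> wN; rewrite vpi2_ge0 /=; have [->|w0] := posnP w.
    by rewrite /vpi2 (_ : divisors 0 = [:: 1%N]) // big_seq1 /vpi mul0r mulr_ge0 // exprn_ge0; slra.
  apply: le_trans (vpi2_le R w0 (leqnn w)) _.
  have -> : 4 * ln N ^+ 2 = (2 * ln N) ^+ 2 by ring.
  apply: lerXn2r; rewrite ?nnegrE ?ln_ge0 ?ler1n //; first slra.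
  by apply: le_trans l2; rewrite ler_ln ?posrE ?ltr0n //; slra.
have := @sum_class_le R _ N _ (prm V) a _ W _ x xN; rewrite q0 VN => /(_ isT ltac:(slra)).
rewrite /E2ra; set S := \sum_(_ <= _ < _ | _) _ => /andP[S0 S1].
set L := \sum_(p <- primes _) _.
have L01 : 0 <= L <= ln N.
  rewrite /L (big_primes_prm _ (fun p => ln (p%:R : R) / p%:R)) //; apply/andP; split.
    by apply: sumr_ge0 => i iV; rewrite divr_ge0 // ln_prime_ge0 // (allpP V aV).
  apply: (@le_trans _ _ (Lg R V)); last by rewrite -ln_prm // ler_ln ?posrE.
  apply: ler_sum => i iV; have pi := allpP V aV i iV; have h := @ln_prime_ge0 R i pi.
  have /andP[_ j1] := @prime_inv R i pi.
  by rewrite ler_piMr //; slra.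
(* The supremum includes x below 1, where log x is unbounded; there x times |log x| is at most 1, by
   log y < y at y = 1/x. *)
have xl : `|x * ln x| <= N * ln N + N.
  have [x1|x1] := leP 1 x.
    have lx := ln_ge0 x1.
    rewrite ger0_norm ?mulr_ge0 ?(ltW x0) //; apply: (@le_trans _ _ (N * ln N)); last by slra.
    by rewrite ler_pM ?(ltW x0) // ler_ln ?posrE.
  have lx : ln x <= 0 by apply: ln_le0; exact: ltW.
  rewrite ler0_norm; last by rewrite mulr_ge0_le0 // ltW.
  have := ln_sublinear (_ : 0 < x^-1); rewrite invr_gt0 x0 => /(_ isT) h.
  rewrite lnV ?posrE // in h; have := ler_wpM2l (ltW x0) (ltW h).
  rewrite mulrN mulfV ?lt0r_neq0 // => h'.
  have : 0 <= N * ln N by rewrite mulr_ge0; slra.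
  slra.
have U : `|x * (ln x + C0 R - 2 * L)| <= N * ((6 + 4 * `|C0 R|) * ln N ^+ 2 + 4 * ln N ^+ 2).
  have -> : x * (ln x + C0 R - 2 * L) = x * ln x + (x * C0 R - 2 * x * L) by ring.
  apply: le_trans (ler_normD _ _) _; apply: le_trans (lerD xl (ler_normB _ _)) _.
  case/andP: L01 => L0 L1.
  rewrite !normrM (gtr0_norm x0) (ger0_norm L0) (gtr0_norm (ltr0n R 2)).
  have u1 : x * `|C0 R| <= N * `|C0 R| by rewrite ler_wpM2r.
  have u2 : x * L <= N * ln N by rewrite ler_pM // ltW.
  have u3 := ler_wpM2l (ltW NN) lN; have u4 := ler_wpM2l (ltW NN) lN1.
  have u5 := ler_wpM2l (mulr_ge0 (ltW NN) c0) lN1.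
  slra.
have T1 : `|x / (totient (prm V))%:R * (ln x + C0 R - 2 * L)| <= N * ((6 + 4 * `|C0 R|) * ln N ^+ 2 + 4 * ln N ^+ 2) * Z.
  rewrite mulrAC normrM (gtr0_norm t0) ler_pM //; exact: ltW.
have S2 : S <= 16 * (N * ln N ^+ 2 * Z).
  apply: le_trans S1 _.
  have -> : 4 * N / (prm V)%:R * (4 * ln N ^+ 2) = 16 * (N * ln N ^+ 2 * (prm V)%:R^-1) by ring.
  by rewrite ler_wpM2l // ler_wpM2l // mulr_ge0 ?exprn_ge0; slra.
move: T1; rewrite !ler_norml => /andP[T1 T2]; apply/andP; split; slra.
Qed.

Lemma Estar_bound n (V : {set 'I_n}) N : allp V -> 2 <= N -> (prm V)%:R <= N ->
  (forall x, 0 < x <= N -> Eq x (prm V) <= Estar N (prm V)) /\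
  Estar N (prm V) <= 10 * (N * ln N * (2 ^+ #|V| / (prm V)%:R)).
Proof.
by move=> aV N2 VN; apply: Estar_sup => [|x xN]; [slra|exact: Eq_bound].
Qed.

Lemma E2star_bound n (V : {set 'I_n}) N : allp V -> 2 <= N -> (prm V)%:R <= N ->
  (forall x, 0 < x <= N -> E2r x (prm V) <= E2star N (prm V)) /\
  E2star N (prm V) <= (26 + 4 * `|C0 R|) * (N * ln N ^+ 2 * (2 ^+ #|V| / (prm V)%:R)).
Proof.
by move=> aV N2 VN; apply: Estar_sup => [|x xN]; [slra|exact: E2r_bound].
Qed.

End TrivialBounds.

(** * Counting the admissible residue classes *)

Section ClassCount.
Implicit Types (H : seq int) (h x y : int) (p q c b m : nat).

Lemma dvd_Ppoly_eqmod q H x y : prime q -> (q%:Z %| x - y)%Z ->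
  (q%:Z %| Ppoly H x)%Z = (q%:Z %| Ppoly H y)%Z.
Proof.
move=> pq xy; rewrite !dvd_Ppoly //; apply: eq_has => h.
have -> : x + h = (x - y) + (y + h) by rewrite addrA subrK.
by rewrite rpredDl.
Qed.

(** The map sending b to c b - h0 permutes the residues mod q, so nu of the b give roots. One of
    them is b = 0, because [h0] lies in [H], and it is the only one not coprime to q. *)
Lemma count_root_shift q H (h0 : int) c : prime q -> h0 \in H -> ~~ (q %| c)%N ->
  count (fun b => ~~ (q %| b)%N && (q%:Z %| Ppoly H ((c * b)%N%:Z - h0))%Z) (iota 0 q) = (nu H q).-1.
Proof.
move=> pq hH qc; have q0 := prime_gt0 pq.
pose phi b := `|(((c * b)%N%:Z - h0) %% q%:Z)%Z|%N.
have qz : q%:Z != 0 by rewrite lt0r_neq0 // ltz_nat.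
have phiE b : (phi b)%:Z = (((c * b)%N%:Z - h0) %% q%:Z)%Z by rewrite /phi gez0_abs // modz_ge0.
have phi_lt b : (phi b < q)%N by rewrite -ltz_nat phiE ltz_pmod // ltz_nat.
have phi_inj : {in iota 0 q &, injective phi}.
  move=> a b; rewrite !mem_iota !add0n /= => aq bq e.
  have : (q%:Z %| ((c * a)%N%:Z - h0) - ((c * b)%N%:Z - h0))%Z.
    by rewrite -eqz_mod_dvd -!phiE e.
  have -> : ((c * a)%N%:Z - h0) - ((c * b)%N%:Z - h0) = c%:Z * (a%:Z - b%:Z).
    by rewrite !PoszM; ring.
  rewrite dvdzE abszM Euclid_dvdM //= (negbTE qc) /= => d.
  apply/eqP; rewrite -eqz_nat -subr_eq0 -absz_eq0; apply/negPn; rewrite -lt0n; apply/negP => n0.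
  by have := dvdn_leq n0 d; lia.
have pe : perm_eq [seq phi b | b <- iota 0 q] (iota 0 q).
  have us : uniq [seq phi b | b <- iota 0 q] by rewrite map_inj_in_uniq ?iota_uniq.
  have sub : {subset [seq phi b | b <- iota 0 q] <= iota 0 q}.
    by move=> _ /mapP[b _ ->]; rewrite mem_iota add0n phi_lt.
  have [_ e] := uniq_min_size us sub (ltac:(by rewrite size_map)).
  by apply: uniq_perm => //; exact: iota_uniq.
have nuE : nu H q = count (fun b => (q%:Z %| Ppoly H ((c * b)%N%:Z - h0))%Z) (iota 0 q).
  rewrite /nu -(permP pe) count_map; apply: eq_count => b /=.
  apply: dvd_Ppoly_eqmod => //; rewrite phiE.
  by rewrite -dvdzN opprB -eqz_mod_dvd modz_mod || (rewrite -eqz_mod_dvd modz_mod).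
have iE : iota 0 q = 0%N :: iota 1 q.-1 by rewrite -{1}(prednK q0).
have r0 : (q%:Z %| Ppoly H ((c * 0)%N%:Z - h0))%Z.
  by rewrite muln0 dvd_Ppoly //; apply/hasP; exists h0; rewrite // sub0r addNr dvdz0.
rewrite nuE iE /= r0 dvdn0 /= ?add0n ?add1n /=.
apply: eq_in_count => b; rewrite mem_iota add1n (prednK q0) => /andP[b1 bq].
by rewrite gtnNdvd.
Qed.

Lemma count_root_prm n (V : {set 'I_n}) H (h0 : int) c : allp V -> h0 \in H -> coprime c (prm V) ->
  count (fun b => coprime b (prm V) && (prm V %| `|Ppoly H ((c * b)%N%:Z - h0)|)%N) (iota 0 (prm V)) =
  (\prod_(i in V) (nu H i).-1)%N.
Proof.
move=> aV hH cV; have hV := allpP V aV.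
have cop b : coprime b (prm V) = [forall i in V, ~~ ((i : nat) %| b)%N].
  rewrite coprime_sym; apply/idP/forall_inP => [h i iV|h].
    have pi := hV i iV; rewrite -prime_coprime //; apply: coprime_dvdl h.
    by rewrite /prm (bigD1 i) //= dvdn_mulr.
  have [b0|b0] := posnP b.
    have [V0|[i iV]] := set_0Vmem V; first by rewrite V0 prm0 coprime1n.
    by have := h i iV; rewrite b0 dvdn0.
  rewrite coprime_has_primes ?prm_gt0 //; apply/hasPn => p; rewrite mem_primes => /and3P[pp _ pb].
  rewrite (perm_mem (primes_prm aV)); apply/negP => /mapP[i]; rewrite mem_enum => iV e.
  by have := h i iV; rewrite -[(i : nat)]e pb.
have -> : (\prod_(i in V) (nu H i).-1 = \prod_(i in V)
    count (fun b => ~~ (i %| b)%N && ((i : nat)%:Z %| Ppoly H ((c * b)%N%:Z - h0))%Z) (iota 0 i))%N.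
  apply: eq_bigr => i iV; rewrite count_root_shift ?hV //.
  by move: cV; rewrite cop => /forall_inP/(_ i iV).
rewrite -(count_crt (fun q b => ~~ (q %| b)%N && (q%:Z %| Ppoly H ((c * b)%N%:Z - h0))%Z)) //.
apply: eq_count => b; rewrite cop dvd_prm_all //.
have -> : [forall i in V, ~~ ((i : nat) %| b %% i)%N && ((i : nat)%:Z %| Ppoly H ((c * (b %% i))%N%:Z - h0))%Z] =
   [forall i in V, ~~ ((i : nat) %| b)%N && ((i : nat) %| `|Ppoly H ((c * b)%N%:Z - h0)|)%N].
  apply: eq_forallb_in => i iV; have pi := hV i iV; congr (_ && _).
    by rewrite /dvdn modn_mod.
  rewrite -[RHS]/((i : nat)%:Z %| Ppoly H ((c * b)%N%:Z - h0))%Z; apply: dvd_Ppoly_eqmod => //.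
  have -> : ((c * (b %% i))%N%:Z - h0) - ((c * b)%N%:Z - h0) = - ((c * (b %/ i))%N%:Z * (i : nat)%:Z).
    by rewrite {2}(divn_eq b i) !PoszM PoszD PoszM; ring.
  by rewrite rpredN dvdz_mull.
apply/andP/forall_inP => [[/forall_inP h1 /forall_inP h2] i iV|h].
  by rewrite h1 // h2.
by split; apply/forall_inP => i iV; have /andP[] := h i iV.
Qed.

End ClassCount.

Section ClassSums.
Variable R : realType.
Implicit Types (x N : R) (H : seq int) (h : int) (p q c b m n : nat).

Lemma range_ext x K (Q : pred nat) (w : nat -> R) : 0 <= x -> ((Num.truncn (2 * x)).+1 <= K)%N ->
  \sum_(0 <= m < (Num.truncn (2 * x)).+1 | (x < m%:R) && (m%:R <= 2 * x) && Q m) w m =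
  \sum_(0 <= m < K | (x < m%:R) && (m%:R <= 2 * x) && Q m) w m.
Proof.
move=> x0 hK; rewrite [RHS](@big_cat_nat _ _ _ (Num.truncn (2 * x)).+1) //=.
rewrite [X in _ = _ + X]big_nat_cond [X in _ = _ + X]big_pred0 ?addr0 // => m.
apply/negbTE; apply/negP => /andP[/andP[h _] /andP[/andP[_ h'] _]].
by move: h; rewrite -(truncn_ge_nat m (_ : 0 <= 2 * x)) ?mulr_ge0 // in h' *; rewrite ltnNge h'.
Qed.

Definition nstar n H (V : {set 'I_n}) : R := \prod_(i in V) ((nu H i)%:R - 1).

Lemma nstarE n H (V : {set 'I_n}) : allp V -> (0 < size H)%N ->
  nstar H V = (\prod_(i in V) (nu H i).-1)%N%:R.
Proof.
move=> aV s0; rewrite natr_prod; apply: eq_bigr => i iV.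
have := nu_ge1 (allpP V aV i iV) s0 => h.
by rewrite -{1}(prednK h) -natr1 addrK.
Qed.

(** The conditions on m depend only on its class mod [prm V] and select [nstar H V] reduced classes,
    each with the same main term A. *)
Lemma class_sum n (V : {set 'I_n}) H (h0 : int) c x (w : nat -> R) (A E : R) : allp V -> h0 \in H -> coprime c (prm V) ->
  (forall a, (a < prm V)%N -> coprime a (prm V) ->
    `|\sum_(0 <= m < (Num.truncn (2 * x)).+1 | (x < m%:R) && (m%:R <= 2 * x) && (m %% prm V == a %% prm V)%N) w m - A| <= E) ->
  `|\sum_(0 <= m < (Num.truncn (2 * x)).+1 | (x < m%:R) && (m%:R <= 2 * x) &&
      (coprime m (prm V) && (prm V %| `|Ppoly H ((c * m)%N%:Z - h0)|)%N)) w m - nstar H V * A| <= nstar H V * E.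
Proof.
move=> aV hH cV hE; have s0 : (0 < size H)%N by case: (H) hH.
pose cd b := coprime b (prm V) && (prm V %| `|Ppoly H ((c * b)%N%:Z - h0)|)%N.
have cdM m : cd (m %% prm V)%N = cd m.
  rewrite /cd coprime_modl !dvd_prm_all //; congr (_ && _).
  apply: eq_forallb_in => i iV; have pi := allpP V aV i iV.
  rewrite -![((i : nat) %| `|_|)%N]/((i : nat)%:Z %| Ppoly H _)%Z; apply: dvd_Ppoly_eqmod => //.
  have iP : (i %| prm V)%N by rewrite /prm (bigD1 i) //= dvdn_mulr.
  have -> : ((c * (m %% prm V))%N%:Z - h0) - ((c * m)%N%:Z - h0) = - ((c * (m %/ prm V))%N%:Z * (prm V)%:Z).
    by rewrite {2}(divn_eq m (prm V)) !PoszM PoszD PoszM; ring.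
  by rewrite rpredN dvdz_mull.
rewrite (sum_class w _ _ (prm_gt0 aV) cdM).
have nE : nstar H V = \sum_(a < prm V | cd a) 1.
  rewrite nstarE // -(count_root_prm aV hH cV) sum_count natr_sum [RHS]big_mkcond.
  by apply: eq_bigr => a _; rewrite /cd; case: ifP.
rewrite nE !mulr_suml -sumrB; apply: le_trans (ler_norm_sum _ _ _) _.
by apply: ler_sum => a /andP[ca _]; rewrite !mul1r; apply: hE.
Qed.

Definition Fstar n H (V : {set 'I_n}) : R := \prod_(i in V) (((nu H i)%:R - 1) / (i%:R - 1)).

Lemma FstarE n H (V : {set 'I_n}) : allp V -> Fstar H V = nstar H V / (totient (prm V))%:R.
Proof.
move=> aV; rewrite /Fstar prodf_div totient_prm // natr_prod; congr (_ / _).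
apply: eq_bigr => i iV; have := prime_gt0 (allpP V aV i iV) => h.
by rewrite -{1}(prednK h) -natr1 addrK.
Qed.

Definition Ssum N H (h0 : int) n (U : {set 'I_n}) : R :=
  \sum_(0 <= m < (Num.truncn (2 * N)).+1 | (N < m%:R) && (m%:R <= 2 * N) &&
      (prm U %| `|Ppoly H (m%:Z - h0)|)%N) vpi2 R m.

(* Integers sharing exactly one prime [p] with the modulus are counted through primes in classes to modulus [prm U / p]. *)
Lemma Ssum_split N H (h0 : int) n (U : {set 'I_n}) : 0 < N -> allp U -> h0 \in H ->
  (forall i j : 'I_n, i \in U -> j \in U -> (i * j)%N%:R <= N) ->
  Ssum N H h0 U =
   \sum_(0 <= m < (Num.truncn (2 * N)).+1 | (N < m%:R) && (m%:R <= 2 * N) &&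
      (coprime m (prm U) && (prm U %| `|Ppoly H ((1 * m)%N%:Z - h0)|)%N)) vpi2 R m
   + \sum_(i in U) 2 * ln i%:R *
      \sum_(0 <= m < (Num.truncn (2 * (N / i%:R))).+1 | (N / i%:R < m%:R) && (m%:R <= 2 * (N / i%:R)) &&
       (coprime m (prm (U :\ i)) && (prm (U :\ i) %| `|Ppoly H ((i * m)%N%:Z - h0)|)%N)) vpi R m.
Proof.
move=> N0 aU hH UN; have hU := allpP U aU.
set K := (Num.truncn (2 * N)).+1.
pose dv m := (prm U %| `|Ppoly H (m%:Z - h0)|)%N.
have pointwise m : N < m%:R -> dv m -> vpi2 R m = (if coprime m (prm U) then vpi2 R m else 0) +
    \sum_(i in U | (i %| m)%N) 2 * ln i%:R * vpi R (m %/ i)%N.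
  move=> Nm dm; have m0 : (0 < m)%N by rewrite -(ltr0n R); slra.
  case: ifP => cm.
    rewrite big_pred0 ?addr0 // => i; apply/negbTE/negP => /andP[iU im].
    have pi := hU i iU; have iP : (i %| prm U)%N by rewrite /prm (bigD1 i) //= dvdn_mulr.
    have : coprime i i by apply: coprime_dvdl im _; apply: coprime_dvdr iP _.
    by rewrite /coprime gcdnn => /eqP e; rewrite e in pi.
  have [i iU im] : exists2 i, i \in U & (i %| m)%N.
    move/negbT: cm; rewrite coprime_has_primes ?prm_gt0 // negbK => /hasP[p].
    rewrite (perm_mem (primes_prm aU)) => /mapP[i]; rewrite mem_enum => iU ->.
    by rewrite mem_primes => /and3P[_ _ im]; exists i.
  have pi := hU i iU.
  (* As m exceeds N, it is not a product of two primes of U, nor the square of one; so a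
     contributing m has exactly one prime factor in U. *)
  have notpair j : j \in U -> (m <> i * j)%N.
    by move=> jU e; have := UN i j iU jU; rewrite -e leNgt Nm.
  rewrite (bigD1 i) /=; last by rewrite iU.
  rewrite [X in _ + (_ + X)]big1 ?addr0 ?add0r.
    rewrite (vpi2_dvd R m0 pi im) ?mulrA //; apply/eqP => e; exact: (notpair i iU).
  move=> j /andP[/andP[jU jm] ji]; have pj := hU j jU.
  rewrite /vpi; case: ifP => pe; last by rewrite mulr0.
  have mE : (m = j * (m %/ j))%N by rewrite mulnC divnK.
  move: im; rewrite mE Euclid_dvdM // !dvdn_prime2 // => /orP[/eqP/val_inj e|/eqP e].
    by rewrite e eqxx in ji.
  by case: (notpair j jU); rewrite mulnC e -mE.
have -> : Ssum N H h0 U = \sum_(0 <= m < K | (N < m%:R) && (m%:R <= 2 * N) && dv m)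
     ((if coprime m (prm U) then vpi2 R m else 0) + \sum_(i in U | (i %| m)%N) 2 * ln i%:R * vpi R (m %/ i)%N).
  by apply: eq_bigr => m /andP[/andP[Nm _] dm]; exact: pointwise.
rewrite big_split /=; congr (_ + _).
  rewrite -big_mkcondr; apply: eq_bigl => m; rewrite mul1n -andbA; congr (_ && _).
  by rewrite andbC.
rewrite (exchange_big_dep (fun i => i \in U)) /=; last by move=> m i _ /andP[].
apply: eq_bigr => i iU; have pi := hU i iU; have i0 := prime_gt0 pi.
have ip : 0 < i%:R :> R by rewrite ltr0n.
have NI : 0 <= N / i%:R by rewrite divr_ge0 ?ltW.
rewrite -mulr_sumr; congr (_ * _).
transitivity (\sum_(0 <= m < i * K | (i %| m)%N) if (N < m%:R) && (m%:R <= 2 * N) && dv m then vpi R (m %/ i) else 0).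
  rewrite -[RHS]big_mkcondr /=.
  transitivity (\sum_(0 <= m < K | (N < m%:R) && (m%:R <= 2 * N) && (dv m && (i %| m)%N)) vpi R (m %/ i)).
    by apply: eq_bigl => m; rewrite iU /= andbA.
  rewrite (@range_ext N (i * K)) ?(ltW N0) ?leq_pmull //.
  by apply: eq_bigl => m; rewrite andbA andbC.
rewrite sum_dvdn //.
have KK : ((Num.truncn (2 * (N / i%:R))).+1 <= K)%N.
  rewrite ltnS; apply: le_truncn; rewrite ler_wpM2l // ler_pdivrMr // ler_peMr ?(ltW N0) // ler1n //.
rewrite (@range_ext (N / i%:R) K) // [RHS]big_mkcond; apply: eq_bigr => m _.
rewrite mulKn //.
have -> : (N < (i * m)%:R) && ((i * m)%:R <= 2 * N) = (N / i%:R < m%:R) && (m%:R <= 2 * (N / i%:R)).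
  by rewrite natrM ltr_pdivrMr // [m%:R * _]mulrC mulrA ler_pdivlMr // [m%:R * _]mulrC.
have dvE : dv (i * m)%N = (prm (U :\ i) %| `|Ppoly H ((i * m)%N%:Z - h0)|)%N.
  rewrite /dv !dvd_prm_all ?allpD //; apply/forall_inP/forall_inP => h j.
    by rewrite inE => /andP[_ jU]; exact: h.
  move=> jU; have [->|ji] := eqVneq j i; last by apply: h; rewrite !inE ji.
  rewrite -[(_ %| `|_|)%N]/((i : nat)%:Z %| Ppoly H _)%Z dvd_Ppoly //; apply/hasP; exists h0 => //.
  by rewrite subrK PoszM dvdz_mulr.
rewrite dvE; case: (boolP ((N / i%:R < m%:R) && (m%:R <= 2 * (N / i%:R)))) => //= /andP[mN _].
case: (boolP (prm (U :\ i) %| _)%N) => hd; rewrite ?andbF ?andbT //.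
rewrite /vpi; case: ifP => pm; last by rewrite if_same.
rewrite ifT // prime_coprime // dvd_prm ?allpD //; apply/exists_inP => -[j].
rewrite inE => /andP[_ jU] /eqP e; have := UN i j iU jU.
by rewrite natrM mulrC -ler_pdivlMr // [(j : nat)]e leNgt mN.
Qed.

Lemma Ssum_main N H (h0 : int) n (U : {set 'I_n}) : 4 <= N -> allp U -> h0 \in H -> (0 < size H)%N ->
  (prm U)%:R <= N ->
  (forall i j : 'I_n, i \in U -> j \in U -> (i * j)%N%:R <= N) ->
  (forall i, i \in U -> 2 <= N / i%:R /\ (prm (U :\ i))%:R <= N / i%:R) ->
  `|Ssum N H h0 U - N * (Fstar H U * (ln N + C0 R - 2 * \sum_(i in U) ln i%:R / i%:R)
      + 2 * \sum_(i in U) ln i%:R / i%:R * Fstar H (U :\ i))| <=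
   nstar H U * E2star N (prm U) + \sum_(i in U) 2 * ln i%:R * (nstar H (U :\ i) * Estar (N / i%:R) (prm (U :\ i))).
Proof.
move=> N4 aU hH s0 UN UU UV; have N0 : 0 < N by slra.
rewrite Ssum_split //.
set A := \sum_(_ <= _ < _ | _) _; set B := \sum_(i in U) _ * _.
have -> : N * (Fstar H U * (ln N + C0 R - 2 * \sum_(i in U) ln i%:R / i%:R)
      + 2 * \sum_(i in U) ln i%:R / i%:R * Fstar H (U :\ i)) =
   nstar H U * (N / (totient (prm U))%:R * (ln N + C0 R - 2 * \sum_(i in U) ln i%:R / i%:R)) +
   \sum_(i in U) 2 * ln i%:R * (nstar H (U :\ i) * (N / i%:R / (totient (prm (U :\ i)))%:R)).
  rewrite FstarE // mulrDr; congr (_ + _); first by ring.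
  rewrite !mulr_sumr; apply: eq_bigr => i iU; rewrite FstarE ?allpD //; ring.
rewrite opprD addrACA; apply: le_trans (ler_normD _ _) _; apply: lerD.
  have N2 : 2 <= N by slra.
  have [E1 _] := E2star_bound aU N2 UN.
  apply: class_sum => //; first exact: coprime1n.
  move=> a aM ca.
  have := E1 N; rewrite N0 lexx => /(_ isT); apply: le_trans.
  have -> : \sum_(i in U) ln (i%:R : R) / i%:R = \sum_(p <- primes (prm U)) ln p%:R / p%:R.
    by rewrite (big_primes_prm _ (fun p => ln (p%:R : R) / p%:R)).
  rewrite /E2r; exact: (@le_bigmax_cond _ _ _ _ (Ordinal aM) _ (fun a : 'I_(prm U) => `|E2ra N (prm U) a|)).
rewrite -sumrB; apply: le_trans (ler_norm_sum _ _ _) _; apply: ler_sum => i iU.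
have pi := allpP U aU i iU; have aV : allp (U :\ i) by exact: allpD.
have [V2 VN] := UV i iU; have l0 := @ln_prime_ge0 R i pi.
rewrite -mulrBr normrM (ger0_norm (_ : 0 <= 2 * ln i%:R)) ?mulr_ge0 // ler_wpM2l ?mulr_ge0 //.
have [E1 _] := Estar_bound aV V2 VN.
apply: class_sum => //.
  by rewrite prime_coprime // dvd_prm //; apply/exists_inP => -[j]; rewrite !inE => /andP[ji _] /eqP/val_inj e; rewrite e eqxx in ji.
move=> a aM ca.
have := E1 (N / i%:R); rewrite lexx andbT => h.
have {h}h := h (ltac:(slra)); apply: le_trans h.
rewrite /Eq; exact: (@le_bigmax_cond _ _ _ _ (Ordinal aM) _ (fun a : 'I_(prm (U :\ i)) => `|Eqa (N / i%:R) (prm (U :\ i)) a|)).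
Qed.

End ClassSums.

(** * Error terms *)

Section PolylogBounds.
Variable R : realType.
Implicit Types (X Y Q t C D N RR : R) (d n p k l c m : nat) (H : seq int) (g : nat -> R).

Lemma Lop1X_ge0 g n (F : R -> R) X : (forall p, prime p -> 0 <= g p) -> (forall Y, 0 <= F Y) ->
  0 <= Lop (fun p => 1 + g p *: 'X) n F X.
Proof.
move=> g0 F0; elim: n X => [|n IH] X //=; case: ifP => pn //.
by rewrite act_1X addr_ge0 // mulr_ge0 // g0.
Qed.

Lemma Lop1X_mono g n m (F : R -> R) X : (forall p, prime p -> 0 <= g p) -> (forall Y, 0 <= F Y) ->
  (n <= m)%N -> Lop (fun p => 1 + g p *: 'X) n F X <= Lop (fun p => 1 + g p *: 'X) m F X.
Proof.
move=> g0 F0 /subnKC <-; elim: (m - n)%N => [|d IH]; first by rewrite addn0.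
rewrite addnS /=; case: ifP => pn //; rewrite act_1X; apply: le_trans IH _.
by rewrite lerDl mulr_ge0 ?g0 // Lop1X_ge0.
Qed.

Lemma setsum_upper_all kap g D : 0 <= D -> (forall p, prime p -> 0 <= g p) ->
  (forall p, prime p -> `|g p - kap%:R / p%:R| * (1 + ln p%:R) ^+ 2 <= D * q32 R p) ->
  exists2 C, 0 < C & forall n X, 0 < X -> setsum n g (pw 0) X <= C * (1 + X) ^+ kap.+2.
Proof.
move=> D0 g0 DP; have [C C0 CP] := setsum_upper D0 g0 DP; exists C => // n X X0.
have [m [nm m0 Xm]] := large_n X n.
apply: le_trans (CP m X m0 Xm X0); rewrite !setsumE; apply: Lop1X_mono => // Y; exact: pw_ge0.
Qed.

Lemma gprod_natX c n (V : {set 'I_n}) : allp V ->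
  gprod (fun p => c%:R / p%:R) V = c%:R ^+ #|V| / (prm V)%:R :> R.
Proof.
move=> aV; rewrite /gprod /prm natr_prod -prodr_const -prodf_div; apply: eq_bigr => i iV.
by rewrite /onprimes (allpP V aV i iV).
Qed.

Lemma sum_natX_upper c : exists2 C, 0 < C & forall n X, 0 < X ->
  \sum_(V : {set 'I_n} | allp V && (Lg R V < X)) c%:R ^+ #|V| / (prm V)%:R <= C * (1 + X) ^+ c.+2.
Proof.
have g0 p : prime p -> 0 <= c%:R / p%:R :> R by move=> _; rewrite divr_ge0.
have [|C C0 CP] := @setsum_upper_all c (fun p => c%:R / p%:R) 0 (lexx 0) g0.
  by move=> p _; rewrite subrr normr0 !mul0r.
exists C => // n X X0; apply: le_trans (CP n X X0); rewrite /setsum big_mkcond; apply: ler_sum => V _.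
case: ifP => [/andP[aV VX]|_]; last by rewrite mulr_ge0 ?pw_ge0 // gprod_ge0.
by rewrite gprod_natX // /pw subr_gt0 VX expr0 mulr1.
Qed.

Lemma gw_dev H : uniq H -> admissible H -> (0 < size H)%N ->
  exists2 D, 0 <= D & forall p, prime p ->
   `|gw R H p - (size H)%:R / p%:R| * (1 + ln p%:R) ^+ 2 <= D * q32 R p.
Proof.
move=> uH ad s0; have [P0 hP] := nu_large uH; have [C C0 CP] := @ln_q32 R 2.
apply: (@eventually_all R (fun p => `|gw R H p - (size H)%:R / p%:R| * (1 + ln p%:R) ^+ 2)
  (q32 R) prime (maxn P0 (2 * size H)) (2 * (size H)%:R ^+ 2 * C)).
  by move=> p pp; apply: q32_gt0; exact: prime_gt0.
move=> p pp; rewrite geq_max => /andP[pP pk].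
rewrite /gw hP //; set k : R := (size H)%:R.
have Pk : 2 * k <= p%:R by rewrite -natrM ler_nat.
have k1 : 1 <= k by rewrite ler1n.
have l0 := @ln_prime_ge0 R p pp; have CPp := CP p (prime_gt0 pp).
set P : R := p%:R in Pk l0 CPp *.
have -> : k / (P - k) - k / P = k ^+ 2 * (P^-1 * (P - k)^-1).
  by field; rewrite !lt0r_neq0 //; slra.
have i1 : (P - k)^-1 <= 2 * P^-1.
  rewrite -[leRHS]invrK lef_pV2 ?posrE ?invr_gt0 ?mulr_gt0 ?invr_gt0 //; [|slra|slra].
  by rewrite invfM invrK; slra.
have P0' : 0 < P^-1 by rewrite invr_gt0; slra.
have i0 : 0 <= (P - k)^-1 by rewrite invr_ge0; slra.
rewrite ger0_norm; last exact: mulr_ge0 (sqr_ge0 _) (mulr_ge0 (ltW P0') i0).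
have L0 : 0 <= (1 + ln P) ^+ 2 by exact: sqr_ge0.
apply: (@le_trans _ _ (2 * k ^+ 2 * ((1 + ln P) ^+ 2 * P^-1 ^+ 2))); last first.
  by rewrite -[leRHS]mulrA ler_wpM2l // mulr_ge0 // sqr_ge0.
have -> : 2 * k ^+ 2 * ((1 + ln P) ^+ 2 * P^-1 ^+ 2) = k ^+ 2 * (P^-1 * (2 * P^-1)) * (1 + ln P) ^+ 2 by ring.
by rewrite ler_wpM2r // ler_wpM2l ?sqr_ge0 // ler_wpM2l // ltW.
Qed.

Lemma fg_bounds H p : admissible H -> (0 < size H)%N -> prime p ->
  0 <= fw R H p * gw R H p <= (size H)%:R + 1.
Proof.
move=> ad s0 pp; have [h1 h2 h3] := @nu_real R _ _ ad s0 pp.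
rewrite /fw /gw; set v : R := (nu H p)%:R in h1 h2 h3 *; set P : R := p%:R in h2 *.
have -> : P / v * (v / (P - v)) = P / (P - v) by field; rewrite !lt0r_neq0 //; slra.
apply/andP; split; first by apply: divr_ge0; slra.
by rewrite ler_pdivrMr; nra.
Qed.

(** Each prime of D contributes f g = p/(p - nu), at most k + 1; the remaining sum weighted by [gw]
    is bounded by a power of log R. C may depend on [H], because the distribution hypotheses save
    any power of the logarithm. *)
Lemma lam_bound H l : uniq H -> admissible H -> (0 < size H)%N ->
  exists2 C, 0 < C & forall RR n (D : {set 'I_n}), 1 < RR ->
   `|lam RR H l D| <= C * (1 + ln RR) ^+ (l + (size H).+2) *
       (if allp D && (Lg R D < ln RR) then ((size H).+1)%:R ^+ #|D| else 0).
Proof.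
move=> uH ad s0; have [D0 D00 DP] := gw_dev uH ad s0.
have g0 p : prime p -> 0 <= gw R H p.
  by move=> pp; have [h1 h2 h3] := @nu_real R _ _ ad s0 pp; apply: divr_ge0; slra.
have [C C0 CP] := setsum_upper_all D00 g0 DP.
have [c c0 cP] := @sing_gt R (size H).
have S0 : 0 < sing R H by apply: lt_le_trans (cP H erefl uH ad s0).
pose S : R := sing R H / l`!%:R.
have Sp : 0 < S by rewrite divr_gt0 // ltr0n fact_gt0.
exists (S * C) => [|RR n D R1]; first exact: mulr_gt0.
have X0 : 0 < ln RR by rewrite ln_gt0.
case: ifP => [/andP[aD DX]|/negbT]; last first.
  rewrite negb_and -leNgt mulr0 => /orP[nD|DX]; first by rewrite lam_nallp ?normr0.
  have [aD|nD] := boolP (allp D); last by rewrite lam_nallp ?normr0.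
  by rewrite lam_large ?normr0.
rewrite /lam lamsetE normrM mulrC; apply: ler_pM => //.
  rewrite /ysum; apply: le_trans (ler_norm_sum _ _ _) _.
  apply: (@le_trans _ _ (\sum_(B : {set 'I_n}) gprod (gw R H) B * (S * (ln RR ^+ l * pw 0 (ln RR - Lg R B))))).
    rewrite big_mkcond; apply: ler_sum => B _; rewrite -/(gprod (gw R H) B).
    have p0 := gprod_ge0 B g0.
    case: ifP => dDB; last first.
      by apply: mulr_ge0 => //; apply: mulr_ge0 (ltW Sp) (mulr_ge0 (exprn_ge0 _ (ltW X0)) (pw_ge0 _ _)).
    have [aB|nB] := boolP (allp B); last by rewrite gprod_nallp // !mul0r normr0.
    rewrite normrM (ger0_norm p0) ler_wpM2l // /wfun -/S normrM (gtr0_norm Sp) ler_wpM2l ?(ltW Sp) //.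
    rewrite ger0_norm ?pw_ge0 // LgU // /pw; have b0 := Lg_ge0 R aB; have d0 := Lg_ge0 R aD.
    case: ltP => h; last by rewrite mulr_ge0 ?exprn_ge0 ?(ltW X0) //; case: ifP.
    rewrite ifT; last by slra.
    by rewrite expr0 mulr1 lerXn2r ?nnegrE; slra.
  have -> : \sum_(B : {set 'I_n}) gprod (gw R H) B * (S * (ln RR ^+ l * pw 0 (ln RR - Lg R B))) =
     S * (ln RR ^+ l * setsum n (gw R H) (pw 0) (ln RR)).
    by rewrite /setsum !mulr_sumr; apply: eq_bigr => B _; ring.
  have -> : S * C * (1 + ln RR) ^+ (l + (size H).+2) = S * ((1 + ln RR) ^+ l * (C * (1 + ln RR) ^+ (size H).+2)).
    by rewrite exprD; ring.
  rewrite ler_wpM2l ?(ltW Sp) //; apply: ler_pM; rewrite ?exprn_ge0 ?(ltW X0) ?CP //.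
    by apply: sumr_ge0 => B _; rewrite mulr_ge0 ?pw_ge0 ?gprod_ge0.
  by rewrite lerXn2r ?nnegrE; slra.
rewrite normr_prod -prodr_const; apply: ler_prod => i iD; rewrite normr_ge0 /=.
rewrite /onprimes (allpP D aD i iD) normrN.
have /andP[h1 h2] := fg_bounds ad s0 (allpP D aD i iD).
by rewrite ger0_norm // -natr1.
Qed.

Lemma sum_powerset n c (U : {set 'I_n}) :
  \sum_(D : {set 'I_n} | D \subset U) c%:R ^+ #|D| = c.+1%:R ^+ #|U| :> R.
Proof.
elim/set_ind: U => [|x S xS IH].
  rewrite (big_pred1 set0) => [|A]; first by rewrite !cards0 !expr0.
  by rewrite /= -subset0.
rewrite sum_subsetU1 // big_split /= IH cardsU1 xS add1n [RHS]exprS.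
have -> : \sum_(A : {set 'I_n} | A \subset S) c%:R ^+ #|x |: A| = c%:R * \sum_(A : {set 'I_n} | A \subset S) c%:R ^+ #|A| :> R.
  rewrite mulr_sumr; apply: eq_bigr => A AS.
  rewrite cardsU1 (_ : x \notin A) ?exprS //.
  by apply: contra xS => /(subsetP AS).
by rewrite IH -natr1; ring.
Qed.

(** Pairs with union U are among all pairs of subsets of U, whose weights sum to (c + 1)^(2|U|); the
    logarithm of a union is at most the sum of the two logarithms. *)
Lemma sum_union_le n c X (Z : {set 'I_n} -> R) : (forall U, 0 <= Z U) ->
  \sum_(D : {set 'I_n}) \sum_(E : {set 'I_n})
     (if allp D && (Lg R D < X) then c%:R ^+ #|D| else 0) *
     (if allp E && (Lg R E < X) then c%:R ^+ #|E| else 0) * Z (D :|: E)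
  <= \sum_(U : {set 'I_n} | allp U && (Lg R U < 2 * X)) (c.+1 ^ 2)%:R ^+ #|U| * Z U.
Proof.
move=> Z0; rewrite pair_big /= (partition_big (fun P : {set 'I_n} * {set 'I_n} => P.1 :|: P.2) xpredT) //=.
rewrite [leRHS]big_mkcond; apply: ler_sum => U _.
pose f (D : {set 'I_n}) : R := if allp D && (Lg R D < X) then c%:R ^+ #|D| else 0.
have f0 (D : {set 'I_n}) : 0 <= f D by rewrite /f; case: ifP => // _; rewrite exprn_ge0.
case: (boolP (allp U && (Lg R U < 2 * X))) => hU; last first.
  rewrite big1 // => -[D E] /= /eqP DE; case: ifP => [/andP[aD DX]|]; last by rewrite !mul0r.
  case: ifP => [/andP[aE EX]|]; last by rewrite mulr0 mul0r.
  case/negP: hU; rewrite -DE allpU aD aE /=.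
  have -> : D :|: E = D :|: (E :\: D) by apply/setP => i; rewrite !inE; case: (i \in D).
  rewrite LgU; last by rewrite disjoint_subset; apply/subsetP => i iD; rewrite !inE iD.
  have : Lg R (E :\: D) <= Lg R E.
    rewrite /Lg [leRHS](big_setID D) /= lerDr; apply: sumr_ge0 => i; rewrite inE => /andP[iE _].
    by rewrite ln_prime_ge0 // (allpP E aE).
  slra.
apply: (@le_trans _ _ (\sum_(P : {set 'I_n} * {set 'I_n} | (P.1 \subset U) && (P.2 \subset U)) (c%:R ^+ #|P.1| * c%:R ^+ #|P.2|) * Z U)).
  rewrite big_mkcond [leRHS]big_mkcond; apply: ler_sum => -[D E] _ /=.
  have c0 : 0 <= c%:R ^+ #|D| * c%:R ^+ #|E| :> R by rewrite mulr_ge0 ?exprn_ge0.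
  case: eqP => [DE|_]; last by case: ifP => // _; rewrite mulr_ge0.
  rewrite -{1 2}DE subsetUl subsetUr /= DE ler_wpM2r //.
  by apply: ler_pM; rewrite ?f0 //; case: ifP => // _; rewrite exprn_ge0.
rewrite -mulr_suml ler_wpM2r //.
rewrite -(pair_big (fun D : {set 'I_n} => D \subset U) (fun D : {set 'I_n} => D \subset U)
   (fun D E : {set 'I_n} => c%:R ^+ #|D| * c%:R ^+ #|E|)) /=.
by rewrite -big_distrlr /= sum_powerset natrX -exprM mulnC exprM expr2.
Qed.

Lemma sum_prm_le n Q (G : nat -> R) : (forall q, 0 <= G q) -> 0 <= Q ->
  \sum_(V : {set 'I_n} | allp V && ((prm V)%:R <= Q)) G (prm V) <= \sum_(1 <= q < (Num.truncn Q).+1) G q.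
Proof.
move=> G0 Q0; set M := (Num.truncn Q).+1.
have vM (V : {set 'I_n}) : (prm V)%:R <= Q -> (prm V < M)%N by rewrite ltnS truncn_ge_nat.
rewrite (partition_big (fun V : {set 'I_n} => inord (prm V) : 'I_M) xpredT) //=.
apply: (@le_trans _ _ (\sum_(q < M) if (0 < q)%N then G q else 0)); last first.
  rewrite -(big_mkord xpredT (fun q => if (0 < q)%N then G q else 0)) big_ltn //= add0r.
  by rewrite le_eqVlt; apply/orP; left; apply/eqP; apply: eq_big_nat => q /andP[-> _].
apply: ler_sum => q _.
case: (pickP (fun V : {set 'I_n} => allp V && ((prm V)%:R <= Q) && (inord (prm V) == q))) => [V0 /andP[/andP[aV V0Q] /eqP e]|h]; last first.
  by rewrite big_pred0 //; case: ifP.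
have eq : (prm V0 = q)%N by rewrite -e inordK // vM.
rewrite (big_pred1 V0) => [|V /=]; last first.
  apply/andP/eqP => [[/andP[aV' VQ] /eqP e']|->]; last by rewrite aV V0Q e eqxx.
  by rewrite -(psetK aV') -(psetK aV); congr pset; rewrite eq -e' inordK // vM.
by rewrite eq -eq prm_gt0.
Qed.

(* AM-GM in the form [b <= t + b ^ 2 / t], with [b = c ^ omega], replaces the usual Cauchy-Schwarz step. *)
Lemma weighted_sum_le c : exists2 C, 0 < C & forall n Q t (G : nat -> R) (A Tr : R),
  (forall q, 0 <= G q) -> 1 <= Q -> 0 < t -> 0 <= Tr ->
  (forall V : {set 'I_n}, allp V -> (prm V)%:R <= Q -> G (prm V) <= Tr * (2 ^+ #|V| / (prm V)%:R)) ->
  \sum_(1 <= q < (Num.truncn Q).+1) G q <= A ->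
  \sum_(V : {set 'I_n} | allp V && ((prm V)%:R <= Q)) c%:R ^+ #|V| * G (prm V) <=
    t * A + Tr / t * (C * (2 + ln Q) ^+ (2 * c ^ 2).+2).
Proof.
have [C C0 CP] := sum_natX_upper (2 * c ^ 2); exists C => // n Q t G A Tr G0 Q1 t0 Tr0 GT GA.
have lQ : 0 <= ln Q by exact: ln_ge0.
apply: (@le_trans _ _ (\sum_(V : {set 'I_n} | allp V && ((prm V)%:R <= Q))
   (t * G (prm V) + Tr / t * ((2 * c ^ 2)%:R ^+ #|V| / (prm V)%:R)))).
  apply: ler_sum => V /andP[aV VQ]; set b : R := c%:R ^+ #|V|.
  have b0 : 0 <= b by rewrite exprn_ge0.
  have v0 : 0 < (prm V)%:R^-1 :> R by rewrite invr_gt0 ltr0n prm_gt0.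
  have h1 : b <= t + b ^+ 2 / t.
    rewrite -subr_ge0 -(pmulr_lge0 _ t0); have -> : (t + b ^+ 2 / t - b) * t = (t - b / 2) ^+ 2 + 3 / 4 * b ^+ 2.
      by field; rewrite lt0r_neq0.
    by rewrite addr_ge0 ?sqr_ge0 // mulr_ge0 ?sqr_ge0.
  apply: le_trans (ler_wpM2r (G0 _) h1) _; rewrite mulrDl lerD2l.
  apply: le_trans (ler_wpM2l _ (GT V aV VQ)) _; first by rewrite divr_ge0 ?sqr_ge0 // ltW.
  rewrite natrM exprMn natrX -exprM mulnC exprM -/b le_eqVlt; apply/orP; left; apply/eqP; ring.
rewrite big_split /= -!mulr_sumr lerD //.
  by rewrite ler_wpM2l ?(ltW t0) //; apply: le_trans GA; exact: sum_prm_le (ltW (lt_le_trans ltr01 Q1)).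
rewrite ler_wpM2l ?divr_ge0 ?(ltW t0) //.
have := CP n (1 + ln Q) (ltac:(slra)); have -> : 1 + (1 + ln Q) = 2 + ln Q by ring.
apply: le_trans; rewrite big_mkcond [leRHS]big_mkcond; apply: ler_sum => V _.
case: ifP => [/andP[aV VQ]|_]; last by case: ifP => // _; rewrite divr_ge0 ?exprn_ge0.
rewrite aV ifT //=; have v0 : 0 < (prm V)%:R :> R by rewrite ltr0n prm_gt0.
by have : ln (prm V)%:R <= ln Q; [rewrite ler_ln ?posrE //; slra|rewrite ln_prm //; slra].
Qed.

End PolylogBounds.

Section ErrorTerms.
Variable R : realType.
Implicit Types (X Y Q t C K N RR d : R) (n p k l c m b : nat) (H : seq int).

Lemma le_ln_expR M N : expR M <= N -> M <= ln N.
Proof. by move=> h; rewrite -(expRK M) ler_ln ?posrE ?expR_gt0 // (lt_le_trans (expR_gt0 M)). Qed.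

Lemma powR_01 N d : 1 <= N -> 0 <= d <= 1 -> 1 <= N `^ d <= N.
Proof.
move=> N1 /andP[d0 d1]; apply/andP; split.
  by rewrite -[leLHS](powRr0 N) ler_powR.
by rewrite -[leRHS]powRr1 ?ler_powR //; slra.
Qed.

Lemma polylog_le_powR C c d : 0 < d -> exists N1, forall N, N1 <= N -> C * ln N ^+ c <= N `^ d.
Proof.
move=> d0; pose M := 1 + `|C| * (c.+1%:R / d) ^+ c.+1.
exists (expR M) => N NM; have LM := le_ln_expR NM.
have q0 : 0 <= (c.+1%:R / d) ^+ c.+1 by rewrite exprn_ge0 // divr_ge0 // ltW.
have M1 : 1 <= M by rewrite lerDl mulr_ge0.
have N0 : 0 < N by apply: lt_le_trans NM; exact: expR_gt0.
have L0 : 0 <= ln N by slra.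
rewrite -[N in leRHS](@lnK _ N) ?posrE // -expRM.
have dL0 : 0 <= ln N * d by rewrite mulr_ge0 // ltW.
apply: le_trans (expR_ge_pow c dL0).
have q0' : 0 < (c.+1%:R / d) ^+ c.+1 by rewrite exprn_gt0 // divr_gt0.
have -> : (ln N * d / c.+1%:R) ^+ c.+1 = ln N ^+ c.+1 / (c.+1%:R / d) ^+ c.+1.
  by rewrite -[(c.+1%:R / d) ^+ _]invrK -exprVn invf_div invrK -exprMn mulrA.
rewrite ler_pdivlMr // [leRHS]exprS [leLHS]mulrAC ler_wpM2r ?exprn_ge0 //.
apply: le_trans (ler_norm _) _; rewrite normrM (ger0_norm q0); move: LM; rewrite /M; slra.
Qed.

Lemma bv_weighted (E : R -> nat -> R) K d c b : 0 < d <= 1 -> 0 <= K ->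
  (forall N q, 0 <= E N q) ->
  (forall n (V : {set 'I_n}) N, allp V -> 8 <= N -> (prm V)%:R <= N ->
     E N (prm V) <= K * (N * ln N ^+ 2 * (2 ^+ #|V| / (prm V)%:R))) ->
  (forall A, 0 < A -> exists C, forall N, 2 <= N ->
     \sum_(1 <= q < (Num.truncn (N `^ d)).+1) E N q <= C * (N * ln N `^ (- A))) ->
  exists N1, forall N n, N1 <= N ->
    \sum_(V : {set 'I_n} | allp V && ((prm V)%:R <= N `^ d)) c%:R ^+ #|V| * E N (prm V) <= N / ln N ^+ b.
Proof.
move=> /andP[d0 d1] K0 E0 ET EB; have [C' C'0 W] := @weighted_sum_le R c.
(* The AM-GM parameter is t = (log N)^a and the saving requested is a + b + 1. Both terms of
   [weighted_sum_le] are then O(N/(log N)^(b + 1)), and the spare logarithm absorbs the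
   constants. *)
set e := (2 * c ^ 2).+2 in W; pose a := (b + e + 3)%N.
have [C CP] := EB ((a + b.+1)%:R) (ltac:(by rewrite ltr0n addnS)).
have KC : 0 <= K * C' * 3 ^+ e by apply: mulr_ge0; [exact: mulr_ge0 K0 (ltW C'0)|exact: exprn_ge0].
pose M := 8 + `|C| + K * C' * 3 ^+ e.
exists (expR M) => N n NM; have LM := le_ln_expR NM; have C0 := normr_ge0 C.
have M2 : 8 <= M by rewrite /M -addrA lerDl addr_ge0.
have N3 : 8 <= N by apply: le_trans NM; have := @expR_ge1Dx _ M; slra.
have [N1' N2] : 1 <= N /\ 2 <= N by split; slra.
have d01 : 0 <= d <= 1 by rewrite d1 ltW.
have /andP[Q1 QN] := powR_01 N1' d01; set Q := N `^ d in Q1 QN *.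
have L0 : 0 < ln N by slra.
have La0 m : 0 < ln N ^+ m by rewrite exprn_gt0.
have Tr0 : 0 <= K * (N * ln N ^+ 2) by rewrite !mulr_ge0 ?sqr_ge0 //; slra.
apply: le_trans (W n Q (ln N ^+ a) (E N) _ _ (E0 N) Q1 (La0 a) Tr0 _ (CP N N2)) _.
  by move=> V aV VQ; rewrite -mulrA; apply: ET => //; exact: le_trans QN.
have -> : - (a + b.+1)%:R = (- 1) *+ (a + b.+1) :> R by rewrite mulNrn.
have -> : ln N `^ ((- 1) *+ (a + b.+1)) = ln N ^- (a + b.+1) by rewrite mulNrn powR_invn // ltW.
have lQ : 2 + ln Q <= 3 * ln N.
  have : ln Q <= ln N by rewrite ler_ln ?posrE //; slra.
  slra.
have lQ0 : 0 <= ln Q by exact: ln_ge0.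
have h : (2 + ln Q) ^+ e <= 3 ^+ e * ln N ^+ e by rewrite -exprMn lerXn2r ?nnegrE //; slra.
have U0 : 0 <= N / ln N ^+ b / ln N by rewrite !divr_ge0 ?(ltW (La0 _)) ?(ltW L0) //; slra.
have ln0 : ln N != 0 by rewrite lt0r_neq0.
apply: (@le_trans _ _ ((C + K * C' * 3 ^+ e) * (N / ln N ^+ b / ln N))).
  rewrite [leRHS]mulrDl; apply: lerD.
    rewrite le_eqVlt; apply/orP; left; apply/eqP; rewrite exprD exprS; field.
    by rewrite !expf_neq0 ?ln0.
  apply: (@le_trans _ _ (K * (N * ln N ^+ 2) / ln N ^+ a * (C' * (3 ^+ e * ln N ^+ e)))).
    rewrite ler_wpM2l ?(ler_wpM2l (ltW C'0)) // divr_ge0 // ltW //.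
  rewrite le_eqVlt; apply/orP; left; apply/eqP; rewrite /a !exprD; field.
  by rewrite !expf_neq0 ?ln0.
apply: (@le_trans _ _ (ln N * (N / ln N ^+ b / ln N))).
  by rewrite ler_wpM2r //; have := ler_norm C; move: LM; rewrite /M; slra.
by rewrite mulrC divfK.
Qed.

Lemma nstar_le H n (V : {set 'I_n}) : uniq H -> allp V -> (0 < size H)%N -> admissible H ->
  nstar R H V <= (size H)%:R ^+ #|V|.
Proof.
move=> uH aV s0 ad; rewrite -prodr_const; apply: ler_prod => i iV.
by have [h1 h2 h3] := @nu_real R _ _ ad s0 (allpP V aV i iV); slra.
Qed.

Lemma ord_truncn_le RR (i : 'I_(Num.truncn RR).+1) : 0 <= RR -> i%:R <= RR.
Proof. by move=> R0; rewrite -truncn_ge_nat // -ltnS. Qed.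

Lemma prm_le_powR n (d N RR : R) (U : {set 'I_n}) : 1 <= N -> 0 < RR -> RR <= N `^ (d / 2) -> allp U ->
  Lg R U < 2 * ln RR -> (prm U)%:R <= N `^ d.
Proof.
move=> N1 R0 RN aU UX; have v0 : 0 < (prm U)%:R :> R by rewrite ltr0n prm_gt0.
have Nd : 0 < N `^ d by rewrite powR_gt0; slra.
rewrite -ler_ln ?posrE // ln_powR ln_prm //; apply/ltW; apply: lt_le_trans UX _.
have : ln RR <= ln (N `^ (d / 2)) by rewrite ler_ln ?posrE // powR_gt0; slra.
by rewrite ln_powR; slra.
Qed.

Lemma sum_setD1_pairs n (P : pred {set 'I_n}) (G : 'I_n -> {set 'I_n} -> R) :
  \sum_(U : {set 'I_n} | P U) \sum_(i in U) G i (U :\ i) =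
  \sum_(i < n) \sum_(V : {set 'I_n} | P (i |: V) && (i \notin V)) G i V.
Proof.
rewrite (exchange_big_dep xpredT) //=; apply: eq_bigr => i _.
rewrite (reindex_onto (fun V => i |: V) (fun U => U :\ i)) /=; last by move=> U /andP[_ iU]; rewrite setD1K.
apply: eq_big => V; last by case/andP=> _ /eqP ->.
rewrite setU11 andbT; congr (_ && _); apply/eqP/idP => [<-|iV]; first by rewrite !inE eqxx.
by rewrite setU1K.
Qed.

Lemma ln_ge1 N : 8 <= N -> 1 <= ln N.
Proof.
move=> N8; have : ln (2 ^+ 3 : R) <= ln N by rewrite ler_ln ?posrE //; slra.
by rewrite lnXn //; have := @ln2_ge R; slra.
Qed.

Lemma error_sum_le H d b (K : nat) : uniq H -> admissible H -> (0 < size H)%N -> 0 < d <= 1 ->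
  (forall A, 0 < A -> exists C, forall N, 2 <= N ->
     \sum_(1 <= q < (Num.truncn (N `^ d)).+1) Estar N q <= C * (N * ln N `^ (- A))) ->
  (forall A, 0 < A -> exists C, forall N, 2 <= N ->
     \sum_(1 <= q < (Num.truncn (N `^ d)).+1) E2star N q <= C * (N * ln N `^ (- A))) ->
  exists N1, forall N RR, N1 <= N -> 2 <= RR -> RR <= N `^ (d / 2) ->
    \sum_(U : {set 'I_(Num.truncn RR).+1} | allp U && (Lg R U < 2 * ln RR))
      K%:R ^+ #|U| * (nstar R H U * E2star N (prm U) +
        \sum_(i in U) 2 * ln i%:R * (nstar R H (U :\ i) * Estar (N / i%:R) (prm (U :\ i)))) <= N / ln N ^+ b.
Proof.
(* Two spare logarithms: one is lost to the sum of log p/p over p up to R, the other absorbs the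
   constants. *)
move=> uH ad s0 d01 EB E2B; pose k := size H; pose b' := b.+2.
have /andP[d0 d1] := d01.
have c0 := normr_ge0 (C0 R).
have [Na NaP] : exists N1, forall N n, N1 <= N -> \sum_(V : {set 'I_n} | allp V && ((prm V)%:R <= N `^ d))
    (K * k)%:R ^+ #|V| * E2star N (prm V) <= N / ln N ^+ b'.
  apply: (@bv_weighted (@E2star R) (26 + 4 * `|C0 R|) d (K * k) b') => //; first exact: E2star_ge0.
  by move=> n V N aV N8 VN; have N2 : 2 <= N by [slra]; have [_] := @E2star_bound R n V N aV N2 VN.
have [Nb NbP] : exists N1, forall N n, N1 <= N -> \sum_(V : {set 'I_n} | allp V && ((prm V)%:R <= N `^ d))
    (K * k)%:R ^+ #|V| * Estar N (prm V) <= N / ln N ^+ b'.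
  apply: (@bv_weighted (@Estar R) 10 d (K * k) b') => //; first exact: Estar_ge0.
  move=> n V N aV N8 VN; have N2 : 2 <= N by [slra]; have [_ h] := @Estar_bound R n V N aV N2 VN.
  have L1 := ln_ge1 N8.
  apply: le_trans h _; rewrite ler_wpM2l // ler_wpM2r ?divr_ge0 ?exprn_ge0 // ler_wpM2l //; first slra.
  by rewrite -[leLHS]mulr1 expr2 ler_wpM2l //; slra.
have [Cm Cm0 CmP] := @mertens R.
pose M1 : R := 2 * K%:R * 2 ^+ b'.
have M10 : 0 <= M1 by rewrite mulr_ge0 ?exprn_ge0 ?mulr_ge0.
pose M := 8 + `|Na| + 2 * `|Nb| + (1 + M1 * (1 + Cm)).
have na0 := normr_ge0 Na; have nb0 := normr_ge0 Nb.
have M1C : 0 <= M1 * (1 + Cm) by rewrite mulr_ge0 //; slra.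
exists (expR M) => N RR NM R2 RN; have LM := le_ln_expR NM.
have NM1 : 1 + M <= N by apply: le_trans NM; exact: expR_ge1Dx.
have N8 : 8 <= N by move: NM1; rewrite /M; slra.
have N1 : 1 <= N by slra.
have L0 : 0 < ln N by move: LM; rewrite /M; slra.
have R0 : 0 < RR by slra.
have X0 : 0 <= ln RR by apply: ln_ge0; slra.
have XL : ln RR <= ln N / 2.
  have : ln RR <= ln (N `^ (d / 2)) by rewrite ler_ln ?posrE // powR_gt0; slra.
  by rewrite ln_powR => h; apply: le_trans h _; rewrite mulrC ler_wpM2l ?(ltW L0) //; slra.
under eq_bigr do rewrite mulrDr.
rewrite big_split /=.
have h1 : \sum_(U : {set 'I_(Num.truncn RR).+1} | allp U && (Lg R U < 2 * ln RR))
   K%:R ^+ #|U| * (nstar R H U * E2star N (prm U)) <= N / ln N ^+ b'.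
  apply: le_trans (NaP N (Num.truncn RR).+1 (ltac:(have := ler_norm Na; move: NM1; rewrite /M; slra))).
  rewrite big_mkcond [leRHS]big_mkcond; apply: ler_sum => U _; have E0 := E2star_ge0 N (prm U).
  case: ifP => [/andP[aU UX]|_]; last by case: ifP => // _; rewrite mulr_ge0 ?exprn_ge0.
  rewrite aU (prm_le_powR N1 R0 RN aU UX) /= natrM exprMn -[leRHS]mulrA ler_wpM2l ?exprn_ge0 //.
  by rewrite ler_wpM2r // nstar_le.
have h2 : \sum_(U : {set 'I_(Num.truncn RR).+1} | allp U && (Lg R U < 2 * ln RR))
   K%:R ^+ #|U| * \sum_(i in U) 2 * ln i%:R * (nstar R H (U :\ i) * Estar (N / i%:R) (prm (U :\ i))) <=
   M1 * (N / ln N ^+ b') * plog R (Num.truncn RR).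
  pose G (i : 'I_(Num.truncn RR).+1) (V : {set 'I_(Num.truncn RR).+1}) : R :=
    K%:R ^+ #|V|.+1 * (2 * ln i%:R * (nstar R H V * Estar (N / i%:R) (prm V))).
  have -> : \sum_(U : {set 'I_(Num.truncn RR).+1} | allp U && (Lg R U < 2 * ln RR))
   K%:R ^+ #|U| * \sum_(i in U) 2 * ln i%:R * (nstar R H (U :\ i) * Estar (N / i%:R) (prm (U :\ i)))
   = \sum_(U : {set 'I_(Num.truncn RR).+1} | allp U && (Lg R U < 2 * ln RR)) \sum_(i in U) G i (U :\ i).
    by apply: eq_bigr => U _; rewrite mulr_sumr; apply: eq_bigr => i iU; rewrite /G (cardsD1 i U) iU add1n.
  rewrite (sum_setD1_pairs (fun U => allp U && (Lg R U < 2 * ln RR)) G).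
  rewrite /plog big_mkord mulr_sumr [leRHS]big_mkcond; apply: ler_sum => i _.
  case: ifP => pi; last by rewrite big1 // => V; rewrite allpU1 pi.
  have l0 := @ln_prime_ge0 R i pi.
  have iR := ord_truncn_le i (ltW R0).
  have i1 : 1 <= i%:R :> R by rewrite ler1n prime_gt0.
  have i0 : 0 < i%:R :> R by slra.
  have lni : ln (i%:R : R) <= ln N / 2.
    by apply: le_trans XL; rewrite ler_ln ?posrE.
  have Ni0 : 0 < N / i%:R by rewrite divr_gt0 //; slra.
  (* The prime i is at most the square root of N, so a saving at N/i is worth the one at N up to the
     factor 2^b'. *)
  have lNi : ln N / 2 <= ln (N / i%:R) by rewrite ln_div ?posrE //; slra.
  have NiB : Nb <= N / i%:R.
    rewrite -[leRHS](@lnK _) ?posrE //; apply: le_trans (expR_ge1Dx _).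
    have := ler_norm Nb; move: LM; rewrite /M; slra.
  apply: (@le_trans _ _ (2 * ln i%:R * K%:R * (N / i%:R / ln (N / i%:R) ^+ b'))); last first.
    have -> : M1 * (N / ln N ^+ b') * (ln i%:R / i%:R) = 2 * ln i%:R * K%:R * (N / i%:R * (2 ^+ b' / ln N ^+ b')).
      by rewrite /M1; ring.
    rewrite ler_wpM2l ?mulr_ge0 // ler_wpM2l ?(ltW Ni0) //.
    rewrite -[2 ^+ b' / _]invrK invf_div lef_pV2 ?posrE ?divr_gt0 ?exprn_gt0 //; last slra.
    by rewrite -expr_div_n lerXn2r ?nnegrE //; slra.
  apply: le_trans (ler_wpM2l _ (NbP (N / i%:R) (Num.truncn RR).+1 NiB)); last by rewrite !mulr_ge0.
  rewrite mulr_sumr big_mkcond [leRHS]big_mkcond; apply: ler_sum => V _.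
  have E0 := Estar_ge0 (N / i%:R) (prm V).
  case: ifP => [/andP[/andP[aiV iVX] iV]|_]; last first.
    by case: ifP => // _; rewrite mulr_ge0 ?mulr_ge0 ?exprn_ge0.
  have aV : allp V by move: aiV; rewrite allpU1 => /andP[].
  (* The modulus i V is at most N^d; since d is at most 1, N^d/i is at most (N/i)^d, so V stays
     within the level of distribution at N/i. *)
  rewrite ifT; last first.
    rewrite aV /=; have := prm_le_powR N1 R0 RN aiV iVX.
    have e : N `^ d = (N / i%:R) `^ d * i%:R `^ d.
      by rewrite -(powRM d (ltW Ni0) (ltW i0)) divfK // lt0r_neq0.
    rewrite prmU1 // natrM e => h.
    have /andP[_ id] := powR_01 i1 (ltac:(rewrite d1 ltW //) : 0 <= d <= 1).
    rewrite -(ler_pM2l i0); apply: le_trans h _; rewrite [leRHS]mulrC ler_wpM2l // ltW // powR_gt0 //.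
  rewrite /G exprS natrM exprMn.
  have -> : K%:R * K%:R ^+ #|V| * (2 * ln i%:R * (nstar R H V * Estar (N / i%:R) (prm V))) =
     2 * ln i%:R * K%:R * (K%:R ^+ #|V| * (nstar R H V * Estar (N / i%:R) (prm V))) by ring.
  rewrite ler_wpM2l ?mulr_ge0 // -[leRHS]mulrA ler_wpM2l ?exprn_ge0 // ler_wpM2r //.
  exact: nstar_le.
have P1 : plog R (Num.truncn RR) <= ln N + Cm.
  have t0 : (0 < Num.truncn RR)%N by rewrite truncn_ge_nat; slra.
  have := CmP _ t0; rewrite ler_norml => /andP[_ h].
  have : ln (Num.truncn RR)%:R <= ln RR :> R by rewrite ler_ln ?posrE ?ltr0n // truncn_le ltW.
  slra.
have W0 : 0 <= N / ln N ^+ b' by rewrite divr_ge0 ?exprn_ge0 ?(ltW L0) //; slra.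
apply: (@le_trans _ _ ((1 + M1 * (ln N + Cm)) * (N / ln N ^+ b'))).
  rewrite [leRHS]mulrDl mul1r; apply: lerD => //; apply: le_trans h2 _.
  by rewrite [leLHS]mulrAC ler_wpM2r // ler_wpM2l.
apply: (@le_trans _ _ (ln N ^+ 2 * (N / ln N ^+ b'))).
  rewrite ler_wpM2r // expr2.
  have -> : 1 + M1 * (ln N + Cm) = 1 + M1 * Cm + M1 * ln N by ring.
  have MC0 : 0 <= M1 * Cm by rewrite mulr_ge0 // ltW.
  have LM' : 1 + M1 * (1 + Cm) <= ln N by move: LM; rewrite /M; slra.
  apply: le_trans (ler_wpM2r (ltW L0) LM').
  have : 1 + M1 * Cm <= (1 + M1 * Cm) * ln N by rewrite ler_peMr //; [slra|exact: ln_ge1].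
  rewrite !mulrDl; slra.
rewrite /b' !exprS le_eqVlt; apply/orP; left; apply/eqP; field.
by rewrite expf_neq0 ?lt0r_neq0.
Qed.
End ErrorTerms.

(** * Reduction of the left-hand side to quadratic forms *)

Section Arithmetic.
Variable R : realType.
Implicit Types (X Y Q t C N RR d B : R) (n p k l c b : nat) (H : seq int).

Lemma range_sum N (Q : pred nat) (F : nat -> R) : 0 <= N ->
  \sum_(0 <= n < (Num.truncn (2 * N)).+1 | (N < n%:R) && (n%:R <= 2 * N) && Q n) F n =
  \sum_((Num.truncn N).+1 <= n < (Num.truncn (2 * N)).+1 | Q n) F n.
Proof.
move=> N0; rewrite [RHS](@big_nat_widenl _ _ _ _ 0) // big_nat_cond [RHS]big_nat_cond; apply: eq_bigl => n.
by rewrite range_truncn // leq0n /=; case: (Q n); case: (Num.truncn N < n)%N; case: (n < _)%N.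
Qed.

(** A shift by one exchanges two boundary values; this is iterated |s| times in either direction. *)
Lemma shift_sum (g : int -> R) (a b : nat) (s : int) B : (a <= b)%N ->
  (forall m : int, (a%:Z - `|s|%:Z <= m <= b%:Z + `|s|%:Z)%R -> `|g m| <= B) ->
  `|\sum_(a <= n < b) g (n%:Z + s) - \sum_(a <= n < b) g n%:Z| <= 2 * `|s|%N%:R * B.
Proof.
move=> ab gB.
have step (h : int) : \sum_(a <= n < b) g (n%:Z + (h + 1)) - \sum_(a <= n < b) g (n%:Z + h) =
    g (b%:Z + h) - g (a%:Z + h).
  rewrite -sumrB -(telescope_sumr (fun n => g (n%:Z + h)) ab); apply: eq_bigr => n _.
  by congr (g _ - _); rewrite -addn1 PoszD; ring.
have key (j : nat) : (j <= `|s|)%N ->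
   `|\sum_(a <= n < b) g (n%:Z + j%:Z) - \sum_(a <= n < b) g n%:Z| <= 2 * j%:R * B /\
   `|\sum_(a <= n < b) g (n%:Z - j%:Z) - \sum_(a <= n < b) g n%:Z| <= 2 * j%:R * B.
  elim: j => [|j IH] js.
    have z1 (n : nat) : n%:Z + 0%N%:Z = n%:Z by lia.
    have z2 (n : nat) : n%:Z - 0%N%:Z = n%:Z by lia.
    have e1 : \sum_(a <= n < b) g (n%:Z + 0%N%:Z) = \sum_(a <= n < b) g n%:Z.
      by apply: eq_bigr => n _; rewrite z1.
    have e2 : \sum_(a <= n < b) g (n%:Z - 0%N%:Z) = \sum_(a <= n < b) g n%:Z.
      by apply: eq_bigr => n _; rewrite z2.
    by rewrite e1 ?e2 subrr normr0 mulr0 mul0r.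
  have [IH1 IH2] := IH (ltnW js).
  have b1 : `|g (b%:Z + j%:Z)| <= B by apply: gB; lia.
  have b2 : `|g (a%:Z + j%:Z)| <= B by apply: gB; lia.
  have b3 : `|g (b%:Z - j.+1%:Z)| <= B by apply: gB; lia.
  have b4 : `|g (a%:Z - j.+1%:Z)| <= B by apply: gB; lia.
  have s1 := step j%:Z; have s2 := step (- j.+1%:Z).
  have e1 : j%:Z + 1 = j.+1%:Z by lia.
  have e2 : - j.+1%:Z + 1 = - j%:Z by lia.
  rewrite e1 in s1; rewrite e2 in s2.
  move: IH1 IH2 b1 b2 b3 b4; rewrite !ler_norml -natr1.
  set x1 := \sum_(a <= n < b) g (n%:Z + j.+1%:Z) in s1 *.
  set x2 := \sum_(a <= n < b) g (n%:Z - j.+1%:Z) in s2 *.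
  move=> /andP[? ?] /andP[? ?] /andP[? ?] /andP[? ?] /andP[? ?] /andP[? ?].
  by split; apply/andP; split; lra.
have [k1 k2] := key `|s|%N (leqnn _).
have : s = `|s|%N%:Z \/ s = - `|s|%N%:Z by lia.
move: k1 k2; move: `|s|%N => j k1 k2.
by case=> ->.
Qed.

Lemma Ppoly_neq0 H (m : int) : (forall h, h \in H -> m + h != 0) -> Ppoly H m != 0.
Proof. by move=> h; rewrite /Ppoly prodf_seq_neq0; apply/allP => x xH; rewrite /= h. Qed.

(** Inserting R/d, which exceeds 1 on the support, reduces the sum to one with weight 1/d. This
    crude bound is enough for the boundary terms of the shift. *)
Lemma sum_lam_le H l : uniq H -> admissible H -> (0 < size H)%N ->
  exists2 C, 0 < C & exists c, forall RR n, 1 < RR ->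
    \sum_(D : {set 'I_n}) `|lam RR H l D| <= C * (1 + ln RR) ^+ c * RR.
Proof.
move=> uH ad s0; have [C1 C10 B1] := @lam_bound R H l uH ad s0.
have [C2 C20 B2] := @sum_natX_upper R (size H).+1.
exists (C1 * C2); first exact: mulr_gt0.
exists (l + (size H).+2 + (size H).+1.+2)%N => RR n R1.
have X0 : 0 < ln RR by rewrite ln_gt0.
apply: le_trans (ler_sum _ (fun D _ => B1 RR n D R1)) _; rewrite -mulr_sumr.
have -> : C1 * C2 * (1 + ln RR) ^+ (l + (size H).+2 + (size H).+1.+2) * RR =
   C1 * (1 + ln RR) ^+ (l + (size H).+2) * (RR * (C2 * (1 + ln RR) ^+ (size H).+1.+2)).
  by rewrite [X in _ * X * RR]exprD; ring.
have p0 : 0 <= (1 + ln RR) ^+ (l + (size H).+2) by rewrite exprn_ge0 //; slra.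
apply: ler_wpM2l; first exact: mulr_ge0 (ltW C10) p0.
apply: le_trans (ler_wpM2l _ (B2 n _ X0)); last by slra.
rewrite -big_mkcond mulr_sumr; apply: ler_sum => D /andP[aD DX].
have v0 : 0 < (prm D)%:R :> R by rewrite ltr0n prm_gt0.
rewrite mulrCA ler_peMr ?exprn_ge0 // ler_pdivlMr // mul1r.
by rewrite -ler_ln ?posrE //; [rewrite ln_prm // ltW|slra].
Qed.

(** The prediction for [Ssum]: the first line comes from m coprime to the modulus, the second from m
    = i q with i in U and q a prime in the reduced classes mod the remaining primes. *)
Definition mainterm N H n (U : {set 'I_n}) : R :=
  N * (Fstar R H U * (ln N + C0 R - 2 * \sum_(i in U) ln i%:R / i%:R)
      + 2 * \sum_(i in U) ln i%:R / i%:R * Fstar R H (U :\ i)).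

Lemma sum_Lam_Lam N RR H (h0 : int) l1 l2 : 0 <= N -> 0 < RR ->
  (forall m : nat, N < m%:R -> Ppoly H (m%:Z - h0) != 0) ->
  \sum_((Num.truncn N).+1 <= m < (Num.truncn (2 * N)).+1)
     vpi2z R m%:Z * Lam RR H l1 (m%:Z - h0) * Lam RR H l2 (m%:Z - h0) =
  \sum_(D : {set 'I_(Num.truncn RR).+1}) \sum_(E : {set 'I_(Num.truncn RR).+1})
     lam RR H l1 D * lam RR H l2 E * Ssum N H h0 (D :|: E).
Proof.
move=> N0 R0 P0.
under [RHS]eq_bigr => D _ do under eq_bigr => E _ do rewrite /Ssum range_sum // big_mkcond mulr_sumr.
under [RHS]eq_bigr => D _ do rewrite exchange_big.
rewrite [RHS]exchange_big; apply: eq_big_nat => m /andP[mN _].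
have Nm : N < m%:R by case: m mN => [|m] //; rewrite ltnS truncn_le_nat.
rewrite !Lam_sum ?P0 // -mulrA big_distrlr mulr_sumr; apply: eq_bigr => D _ /=.
rewrite mulr_sumr; apply: eq_bigr => E _.
have [aD|nD] := boolP (allp D); last by rewrite (lam_nallp _ _ _ nD) /= ?(mul0r, mulr0).
have [aE|nE] := boolP (allp E); last by rewrite (lam_nallp _ _ _ nE) /= ?(mul0r, mulr0).
have -> : (prm (D :|: E) %| `|Ppoly H (m%:Z - h0)|)%N =
   (prm D %| `|Ppoly H (m%:Z - h0)|)%N && (prm E %| `|Ppoly H (m%:Z - h0)|)%N.
  rewrite !dvd_prm_all ?allpU ?aD ?aE //; apply/forall_inP/andP => [h|[/forall_inP hD /forall_inP hE] i].
    by split; apply/forall_inP => i iD; apply: h; rewrite inE iD ?orbT.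
  by rewrite inE => /orP[/hD|/hE].
rewrite /=; case: (prm D %| _)%N; case: (prm E %| _)%N; rewrite ?(mul0r, mulr0) //.
by rewrite /= mulrC.
Qed.
End Arithmetic.

Section ArithmeticMain.
Variable R : realType.
Implicit Types (X Y Q t C N RR d B : R) (n p k l c b : nat) (H : seq int).

Lemma powR_half_sqr N d : 0 < N -> N `^ (d / 2) * N `^ (d / 2) = N `^ d.
Proof. by move=> N0; rewrite -powRD ?lt0r_neq0 ?implybT //; congr (_ `^ _); field. Qed.

Lemma Ssum_error_sum H (h0 : int) l1 l2 d : uniq H -> admissible H -> (0 < size H)%N -> h0 \in H -> 0 < d < 1 ->
  (forall A, 0 < A -> exists C, forall N, 2 <= N ->
     \sum_(1 <= q < (Num.truncn (N `^ d)).+1) Estar N q <= C * (N * ln N `^ (- A))) ->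
  (forall A, 0 < A -> exists C, forall N, 2 <= N ->
     \sum_(1 <= q < (Num.truncn (N `^ d)).+1) E2star N q <= C * (N * ln N `^ (- A))) ->
  exists N1, forall N RR, N1 <= N -> 2 <= RR -> RR <= N `^ (d / 2) ->
    `|\sum_(D : {set 'I_(Num.truncn RR).+1}) \sum_(E : {set 'I_(Num.truncn RR).+1})
       lam RR H l1 D * lam RR H l2 E * (Ssum N H h0 (D :|: E) - mainterm N H (D :|: E))| <= N / 2.
Proof.
move=> uH ad s0 hH /andP[d0 d1] EB E2B; have d01 : 0 < d <= 1 by rewrite d0 ltW.
have [C1 C10 B1] := @lam_bound R H l1 uH ad s0.
have [C2 C20 B2] := @lam_bound R H l2 uH ad s0.
pose m := ((l1 + (size H).+2) + (l2 + (size H).+2))%N.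
(* The two sieve weights cost (log N)^m together, so m + 1 powers are saved. The base (k + 2)^2 is
   what [sum_union_le] yields from the weights (k + 1)^|D|. *)
have [N1 NP] := @error_sum_le R H d m.+1 ((size H).+2 ^ 2) uH ad s0 d01 EB E2B.
have CC : 0 < C1 * C2 by exact: mulr_gt0.
exists (expR (8 + `|N1| + 2 * (C1 * C2))) => N RR NM R2 RN.
have LM := le_ln_expR NM; have a0 := normr_ge0 N1.
have NM1 : 9 + `|N1| <= N by apply: le_trans NM; apply: le_trans (expR_ge1Dx _); slra.
have N10 : 0 < N by slra.
have Nge1 : 1 <= N by slra.
have R0 : 0 < RR by slra.
have X0 : 0 <= ln RR by apply: ln_ge0; slra.
have RRN : RR * RR <= N.
  apply: le_trans (_ : N `^ d <= _); last by have /andP[] := @powR_01 R N d (ltac:(slra)) (ltac:(slra)).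
  by rewrite -powR_half_sqr //; apply: ler_pM => //; exact: ltW.
have X2 : 2 * ln RR <= ln N.
  have : ln (RR * RR) <= ln N by rewrite ler_ln ?posrE // mulr_gt0.
  by rewrite lnM ?posrE //; slra.
have LX : 1 + ln RR <= ln N by slra.
have L0 : 0 < ln N by slra.
pose ind (D : {set 'I_(Num.truncn RR).+1}) : R :=
  if allp D && (Lg R D < ln RR) then ((size H).+1)%:R ^+ #|D| else 0.
have ind0 D : 0 <= ind D by rewrite /ind; case: ifP => // _; rewrite exprn_ge0.
pose Z (U : {set 'I_(Num.truncn RR).+1}) := `|Ssum N H h0 U - mainterm N H U|.
apply: (@le_trans _ _ (\sum_(D : {set 'I_(Num.truncn RR).+1}) \sum_(E : {set 'I_(Num.truncn RR).+1})
   C1 * C2 * ln N ^+ m * (ind D * ind E * Z (D :|: E)))).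
  apply: le_trans (ler_norm_sum _ _ _) _; apply: ler_sum => D _.
  apply: le_trans (ler_norm_sum _ _ _) _; apply: ler_sum => E _.
  rewrite normrM -/(Z _) normrM [leRHS]mulrA ler_wpM2r ?normr_ge0 //.
  have h (l : nat) (C : R) (D' : {set 'I_(Num.truncn RR).+1}) : 0 < C ->
     `|lam RR H l D'| <= C * (1 + ln RR) ^+ (l + (size H).+2) * ind D' ->
     `|lam RR H l D'| <= C * ln N ^+ (l + (size H).+2) * ind D'.
    move=> C0 hh; apply: le_trans hh _; rewrite ler_wpM2r // ler_wpM2l ?(ltW C0) //.
    by rewrite lerXn2r ?nnegrE //; slra.
  have R1 : 1 < RR by slra.
  have -> : C1 * C2 * ln N ^+ m * (ind D * ind E) =
     C1 * ln N ^+ (l1 + (size H).+2) * ind D * (C2 * ln N ^+ (l2 + (size H).+2) * ind E).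
    by rewrite /m exprD; ring.
  by apply: ler_pM => //; [apply: h => //; exact: B1|apply: h => //; exact: B2].
under eq_bigr do rewrite -mulr_sumr.
rewrite -mulr_sumr.
have P0 : 0 <= C1 * C2 * ln N ^+ m by rewrite mulr_ge0 ?(ltW CC) // exprn_ge0 // ltW.
apply: le_trans (ler_wpM2l P0 (@sum_union_le R _ (size H).+1 (ln RR) Z _)) _ => [U|]; first exact: normr_ge0.
have NP' := NP N RR (ltac:(have := ler_norm N1; slra)) R2 RN.
apply: (@le_trans _ _ (C1 * C2 * ln N ^+ m * (N / ln N ^+ m.+1))).
  apply: ler_wpM2l => //; apply: le_trans NP'; apply: ler_sum => U /andP[aU UX].
  apply: ler_wpM2l; first by rewrite exprn_ge0.
  have UN : (prm U)%:R <= N.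
    apply: le_trans (prm_le_powR Nge1 R0 RN aU UX) _.
    by have /andP[] := @powR_01 R N d (ltac:(slra)) (ltac:(slra)).
  have iR (i : 'I_(Num.truncn RR).+1) := ord_truncn_le i (ltW R0).
  apply: Ssum_main => // [|i j _ _|i iU]; first by slra.
    by rewrite natrM; apply: le_trans RRN; apply: ler_pM.
  have i0 : 0 < i%:R :> R by rewrite ltr0n prime_gt0 // (allpP U aU).
  split; rewrite ler_pdivlMr //.
    by apply: le_trans RRN; apply: ler_pM => //; slra.
  apply: le_trans UN; rewrite mulrC -natrM -prmU1 ?setD1K //.
  by rewrite !inE eqxx.
have -> : C1 * C2 * ln N ^+ m * (N / ln N ^+ m.+1) = C1 * C2 * N / ln N.
  by rewrite exprS; field; rewrite expf_neq0 ?lt0r_neq0.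
rewrite ler_pdivrMr // [leLHS]mulrC -[leRHS]mulrA ler_wpM2l ?(ltW N10) //; slra.
Qed.

Lemma shift_neq0 (m a : nat) (x h : int) : (`|h| <= a)%N -> (`|x|%N + a < m)%N -> m%:Z - x + h != 0.
Proof. lia. Qed.

Lemma arith_main H (h0 : int) l1 l2 d : uniq H -> admissible H -> (0 < size H)%N -> h0 \in H -> 0 < d < 1 ->
  (forall A, 0 < A -> exists C, forall N, 2 <= N ->
     \sum_(1 <= q < (Num.truncn (N `^ d)).+1) Estar N q <= C * (N * ln N `^ (- A))) ->
  (forall A, 0 < A -> exists C, forall N, 2 <= N ->
     \sum_(1 <= q < (Num.truncn (N `^ d)).+1) E2star N q <= C * (N * ln N `^ (- A))) ->
  exists N1, forall N RR, N1 <= N -> 2 <= RR -> RR <= N `^ (d / 2) ->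
    `|LHS7 N RR H h0 l1 l2 -
      \sum_(D : {set 'I_(Num.truncn RR).+1}) \sum_(E : {set 'I_(Num.truncn RR).+1})
       lam RR H l1 D * lam RR H l2 E * mainterm N H (D :|: E)| <= N.
Proof.
move=> uH ad s0 hH d01 EB E2B.
have [N1 NP] := @Ssum_error_sum H h0 l1 l2 d uH ad s0 hH d01 EB E2B.
case/andP: d01 => d0 d1.
have [C1 C10 [c1 B1]] := @sum_lam_le R H l1 uH ad s0.
have [C2 C20 [c2 B2]] := @sum_lam_le R H l2 uH ad s0.
pose j := `|h0|%N; pose hs := (\sum_(h <- H) `|h|)%N.
(* The shift by [h0] costs 2|h0| terms, each at most R^2 times logarithms; R^2 is at most N^d, and
   the positive exponent 1 - d absorbs the rest. *)
have [N2 NQ] := @polylog_le_powR R (16 * j%:R * (C1 * C2)) (2 + c1 + c2) (1 - d) (ltac:(slra)).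
exists (expR (8 + `|N1| + `|N2| + j%:R + j%:R + hs%:R)) => N RR NM R2 RN.
have LM := le_ln_expR NM; have a1 := normr_ge0 N1; have a2 := normr_ge0 N2.
have j0 : 0 <= j%:R :> R by []. have hs0 : 0 <= hs%:R :> R by [].
have NM1 : 9 + `|N1| + `|N2| + j%:R + j%:R + hs%:R <= N by apply: le_trans NM; apply: le_trans (expR_ge1Dx _); slra.
have N0 : 0 < N by slra.
have R0 : 0 < RR by slra.
have X0 : 0 <= ln RR by apply: ln_ge0; slra.
have XL : ln RR <= ln N / 2.
  have : ln RR <= ln (N `^ (d / 2)) by rewrite ler_ln ?posrE // powR_gt0.
  rewrite ln_powR => h; apply: le_trans h _; rewrite mulrC ler_wpM2l //; slra.
have L0 : 0 < ln N by slra.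
set g := fun m : int => vpi2z R m * Lam RR H l1 (m - h0) * Lam RR H l2 (m - h0).
have -> : LHS7 N RR H h0 l1 l2 = \sum_((Num.truncn N).+1 <= n < (Num.truncn (2 * N)).+1) g (n%:Z + h0).
  rewrite -(range_sum xpredT (fun n => g (n%:Z + h0)) (ltW N0)) /LHS7; apply: eq_big => n; first by rewrite andbT.
  by rewrite /g addrK.
have ab : ((Num.truncn N).+1 <= (Num.truncn (2 * N)).+1)%N.
  by rewrite ltnS truncn_ge_nat; [have := truncn_le N; rewrite (ltW N0); slra|slra].
set B := (2 * ln N) ^+ 2 * (C1 * ln N ^+ c1 * RR) * (C2 * ln N ^+ c2 * RR).
have LB (l c : nat) (C : R) (m : int) : 0 < C -> (forall RR n, 1 < RR -> \sum_(D : {set 'I_n}) `|lam RR H l D| <= C * (1 + ln RR) ^+ c * RR) ->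
    `|Lam RR H l m| <= C * ln N ^+ c * RR.
  move=> C0 hC; apply: le_trans (Lam_le _ _ _ R0) _; apply: le_trans (hC RR _ _) _; first slra.
  rewrite ler_wpM2r ?(ltW R0) // ler_wpM2l ?(ltW C0) // lerXn2r ?nnegrE //; slra.
have gB (m : int) : ((Num.truncn N).+1%:Z - j%:Z <= m <= (Num.truncn (2 * N)).+1%:Z + j%:Z)%R -> `|g m| <= B.
  move=> /andP[_ mb]; rewrite /g !normrM; apply: ler_pM => //; last exact: LB.
  apply: ler_pM => //; last exact: LB.
  case: m mb => m mb; last by rewrite /= normr0 sqr_ge0.
  rewrite /= (ger0_norm (vpi2_ge0 _ _)).
  have m0 : (m <= (Num.truncn (2 * N)).+1 + j)%N by rewrite -lez_nat PoszD.
  apply: le_trans (vpi2_le R _ m0) _; first by rewrite addSn.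
  have l1' : 0 <= ln ((Num.truncn (2 * N)).+1 + j)%N%:R :> R by apply: ln_ge0; rewrite ler1n addSn.
  have l2' : 0 <= 2 * ln N by rewrite mulr_ge0 // ltW.
  suff le12 : ln ((Num.truncn (2 * N)).+1 + j)%N%:R <= 2 * ln N by apply: lerXn2r.
  have -> : 2 * ln N = ln (N ^+ 2) by rewrite lnXn // mulr2n; ring.
  rewrite ler_ln ?posrE ?ltr0n ?addSn ?exprn_gt0 // -addSn natrD -natr1.
  have : (Num.truncn (2 * N))%:R <= 2 * N by rewrite truncn_le; slra.
  by move=> h; rewrite expr2; apply: (@le_trans _ _ (3 * N)); [slra|rewrite ler_wpM2r ?(ltW N0) //; slra].
have SH := shift_sum ab gB.
have PN (m : nat) : N < m%:R -> Ppoly H (m%:Z - h0) != 0.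
  move=> Nm; apply: Ppoly_neq0 => h hH'.
  have hh : (`|h| <= hs)%N by rewrite /hs (big_rem h) //= leq_addr.
  have : (j + hs)%:R < m%:R :> R by rewrite natrD; slra.
  by rewrite ltr_nat; apply: shift_neq0.
have E := sum_Lam_Lam l1 l2 (ltW N0) R0 PN.
rewrite -/g in E; rewrite E in SH.
have := NP N RR (ltac:(have := ler_norm N1; slra)) R2 RN.
under eq_bigr => D _ do (under eq_bigr => E' _ do rewrite mulrBr; rewrite sumrB).
rewrite sumrB.
set S1 := \sum_D _ in SH *; set S2 := \sum_D _ => H1.
have HB : 2 * j%:R * B <= N / 2.
  have RRN : RR * RR <= N `^ d by rewrite -powR_half_sqr //; apply: ler_pM => //; exact: ltW.
  have -> : N / 2 = N `^ d * N `^ (1 - d) / 2.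
    by rewrite -powRD ?lt0r_neq0 ?implybT // (_ : d + (1 - d) = 1) ?powRr1 ?(ltW N0) //; ring.
  have -> : 2 * j%:R * B = RR * RR * (16 * j%:R * (C1 * C2) * ln N ^+ (2 + c1 + c2)) / 2.
    by rewrite /B !exprD; field.
  rewrite ler_wpM2r //; apply: ler_pM => //.
  - by rewrite mulr_ge0 // ltW.
  - by apply: mulr_ge0; [rewrite !mulr_ge0 ?(ltW C10) ?(ltW C20)|rewrite exprn_ge0 // ltW].
  by apply: NQ; have := ler_norm N2; slra.
rewrite -/j in SH.
by rewrite -(subrK S1 (\sum_(_ <= _ < _) _)) -addrA; apply: le_trans (ler_normD _ _) _; slra.
Qed.
End ArithmeticMain.

(** * Main terms *)

Section MainTermAlgebra.
Variable R : realType.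
Implicit Types (X Y t C RR : R) (p k l c b : nat) (H : seq int).

Definition Fw H p : R := ((nu H p)%:R - 1) / (p%:R - 1).
Definition inset n (A : {set 'I_n}) : pred nat := fun q => [exists i in A, (i : nat) == q].
Definition Gam H n (A : {set 'I_n}) : R := gprod (fun p => Fw H p * (1 - Fw H p) * (fw R H p * gw R H p) ^+ 2) A.
Definition Vw n (A : {set 'I_n}) l Y : R := setsum n (gmask R (inset A)) (pw l) Y.

Lemma inset_ord n (A : {set 'I_n}) (i : 'I_n) : inset A i = (i \in A).
Proof.
apply/exists_inP/idP => [[j jA /eqP/val_inj <-] //|iA]; by exists i.
Qed.

Lemma prod_inset n (A : {set 'I_n}) (h : nat -> R) : allp A ->
  \prod_(0 <= q < n | prime q && inset A q) h q = \prod_(i in A) h i.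
Proof.
move=> aA; rewrite big_mkord; apply: eq_bigl => i; rewrite inset_ord.
by case: (boolP (i \in A)) => iA; rewrite ?andbF // (allpP A aA).
Qed.

Lemma setsum_disjoint n (A A' : {set 'I_n}) (F : R -> R) Y : A \subset A' ->
  setsum n (gmask R (inset A')) F Y =
  \sum_(B : {set 'I_n} | [disjoint A & B]) (\prod_(i in B) onprimes (gmask R (inset A')) i) * F (Y - Lg R B).
Proof.
move=> /subsetP sA; rewrite /setsum [RHS]big_mkcond; apply: eq_bigr => B _.
case: ifP => // /negbT; rewrite disjoint_subset => /subsetPn[i iA]; rewrite inE negbK => iB.
by rewrite /gprod (bigD1 i) //= /onprimes /gmask inset_ord sA // if_same !mul0r.
Qed.

(** The first identity makes the inner sums totient-weighted, the second is the condition in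
    [sum_lamset_mem], and the third turns the outer weight times the squared density of the inner
    sums into [Gs]. *)
Lemma one_sub_fF H p : admissible H -> (0 < size H)%N -> prime p ->
  [/\ (1 - fw R H p * Fw H p) * gw R H p = invm1 R p, gw R H p - fw R H p * gw R H p = -1 &
   Fw H p * (1 - Fw H p) * (fw R H p * gw R H p) ^+ 2 * (1 - p%:R^-1) ^+ 2 = Gs R H p].
Proof.
move=> ad s0 pp; have [h1 h2 h3] := @nu_real R _ _ ad s0 pp.
rewrite /fw /gw /Fw /Gs /invm1; set v : R := (nu H p)%:R in h1 h2 h3 *; set P : R := p%:R in h2 *.
have v0 : v != 0 by rewrite lt0r_neq0 //; slra.
have P0 : P != 0 by rewrite lt0r_neq0 //; slra.
have P1 : P - 1 != 0 by rewrite lt0r_neq0 //; slra.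
have Pv : P - v != 0 by rewrite lt0r_neq0 //; slra.
by split; field; rewrite ?v0 ?P0 ?P1 ?Pv.
Qed.

Lemma ysum_V RR H l n (A : {set 'I_n}) : admissible H -> (0 < size H)%N ->
  ysum (fun i : 'I_n => (1 - fw R H i * Fw H i) * onprimes (gw R H) i) (@wfun R RR H l n) A =
  sing R H / l`!%:R * Vw A l (ln RR - Lg R A).
Proof.
move=> ad s0; rewrite /Vw (setsum_disjoint _ _ (subxx A)) /ysum mulr_sumr; apply: eq_bigr => B dAB.
rewrite /wfun LgU // opprD addrA [RHS]mulrCA; congr (_ * _).
apply: eq_bigr => i iB; rewrite /onprimes /gmask inset_ord.
have -> : (i \in A) = false by apply/negP => iA; move: dAB; rewrite disjoint_subset => /subsetP /(_ i iA); rewrite !inE iB.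
by case: ifP => pi; rewrite ?mulr0 //; have [-> _ _] := one_sub_fF ad s0 pi.
Qed.

(** Masking the weight at p adds p to the excluded primes, and evaluating the cut-off at [p |: T]
    shifts its argument by log p. *)
Lemma ysum_mask_V RR H l n (p : 'I_n) t (A : {set 'I_n}) : admissible H -> (0 < size H)%N -> prime p -> p \notin A ->
  ysum (fun i : 'I_n => (1 - fw R H i * Fw H i) * mask p (fun i : 'I_n => onprimes (gw R H) i) i)
    (fun T => @wfun R RR H l n T + t * @wfun R RR H l n (p |: T)) A =
  sing R H / l`!%:R * (Vw (p |: A) l (ln RR - Lg R A) + t * Vw (p |: A) l (ln RR - Lg R A - ln p%:R)).
Proof.
move=> ad s0 pp pA; rewrite /Vw !(setsum_disjoint _ _ (subsetUr [set p] A)) /ysum.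
rewrite mulr_sumr -big_split mulr_sumr; apply: eq_bigr => B dAB /=.
have dF i : i \in B -> (i \in A) = false.
  by move=> iB; apply/negP => iA; move: dAB; rewrite disjoint_subset => /subsetP /(_ i iA); rewrite !inE iB.
have -> : \prod_(i in B) ((1 - fw R H i * Fw H i) * mask p (fun i : 'I_n => onprimes (gw R H) i) i) =
   \prod_(i in B) onprimes (gmask R (inset (p |: A))) i.
  apply: eq_bigr => i iB; rewrite /onprimes /gmask inset_ord !inE dF // orbF /mask.
  case: eqP => [->|_]; first by rewrite mulr0 if_same.
  by case: ifP => pi; rewrite ?mulr0 //; have [-> _ _] := one_sub_fF ad s0 pi.
have [pB|pB] := boolP (p \in B).
  have -> : \prod_(i in B) onprimes (gmask R (inset (p |: A))) i = 0.
    by rewrite (bigD1 p) //= /onprimes /gmask inset_ord !inE eqxx if_same mul0r.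
  by rewrite !mul0r mulr0 addr0 mulr0.
rewrite /wfun LgU //.
have -> : Lg R (p |: (A :|: B)) = ln p%:R + (Lg R A + Lg R B).
  rewrite -LgU // /Lg big_setU1 //= inE negb_or pA //.
have -> : ln RR - (ln p%:R + (Lg R A + Lg R B)) = ln RR - Lg R A - ln p%:R - Lg R B by ring.
have -> : ln RR - (Lg R A + Lg R B) = ln RR - Lg R A - Lg R B by ring.
ring.
Qed.

Definition Qsum RR H l1 l2 n : R :=
  \sum_(D : {set 'I_n}) \sum_(E : {set 'I_n}) lam RR H l1 D * lam RR H l2 E * Fstar R H (D :|: E).
Definition Bsum RR H l1 l2 n (p : 'I_n) : R :=
  \sum_(D : {set 'I_n}) \sum_(E : {set 'I_n} | p \in D :|: E) lam RR H l1 D * lam RR H l2 E * Fstar R H ((D :|: E) :\ p).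

Lemma Gam_prod H n (A : {set 'I_n}) :
  \prod_(i in A) (Fw H i * (1 - Fw H i) * (fw R H i * onprimes (gw R H) i) ^+ 2) = Gam H A.
Proof. by apply: eq_bigr => i _; rewrite /onprimes; case: ifP => // _; rewrite mulr0 expr0n mulr0. Qed.

Lemma Qsum_V RR H l1 l2 n : admissible H -> (0 < size H)%N ->
  Qsum RR H l1 l2 n = sing R H ^+ 2 / (l1`!%:R * l2`!%:R) *
   \sum_(A : {set 'I_n}) Gam H A * (Vw A l1 (ln RR - Lg R A) * Vw A l2 (ln RR - Lg R A)).
Proof.
move=> ad s0; rewrite /Qsum /lam /Fstar.
rewrite (diagonalization (fun i : 'I_n => fw R H i) _ (fun i : 'I_n => Fw H i)) mulr_sumr.
by apply: eq_bigr => A _; rewrite Gam_prod !ysum_V // invfM; ring.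
Qed.

Lemma Bsum_nprime RR H l1 l2 n (p : 'I_n) : ~~ prime p -> Bsum RR H l1 l2 p = 0.
Proof.
move=> np; rewrite /Bsum big1 // => D _; rewrite big1 // => E; rewrite inE => /orP[pD|pE].
  rewrite lam_nallp ?mul0r //; apply/negP => aD; case/negP: np; exact: allpP aD p pD.
rewrite (lam_nallp RR H l2 (D := E)) ?mulr0 ?mul0r //; apply/negP => aE; case/negP: np; exact: allpP aE p pE.
Qed.

(** With x' and y' the values of x and y shifted by log p, this expands (x - x')(y - y') - (x + g
    x')(y + g y'). The products x y cancel, so every remaining term contains a shift by log p. *)
Lemma Bsum_V RR H l1 l2 n (p : 'I_n) : admissible H -> (0 < size H)%N -> prime p ->
  Bsum RR H l1 l2 p = sing R H ^+ 2 / (l1`!%:R * l2`!%:R) *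
   \sum_(A : {set 'I_n} | p \notin A) Gam H A *
    (let Y := ln RR - Lg R A in let V := Vw (p |: A) in let Z := Y - ln p%:R in
     - (1 + gw R H p) * (V l1 Y * V l2 Z + V l1 Z * V l2 Y) + (1 - gw R H p ^+ 2) * (V l1 Z * V l2 Z)).
Proof.
move=> ad s0 pp; rewrite /Bsum /lam /Fstar.
have [_ fg _] := one_sub_fF ad s0 pp.
rewrite (@sum_lamset_mem _ R p (fun i : 'I_n => fw R H i) _ (fun i : 'I_n => Fw H i)); last first.
  by rewrite /onprimes pp.
have red t : \sum_(D : {set 'I_n}) \sum_(E : {set 'I_n})
   lamset (fun i : 'I_n => fw R H i) (mask p (fun i : 'I_n => onprimes (gw R H) i))
     (fun T => @wfun R RR H l1 n T + t * @wfun R RR H l1 n (p |: T)) D *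
   lamset (fun i : 'I_n => fw R H i) (mask p (fun i : 'I_n => onprimes (gw R H) i))
     (fun T => @wfun R RR H l2 n T + t * @wfun R RR H l2 n (p |: T)) E * \prod_(i in D :|: E) Fw H i =
   sing R H ^+ 2 / (l1`!%:R * l2`!%:R) * \sum_(A : {set 'I_n} | p \notin A) Gam H A *
    ((Vw (p |: A) l1 (ln RR - Lg R A) + t * Vw (p |: A) l1 (ln RR - Lg R A - ln p%:R)) *
     (Vw (p |: A) l2 (ln RR - Lg R A) + t * Vw (p |: A) l2 (ln RR - Lg R A - ln p%:R))).
  rewrite (diagonalization (fun i : 'I_n => fw R H i) _ (fun i : 'I_n => Fw H i)) mulr_sumr.
  rewrite (bigID (fun A : {set 'I_n} => p \in A)) /= big1 ?add0r => [|A pA]; last first.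
    by rewrite (bigD1 p) //= /mask eqxx mulr0 expr0n mulr0 !mul0r.
  apply: eq_bigr => A pA; rewrite !ysum_mask_V //.
  have -> : \prod_(i in A) (Fw H i * (1 - Fw H i) * (fw R H i * mask p (fun i : 'I_n => onprimes (gw R H) i) i) ^+ 2) = Gam H A.
    rewrite -Gam_prod; apply: eq_bigr => i iA; rewrite /mask.
    by case: eqP => // e; rewrite -e iA in pA.
  rewrite invfM; ring.
have mN l : (fun T => @wfun R RR H l n T - @wfun R RR H l n (p |: T)) =
            (fun T => @wfun R RR H l n T + (-1) * @wfun R RR H l n (p |: T)).
  by apply/funext => T; rewrite mulN1r.
rewrite !mN !red -mulrBr -sumrB; congr (_ * _); apply: eq_bigr => A pA.
rewrite /onprimes pp /=; ring.
Qed.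

(** [Fstar] factors off the prime i as [Fw H i], so the negative sum over primes in the [vpi2]
    asymptotics and the positive one from prime multiples merge into a single sum with weight 1 -
    [Fw]. *)
Lemma mainterm_split N RR H l1 l2 n :
  \sum_(D : {set 'I_n}) \sum_(E : {set 'I_n}) lam RR H l1 D * lam RR H l2 E * mainterm N H (D :|: E) =
  N * ((ln N + C0 R) * Qsum RR H l1 l2 n + 2 * \sum_(i < n) ln i%:R / i%:R * (1 - Fw H i) * Bsum RR H l1 l2 i).
Proof.
pose s (i : 'I_n) : R := ln i%:R / i%:R.
have e (U : {set 'I_n}) : mainterm N H U =
   N * ((ln N + C0 R) * Fstar R H U + 2 * \sum_(i in U) s i * (1 - Fw H i) * Fstar R H (U :\ i)).
  have h1 : Fstar R H U * \sum_(i in U) s i = \sum_(i in U) s i * Fw H i * Fstar R H (U :\ i).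
    rewrite mulr_sumr; apply: eq_bigr => i iU.
    by rewrite {1}/Fstar (big_setD1 i) //= -/(Fstar R H (U :\ i)) -/(Fw H i); ring.
  have -> : \sum_(i in U) s i * (1 - Fw H i) * Fstar R H (U :\ i) =
     \sum_(i in U) s i * Fstar R H (U :\ i) - \sum_(i in U) s i * Fw H i * Fstar R H (U :\ i).
    by rewrite -sumrB; apply: eq_bigr => i _; ring.
  by rewrite -h1 /mainterm; ring.
have eB : \sum_(i < n) s i * (1 - Fw H i) * Bsum RR H l1 l2 i =
   \sum_(D : {set 'I_n}) \sum_(E : {set 'I_n}) lam RR H l1 D * lam RR H l2 E *
     \sum_(i in D :|: E) s i * (1 - Fw H i) * Fstar R H ((D :|: E) :\ i).
  under eq_bigr => i _ do rewrite /Bsum mulr_sumr.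
  rewrite exchange_big; apply: eq_bigr => D _ /=.
  under eq_bigr => i _ do rewrite mulr_sumr.
  rewrite (exchange_big_dep xpredT) //=; apply: eq_bigr => E _.
  by rewrite mulr_sumr; apply: eq_bigr => i _; ring.
rewrite -/s eB /Qsum !mulr_sumr -big_split /= mulr_sumr; apply: eq_bigr => D _.
rewrite !mulr_sumr -big_split /= mulr_sumr; apply: eq_bigr => E _.
by rewrite e; ring.
Qed.
End MainTermAlgebra.

(** * Inner sums and the contribution of one prime *)

Section InnerSums.
Variable R : realType.
Implicit Types (X Y C M a b q g w : R) (p k l c : nat) (H : seq int).

(** The factor by which excluding p enlarges the error in [setsum_coprime]. *)
Definition rr (c : R) p : R := 1 + c * ((1 + ln p%:R) / p%:R).
Definition Pp n (A : {set 'I_n}) : R := \prod_(i in A) (1 - i%:R^-1).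
Definition Rp (c : R) n (A : {set 'I_n}) : R := \prod_(i in A) rr c i.

Lemma rr_bounds (c : R) p : 0 <= c -> prime p -> 1 <= rr c p <= 1 + 2 * c.
Proof.
move=> c0 pp; have l0 := @ln_prime_ge0 R p pp; have P0 : 0 < p%:R :> R by rewrite ltr0n prime_gt0.
have P1 : 1 <= p%:R :> R by rewrite ler1n prime_gt0.
have l1 := ln_sublinear P0.
have h0 : 0 <= (1 + ln (p%:R : R)) / p%:R by rewrite divr_ge0 //; slra.
have h2 : (1 + ln (p%:R : R)) / p%:R <= 2 by rewrite ler_pdivrMr //; slra.
rewrite /rr lerDl mulr_ge0 //= lerD2l mulrC ler_wpM2r //.
Qed.

Lemma Pp_bounds n (A : {set 'I_n}) : allp A -> 0 <= Pp A <= 1.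
Proof.
move=> aA; apply/andP; split.
  by apply: prodr_ge0 => i iA; have /andP[] := @prime_inv R i (allpP A aA i iA); slra.
apply: (@le_trans _ _ (\prod_(i in A) 1)); last by rewrite big1_eq.
by apply: ler_prod => i iA; have /andP[] := @prime_inv R i (allpP A aA i iA); slra.
Qed.

Lemma Rp_ge1 (c : R) n (A : {set 'I_n}) : 0 <= c -> allp A -> 1 <= Rp c A.
Proof.
move=> c0 aA; apply: (@le_trans _ _ (\prod_(i in A) 1)); first by rewrite big1_eq.
by apply: ler_prod => i iA; rewrite ler01 /=; have /andP[] := rr_bounds c0 (allpP A aA i iA).
Qed.

(** Mertens' sum runs over all primes while p in A must be left out; the discrepancy is thus covered
    by the error factor already present. The induction proves the stronger bound with 1 added on the
    left. *)
Lemma sum_le_Rp (c : R) n (A : {set 'I_n}) : 1 <= c -> allp A -> \sum_(i in A) ln i%:R / i%:R <= Rp c A.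
Proof.
move=> c1 aA; suff : 1 + \sum_(i in A) ln (i%:R : R) / i%:R <= Rp c A by slra.
elim/set_ind: A aA => [|x S xS IH]; first by rewrite /Rp !big_set0 addr0.
rewrite allpU1 => /andP[px aS]; rewrite /Rp !big_setU1 //= -/(Rp c S).
have h := IH aS; have P0 : 0 < x%:R :> R by rewrite ltr0n prime_gt0.
have l0 := @ln_prime_ge0 R x px.
have t0 : 0 <= ln (x%:R : R) / x%:R by rewrite divr_ge0 // ltW.
have e : 1 + ln (x%:R : R) / x%:R <= rr c x.
  rewrite /rr lerD2l -[leLHS]mul1r; apply: ler_pM => //; rewrite ler_pM2r ?invr_gt0 //; slra.
have r1 := Rp_ge1 (le_trans ler01 c1) aS.
have : (1 + ln (x%:R : R) / x%:R) * Rp c S <= rr c x * Rp c S by rewrite ler_wpM2r //; slra.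
have : ln (x%:R : R) / x%:R * 1 <= ln (x%:R : R) / x%:R * Rp c S by rewrite ler_wpM2l.
rewrite mulrDl; slra.
Qed.

Lemma Vw_le0 n (A : {set 'I_n}) l Y : Y <= 0 -> Vw A l Y = 0.
Proof.
move=> Y0; rewrite /Vw /setsum big1 // => B _.
have [aB|nB] := boolP (allp B); last by rewrite gprod_nallp // mul0r.
by rewrite supp0_pw ?mulr0 //; have := Lg_ge0 R aB; slra.
Qed.

Lemma Vw_asy : {Cc : R * R | 0 < Cc.1 /\ 1 <= Cc.2 & forall l n (A : {set 'I_n}) Y, allp A ->
  (0 < n)%N -> Y <= ln n%:R -> 0 < Y ->
  `|Vw A l Y - Pp A * (Y ^+ l.+1 / l.+1%:R)| <= Cc.1 * Rp Cc.2 A * (1 + Y) ^+ l}.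
Proof.
have [[C1 c1] /= [C10 c10] CP] := @setsum_coprime R.
(* Adding 1 makes the constant at least 1, as [sum_le_Rp] requires. *)
exists (C1, c1 + 1) => /= [|l n A Y aA n0 Yn Y0]; first by split=> //; slra.
have := CP l n (inset A) Y n0 Yn Y0.
rewrite (prod_inset (fun p => 1 - p%:R^-1) aA) (prod_inset (fun p => 1 + c1 * ((1 + ln p%:R) / p%:R)) aA).
rewrite -/(Vw A l Y) -/(Pp A) -mulrA => h; apply: le_trans h _.
rewrite ler_wpM2r ?exprn_ge0 //; first by slra.
rewrite ler_wpM2l ?(ltW C10) //; apply: ler_prod => i iA.
have := @rr_bounds c1 i (ltW c10) (allpP A aA i iA); rewrite /rr => /andP[h1 _].
apply/andP; split; first by slra.
rewrite lerD2l ler_wpM2r //; last by slra.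
rewrite divr_ge0 // addr_ge0 // ln_prime_ge0 //; exact: allpP aA i iA.
Qed.

Lemma prod_close C Q M a a1 b b1 l1 l2 : 0 <= C -> 1 <= Q -> 1 <= M ->
  `|a - a1| <= C * Q * M ^+ l1 -> `|b - b1| <= C * Q * M ^+ l2 ->
  `|a1| <= M ^+ l1.+1 -> `|b1| <= M ^+ l2.+1 ->
  `|a * b - a1 * b1| <= (2 * C + C ^+ 2) * Q ^+ 2 * M ^+ (l1 + l2).+1.
Proof.
move=> C0 Q1 M1 ha hb ha1 hb1.
have -> : a * b - a1 * b1 = (a - a1) * (b - b1) + (a - a1) * b1 + a1 * (b - b1) by ring.
have p l : 0 < M ^+ l by rewrite exprn_gt0 //; slra.
have h1 : `|(a - a1) * (b - b1)| <= C ^+ 2 * Q ^+ 2 * M ^+ (l1 + l2).+1.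
  rewrite normrM; apply: le_trans (ler_pM _ _ ha hb) _ => //.
  have -> : C * Q * M ^+ l1 * (C * Q * M ^+ l2) = C ^+ 2 * Q ^+ 2 * M ^+ (l1 + l2) by rewrite exprD; ring.
  by apply: ler_wpM2l; [rewrite mulr_ge0 ?sqr_ge0|apply: ler_weXn2l].
have QQ : Q <= Q ^+ 2 by rewrite expr2 ler_peMl //; slra.
have h2 : `|(a - a1) * b1| <= C * Q ^+ 2 * M ^+ (l1 + l2).+1.
  rewrite normrM; apply: le_trans (ler_pM _ _ ha hb1) _ => //.
  have -> : C * Q * M ^+ l1 * M ^+ l2.+1 = C * Q * M ^+ (l1 + l2).+1 by rewrite -addnS exprD; ring.
  by apply: ler_wpM2r (ltW (p _)) _ _ (ler_wpM2l C0 QQ).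
have h3 : `|a1 * (b - b1)| <= C * Q ^+ 2 * M ^+ (l1 + l2).+1.
  rewrite normrM; apply: le_trans (ler_pM _ _ ha1 hb) _ => //.
  have -> : M ^+ l1.+1 * (C * Q * M ^+ l2) = C * Q * M ^+ (l1 + l2).+1 by rewrite -addSn exprD; ring.
  by apply: ler_wpM2r (ltW (p _)) _ _ (ler_wpM2l C0 QQ).
apply: le_trans (ler_normD _ _) _; apply: le_trans (lerD (ler_normD _ _) (lexx _)) _.
apply: le_trans (lerD (lerD h1 h2) h3) _.
by rewrite le_eqVlt; apply/orP; left; apply/eqP; ring.
Qed.

(* One prime of the second main term; the local identity [w (1 + g) (1 - q)^2 = 1 - q], with [q = 1/p],
   makes the density at [p] asymptotically 1. *)
Lemma local_step (C G Q M P q g w a a' b b' al al' be be' : R) l1 l2 :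
  0 <= C -> 1 <= Q -> 1 <= M -> 0 <= P <= 1 -> 0 <= q <= 1 / 2 -> 0 <= g -> 0 <= G -> g <= G * q -> 0 <= w * (1 + g) <= 2 ->
  w * (1 + g) * (1 - q) ^+ 2 = 1 - q ->
  0 <= al <= M ^+ l1.+1 -> 0 <= al' <= M ^+ l1.+1 -> 0 <= be <= M ^+ l2.+1 -> 0 <= be' <= M ^+ l2.+1 ->
  `|a - P * (1 - q) * al| <= C * Q * M ^+ l1 -> `|a' - P * (1 - q) * al'| <= C * Q * M ^+ l1 ->
  `|b - P * (1 - q) * be| <= C * Q * M ^+ l2 -> `|b' - P * (1 - q) * be'| <= C * Q * M ^+ l2 ->
  `|w * (- (1 + g) * (a * b' + a' * b) + (1 - g ^+ 2) * (a' * b')) - P ^+ 2 * (- (al * be' + al' * be) + al' * be')|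
  <= (6 + 2 * G) * (2 * C + C ^+ 2) * Q ^+ 2 * M ^+ (l1 + l2).+1 + (3 + G) * q * M ^+ (l1 + l2).+2.
Proof.
move=> C0 Q1 M1 /andP[P0 P1] /andP[q0 q1] g0 G0 gG /andP[W0 W2] wq al0 al0' be0 be0' ha ha' hb hb'.
have p l : 0 < M ^+ l by rewrite exprn_gt0 //; slra.
have bd x l : 0 <= x <= M ^+ l -> `|P * (1 - q) * x| <= M ^+ l.
  move=> /andP[x0 xM]; have Pq : 0 <= P * (1 - q) <= 1 by apply/andP; split; nra.
  case/andP: Pq => Pq0 Pq1; rewrite ger0_norm; last exact: mulr_ge0.
  by apply: le_trans xM; rewrite ler_piMl.
have b1 := bd _ _ al0; have b2 := bd _ _ al0'; have b3 := bd _ _ be0; have b4 := bd _ _ be0'.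
set E := (2 * C + C ^+ 2) * Q ^+ 2 * M ^+ (l1 + l2).+1.
have e1 : `|a * b' - P * (1 - q) * al * (P * (1 - q) * be')| <= E by apply: prod_close.
have e2 : `|a' * b - P * (1 - q) * al' * (P * (1 - q) * be)| <= E by apply: prod_close.
have e3 : `|a' * b' - P * (1 - q) * al' * (P * (1 - q) * be')| <= E by apply: prod_close.
have E0 : 0 <= E by apply: le_trans e1; exact: normr_ge0.
have mm x y : 0 <= x <= M ^+ l1.+1 -> 0 <= y <= M ^+ l2.+1 -> 0 <= x * y <= M ^+ (l1 + l2).+2.
  move=> /andP[x0 xM] /andP[y0 yM]; rewrite mulr_ge0 //=.
  by have := ler_pM x0 y0 xM yM; rewrite -exprD addnS addSn.
have m1 := mm _ _ al0 be0'; have m2 := mm _ _ al0' be0; have m3 := mm _ _ al0' be0'.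
set D := M ^+ (l1 + l2).+2 in m1 m2 m3 *.
have D0 : 0 <= D by rewrite ltW ?p.
set W := w * (1 + g) in W0 W2 wq.
set x1 := a * b' - _ in e1; set x2 := a' * b - _ in e2; set x3 := a' * b' - _ in e3.
have -> : w * (- (1 + g) * (a * b' + a' * b) + (1 - g ^+ 2) * (a' * b')) - P ^+ 2 * (- (al * be' + al' * be) + al' * be') =
   (- W * (x1 + x2) + W * (1 - g) * x3) +
   P ^+ 2 * (q * (al * be' + al' * be) + ((1 - q) * (1 - g) - 1) * (al' * be')).
  transitivity (- W * (x1 + x2) + W * (1 - g) * x3 + P ^+ 2 * (- (W * (1 - q) ^+ 2) * (al * be' + al' * be) +
      (W * (1 - q) ^+ 2) * (1 - g) * (al' * be') + (al * be' + al' * be) - al' * be')).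
    by rewrite /W /x1 /x2 /x3; ring.
  by rewrite wq; ring.
have Ed : E = (2 * C + C ^+ 2) * Q ^+ 2 * M ^+ (l1 + l2).+1 by [].
clearbody x1 x2 x3 W D E.
have gG2 : g <= G by nra.
apply: le_trans (ler_normD _ _) _; apply: lerD.
  apply: le_trans (ler_normD _ _) _; rewrite !normrM normrN (ger0_norm W0).
  have h1 : `|x1 + x2| <= E + E by apply: le_trans (ler_normD _ _) _; exact: lerD.
  have h2 : `|1 - g| <= 1 + G by rewrite ler_norml; apply/andP; split; slra.
  have h3 : W * `|x1 + x2| <= 2 * (E + E) by apply: ler_pM.
  have h4 : W * `|1 - g| * `|x3| <= 2 * (1 + G) * E by apply: ler_pM; rewrite ?mulr_ge0 //; apply: ler_pM.
  have -> : (6 + 2 * G) * (2 * C + C ^+ 2) * Q ^+ 2 * M ^+ (l1 + l2).+1 = 2 * (E + E) + 2 * (1 + G) * E by rewrite Ed; ring.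
  exact: lerD.
have P2 : 0 <= P ^+ 2 <= 1 by rewrite sqr_ge0 expr_le1.
case/andP: P2 => P20 P21.
rewrite normrM (ger0_norm P20); apply: le_trans (ler_piMl (normr_ge0 _) P21) _.
case/andP: m1 => m10 m11; case/andP: m2 => m20 m21; case/andP: m3 => m30 m31.
apply: le_trans (ler_normD _ _) _; rewrite (ger0_norm (mulr_ge0 q0 (addr_ge0 m10 m20))) normrM (ger0_norm m30).
have h1 : q * (al * be' + al' * be) <= q * (D + D) by rewrite ler_wpM2l //; slra.
have h2 : `|(1 - q) * (1 - g) - 1| <= (1 + G) * q.
  by rewrite ler_norml; apply/andP; split; nra.
have h3 : `|(1 - q) * (1 - g) - 1| * (al' * be') <= (1 + G) * q * D by apply: ler_pM.
by apply: le_trans (lerD h1 h3) _; rewrite le_eqVlt; apply/orP; left; apply/eqP; ring.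
Qed.
End InnerSums.

(** * The sum over primes in the secondary main term *)

Section SecondMainTerm.
Variable R : realType.
Implicit Types (X Y C M : R) (k l c : nat) (H : seq int).

Lemma gw_small H p : admissible H -> (0 < size H)%N -> prime p ->
  0 <= gw R H p <= ((size H)%:R * ((size H)%:R + 1)) * p%:R^-1.
Proof.
move=> ad s0 pp; have [h1 h2 h3] := @nu_real R _ _ ad s0 pp.
rewrite /gw; set v : R := (nu H p)%:R in h1 h2 h3 *; set P : R := p%:R in h2 *; set k : R := (size H)%:R in h3 *.
have Pv : 1 <= P - v by slra.
apply/andP; split; first by apply: divr_ge0; slra.
rewrite ler_pdivrMr; last by slra.
rewrite mulrAC ler_pdivlMr; last by slra.
rewrite -mulrA; apply: ler_pM; [slra|slra|slra|].
have h : k * 1 <= k * (P - v) by rewrite ler_wpM2l //; slra.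
rewrite [leRHS]mulrDl; slra.
Qed.

Lemma Fw_weight H p : admissible H -> (0 < size H)%N -> prime p ->
  0 <= (1 - Fw R H p) * (1 + gw R H p) <= 2 /\
  (1 - Fw R H p) * (1 + gw R H p) * (1 - p%:R^-1) ^+ 2 = 1 - p%:R^-1.
Proof.
move=> ad s0 pp; have [h1 h2 h3] := @nu_real R _ _ ad s0 pp.
rewrite /gw /Fw; set v : R := (nu H p)%:R in h1 h2 h3 *; set P : R := p%:R in h2 *.
have P0 : P != 0 by rewrite lt0r_neq0 //; slra.
have P1 : P - 1 != 0 by rewrite lt0r_neq0 //; slra.
have Pv : P - v != 0 by rewrite lt0r_neq0 //; slra.
split; last by field; rewrite P0 P1 Pv.
have -> : (1 - (v - 1) / (P - 1)) * (1 + v / (P - v)) = P / (P - 1) by field; rewrite P1 Pv.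
apply/andP; split; first by apply: divr_ge0; slra.
by rewrite ler_pdivrMr; slra.
Qed.

Lemma sum_logp_le : {C : R | 0 < C & forall n Y, 0 < Y ->
  \sum_(p < n | prime p && (ln (p%:R : R) < Y)) ln (p%:R : R) / p%:R <= Y + C}.
Proof.
have [C C0 CP] := @mertens R; exists C => // n Y Y0.
set T := Num.truncn (expR Y).
have T0 : (0 < T)%N by rewrite truncn_ge_nat ?expR_ge0 //; have := expR_ge1Dx Y; slra.
have := CP T T0; rewrite ler_norml => /andP[_ h].
have lT : ln T%:R <= Y.
  by rewrite -[leRHS]expRK ler_ln ?posrE ?expR_gt0 ?ltr0n // truncn_le expR_ge0.
apply: (@le_trans _ _ (plog R T)); last by slra.
rewrite /plog -(big_mkord (fun p => prime p && (ln (p%:R : R) < Y)) (fun p => ln (p%:R : R) / p%:R)).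
rewrite [leLHS](big_nat_widen 0 n (maxn n T.+1)) ?leq_maxl // [leRHS](big_nat_widen 0 T.+1 (maxn n T.+1)) ?leq_maxr //.
rewrite big_mkcond [leRHS]big_mkcond; apply: ler_sum => p _.
case: ifP => [/andP[/andP[pp pY] _]|_]; last first.
  by case: ifP => // /andP[pp _]; rewrite divr_ge0 ?ln_prime_ge0.
rewrite pp ltnS ifT // truncn_ge_nat ?expR_ge0 //.
have P0 : 0 < p%:R :> R by rewrite ltr0n prime_gt0.
by rewrite -[leLHS](@lnK _ p%:R) ?posrE // ler_expR ltW.
Qed.

Lemma sum_logp2_le : {C : R | 0 < C & forall n, \sum_(p < n | prime p) ln (p%:R : R) / p%:R * p%:R^-1 <= C}.
Proof.
have [C C0 CP] := @ln_q32 R 1; exists (4 * C) => [|n]; first by slra.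
rewrite -(big_mkord prime (fun p => ln (p%:R : R) / p%:R * p%:R^-1)).
apply: sum_primes_q32 => [p pp|]; last exact: ltW.
apply: le_trans (CP p (prime_gt0 pp)); rewrite expr1 -mulrA -expr2 ler_wpM2r ?sqr_ge0 //; slra.
Qed.

Definition Kterm H l1 l2 n (A : {set 'I_n}) (p : 'I_n) Y : R :=
  let Z := Y - ln p%:R in let V := Vw (p |: A) in
  - (1 + gw R H p) * (V l1 Y * V l2 Z + V l1 Z * V l2 Y) + (1 - gw R H p ^+ 2) * (V l1 Z * V l2 Z).
Definition Tsum H l1 l2 n (A : {set 'I_n}) Y : R :=
  \sum_(p < n | prime p && (p \notin A)) ln p%:R / p%:R * ((1 - Fw R H p) * Kterm H l1 l2 A p Y).
(** The second factor is the integral over t from 0 to 1 of (1 - t)^(l1 + l2 + 2) - (1 - t)^(l1 + 1)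
    - (1 - t)^(l2 + 1), which is what Mertens' theorem gives with log p = t Y. *)
Definition kap l1 l2 : R :=
  (l1.+1%:R * l2.+1%:R)^-1 * ((l1 + l2).+3%:R^-1 - l1.+2%:R^-1 - l2.+2%:R^-1).
(** The limiting shape of (1 - [Fw]) [Kterm]: inner sums replaced by their leading terms, the
    squared density of A divided out, and the local density at p replaced by 1. *)
Definition Jterm l1 l2 p Y : R :=
  let al := Y ^+ l1.+1 / l1.+1%:R in let al' := pw l1.+1 (Y - ln p%:R) / l1.+1%:R in
  let be := Y ^+ l2.+1 / l2.+1%:R in let be' := pw l2.+1 (Y - ln p%:R) / l2.+1%:R in
  - (al * be' + al' * be) + al' * be'.

Lemma Jterm_sum : {C : R | 0 < C & forall l1 l2 n Y, 0 < Y -> Y <= ln n%:R -> (0 < n)%N ->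
  `|\sum_(p < n | prime p) ln (p%:R : R) / p%:R * Jterm l1 l2 p Y - kap l1 l2 * Y ^+ (l1 + l2).+3|
  <= C * (1 + Y) ^+ (l1 + l2).+2}.
Proof.
have [C C0 CP] := @sum_prime_log R; exists (3 * C) => [|l1 l2 n Y Y0 Yn n0]; first by slra.
pose s l : R := \sum_(0 <= p < n | prime p) ln p%:R / p%:R * pw l.+1 (Y - ln p%:R).
have hs l : `|s l - Y ^+ l.+2 / l.+2%:R| <= C * (1 + Y) ^+ l.+1 by exact: CP.
have i1 l : 0 <= (l.+1%:R : R)^-1 <= 1.
  by rewrite invr_ge0 ler0n /= invf_le1 ?ltr0n // ler1n.
have e : \sum_(p < n | prime p) ln (p%:R : R) / p%:R * Jterm l1 l2 p Y =
    (l1.+1%:R * l2.+1%:R)^-1 * (- (Y ^+ l1.+1 * s l2 + Y ^+ l2.+1 * s l1) + s (l1 + l2).+1).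
  rewrite /s !big_mkord !mulr_sumr -big_split /= -sumrN -big_split /= mulr_sumr; apply: eq_bigr => p pp.
  have pe : pw (l1 + l2).+2 (Y - ln p%:R) = pw l1.+1 (Y - ln (p%:R : R)) * pw l2.+1 (Y - ln p%:R).
    by rewrite /pw; case: ifP => _; rewrite ?mul0r // -exprD addSn addnS.
  rewrite pe /Jterm invfM; set x := pw _ _; set y := pw _ _; ring.
rewrite e /kap -[X in _ - X]mulrA -mulrBr normrM.
have -> : - (Y ^+ l1.+1 * s l2 + Y ^+ l2.+1 * s l1) + s (l1 + l2).+1 -
    ((l1 + l2).+3%:R^-1 - l1.+2%:R^-1 - l2.+2%:R^-1) * Y ^+ (l1 + l2).+3 =
   (- (Y ^+ l1.+1 * (s l2 - Y ^+ l2.+2 / l2.+2%:R)) - Y ^+ l2.+1 * (s l1 - Y ^+ l1.+2 / l1.+2%:R)) +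
   (s (l1 + l2).+1 - Y ^+ (l1 + l2).+3 / (l1 + l2).+3%:R).
  have -> : Y ^+ (l1 + l2).+3 = Y ^+ l1.+1 * Y ^+ l2.+2 by rewrite -exprD addSn !addnS.
  have e2 : Y ^+ l2.+1 * Y ^+ l1.+2 = Y ^+ l1.+1 * Y ^+ l2.+2 by rewrite -!exprD !addSn !addnS [(l2 + l1)%N]addnC.
  have e3 : Y ^+ l2.+1 * (Y ^+ l1.+2 / l1.+2%:R) = Y ^+ l1.+1 * Y ^+ l2.+2 / l1.+2%:R by rewrite mulrA e2.
  by rewrite [Y ^+ l2.+1 * (s l1 - _)]mulrBr e3; ring.
have M0 l : 0 <= (1 + Y) ^+ l by rewrite exprn_ge0 //; slra.
have YM l : 0 <= Y ^+ l <= (1 + Y) ^+ l.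
  by rewrite exprn_ge0 ?(ltW Y0) //= lerXn2r ?nnegrE //; slra.
have b l l' : `|Y ^+ l.+1 * (s l' - Y ^+ l'.+2 / l'.+2%:R)| <= C * (1 + Y) ^+ (l + l').+2.
  rewrite normrM; have /andP[y0 y1] := YM l.+1.
  have -> : C * (1 + Y) ^+ (l + l').+2 = (1 + Y) ^+ l.+1 * (C * (1 + Y) ^+ l'.+1).
    by rewrite [RHS]mulrCA -exprD addSn addnS.
  by apply: ler_pM; rewrite ?(ger0_norm y0).
have c1 : `|(l1.+1%:R * l2.+1%:R : R)^-1| <= 1.
  have /andP[u0 u1] := i1 l1; have /andP[v0 v1] := i1 l2.
  by rewrite invfM normrM !ger0_norm //; apply: mulr_ile1.
apply: le_trans (ler_piMl (normr_ge0 _) c1) _.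
have b1 := b l1 l2; have b2 := b l2 l1; have b3 := hs (l1 + l2).+1; rewrite [(l2 + l1)%N]addnC in b2.
apply: le_trans (ler_normD _ _) _; apply: le_trans (lerD (ler_normD _ _) (lexx _)) _; rewrite !normrN.
move: b1 b2 b3; set m := (1 + Y) ^+ _; slra.
Qed.
End SecondMainTerm.

Section Outer.
Variable R : realType.
Implicit Types (X Y C M : R) (k l c : nat) (H : seq int).

Lemma Rp_ext (c : R) n (A : {set 'I_n}) (p : 'I_n) : p \notin A -> Rp c (p |: A) = Rp c A * rr c p.
Proof. by move=> pA; rewrite /Rp big_setU1 //= mulrC. Qed.

Lemma Pp_ext n (A : {set 'I_n}) (p : 'I_n) : p \notin A -> Pp R (p |: A) = Pp R A * (1 - p%:R^-1).
Proof. by move=> pA; rewrite /Pp big_setU1 //= mulrC. Qed.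

Lemma pw_le_pow l (Y Z : R) : 0 < Y -> Z <= Y -> 0 <= pw l Z <= (1 + Y) ^+ l.
Proof.
move=> Y0 ZY; rewrite pw_ge0 /= /pw; case: ltP => Z0; last by rewrite exprn_ge0 //; slra.
by rewrite lerXn2r ?nnegrE //; slra.
Qed.

Lemma div_nat_le l (x M : R) : 0 <= x <= M -> 0 <= x / l.+1%:R <= M.
Proof.
move=> /andP[h0 h1]; rewrite divr_ge0 //=; apply: le_trans h1.
by rewrite ler_piMr // invf_le1 ?ltr0n // ler1n.
Qed.

Lemma Tsum_asy k : {Cc : R * R | 0 < Cc.1 /\ 1 <= Cc.2 & forall H l1 l2 n (A : {set 'I_n}) Y,
  size H = k -> (0 < k)%N -> admissible H -> allp A -> (0 < n)%N -> Y <= ln n%:R -> 0 < Y ->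
  `|Vw A l1 Y * Vw A l2 Y - Pp R A ^+ 2 * ((l1.+1%:R * l2.+1%:R)^-1 * Y ^+ (l1 + l2).+2)| <= Cc.1 * Rp Cc.2 A ^+ 2 * (1 + Y) ^+ (l1 + l2).+1 /\
  `|Tsum H l1 l2 A Y - Pp R A ^+ 2 * (kap R l1 l2 * Y ^+ (l1 + l2).+3)| <= Cc.1 * Rp Cc.2 A ^+ 2 * (1 + Y) ^+ (l1 + l2).+2}.
Proof.
have [[C c] /= [C0 c1] VP] := @Vw_asy R; have [Cs Cs0 CsP] := @sum_logp_le R.
have [Cq Cq0 CqP] := @sum_logp2_le R; have [Cj Cj0 CjP] := @Jterm_sum R.
pose D := 2 * C + C ^+ 2; have D0 : 0 < D by rewrite addr_gt0 ?exprn_gt0 // mulr_gt0.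
pose G : R := k%:R * (k%:R + 1); have G0 : 0 <= G by rewrite mulr_ge0 // addr_ge0.
pose c2 := (6 + 2 * G) * D * (1 + 2 * c) ^+ 2.
have c20 : 0 <= c2 by rewrite mulr_ge0 ?sqr_ge0 // mulr_ge0 ?(ltW D0) // addr_ge0 // mulr_ge0.
pose C1 := c2 * (1 + Cs) + (3 + G) * Cq + 2 + Cj.
have C10 : 0 <= C1.
  apply: addr_ge0 (ltW Cj0); apply: addr_ge0 => //; apply: addr_ge0.
    by apply: mulr_ge0 c20 _; rewrite addr_ge0 // ltW.
  by apply: mulr_ge0 (ltW Cq0); rewrite addr_ge0.
exists (D + C1, c) => /= [|H l1 l2 n A Y sH k0 ad aA n0 Yn Y0].
  by split=> //; rewrite ltr_wpDr.
have s0 : (0 < size H)%N by rewrite sH.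
have c0 : 0 <= c by exact: le_trans c1.
have /andP[P0 P1] := @Pp_bounds R n A aA; have Q1 := Rp_ge1 c0 aA.
set P := Pp R A in P0 P1 *; set Q := Rp c A in Q1 *.
have Q0 : 0 < Q by exact: lt_le_trans Q1.
have M1 : 1 <= 1 + Y by rewrite lerDl ltW.
have M0 l : 0 < (1 + Y) ^+ l by rewrite exprn_gt0 //; exact: lt_le_trans M1.
have YM l : 0 <= Y ^+ l.+1 / l.+1%:R <= (1 + Y) ^+ l.+1.
  apply: div_nat_le; rewrite exprn_ge0 ?(ltW Y0) //= lerXn2r ?nnegrE ?(ltW Y0) ?(le_trans ler01 M1) // lerDr //.
split.
  have cl l : `|Vw A l Y - P * (Y ^+ l.+1 / l.+1%:R)| <= C * Q * (1 + Y) ^+ l by exact: VP.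
  have bl l : `|P * (Y ^+ l.+1 / l.+1%:R)| <= (1 + Y) ^+ l.+1.
    have /andP[y0 y1] := YM l; rewrite ger0_norm; last exact: mulr_ge0.
    by apply: le_trans y1; rewrite ler_piMl.
  have := prod_close (ltW C0) Q1 M1 (cl l1) (cl l2) (bl l1) (bl l2).
  have -> : P * (Y ^+ l1.+1 / l1.+1%:R) * (P * (Y ^+ l2.+1 / l2.+1%:R)) =
     P ^+ 2 * ((l1.+1%:R * l2.+1%:R)^-1 * Y ^+ (l1 + l2).+2).
    by rewrite -addnS -addSn exprD invfM; ring.
  move=> h; apply: le_trans h _; rewrite -/D ler_wpM2r ?(ltW (M0 _)) // ler_wpM2r ?sqr_ge0 // lerDl //.
have Vasy l (p : 'I_n) (Z : R) : prime p -> p \notin A -> Z <= Y ->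
   `|Vw (p |: A) l Z - P * (1 - p%:R^-1) * (pw l.+1 Z / l.+1%:R)| <= C * (Q * rr c p) * (1 + Y) ^+ l.
  move=> pp pA ZY; have apA : allp (p |: A) by rewrite allpU1 pp.
  have /andP[r1 _] := rr_bounds c0 pp.
  have [Z0|Z0] := leP Z 0.
    rewrite Vw_le0 // supp0_pw // mul0r mulr0 subrr normr0.
    by apply: mulr_ge0 (ltW (M0 _)); apply: mulr_ge0 (ltW C0) _; apply: mulr_ge0 (ltW Q0) (le_trans ler01 r1).
  have := VP l n (p |: A) Z apA n0 (le_trans ZY Yn) Z0.
  rewrite Rp_ext // Pp_ext // -/P -/Q pwS_E ?(ltW Z0) // => h; apply: le_trans h _.
  apply: ler_wpM2l; first by apply: mulr_ge0 (ltW C0) _; apply: mulr_ge0 (ltW Q0) (le_trans ler01 r1).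
  by rewrite lerXn2r ?nnegrE ?lerD2l // ?addr_ge0 // ltW.
have Jb (p : 'I_n) : prime p -> `|Jterm l1 l2 p Y| <= 2 * (1 + Y) ^+ (l1 + l2).+2.
  move=> pp; have l0 := @ln_prime_ge0 R p pp.
  have Zb l : 0 <= pw l.+1 (Y - ln (p%:R : R)) / l.+1%:R <= (1 + Y) ^+ l.+1.
    by apply: div_nat_le; apply: pw_le_pow => //; slra.
  have mm (x y : R) : 0 <= x <= (1 + Y) ^+ l1.+1 -> 0 <= y <= (1 + Y) ^+ l2.+1 -> 0 <= x * y <= (1 + Y) ^+ (l1 + l2).+2.
    move=> /andP[x0 xM] /andP[y0 yM]; rewrite mulr_ge0 //=.
    by have := ler_pM x0 y0 xM yM; rewrite -exprD addnS addSn.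
  have := mm _ _ (YM l1) (Zb l2); have := mm _ _ (Zb l1) (YM l2); have := mm _ _ (Zb l1) (Zb l2).
  rewrite /Jterm /=; set x := _ * _; set y := _ * _; set z := _ * _; set m := _ ^+ _ => /andP[? ?] /andP[? ?] /andP[? ?].
  by rewrite ler_norml; apply/andP; split; slra.
have step (p : 'I_n) : prime p -> p \notin A ->
   `|ln p%:R / p%:R * ((1 - Fw R H p) * Kterm H l1 l2 A p Y) - P ^+ 2 * (ln p%:R / p%:R * Jterm l1 l2 p Y)| <=
   (if ln (p%:R : R) < Y then ln p%:R / p%:R else 0) * (c2 * Q ^+ 2 * (1 + Y) ^+ (l1 + l2).+1) +
   (3 + G) * (1 + Y) ^+ (l1 + l2).+2 * (ln p%:R / p%:R * p%:R^-1).
  move=> pp pA; have l0 := @ln_prime_ge0 R p pp; have /andP[q0 q1] := @prime_inv R p pp.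
  have sp0 : 0 <= ln (p%:R : R) / p%:R by rewrite divr_ge0.
  have /andP[r1 r2] := rr_bounds c0 pp.
  have rest : 0 <= (3 + G) * (1 + Y) ^+ (l1 + l2).+2 * (ln (p%:R : R) / p%:R * p%:R^-1).
    by apply: mulr_ge0 (mulr_ge0 sp0 (ltW q0)); apply: mulr_ge0 (ltW (M0 _)); rewrite addr_ge0.
  (* If log p is at least Y, all shifted sums vanish. The other primes have total weight at most Y +
     Cs in the sum of log p/p, so the error gains exactly one degree. *)
  case: ltP => pY; last first.
    have Z0 : Y - ln (p%:R : R) <= 0 by slra.
    rewrite /Kterm /Jterm /= !(Vw_le0 _ _ Z0) !(supp0_pw _ Z0) !(mul0r, mulr0, addr0, oppr0) ?subrr normr0.
    by rewrite ?add0r.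
  rewrite [X in _ - X]mulrCA -mulrBr normrM (ger0_norm sp0).
  have ZY : Y - ln (p%:R : R) <= Y by slra.
  have Zb l : 0 <= pw l.+1 (Y - ln (p%:R : R)) / l.+1%:R <= (1 + Y) ^+ l.+1.
    by apply: div_nat_le; exact: pw_le_pow.
  have [w02 wq] := @Fw_weight R H p ad s0 pp; have /andP[g0 gG] := @gw_small R H p ad s0 pp.
  have Qr1 : 1 <= Q * rr c p by rewrite -[leLHS]mulr1; apply: ler_pM.
  have VY l : `|Vw (p |: A) l Y - P * (1 - p%:R^-1) * (Y ^+ l.+1 / l.+1%:R)| <= C * (Q * rr c p) * (1 + Y) ^+ l.
    by rewrite -pwS_E ?(ltW Y0) //; apply: Vasy.
  have VZ l : `|Vw (p |: A) l (Y - ln p%:R) - P * (1 - p%:R^-1) * (pw l.+1 (Y - ln p%:R) / l.+1%:R)| <= C * (Q * rr c p) * (1 + Y) ^+ l.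
    by apply: Vasy.
  rewrite sH -/G in gG.
  have P01 : 0 <= P <= 1 by rewrite P0.
  have q01 : 0 <= (p%:R^-1 : R) <= 1 / 2 by rewrite (ltW q0).
  have LS := local_step (ltW C0) Qr1 M1 P01 q01 g0 G0 gG w02 wq
     (YM l1) (Zb l1) (YM l2) (Zb l2) (VY l1) (VZ l1) (VY l2) (VZ l2).
  apply: le_trans (ler_wpM2l sp0 LS) _.
  rewrite [leLHS]mulrDr; apply: lerD; last by rewrite le_eqVlt; apply/orP; left; apply/eqP; ring.
  apply: ler_wpM2l => //; apply: ler_wpM2r; first exact: ltW.
  rewrite -/D exprMn /c2.
  have -> : (6 + 2 * G) * D * (Q ^+ 2 * rr c p ^+ 2) = (6 + 2 * G) * D * Q ^+ 2 * rr c p ^+ 2 by ring.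
  have -> : (6 + 2 * G) * D * (1 + 2 * c) ^+ 2 * Q ^+ 2 = (6 + 2 * G) * D * Q ^+ 2 * (1 + 2 * c) ^+ 2 by ring.
  apply: ler_wpM2l; first by apply: mulr_ge0 (sqr_ge0 _); apply: mulr_ge0 (ltW D0); rewrite addr_ge0 // mulr_ge0.
  by rewrite lerXn2r ?nnegrE ?(le_trans ler01 r1) // (le_trans (le_trans ler01 r1)).
have S1 : `|Tsum H l1 l2 A Y - P ^+ 2 * \sum_(p < n | prime p && (p \notin A)) ln (p%:R : R) / p%:R * Jterm l1 l2 p Y| <=
   (c2 * (1 + Cs) + (3 + G) * Cq) * Q ^+ 2 * (1 + Y) ^+ (l1 + l2).+2.
  rewrite /Tsum mulr_sumr -sumrB; apply: le_trans (ler_norm_sum _ _ _) _.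
  apply: (@le_trans _ _ (\sum_(p < n | prime p)
     ((if ln (p%:R : R) < Y then ln p%:R / p%:R else 0) * (c2 * Q ^+ 2 * (1 + Y) ^+ (l1 + l2).+1) +
   (3 + G) * (1 + Y) ^+ (l1 + l2).+2 * (ln p%:R / p%:R * p%:R^-1)))).
    rewrite big_mkcond [leRHS]big_mkcond; apply: ler_sum => p _.
    case: (boolP (prime p)) => pp //=; case: ifP => [pA|_]; first exact: step.
    have sp0 : 0 <= ln (p%:R : R) / p%:R by rewrite divr_ge0 ?ln_prime_ge0.
    apply: addr_ge0; first by apply: mulr_ge0; [case: ifP|apply: mulr_ge0 (ltW (M0 _)); exact: mulr_ge0 c20 (sqr_ge0 _)].
    by apply: mulr_ge0; [apply: mulr_ge0 (ltW (M0 _)); rewrite addr_ge0|rewrite mulr_ge0 // invr_ge0].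
  rewrite big_split /= -mulr_suml -mulr_sumr -big_mkcondr.
  have h1 := CsP n Y Y0; have h2 := CqP n.
  have -> : (c2 * (1 + Cs) + (3 + G) * Cq) * Q ^+ 2 * (1 + Y) ^+ (l1 + l2).+2 =
     c2 * (1 + Cs) * Q ^+ 2 * (1 + Y) ^+ (l1 + l2).+2 + (3 + G) * Cq * Q ^+ 2 * (1 + Y) ^+ (l1 + l2).+2 by ring.
  apply: lerD.
    apply: (@le_trans _ _ ((1 + Cs) * (1 + Y) * (c2 * Q ^+ 2 * (1 + Y) ^+ (l1 + l2).+1))).
      apply: ler_wpM2r; first by apply: mulr_ge0 (ltW (M0 _)); exact: mulr_ge0 c20 (sqr_ge0 _).
      by apply: le_trans h1 _; have : 0 <= Cs * Y by [exact: mulr_ge0 (ltW Cs0) (ltW Y0)]; slra.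
    rewrite [_ ^+ (l1 + l2).+2]exprS le_eqVlt; apply/orP; left; apply/eqP; ring.
  have -> : (3 + G) * (1 + Y) ^+ (l1 + l2).+2 * \sum_(i < n | prime i) ln (i%:R : R) / i%:R * i%:R^-1 =
     (3 + G) * (\sum_(i < n | prime i) ln (i%:R : R) / i%:R * i%:R^-1) * (1 + Y) ^+ (l1 + l2).+2 by ring.
  apply: ler_wpM2r; first exact: ltW.
  rewrite -[leRHS]mulrA; apply: ler_wpM2l; first by rewrite addr_ge0.
  by apply: le_trans h2 _; rewrite ler_peMr ?(ltW Cq0) // exprn_ege1.
(* [Jterm_sum] covers all primes; those in A are removed by [sum_le_Rp] at the price of one factor
   [Rp]. *)
have S2 : `|\sum_(p < n | prime p && (p \notin A)) ln (p%:R : R) / p%:R * Jterm l1 l2 p Y - kap R l1 l2 * Y ^+ (l1 + l2).+3| <=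
   (2 + Cj) * Q ^+ 2 * (1 + Y) ^+ (l1 + l2).+2.
  have := CjP l1 l2 n Y Y0 Yn n0; rewrite (bigID (fun p : 'I_n => p \in A)) /=.
  set x := \sum_(p < n | _ && (p \in A)) _; set y := \sum_(p < n | _) _; set z := _ * _ => h.
  have hx : `|x| <= 2 * Q * (1 + Y) ^+ (l1 + l2).+2.
    apply: le_trans (ler_norm_sum _ _ _) _.
    apply: (@le_trans _ _ (\sum_(p in A) ln (p%:R : R) / p%:R * (2 * (1 + Y) ^+ (l1 + l2).+2))).
      rewrite big_mkcond [leRHS]big_mkcond; apply: ler_sum => p _.
      case: (boolP (p \in A)) => pA; last by rewrite andbF.
      have pp := allpP A aA p pA; rewrite pp /= normrM ger0_norm ?divr_ge0 ?ln_prime_ge0 //.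
      by apply: ler_wpM2l; [rewrite divr_ge0 ?ln_prime_ge0|exact: Jb].
    rewrite -mulr_suml; have := sum_le_Rp c1 aA; rewrite -/Q => hh.
    have -> : 2 * Q * (1 + Y) ^+ (l1 + l2).+2 = Q * (2 * (1 + Y) ^+ (l1 + l2).+2) by ring.
    by apply: ler_wpM2r hh; rewrite mulr_ge0 // ltW.
  have -> : y - z = x + y - z - x by ring.
  apply: le_trans (ler_normB _ _) _; apply: le_trans (lerD h hx) _.
  have QQ : Q <= Q ^+ 2 by rewrite expr2 ler_peMl // ltW.
  have Q21 : 1 <= Q ^+ 2 by rewrite exprn_ege1.
  rewrite -mulrDl; apply: ler_wpM2r; first exact: ltW.
  by rewrite [leRHS]mulrDl addrC; apply: lerD; [exact: ler_wpM2l|rewrite ler_peMr // ltW].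
have -> : Tsum H l1 l2 A Y - P ^+ 2 * (kap R l1 l2 * Y ^+ (l1 + l2).+3) =
   (Tsum H l1 l2 A Y - P ^+ 2 * \sum_(p < n | prime p && (p \notin A)) ln (p%:R : R) / p%:R * Jterm l1 l2 p Y) +
   P ^+ 2 * (\sum_(p < n | prime p && (p \notin A)) ln (p%:R : R) / p%:R * Jterm l1 l2 p Y - kap R l1 l2 * Y ^+ (l1 + l2).+3) by ring.
apply: le_trans (ler_normD _ _) _.
have P21 : `|P ^+ 2| <= 1 by rewrite ger0_norm ?sqr_ge0 // expr_le1.
have S2' := le_trans (ler_piMl (normr_ge0 _) P21) S2; rewrite -normrM in S2'.
apply: le_trans (lerD S1 S2') _; rewrite -!mulrDl; apply: ler_wpM2r; first exact: ltW.
rewrite ler_wpM2r ?sqr_ge0 // /C1; move: D0; slra.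
Qed.
End Outer.

(** * The outer sum over a and the binomial coefficients *)

Section Assembly.
Variable R : realType.
Implicit Types (X Y C RR : R) (k l m : nat) (H : seq int).

Lemma Gam_Gs H n (A : {set 'I_n}) : admissible H -> (0 < size H)%N -> allp A ->
  Gam R H A * Pp R A ^+ 2 = gprod (Gs R H) A.
Proof.
move=> ad s0 aA; rewrite /Gam /Pp /gprod -prodrXl -big_split /=; apply: eq_bigr => i iA.
have pi := allpP A aA i iA; rewrite /onprimes pi.
by have [_ _ ->] := @one_sub_fF R H i ad s0 pi.
Qed.

Lemma Gam_GamP (c : R) H n (A : {set 'I_n}) : admissible H -> (0 < size H)%N -> allp A ->
  Gam R H A * Rp c A ^+ 2 = gprod (GamP c H) A.
Proof.
move=> ad s0 aA; rewrite /Gam /Rp /gprod -prodrXl -big_split /=; apply: eq_bigr => i iA.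
have pi := allpP A aA i iA; rewrite /onprimes pi.
have [_ _ e] := @one_sub_fF R H i ad s0 pi; have /andP[q0 q1] := @prime_inv R i pi.
rewrite /GamP -e /rr; set q := (i%:R)^-1 in q0 q1 *.
set w := Fw R H i * _ * _; set r := 1 + c * _.
by field; rewrite lt0r_neq0 //; slra.
Qed.

Lemma Gam_nallp H n (A : {set 'I_n}) : ~~ allp A -> Gam R H A = 0.
Proof. exact: gprod_nallp. Qed.

(** The squared density [Pp] turns [Gam] into [Gs], whose sum gives the main term. The squared error
    factor [Rp] turns it into [GamP], whose sum is O(X^(k - 1)/S) uniformly in [H]; inserting 4
    [betaH], which is at least 1, gives both errors the same form. *)
Lemma outer_sum k m (c C' : R) : 0 <= c -> 0 < C' -> (2 <= k)%N ->
  {C : R | 0 < C & forall H, size H = k -> uniq H -> admissible H -> exists X0, forall n X (kp : R) (T : {set 'I_n} -> R),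
    X0 <= X -> (0 < n)%N -> X <= ln n%:R -> `|kp| <= 1 ->
    (forall A, allp A -> 0 < X - Lg R A ->
       `|T A - Pp R A ^+ 2 * (kp * (X - Lg R A) ^+ m.+2)| <= C' * Rp c A ^+ 2 * (1 + (X - Lg R A)) ^+ m.+1) ->
    (forall A, allp A -> X - Lg R A <= 0 -> T A = 0) ->
    `|\sum_(A : {set 'I_n}) Gam R H A * T A - kp * (m.+2`!%:R / (k.-1 + m).+2`!%:R / sing R H * X ^+ (k.-1 + m).+2)|
      <= C * (betaH R H / sing R H * X ^+ (k.-1 + m).+1)}.
Proof.
move=> c0 C'0 k2; have k0 : (0 < k)%N by exact: leq_trans k2.
have [C1 C10 G1] := @Gs_sum R k m k2; have [C2 C20 G2] := @GamP_sum R k c c0 k2.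
have l2 := @ln2_ge R.
exists (C1 + C' * 2 ^+ m.+1 * C2 * 4) => [|H sH uH ad].
  by rewrite addr_gt0 // mulr_gt0 // mulr_gt0 // mulr_gt0 // exprn_gt0.
have [Xa XaP] := G1 H sH uH ad; have [Xb XbP] := G2 H sH uH ad.
have s0 : (0 < size H)%N by rewrite sH.
have [cs cs0 csP] := @sing_gt R k; have Sp : 0 < sing R H by apply: lt_le_trans cs0 (csP H sH uH ad k0).
have b0 : 1 <= 4 * betaH R H by have := @betaH_ge R H uH ad (ltac:(by rewrite sH)); slra.
exists (1 + `|Xa| + `|Xb|) => n X kp T XX n0 Xn kp1 HT HT0.
have aa := normr_ge0 Xa; have bb := normr_ge0 Xb.
have X1 : 1 <= X by slra.
have g1 := XaP n X (ltac:(have := ler_norm Xa; slra)) n0 Xn.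
have g2 := XbP n X (ltac:(have := ler_norm Xb; slra)) n0 Xn.
set S := sing R H in Sp g1 g2 *; set W := X ^+ (k.-1 + m).+2 in g1 *.
set main := _ / _ / S * W in g1 *.
have X0 : 0 <= X by slra.
have -> : \sum_(A : {set 'I_n}) Gam R H A * T A - kp * main =
   \sum_(A : {set 'I_n}) Gam R H A * (T A - Pp R A ^+ 2 * (kp * pw m.+2 (X - Lg R A))) + kp * (setsum n (Gs R H) (pw m.+2) X - main).
  rewrite mulrBr addrA; congr (_ - _); rewrite /setsum mulr_sumr -big_split /=; apply: eq_bigr => A _.
  have [aA|nA] := boolP (allp A); last by rewrite Gam_nallp // gprod_nallp // !mul0r mulr0 addr0.
  by rewrite -(Gam_Gs ad s0 aA); ring.
apply: le_trans (ler_normD _ _) _; rewrite addrC mulrDl; apply: lerD.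
  by rewrite normrM; apply: le_trans g1; rewrite ler_piMl.
apply: le_trans (ler_norm_sum _ _ _) _.
apply: (@le_trans _ _ (C' * (1 + X) ^+ m.+1 * setsum n (GamP c H) (pw 0) X)).
  rewrite /setsum mulr_sumr; apply: ler_sum => A _.
  have M0 : 0 <= C' * (1 + X) ^+ m.+1 by rewrite mulr_ge0 ?(ltW C'0) // exprn_ge0 // addr_ge0.
  have [aA|nA] := boolP (allp A); last by rewrite Gam_nallp // gprod_nallp // !mul0r normr0 mulr0.
  have a0 := Lg_ge0 R aA.
  have gP0 : 0 <= gprod (GamP c H) A.
    apply: gprod_ge0 => p pp; have /andP[h _] := GamP_bounds c0 ad s0 pp.
    by apply: le_trans h; exact: Gs_ge0.
  have [Y0|Y0] := leP (X - Lg R A) 0.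
    by rewrite HT0 // !supp0_pw // !(mulr0, subrr) normr0.
  rewrite pwS_E ?(ltW Y0) // normrM; apply: le_trans (ler_wpM2l (normr_ge0 _) (HT A aA Y0)) _.
  have -> : `|Gam R H A| * (C' * Rp c A ^+ 2 * (1 + (X - Lg R A)) ^+ m.+1) =
     C' * (1 + (X - Lg R A)) ^+ m.+1 * (`|Gam R H A| * Rp c A ^+ 2) by ring.
  have -> : `|Gam R H A| * Rp c A ^+ 2 = gprod (GamP c H) A.
    by rewrite -[Rp c A ^+ 2]ger0_norm ?sqr_ge0 // -normrM Gam_GamP // ger0_norm.
  rewrite /pw Y0 expr0 mulr1 ler_wpM2r // ler_wpM2l ?(ltW C'0) //.
  by rewrite lerXn2r ?nnegrE; slra.
have M2 : (1 + X) ^+ m.+1 <= 2 ^+ m.+1 * X ^+ m.+1.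
  by rewrite -exprMn lerXn2r ?nnegrE; slra.
have g3 : C' * (1 + X) ^+ m.+1 * setsum n (GamP c H) (pw 0) X <=
    C' * (2 ^+ m.+1 * X ^+ m.+1) * (C2 / S * X ^+ k.-1).
  apply: ler_pM => //.
  - by rewrite mulr_ge0 ?(ltW C'0) // exprn_ge0 // addr_ge0.
  - apply: sumr_ge0 => A _; rewrite mulr_ge0 ?pw_ge0 //.
    apply: gprod_ge0 => p pp; have /andP[h _] := GamP_bounds c0 ad s0 pp.
    by apply: le_trans h; exact: Gs_ge0.
  by rewrite ler_wpM2l ?(ltW C'0).
apply: le_trans g3 _.
have -> : C' * (2 ^+ m.+1 * X ^+ m.+1) * (C2 / S * X ^+ k.-1) = C' * 2 ^+ m.+1 * C2 * (1 / S * X ^+ (k.-1 + m).+1).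
  by rewrite -addnS exprD; field; rewrite lt0r_neq0.
have -> : C' * 2 ^+ m.+1 * C2 * 4 * (betaH R H / S * X ^+ (k.-1 + m).+1) =
  C' * 2 ^+ m.+1 * C2 * (4 * betaH R H / S * X ^+ (k.-1 + m).+1) by ring.
apply: ler_wpM2l; first by rewrite mulr_ge0 ?(ltW C20) // mulr_ge0 ?(ltW C'0) // exprn_ge0.
apply: ler_wpM2r; first by rewrite exprn_ge0.
by rewrite ler_wpM2r // invr_ge0 ltW.
Qed.

Lemma bin_fracE a b : 'C(a + b, a)%:R = (a + b)`!%:R / (a`!%:R * b`!%:R) :> R.
Proof.
have f0 n : n`!%:R != 0 :> R by rewrite pnatr_eq0 -lt0n fact_gt0.
apply: (@mulIf _ (a`!%:R * b`!%:R)); first by rewrite mulf_neq0.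
rewrite divfK ?mulf_neq0 // -!natrM -(bin_fact (leq_addr b a)).
by rewrite addKn.
Qed.

Lemma binom_coef l1 l2 :
  (l1`!%:R * l2`!%:R)^-1 * (l1.+1%:R * l2.+1%:R)^-1 * (l1 + l2).+2`!%:R = 'C(l1 + l2 + 2, l1 + 1)%:R :> R.
Proof.
have -> : 'C(l1 + l2 + 2, l1 + 1) = 'C(l1.+1 + l2.+1, l1.+1) by congr 'C(_, _); lia.
rewrite bin_fracE; have -> : (l1.+1 + l2.+1 = (l1 + l2).+2)%N by lia.
rewrite (factS l1) (factS l2) !natrM.
have f0 n : n`!%:R != 0 :> R by rewrite pnatr_eq0 -lt0n fact_gt0.
have s0 n : n.+1%:R != 0 :> R by rewrite pnatr_eq0.
have key (a b a' b' x : R) : a != 0 -> b != 0 -> a' != 0 -> b' != 0 ->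
    (a * b)^-1 * (a' * b')^-1 * x = x / (a' * a * (b' * b)).
  by move=> ha hb ha' hb'; field; rewrite ha hb ha' hb'.
exact: key.
Qed.

Lemma Tcoef_kap l1 l2 :
  (l1`!%:R * l2`!%:R)^-1 * kap R l1 l2 * (l1 + l2).+3`!%:R = Tcoef R l1 l2.
Proof.
rewrite /Tcoef.
have -> : 'C(l1 + l2 + 3, l2 + 1) = 'C(l2.+1 + l1.+2, l2.+1) by congr 'C(_, _); lia.
have -> : 'C(l1 + l2 + 3, l1 + 1) = 'C(l1.+1 + l2.+2, l1.+1) by congr 'C(_, _); lia.
have -> : 'C(l1 + l2 + 2, l1 + 1) = 'C(l1.+1 + l2.+1, l1.+1) by congr 'C(_, _); lia.
rewrite !bin_fracE.
have -> : (l2.+1 + l1.+2 = (l1 + l2).+3)%N by lia.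
have -> : (l1.+1 + l2.+2 = (l1 + l2).+3)%N by lia.
have -> : (l1.+1 + l2.+1 = (l1 + l2).+2)%N by lia.
rewrite /kap (factS (l1 + l2).+2) (factS l1.+1) (factS l2.+1) (factS l1) (factS l2) !natrM.
have f0 n : n`!%:R != 0 :> R by rewrite pnatr_eq0 -lt0n fact_gt0.
have s0 n : n.+1%:R != 0 :> R by rewrite pnatr_eq0.
have key (a b a' b' a'' b'' y x : R) : a != 0 -> b != 0 -> a' != 0 -> b' != 0 -> a'' != 0 -> b'' != 0 -> y != 0 ->
    (a * b)^-1 * ((a' * b')^-1 * (y^-1 - a''^-1 - b''^-1)) * (y * x) =
    - (y * x / (b' * b * (a'' * (a' * a)))) - y * x / (a' * a * (b'' * (b' * b))) + x / (a' * a * (b' * b)).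
  move=> ha hb ha' hb' ha'' hb'' hy; field; by rewrite ?ha ?hb ?ha' ?hb' ?ha'' ?hb'' ?hy.
exact: key.
Qed.
End Assembly.

Section Final.
Variable R : realType.
Implicit Types (X C RR N : R) (k l m : nat) (H : seq int).

(** One of the two factors S cancels the 1/S of the outer sum. The error is then inflated to S^2 by
    S at least cs, the size that a relative error with factor [betaH] times S permits. *)
Lemma scale_outer (S W Sg kp f x y be Y C cs B : R) : 0 < cs -> cs <= S -> 0 <= f <= 1 -> 0 <= be -> 0 <= Y -> 0 <= C ->
  f * kp * x = B -> `|Sg - kp * (x / y / S * W)| <= C * (be / S * Y) ->
  `|S ^+ 2 * f * Sg - B * (S * W / y)| <= C / cs * (be * S ^+ 2 * Y).
Proof.
move=> cs0 csS /andP[f0 f1] b0 Y0 C0 <- h; have S0 : 0 < S by exact: lt_le_trans csS.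
have Sn : S != 0 by rewrite lt0r_neq0.
have -> : S ^+ 2 * f * Sg - f * kp * x * (S * W / y) = S ^+ 2 * f * (Sg - kp * (x / y / S * W)).
  have -> : x / y / S * W = x / S * W / y by ring.
  rewrite mulrBr; congr (_ - _).
  transitivity (S ^+ 2 / S * (f * kp * x * W / y)); last by ring.
  by rewrite expr2 mulfK //; ring.
rewrite normrM ger0_norm; last by rewrite mulr_ge0 ?sqr_ge0.
apply: (@le_trans _ _ (S ^+ 2 * 1 * (C * (be / S * Y)))).
  by apply: ler_pM => //; [rewrite mulr_ge0 ?sqr_ge0|rewrite ler_wpM2l ?sqr_ge0].
have -> : S ^+ 2 * 1 * (C * (be / S * Y)) = C * be * Y * S by field.
have -> : C / cs * (be * S ^+ 2 * Y) = C * be * Y * (S * (S / cs)) by ring.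
apply: ler_wpM2l; first by rewrite !mulr_ge0.
by rewrite ler_peMr ?(ltW S0) // ler_pdivlMr // mul1r.
Qed.

Lemma inv_le1 (m : nat) : (0 < m)%N -> 0 <= (m%:R : R)^-1 <= 1.
Proof. by move=> m0; rewrite invr_ge0 ler0n invf_le1 ?ltr0n // ler1n. Qed.

Lemma exponentE k l1 l2 : (0 < k)%N -> [/\ (k.-1 + (l1 + l2)).+1 = (k + l1 + l2)%N,
  (k.-1 + (l1 + l2)).+2 = (k + l1 + l2 + 1)%N, (k.-1 + (l1 + l2).+1).+1 = (k + l1 + l2 + 1)%N & (k.-1 + (l1 + l2).+1).+2 = (k + l1 + l2 + 2)%N].
Proof. by split; lia. Qed.

Lemma main_asy k l1 l2 : (2 <= k)%N -> {C : R | 0 < C & forall H, size H = k -> uniq H -> admissible H ->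
  exists X0, forall n RR, X0 <= ln RR -> (0 < n)%N -> ln RR <= ln n%:R ->
   `|Qsum RR H l1 l2 n - 'C(l1 + l2 + 2, l1 + 1)%:R * (sing R H * ln RR ^+ (k + l1 + l2 + 1) / (k + l1 + l2 + 1)`!%:R)|
     <= C * (betaH R H * sing R H ^+ 2 * ln RR ^+ (k + l1 + l2)) /\
   `|\sum_(i < n) ln i%:R / i%:R * (1 - Fw R H i) * Bsum RR H l1 l2 i -
       Tcoef R l1 l2 * (sing R H * ln RR ^+ (k + l1 + l2 + 2) / (k + l1 + l2 + 2)`!%:R)|
     <= C * (betaH R H * sing R H ^+ 2 * ln RR ^+ (k + l1 + l2 + 1))}.
Proof.
move=> k2; have k0 : (0 < k)%N by exact: leq_trans k2.
have [[Cc c] /= [Cc0 c1] TP] := @Tsum_asy R k.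
have c0 : 0 <= c by exact: le_trans c1.
have [Ca Ca0 Pa] := @outer_sum R k (l1 + l2) c Cc c0 Cc0 k2.
have [Cb Cb0 Pb] := @outer_sum R k (l1 + l2).+1 c Cc c0 Cc0 k2.
have [cs cs0 csP] := @sing_gt R k.
exists (Ca / cs + Cb / cs) => [|H sH uH ad]; first by rewrite addr_gt0 // divr_gt0.
have s0 : (0 < size H)%N by rewrite sH.
have csS := csP H sH uH ad k0.
have b0 : 0 <= betaH R H by have := @betaH_ge R H uH ad (ltac:(by rewrite sH)); have := @ln2_ge R; slra.
have [Xa XaP] := Pa H sH uH ad; have [Xb XbP] := Pb H sH uH ad.
exists (`|Xa| + `|Xb| + 1) => n RR XX n0 Xn.
have aa := normr_ge0 Xa; have bb := normr_ge0 Xb.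
have X0 : 0 <= ln RR by slra.
have f1 : 0 <= (l1`!%:R * l2`!%:R : R)^-1 <= 1 by rewrite -natrM; apply: inv_le1; rewrite muln_gt0 !fact_gt0.
have /andP[kp0 kp1] : 0 <= (l1.+1%:R * l2.+1%:R : R)^-1 <= 1 by rewrite -natrM; exact: inv_le1.
have kapb : `|kap R l1 l2| <= 1.
  rewrite /kap normrM (ger0_norm kp0); apply: mulr_ile1 => //.
  have h2 (m : nat) : (m.+2%:R : R)^-1 <= 1 / 2.
    by rewrite div1r lef_pV2 ?posrE ?ltr0n // ler_nat.
  have h0 (m : nat) : 0 <= (m.+2%:R : R)^-1 by rewrite invr_ge0.
  have := h2 l1; have := h2 l2; have := h2 (l1 + l2).+1; have := h0 l1; have := h0 l2; have := h0 (l1 + l2).+1.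
  move: (l1.+2%:R^-1 : R) (l2.+2%:R^-1 : R) ((l1 + l2).+3%:R^-1 : R) => x y z.
  by rewrite ler_norml => ? ? ? ? ? ?; apply/andP; split; slra.
have Cw (a b C' t : R) : 0 <= t -> 0 <= C' -> a <= b * t -> a <= (b + C') * t.
  by move=> t0 C'0 h; apply: le_trans h _; rewrite ler_wpM2r // lerDl.
have t0 j : 0 <= betaH R H * sing R H ^+ 2 * ln RR ^+ j.
  by apply: mulr_ge0 (exprn_ge0 _ X0); apply: mulr_ge0 b0 (sqr_ge0 _).
have XYn (A : {set 'I_n}) : allp A -> ln RR - Lg R A <= ln n%:R by move=> aA; have := Lg_ge0 R aA; slra.
split.
  rewrite Qsum_V //; apply: Cw => //; first by rewrite divr_ge0 // ltW.
  have := XaP n (ln RR) (l1.+1%:R * l2.+1%:R)^-1 (fun A => Vw A l1 (ln RR - Lg R A) * Vw A l2 (ln RR - Lg R A))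
    (ltac:(have := ler_norm Xa; slra)) n0 Xn (ltac:(by rewrite ger0_norm)).
  have [i1 i2 _ _] := exponentE l1 l2 k0; rewrite i2 i1.
  move=> h; apply: (scale_outer cs0 csS f1 b0 (exprn_ge0 _ X0) (ltW Ca0) (binom_coef R l1 l2)).
  apply: h => A aA Y0; last by rewrite Vw_le0 // mul0r.
  by have [] := TP H l1 l2 n A (ln RR - Lg R A) sH k0 ad aA n0 (XYn A aA) Y0.
have -> : \sum_(i < n) ln i%:R / i%:R * (1 - Fw R H i) * Bsum RR H l1 l2 i =
   sing R H ^+ 2 * (l1`!%:R * l2`!%:R)^-1 * \sum_(A : {set 'I_n}) Gam R H A * Tsum H l1 l2 A (ln RR - Lg R A).
  rewrite mulr_sumr; under [RHS]eq_bigr => A _ do rewrite /Tsum big_mkcond mulr_sumr mulr_sumr.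
  rewrite exchange_big; apply: eq_bigr => i _ /=.
  have [pi|ni] := boolP (prime i); last by rewrite Bsum_nprime // mulr0 big1 // => A _; rewrite !mulr0.
  rewrite Bsum_V // big_mkcond !mulr_sumr; apply: eq_bigr => A _ /=.
  by case: ifP => _; rewrite ?mulr0 // /Kterm; ring.
rewrite [X in _ <= X * _]addrC; apply: Cw => //; first by rewrite divr_ge0 // ltW.
have := XbP n (ln RR) (kap R l1 l2) (fun A => Tsum H l1 l2 A (ln RR - Lg R A))
    (ltac:(have := ler_norm Xb; slra)) n0 Xn kapb.
have [_ _ i2 i3] := exponentE l1 l2 k0; rewrite i3 i2.
move=> h; apply: (scale_outer cs0 csS f1 b0 (exprn_ge0 _ X0) (ltW Cb0) (Tcoef_kap R l1 l2)).
apply: h => A aA Y0.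
  by have [] := TP H l1 l2 n A (ln RR - Lg R A) sH k0 ad aA n0 (XYn A aA) Y0.
rewrite /Tsum big1 // => p /andP[pp _]; rewrite /Kterm /=.
have l0 := @ln_prime_ge0 R p pp.
have Z0 : ln RR - Lg R A - ln (p%:R : R) <= 0 by slra.
by rewrite !(Vw_le0 _ _ Z0) !(mulr0, mul0r, addr0).
Qed.

(** With a = l1 + 2 and b = l2 + 2 the claim reduces to 2((a + b - 1)(a + b) - a b) at most (a + b)
    a b, which follows from (a - 2)(b - 2) nonnegative and a + b at least 4. *)
Lemma Tcoef_ge l1 l2 : - (2 * Tcoef R l1 l2) <= (l1 + l2 + 4)%:R * 'C(l1 + l2 + 2, l1 + 1)%:R.
Proof.
rewrite -Tcoef_kap -binom_coef /kap (factS (l1 + l2).+2) natrM.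
set f := (_ * _)^-1; set g := (_ * _)^-1; set x := (_.+2`!)%:R.
have f0 : 0 <= f by rewrite invr_ge0 mulr_ge0.
have g0 : 0 <= g by rewrite invr_ge0 mulr_ge0.
have x0 : 0 <= x by [].
pose a : R := l1.+2%:R; pose b : R := l2.+2%:R.
have a2 : 2 <= a by rewrite ler_nat.
have b2 : 2 <= b by rewrite ler_nat.
have e3 : (l1 + l2).+3%:R = a + b - 1 by rewrite /a /b -!natr1 natrD; ring.
have e4 : (l1 + l2 + 4)%:R = a + b :> R by rewrite /a /b -natrD addSn !addnS addn0.
rewrite e3 e4 -/a -/b.
have -> : - (2 * (f * (g * ((a + b - 1)^-1 - a^-1 - b^-1)) * ((a + b - 1) * x))) =
  f * g * x * (2 * ((a + b - 1) * (a + b) - a * b) / (a * b)).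
  by field; rewrite !lt0r_neq0 //; slra.
have -> : (a + b) * (f * g * x) = f * g * x * (a + b) by ring.
apply: ler_wpM2l; first by rewrite !mulr_ge0.
rewrite ler_pdivrMr; last by rewrite mulr_gt0 //; slra.
have : 0 <= (a - 2) * (b - 2) by rewrite mulr_ge0 // subr_ge0.
clear e3 e4; clearbody a b => h; nra.
Qed.
End Final.

Section Conclusion.
Variable R : realType.
Implicit Types (X C RR N : R) (k l m : nat) (H : seq int).

Lemma exponent_le k l1 l2 : (2 <= k)%N -> (l1 + l2 + 4 <= (k + l1 + l2 + 1).+1)%N.
Proof. lia. Qed.

(** The quotient of the factorials is k + l1 + l2 + 2, at least the l1 + l2 + 4 of [Tcoef_ge] since
    k is at least 2. The second term therefore removes at most log R out of log N, that is, at most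
    half. *)
Lemma Main7_ge N RR H l1 l2 : (2 <= size H)%N -> 0 <= N -> 0 <= ln RR -> 2 * ln RR <= ln N -> 0 <= sing R H ->
  (2 * (size H + l1 + l2 + 1)`!%:R)^-1 * (N * ln N * sing R H * ln RR ^+ (size H + l1 + l2 + 1)) <= Main7 N RR H l1 l2.
Proof.
move=> k2 N0 X0 XL S0; rewrite /Main7; set k := size H in k2 *; set m := (k + l1 + l2 + 1)%N.
have -> : (k + l1 + l2 + 2 = m.+1)%N by rewrite /m addn1 addn2.
set X := ln RR in X0 XL *; set L := ln N in XL *; set S := sing R H in S0 *.
have f0 : 0 < m`!%:R :> R by rewrite ltr0n fact_gt0.
have T2 := Tcoef_ge R l1 l2; set T := Tcoef R l1 l2 in T2 *.
have B1 : 1 <= 'C(l1 + l2 + 2, l1 + 1)%:R :> R by rewrite ler1n bin_gt0 -addnA leq_add2l addn2.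
set B : R := 'C(_, _)%:R in B1 T2 *.
have m4 : (l1 + l2 + 4)%:R <= m.+1%:R :> R by rewrite ler_nat; exact: exponent_le.
have m0 : 0 < m.+1%:R :> R by rewrite ltr0n.
rewrite factS natrM exprS.
have -> : B * (N * L) * S * X ^+ m / m`!%:R + 2 * T * N * S * (X * X ^+ m) / (m.+1%:R * m`!%:R) =
  (m`!%:R)^-1 * (N * S * X ^+ m) * (B * L + 2 * T * (X / m.+1%:R)).
  by field; rewrite !lt0r_neq0.
have -> : (2 * m`!%:R)^-1 * (N * L * S * X ^+ m) = (m`!%:R)^-1 * (N * S * X ^+ m) * (L / 2).
  by field; rewrite lt0r_neq0.
apply: ler_wpM2l.
  by apply: mulr_ge0; [rewrite invr_ge0 ltW|apply: mulr_ge0 (exprn_ge0 _ X0); exact: mulr_ge0].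
have h1 : - (2 * T) * (X / m.+1%:R) <= B * X.
  have q0 : 0 <= X / m.+1%:R by rewrite divr_ge0.
  apply: le_trans (ler_wpM2r q0 T2) _.
  apply: (@le_trans _ _ (m.+1%:R * B * (X / m.+1%:R))).
    by apply: ler_wpM2r => //; apply: ler_wpM2r => //; slra.
  by rewrite le_eqVlt; apply/orP; left; apply/eqP; field; rewrite lt0r_neq0.
have h2 : L / 2 <= B * (L / 2) by rewrite ler_peMl //; slra.
have h3 : B * X <= B * (L / 2) by rewrite ler_wpM2l //; slra.
have -> : 2 * T * (X / m.+1%:R) = - (- (2 * T) * (X / m.+1%:R)) by ring.
have -> : B * L = B * (L / 2) + B * (L / 2) by field.
move: h1 h2 h3; move: (- (2 * T) * (X / m.+1%:R)) (B * X) (B * (L / 2)) => u v w; slra.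
Qed.

(** The arithmetic error N and the term with c0 carry no factor be; [1 <= 4 * be] and [cs <= S]
    bring them to the common size N L be S^2 Y. In the other two errors c0 and X are bounded through
    L. *)
Lemma error_assembly (N L X S be c0 B C cs Q Bs Qm Bm T E0 Y fm : R) :
  0 < N -> 1 <= L -> 2 * X <= L -> 1 <= X -> 0 < cs -> cs <= S -> 1 <= 4 * be -> 0 <= C -> 1 <= Y -> 0 <= B -> 0 <= fm <= 1 ->
  Qm = S * (X * Y) * fm ->
  `|Q - B * Qm| <= C * (be * S ^+ 2 * Y) -> `|Bs - T * Bm| <= C * (be * S ^+ 2 * (X * Y)) ->
  `|E0 - N * ((L + c0) * Q + 2 * Bs)| <= N ->
  `|E0 - N * (L * (B * Qm) + 2 * (T * Bm))| <=
    (4 / cs ^+ 2 + `|c0| * B * (4 / cs) + (1 + `|c0|) * C + C) * (N * L * (be * S ^+ 2 * Y)).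
Proof.
move=> N0 L1 XL X1 cs0 csS b1 C0 Y1 B0 /andP[fm0 fm1] Qe hQ hB hE.
have S0 : 0 < S by exact: lt_le_trans csS.
have c0n := normr_ge0 c0.
set D := be * S ^+ 2 * Y in hQ *.
have be0 : 0 <= be by slra.
have D0 : 0 <= D by apply: mulr_ge0 (le_trans ler01 Y1); exact: mulr_ge0 be0 (sqr_ge0 _).
have hB' : `|Bs - T * Bm| <= C * (X * D) by move: hB; rewrite (_ : be * S ^+ 2 * (X * Y) = X * D) // /D; ring.
have p1 : 1 <= 4 / cs ^+ 2 * D.
  have -> : 4 / cs ^+ 2 * D = (4 * be) * ((S ^+ 2 / cs ^+ 2) * Y) by rewrite /D; ring.
  have r1 : 1 <= S ^+ 2 / cs ^+ 2 by rewrite ler_pdivlMr ?exprn_gt0 // mul1r lerXn2r ?nnegrE // ltW.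
  by rewrite -[leLHS]mulr1; apply: ler_pM => //; rewrite -[leLHS]mulr1; apply: ler_pM.
have p2 : S * Y <= 4 / cs * D.
  have -> : 4 / cs * D = S * Y * ((4 * be) * (S / cs)) by rewrite /D; ring.
  rewrite ler_peMr //; first by rewrite mulr_ge0 ?(ltW S0) // (le_trans ler01).
  have r1 : 1 <= S / cs by rewrite ler_pdivlMr // mul1r.
  by rewrite -[leLHS]mulr1; apply: ler_pM.
have -> : E0 - N * (L * (B * Qm) + 2 * (T * Bm)) = (E0 - N * ((L + c0) * Q + 2 * Bs)) +
   N * (c0 * (B * Qm) + ((L + c0) * (Q - B * Qm) + 2 * (Bs - T * Bm))) by ring.
apply: le_trans (ler_normD _ _) _; rewrite normrM (gtr0_norm N0).
have Qm0 : 0 <= Qm by rewrite Qe; apply: mulr_ge0 fm0; apply: mulr_ge0 (ltW S0) _; apply: mulr_ge0; slra.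
have e1 : `|c0 * (B * Qm)| <= L * (`|c0| * B * (4 / cs) * D).
  rewrite normrM (ger0_norm (mulr_ge0 B0 Qm0)).
  have -> : L * (`|c0| * B * (4 / cs) * D) = `|c0| * B * (L * (4 / cs * D)) by ring.
  rewrite mulrA; apply: ler_wpM2l; first exact: mulr_ge0.
  apply: (@le_trans _ _ (L * (S * Y))); last by apply: ler_wpM2l; slra.
  rewrite Qe; apply: (@le_trans _ _ (S * (X * Y))).
    by rewrite ler_piMr // mulr_ge0 ?(ltW S0) // mulr_ge0 //; slra.
  rewrite mulrCA; apply: ler_wpM2r; [by apply: mulr_ge0; slra|slra].
have e2 : `|(L + c0) * (Q - B * Qm)| <= L * ((1 + `|c0|) * C * D).
  rewrite normrM.
  have -> : L * ((1 + `|c0|) * C * D) = L * (1 + `|c0|) * (C * D) by ring.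
  apply: ler_pM => //; apply: le_trans (ler_normD _ _) _; rewrite ger0_norm; last by slra.
  rewrite mulrDr mulr1 lerD2l ler_peMl //.
have e3 : `|2 * (Bs - T * Bm)| <= L * (C * D).
  rewrite normrM ger0_norm //; apply: le_trans (ler_wpM2l _ hB') _ => //.
  have -> : 2 * (C * (X * D)) = 2 * X * (C * D) by ring.
  by apply: ler_wpM2r => //; exact: mulr_ge0.
have e0 : N <= N * (L * (4 / cs ^+ 2 * D)).
  by rewrite ler_peMr ?(ltW N0) // -[leLHS]mulr1; apply: ler_pM.
have e4 : `|c0 * (B * Qm) + ((L + c0) * (Q - B * Qm) + 2 * (Bs - T * Bm))| <=
  L * (`|c0| * B * (4 / cs) * D) + (L * ((1 + `|c0|) * C * D) + L * (C * D)).
  apply: le_trans (ler_normD _ _) _; apply: lerD => //; apply: le_trans (ler_normD _ _) _; exact: lerD.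
apply: le_trans (lerD (le_trans hE e0) (ler_wpM2l (ltW N0) e4)) _.
by rewrite le_eqVlt; apply/orP; left; apply/eqP; ring.
Qed.

Lemma theorem7_fixed k l1 l2 : (2 <= k)%N -> {C : R | 0 <= C & forall H (h0 : int),
    uniq H -> size H = k -> admissible H -> h0 \in H ->
    forall theta eps : R, 1 / 2 < theta <= 1 -> 0 < eps -> BV theta -> BV2 theta ->
    exists N0 R0 : R, forall N RR, N0 <= N -> R0 <= RR -> RR <= N `^ ((theta - eps) / 2) ->
      exists E : R, LHS7 N RR H h0 l1 l2 = Main7 N RR H l1 l2 * (1 + E) /\
        `|E| <= C * (betaH R H * sing R H / ln RR)}.
Proof.
move=> k2; have k0 : (0 < k)%N by exact: leq_trans k2.
have [C Cp CP] := @main_asy R k l1 l2 k2; have [cs cs0 csP] := @sing_gt R k.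
pose B : R := 'C(l1 + l2 + 2, l1 + 1)%:R.
have B0 : 0 <= B by [].
pose K := 4 / cs ^+ 2 + `|C0 R| * B * (4 / cs) + (1 + `|C0 R|) * C + C.
pose m := (k + l1 + l2)%N.
have c0n := normr_ge0 (C0 R).
have K0 : 0 <= K.
  apply: addr_ge0 (ltW Cp); apply: addr_ge0; last by apply: mulr_ge0 (ltW Cp); slra.
  apply: addr_ge0; first by rewrite divr_ge0 // sqr_ge0.
  by apply: mulr_ge0; [exact: mulr_ge0|rewrite divr_ge0 // ltW].
exists (2 * (m + 1)`!%:R * K) => [|H h0 uH sH ad hH theta eps /andP[_ th1] ep0 BVt BV2t].
  by rewrite mulr_ge0 // mulr_ge0.
have s0 : (0 < size H)%N by rewrite sH.
(* If eps is at least theta, R would be at most 1, so the threshold 2 for R makes the claim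
   vacuous. *)
have [d0|d0] := leP (theta - eps) 0.
  exists 1, 2 => N RR N1 R2 RN; exfalso.
  have : N `^ ((theta - eps) / 2) <= N `^ 0 by apply: ler_powR => //; slra.
  by rewrite powRr0; slra.
have d01 : 0 < theta - eps < 1 by rewrite d0 /=; slra.
have [N1 AP] := @arith_main R H h0 l1 l2 (theta - eps) uH ad s0 hH d01
   (fun A A0 => BVt A eps A0 ep0) (fun A A0 => BV2t A eps A0 ep0).
have [X0 XP] := CP H sH uH ad; have csS := csP H sH uH ad k0.
have b1 : 1 <= 4 * betaH R H.
  by have := @betaH_ge R H uH ad (ltac:(by rewrite sH)); have := @ln2_ge R; slra.
have S0 : 0 < sing R H by exact: lt_le_trans csS.
have x0 := normr_ge0 X0; have n1 := normr_ge0 N1.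
exists (8 + `|N1|), (2 + expR (1 + `|X0|)) => N RR NN RRR RN.
have RX : expR (1 + `|X0|) <= RR by slra.
have LX := le_ln_expR RX.
have R2 : 2 <= RR by have := expR_gt0 (1 + `|X0|); slra.
have AP' := AP N RR (ltac:(have := ler_norm N1; slra)) R2 RN.
have N8 : 8 <= N by slra.
have L1 := ln_ge1 N8; have X1 : 1 <= ln RR by slra.
have Np : 0 < N by slra.
have Lp : 0 < ln N by exact: lt_le_trans L1.
have Xp : 0 < ln RR by exact: lt_le_trans X1.
have be0 : 0 <= betaH R H by slra.
have XL : 2 * ln RR <= ln N.
  have h : ln RR <= ln (N `^ ((theta - eps) / 2)) by rewrite ler_ln ?posrE ?powR_gt0 //; slra.
  rewrite ln_powR in h.
  have : (theta - eps) / 2 * ln N <= 1 / 2 * ln N by apply: ler_wpM2r; slra.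
  slra.
have RnX : ln RR <= ln (Num.truncn RR).+1%:R.
  by rewrite ler_ln ?posrE ?ltr0n // ?ltW //; [rewrite -truncn_le_nat|slra].
have [hQ hB] := XP (Num.truncn RR).+1 RR (ltac:(have := ler_norm X0; slra)) isT RnX.
rewrite mainterm_split in AP'.
have Y1 : 1 <= ln RR ^+ m by exact: exprn_ege1.
have fm := @inv_le1 R (m + 1)`! (fact_gt0 _).
have e1 : ln RR ^+ (k + l1 + l2 + 1) = ln RR * ln RR ^+ m by rewrite addn1 exprS.
rewrite e1 in hQ hB.
have EA := error_assembly Np L1 XL X1 cs0 csS b1 (ltW Cp) Y1 B0 fm erefl hQ hB AP'.
have ME : N * (ln N * (B * (sing R H * (ln RR * ln RR ^+ m) / (k + l1 + l2 + 1)`!%:R)) +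
   2 * (Tcoef R l1 l2 * (sing R H * ln RR ^+ (k + l1 + l2 + 2) / (k + l1 + l2 + 2)`!%:R))) = Main7 N RR H l1 l2.
  by rewrite /Main7 sH e1 -/B; ring.
rewrite ME -/K in EA.
have MG := Main7_ge (N := N) (RR := RR) l1 l2 (ltac:(by rewrite sH) : (2 <= size H)%N) (ltW Np) (ltW Xp) XL (ltW S0).
rewrite sH e1 -/m in MG.
set M := Main7 N RR H l1 l2 in EA MG *; set W := LHS7 N RR H h0 l1 l2 in EA *.
have f0 : 0 < (m + 1)`!%:R :> R by rewrite ltr0n fact_gt0.
have Gp : 0 < (2 * (m + 1)`!%:R)^-1 * (N * ln N * sing R H * (ln RR * ln RR ^+ m)).
  apply: mulr_gt0; first by rewrite invr_gt0 mulr_gt0.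
  by apply: mulr_gt0; [apply: mulr_gt0 => //; exact: mulr_gt0|apply: mulr_gt0 => //; exact: exprn_gt0].
have M0 : 0 < M by exact: lt_le_trans MG.
(* The relative error is defined by division, legitimate because [Main7_ge] makes M positive; the
   same lower bound converts the absolute error into the relative one. *)
exists (W / M - 1); split; first by rewrite addrC subrK mulrC divfK // lt0r_neq0.
have -> : W / M - 1 = (W - M) / M by field; rewrite lt0r_neq0.
rewrite normrM normfV (gtr0_norm M0) ler_pdivrMr //; apply: le_trans EA _.
have X0' : ln RR != 0 by rewrite lt0r_neq0.
have -> : K * (N * ln N * (betaH R H * sing R H ^+ 2 * ln RR ^+ m)) =
  2 * (m + 1)`!%:R * K * (betaH R H * sing R H / ln RR) *
   ((2 * (m + 1)`!%:R)^-1 * (N * ln N * sing R H * (ln RR * ln RR ^+ m))).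
  by field; rewrite X0' lt0r_neq0.
apply: ler_wpM2l => //.
by apply: mulr_ge0; [rewrite mulr_ge0 // mulr_ge0|apply: divr_ge0 (ltW Xp); exact: mulr_ge0 be0 (ltW S0)].
Qed.
End Conclusion.

Theorem theorem7 (R : realType) (k : nat) : (2 <= k)%N ->
  exists C : R, forall (H : seq int) (l1 l2 : nat) (h0 : int),
    uniq H -> size H = k -> admissible H ->
    (l1 <= k)%N -> (l2 <= k)%N -> h0 \in H ->
    forall theta eps : R, 1 / 2 < theta <= 1 -> 0 < eps ->
    BV theta -> BV2 theta ->
    exists N0 R0 : R, forall N RR : R, N0 <= N -> R0 <= RR ->
      RR <= N `^ ((theta - eps) / 2) ->
      exists E : R,
        LHS7 N RR H h0 l1 l2 = Main7 N RR H l1 l2 * (1 + E) /\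
        `|E| <= C * (betaH R H * sing R H / ln RR).
Proof.
move=> k2; pose c (i j : nat) := s2val (@theorem7_fixed R k i j k2).
have c0 i j : 0 <= c i j by rewrite /c; case: theorem7_fixed.
(* Only finitely many exponents l1, l2 up to k occur, so the sum of the nonnegative constants serves
   all of them. *)
exists (\sum_(i < k.+1) \sum_(j < k.+1) c i j) => H l1 l2 h0 uH sH ad k1 k3 hH theta eps th e0 b1 b2.
have [N0 [R0 P]] := s2valP' (@theorem7_fixed R k l1 l2 k2) H h0 uH sH ad hH theta eps th e0 b1 b2.
(* This threshold is at least R0 and at least e, whatever the sign of R0; then log R is positive and
   enlarging the constant weakens the bound. *)
exists N0, (R0 + expR 1 + `|R0|) => N RR NN RRR RN.
have r0 := normr_ge0 R0; have p1 := expR_gt0 (1 : R).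
have [|E [eE bE]] := P N RR NN _ RN; first by slra.
exists E; split=> //; apply: le_trans bE _.
have R1 : expR 1 <= RR by have := ler_norm (- R0); rewrite normrN; slra.
have X1 := le_ln_expR R1.
apply: ler_wpM2r.
  have [cs cs0 csP] := @sing_gt R k; have := csP H sH uH ad (ltnW k2).
  have := @betaH_ge R H uH ad (ltac:(by rewrite sH)); have := @ln2_ge R => *.
  by apply: divr_ge0; [apply: mulr_ge0; slra|slra].
rewrite (bigD1 (inord l1)) //= (bigD1 (inord l2)) //= !inordK //.
rewrite -/(c l1 l2) -addrA lerDl addr_ge0 //; first exact: sumr_ge0.
by apply: sumr_ge0 => i _; apply: sumr_ge0 => j _.
Qed.
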